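(* Let $\rho:\Gamma\to GL_p(\mathbb{C})$ be a representation such that every eigenvalue of $\rho(T)$ has absolute value $1$, and suppose $F\in\mathcal{H}(k,\rho)$ has linearly independent component functions. Then there are $l\ge0$ and $g_j\in\mathcal{M}_{l+2j}$ ($0\le j\le p$), $g_0\ne0$, such that the component functions of $F$ form a basis of the space of holomorphic solutions $f$ on $\mathfrak{H}$ of the modular linear differential equation $(g_0D_k^p+g_1D_k^{p-1}+\dots+g_p)f=0$. Moreover, the set $I\subseteq\mathcal{M}$ consisting of $0$ together with all leading coefficients $g_0$ of order-$p$ equations of this form satisfied by (each component of) $F$ is a nonzero principal graded ideal of $\mathcal{M}$, generated by the unique normalized modular form $g$ of least weight in $I$ (normalized meaning that the leading coefficient of its $q$-expansion is $1$).
   Context: $\Gamma=SL_2(\mathbb{Z})$ acts on the upper half-plane $\mathfrak{H}$; $S=\begin{pmatrix}0&-1\\1&0\end{pmatrix}$, $T=\begin{pmatrix}1&1\\0&1\end{pmatrix}$; $q=e^{2\pi i\tau}$, $q^x=e^{2\pi i x\tau}$; $\binom{x}{t}=x(x-1)\cdots(x-t+1)/t!$, $\binom{x}{0}=1$. A holomorphic (logarithmic) vector-valued modular form of weight $k$ for $\rho$ is a holomorphic $F:\mathfrak{H}\to\mathbb{C}^p$ with $(c\tau+d)^{-k}F(\gamma\tau)=\rho(\gamma)F(\tau)$ for all $\gamma\in\Gamma$ such that, writing the span of its components in a basis of chains $(g_0,\dots,g_{m-1})$ with $g_j(\tau+1)=\lambda(g_j(\tau)+g_{j-1}(\tau))$,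 $g_{-1}=0$, $\lambda=e^{2\pi i\mu}$, $\mu$ real, and $g_j=\sum_{s=0}^j\binom{\tau}{s}h_{j-s}$ with $h_s=\sum_n a_s(n)q^{n+\mu}$, one has $a_s(n)=0$ whenever $n+\mu<0$; $\mathcal{H}(k,\rho)$ denotes their space. $\mathcal{M}=\bigoplus_k\mathcal{M}_k=\mathbb{C}[E_4,E_6]$ is the graded ring of holomorphic modular forms on $\Gamma$. The modular derivative on weight $k$ is $D_kf=\theta f+kPf$, where $\theta=q\,d/dq=\frac{1}{2\pi i}\frac{d}{d\tau}$ and $P=-1/12+2\sum_{n\ge1}\sigma_1(n)q^n$; $D_k^j=D_{k+2j-2}\circ\dots\circ D_{k+2}\circ D_k$.
   Formalization: The set of 0 and all leading coefficients is not closed under sums of different weights (for F=1, k=0 it contains 1 and E_4 but not 1+E_4), so I is taken to be the set of finite sums of leading coefficients, and its homogeneous elements are shown to be exactly 0 and the leading coefficients. *)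

(* Defs.v *)
From mathcomp Require Import all_boot all_order all_algebra.
From mathcomp Require Import all_classical all_reals all_analysis.
From mathcomp Require Import complex.
Set Implicit Arguments.
Unset Strict Implicit.
Unset Printing Implicit Defensive.
Import Order.TTheory GRing.Theory Num.Theory.
Import numFieldNormedType.Exports.
Local Open Scope classical_set_scope.
Local Open Scope ring_scope.

(* R[i] typed as a numClosedFieldType, so that it receives the norm topology
   (hence limits and complex derivatives) of MathComp-Analysis. *)
Definition cplx (R : realType) : numClosedFieldType := R[i].

Definition ofreal (R : realType) (x : R) : cplx R := (x%:C)%C.

Definition cexp (R : realType) (z : cplx R) : cplx R :=
  ofreal (expR (complex.Re z)) *
  (cos (complex.Im z) +i* sin (complex.Im z))%C.

Definition twopii (R : realType) : cplx R := (0 +i* (2 * pi))%C.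

Definition e2pii (R : realType) (z : cplx R) : cplx R := cexp (twopii R * z).

Definition qpow (R : realType) (x : R) (tau : cplx R) : cplx R :=
  e2pii (ofreal x * tau).

Definition uhp (R : realType) : set (cplx R) := [set z | 0 < complex.Im z].
Arguments uhp : clear implicits.

(* Functions on the upper half-plane are represented by total functions on the
   complex plane whose values off [uhp R] are irrelevant: every notion below
   depends only on the restriction to the open set [uhp R]. *)
Definition eq_uhp (R : realType) (f g : cplx R -> cplx R) : Prop :=
  forall tau, uhp R tau -> f tau = g tau.

Definition holomorphic_uhp (R : realType) (f : cplx R -> cplx R) : Prop :=
  forall tau, uhp R tau -> derivable f tau 1.

Definition lin_indep (R : realType) (I : finType)
    (f : I -> cplx R -> cplx R) : Prop :=
  forall c : I -> cplx R,
    eq_uhp (fun tau => \sum_i c i * f i tau) (fun=> 0) -> forall i, c i = 0.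

Definition in_span (R : realType) (I : finType)
    (f : I -> cplx R -> cplx R) (h : cplx R -> cplx R) : Prop :=
  exists c : I -> cplx R, eq_uhp h (fun tau => \sum_i c i * f i tau).

Definition is_basis_of (R : realType) (I : finType)
    (f : I -> cplx R -> cplx R) (V : set (cplx R -> cplx R)) : Prop :=
  [/\ forall i, V (f i), lin_indep f & forall h, V h -> in_span f h].

Definition SL2Z : {pred 'M[int]_2} := [pred g | \det g == 1].

Definition matT : 'M[int]_2 :=
  \matrix_(i < 2, j < 2) (if (i == 1) && (j == 0) then 0 else 1).

Definition autom_factor (R : realType) (g : 'M[int]_2) (tau : cplx R)
  : cplx R := (g 1 0)%:~R * tau + (g 1 1)%:~R.

Definition moebius (R : realType) (g : 'M[int]_2) (tau : cplx R) : cplx R :=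
  ((g 0 0)%:~R * tau + (g 0 1)%:~R) / autom_factor g tau.

(* A homomorphism SL_2(Z) -> GL_p(C); values of rho off SL2Z are irrelevant. *)
Definition is_repr (R : realType) (p : nat)
    (rho : 'M[int]_2 -> 'M[cplx R]_p) : Prop :=
  [/\ {in SL2Z, forall g, rho g \in unitmx},
      rho 1%:M = 1%:M
    & {in SL2Z &, {morph rho : g h / g *m h >-> g *m h}}].

Definition has_qexp (R : realType) (a : nat -> cplx R)
    (f : cplx R -> cplx R) : Prop :=
  forall tau, uhp R tau ->
    series (fun n => a n * qpow n%:R tau) @ \oo --> f tau.

Definition modular_form (R : realType) (k : int) (f : cplx R -> cplx R)
  : Prop :=
  [/\ holomorphic_uhp f,
      forall g, g \in SL2Z -> forall tau, uhp R tau ->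
        (autom_factor g tau) ^ (- k) * f (moebius g tau) = f tau
    & exists a, has_qexp a f].

Definition normalized (R : realType) (f : cplx R -> cplx R) : Prop :=
  exists (a : nat -> cplx R) (m : nat),
    [/\ has_qexp a f, forall n, (n < m)%N -> a n = 0 & a m = 1].

(* The ring M, the sum of the spaces of modular forms of all weights, as a set
   of functions. *)
Definition Mring (R : realType) : set (cplx R -> cplx R) :=
  [set f | exists (n : nat) (w : 'I_n -> int) (u : 'I_n -> cplx R -> cplx R),
     (forall i, modular_form (w i) (u i)) /\
     eq_uhp f (fun tau => \sum_i u i tau)].
Arguments Mring : clear implicits.

Definition is_ideal (R : realType) (I : set (cplx R -> cplx R)) : Prop :=
  [/\ I `<=` Mring R,
      I (fun=> 0),
      forall f g, I f -> I g -> I (fun tau => f tau + g tau)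
    & forall f g, Mring R f -> I g -> I (fun tau => f tau * g tau)].

Definition is_graded (R : realType) (I : set (cplx R -> cplx R)) : Prop :=
  forall (n : nat) (w : 'I_n -> int) (u : 'I_n -> cplx R -> cplx R),
    injective w -> (forall i, modular_form (w i) (u i)) ->
    I (fun tau => \sum_i u i tau) -> forall i, I (u i).

Definition generated_by (R : realType) (I : set (cplx R -> cplx R))
    (g : cplx R -> cplx R) : Prop :=
  forall f, I f <->
    exists2 h, Mring R h & eq_uhp f (fun tau => g tau * h tau).

Definition normalized_least_weight (R : realType)
    (I : set (cplx R -> cplx R)) (g : cplx R -> cplx R) : Prop :=
  exists w : int,
    [/\ modular_form w g, normalized g, I g
      & forall (v : int) (h : cplx R -> cplx R),
          modular_form v h -> I h -> ~ eq_uhp h (fun=> 0) -> w <= v].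

Definition cbinom (R : realType) (x : cplx R) (t : nat) : cplx R :=
  (\prod_(i < t) (x - i%:R)) / t`!%:R.

(* v is the sum over all integers n of a n * q^(n + mu) at tau; the terms
   n >= 0 and n < 0 are summed separately. *)
Definition is_laurent_sum (R : realType) (a : int -> cplx R) (mu : R)
    (tau v : cplx R) : Prop :=
  exists v1 v2 : cplx R,
    [/\ series (fun n : nat => a n%:Z * qpow (n%:R + mu) tau) @ \oo --> v1,
        series (fun n : nat =>
          a (- n.+1%:Z) * qpow (- n.+1%:R + mu) tau) @ \oo --> v2
      & v = v1 + v2].

(* g 0, ..., g m.-1 is a chain g_j(tau + 1) = lambda (g_j + g_(j-1))(tau) whose
   expansions h_s have no term q^(n + mu) with n + mu < 0. *)
Definition holomorphic_chain (R : realType) (m : nat)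
    (g : nat -> cplx R -> cplx R) : Prop :=
  exists (mu : R) (h : nat -> cplx R -> cplx R) (a : nat -> int -> cplx R),
    [/\ forall j tau, (j < m)%N -> uhp R tau ->
          g j (tau + 1) =
          e2pii (ofreal mu) *
            (g j tau + (if j is j'.+1 then g j' tau else 0)),
        forall j tau, (j < m)%N -> uhp R tau ->
          g j tau = \sum_(s < j.+1) cbinom tau s * h (j - s)%N tau,
        forall s tau, (s < m)%N -> uhp R tau ->
          is_laurent_sum (a s) mu tau (h s tau)
      & forall s (n : int), (s < m)%N -> n%:~R + mu < 0 -> a s n = 0].

Definition component (R : realType) (p : nat) (F : cplx R -> 'cV[cplx R]_p)
    (i : 'I_p) (tau : cplx R) : cplx R := F tau i 0.

(* F lies in H(k, rho). The span of its components has a basis made of N chains,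
   the b-th one being g b 0, ..., g b (m b).-1. *)
Definition log_vvmf (R : realType) (p : nat) (k : int)
    (rho : 'M[int]_2 -> 'M[cplx R]_p) (F : cplx R -> 'cV[cplx R]_p) : Prop :=
  [/\ forall i, holomorphic_uhp (component F i),
      forall g, g \in SL2Z -> forall tau, uhp R tau ->
        (autom_factor g tau) ^ (- k) *: F (moebius g tau) = rho g *m F tau
    & exists (N : nat) (m : 'I_N -> nat)
             (g : 'I_N -> nat -> cplx R -> cplx R),
        is_basis_of
          (fun bj : {b : 'I_N & 'I_(m b)} => g (tag bj) (tagged bj))
          [set f | in_span (component F) f] /\
        forall b, holomorphic_chain (m b) (g b)].

Definition sigma1 (n : nat) : nat := \sum_(d <- divisors n) d.

Definition eisP (R : realType) (tau : cplx R) : cplx R :=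
  - 12^-1 + 2 * lim (series (fun n : nat =>
      (sigma1 n.+1)%:R * qpow n.+1%:R tau) @ \oo).

Definition modD (R : realType) (k : int) (f : cplx R -> cplx R)
  : cplx R -> cplx R :=
  fun tau => (twopii R)^-1 * derive1 f tau + k%:~R * eisP tau * f tau.

(* D_k^j = D_(k+2j-2) o ... o D_(k+2) o D_k *)
Fixpoint modD_iter (R : realType) (k : int) (j : nat) (f : cplx R -> cplx R)
  : cplx R -> cplx R :=
  if j is i.+1 then modD (k + (2 * i)%N%:Z) (modD_iter k i f) else f.

Definition mlde_coefs (R : realType) (p l : nat) (g : nat -> cplx R -> cplx R)
  : Prop :=
  (forall j, (j <= p)%N -> modular_form (l + 2 * j)%N%:Z (g j)) /\
  ~ eq_uhp (g 0%N) (fun=> 0).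

(* f satisfies (g_0 D_k^p + g_1 D_k^(p-1) + ... + g_p) f = 0 *)
Definition satisfies_mlde (R : realType) (p : nat) (k : int)
    (g : nat -> cplx R -> cplx R) (f : cplx R -> cplx R) : Prop :=
  eq_uhp (fun tau => \sum_(j < p.+1) g j tau * modD_iter k (p - j) f tau)
         (fun=> 0).

Definition mlde_solutions (R : realType) (p : nat) (k : int)
    (g : nat -> cplx R -> cplx R) : set (cplx R -> cplx R) :=
  [set f | holomorphic_uhp f /\ satisfies_mlde p k g f].

Definition mlde_lead (R : realType) (p : nat) (k : int)
    (F : cplx R -> 'cV[cplx R]_p) : set (cplx R -> cplx R) :=
  [set g0 | exists (l : nat) (g : nat -> cplx R -> cplx R),
     [/\ g 0%N = g0, mlde_coefs p l g
       & forall i, satisfies_mlde p k g (component F i)]].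

(* The graded ideal whose homogeneous elements are 0 and the elements of
   mlde_lead: since members of mlde_lead are homogeneous, it is formed by the
   finite sums of such members. *)
Definition mlde_ideal (R : realType) (p : nat) (k : int)
    (F : cplx R -> 'cV[cplx R]_p) : set (cplx R -> cplx R) :=
  [set f | exists (n : nat) (u : 'I_n -> cplx R -> cplx R),
     (forall i, mlde_lead k F (u i)) /\
     eq_uhp f (fun tau => \sum_i u i tau)].

(* Main.v *)
(** The modular derivatives of the components of F form a Wronskian matrix
    (D^s F_i), and Cramer's rule writes W D^p F as a combination of the D^s F,
    s < p, whose coefficients are, like W, determinants of modular derivatives.
    They transform with the character det rho, which has order dividing 12, and
    the logarithmic q-expansions make them grow at most polynomially at the cusp;
    multiplied by W^11 they are therefore modular forms.  A further solution makes
    a Wronskian of order p + 1 vanish, hence depends linearly on the F_i.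

    Any two equations of order p satisfied by F are proportional.  Dividing an
    equation with leading coefficient g by the part of g prime to another leading
    coefficient f gives an equation with leading coefficient gcd(f, g), so a g of
    least weight divides every f.  Greatest common divisors exist because a zero of
    a modular form at a point of the upper half-plane or at infinity can be divided
    out by E_4, by E_6, by Delta or by a combination of E_4^3 and E_6^2.

    The transformation law of P is obtained from the q-series of the Weierstrass
    zeta function: the series for the lattices of tau and -1/tau differ by an
    elliptic function without poles, whose derivative at 0 compares P(tau) and
    P(-1/tau). *)
Require Import Defs.
From mathcomp Require Import all_boot all_order all_algebra.
From mathcomp Require Import all_classical all_reals all_analysis.
From mathcomp Require Import complex.
From mathcomp Require Import ring lra zify.
Set Implicit Arguments.
Unset Strict Implicit.
Unset Printing Implicit Defensive.
Import Order.TTheory GRing.Theory Num.Theory.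
Import numFieldNormedType.Exports.
Local Open Scope classical_set_scope.
Local Open Scope ring_scope.

(** Integrals are taken along horizontal and vertical segments only. Goursat's theorem on rectangles
    makes the Fourier integrals of a periodic function independent of the height, and the Fourier
    series is summed by expanding a difference quotient in q. Taylor series then come from Fourier
    series by the substitution w = r e(t), so no integral over a circle occurs. The components of F
    are not periodic; their logarithmic terms are polynomials in tau. Growth is therefore measured
    by powers of |tau|, a class closed under products and derivatives. Only the final determinants
    are periodic, and for them growth o(1/q) already yields a q-expansion. All coefficients receive
    the same factor W^11, so that [det rho] occurs to the power 12 in each. No valence formula is
    used. Two facts replace it: a form of negative weight vanishes, and a form vanishing at infinity
    is divisible by Delta. They show that weight 0 consists of constants and weight 2 of zero, and
    they drive an induction on the weight for divisibility at any other point. *)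

Lemma is_deriveP (K : numFieldType) (f : K -> K) (a l : K) :
  is_derive a 1 f l <->
  forall e, 0 < e -> exists2 d, 0 < d &
    forall h, `|h| < d -> `|f (a + h) - f a - l * h| <= e * `|h|.
Proof.
split.
- move=> [dv dl] e e0.
  have : (fun h : K => h^-1 *: (f (h *: 1 + a) - f a)) @ 0^' --> l.
    by rewrite -dl; exact: dv.
  move=> /cvgrPdist_le /(_ e e0).
  rewrite near_withinE => /nbhs_ballP[d /= d0 H].
  exists d => // h hd; have [->|h0] := eqVneq h 0.
    by rewrite addr0 subrr mulr0 subrr normr0 mulr0.
  have := H h; rewrite /ball /= sub0r normrN => /(_ hd h0).
  rewrite [h *: 1]mulr1 [h + a]addrC => Hh.
  have -> : f (a + h) - f a - l * h = (h^-1 *: (f (a + h) - f a) - l) * h.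
    by rewrite /GRing.scale /=; field.
  by rewrite normrM ler_wpM2r// distrC.
- move=> H.
  have Hc : (fun h : K => h^-1 *: (f (h *: 1 + a) - f a)) @ 0^' --> l.
    apply/cvgrPdist_le => e e0; rewrite near_withinE; apply/nbhs_ballP.
    have [d d0 Hd] := H e e0; exists d => //= h.
    rewrite /ball /= sub0r normrN => hd h0.
    have := Hd h hd; rewrite [h *: 1]mulr1 [h + a]addrC => Hh.
    have -> : l - h^-1 *: (f (a + h) - f a) =
              - (f (a + h) - f a - l * h) / h.
      by rewrite /GRing.scale /=; field.
    by rewrite normrM normrN normfV ler_pdivrMr ?normr_gt0.
  by split; [apply/cvg_ex; exists l | apply: cvg_lim].
Qed.

(** * Complex limits and derivatives *)

Section Basics.
Variable R : realType.
Local Notation C := (cplx R).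
Implicit Types (z w : C) (f g : C -> C).

(** The norm of [cplx R] has values in [cplx R]; this is its real counterpart, on which [lra] and
    [nra] work. *)
Definition nrm (z : C) : R := ComplexField.Normc.normc z.

Lemma normE (z : C) : `|z| = ofreal (nrm z). Proof. by []. Qed.

Lemma ofrealD (x y : R) : ofreal (x + y) = ofreal x + ofreal y.
Proof. exact: rmorphD. Qed.
Lemma ofrealM (x y : R) : ofreal (x * y) = ofreal x * ofreal y.
Proof. exact: rmorphM. Qed.
Lemma ofrealN (x : R) : ofreal (- x) = - ofreal x.
Proof. exact: rmorphN. Qed.
Lemma ofrealV (x : R) : ofreal (x^-1) = (ofreal x)^-1.
Proof. exact: fmorphV. Qed.
Lemma ofreal_nat n : ofreal (n%:R : R) = n%:R.
Proof. exact: rmorph_nat. Qed.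

Lemma nrm0 : nrm 0 = 0. Proof. exact: ComplexField.Normc.normc0. Qed.
Lemma nrm1 : nrm 1 = 1. Proof. exact: ComplexField.Normc.normc1. Qed.
Lemma nrmM z w : nrm (z * w) = nrm z * nrm w.
Proof. exact: ComplexField.Normc.normcM. Qed.
Lemma nrmV z : nrm z^-1 = (nrm z)^-1.
Proof. exact: ComplexField.Normc.normcV. Qed.
Lemma nrmD z w : nrm (z + w) <= nrm z + nrm w.
Proof. exact: le_normcD. Qed.
Lemma nrmN z : nrm (- z) = nrm z. Proof. exact: normcN. Qed.
Lemma nrm_ge0 z : 0 <= nrm z.
Proof. by case: z => a b; rewrite /nrm /= sqrtr_ge0. Qed.
Lemma nrm_eq0 z : (nrm z == 0) = (z == 0).
Proof.
apply/eqP/eqP => [|->]; last exact: nrm0.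
exact: ComplexField.Normc.eq0_normc.
Qed.
Lemma nrm_gt0 z : (0 < nrm z) = (z != 0).
Proof. by rewrite lt_def nrm_ge0 andbT nrm_eq0. Qed.
Lemma nrmX z n : nrm (z ^+ n) = nrm z ^+ n.
Proof. by elim: n => [|n IH]; rewrite ?expr0 ?nrm1// !exprS nrmM IH. Qed.
Lemma nrm_ofreal (x : R) : nrm (ofreal x) = `|x|.
Proof. by rewrite /nrm /= expr0n addr0 sqrtr_sqr. Qed.
Lemma nrm_nat n : nrm n%:R = n%:R.
Proof. by rewrite -ofreal_nat nrm_ofreal normr_nat. Qed.
Lemma nrmB z w : nrm (z - w) <= nrm z + nrm w.
Proof. by rewrite -[nrm w]nrmN nrmD. Qed.
Lemma nrm_sub z w : nrm (z - w) = nrm (w - z).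
Proof. by rewrite -nrmN opprB. Qed.
Lemma nrm_geB z w : nrm z - nrm w <= nrm (z + w).
Proof.
have := nrmD (z + w) (- w).
by rewrite addrK nrmN; lra.
Qed.
Lemma nrm_sum (I : Type) (r : seq I) (P : pred I) (F : I -> C) :
  nrm (\sum_(i <- r | P i) F i) <= \sum_(i <- r | P i) nrm (F i).
Proof.
elim/big_rec2: _ => [|i y x _ H]; first by rewrite nrm0.
by apply: le_trans (nrmD _ _) _; rewrite lerD2l.
Qed.
Lemma nrm_le_split z : nrm z <= `|complex.Re z| + `|complex.Im z|.
Proof.
case: z => a b; rewrite /nrm /=.
rewrite -[leRHS]ger0_norm ?addr_ge0// -sqrtr_sqr ler_wsqrtr//.
rewrite -(real_normK (num_real a)) -(real_normK (num_real b)).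
have := normr_ge0 a; have := normr_ge0 b; nra.
Qed.
Lemma normRe_le z : `|complex.Re z| <= nrm z.
Proof.
case: z => a b; rewrite /nrm /=.
by rewrite -sqrtr_sqr ler_wsqrtr// lerDl sqr_ge0.
Qed.
Lemma normIm_le z : `|complex.Im z| <= nrm z.
Proof.
case: z => a b; rewrite /nrm /=.
by rewrite -sqrtr_sqr ler_wsqrtr// lerDr sqr_ge0.
Qed.
Lemma nrm_sqr z : nrm z ^+ 2 = complex.Re z ^+ 2 + complex.Im z ^+ 2.
Proof. by case: z => a b; rewrite /nrm /= sqr_sqrtr// addr_ge0 ?sqr_ge0. Qed.

Lemma cReD z w : complex.Re (z + w) = complex.Re z + complex.Re w.
Proof. by case: z; case: w. Qed.
Lemma cImD z w : complex.Im (z + w) = complex.Im z + complex.Im w.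
Proof. by case: z; case: w. Qed.
Lemma cReN z : complex.Re (- z) = - complex.Re z.
Proof. by case: z. Qed.
Lemma cImN z : complex.Im (- z) = - complex.Im z.
Proof. by case: z. Qed.
Lemma cReM z w : complex.Re (z * w) =
  complex.Re z * complex.Re w - complex.Im z * complex.Im w.
Proof. by case: z; case: w. Qed.
Lemma cImM z w : complex.Im (z * w) =
  complex.Re z * complex.Im w + complex.Im z * complex.Re w.
Proof. by case: z; case: w. Qed.
Lemma cRe_ofreal (x : R) : complex.Re (ofreal x) = x. Proof. by []. Qed.
Lemma cIm_ofreal (x : R) : complex.Im (ofreal x) = 0. Proof. by []. Qed.
Lemma cplxP z w : complex.Re z = complex.Re w -> complex.Im z = complex.Im w ->
  z = w.
Proof. by case: z; case: w => a b c d /= -> ->. Qed.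

Definition clim (u : nat -> C) (l : C) := forall e : R, 0 < e ->
  exists N, forall n, (N <= n)%N -> nrm (u n - l) <= e.

(** The difference quotient is multiplied out, so h = 0 needs no separate treatment in products and
    compositions, and the tolerances are real. *)
Definition cder (f : C -> C) (z l : C) := forall e : R, 0 < e ->
  exists2 d : R, 0 < d &
    forall h, nrm h < d -> nrm (f (z + h) - f z - l * h) <= e * nrm h.

Definition ccont (f : C -> C) (z : C) := forall e : R, 0 < e ->
  exists2 d : R, 0 < d & forall h, nrm h < d -> nrm (f (z + h) - f z) <= e.

Lemma ltC_ofreal (d : C) : 0 < d -> exists2 r : R, 0 < r & d = ofreal r.
Proof.
by rewrite ltcE => /andP[/eqP H1 H2]; exists (complex.Re d) => //; apply: cplxP.
Qed.

Lemma is_derive_cder f z l : is_derive z 1 f l <-> cder f z l.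
Proof.
rewrite is_deriveP; split=> H e e0.
- have [|_ /ltC_ofreal[d d0 ->] Hd] := H (ofreal e); first by rewrite ltcR.
  by exists d => // h hd; rewrite -lecR; have := Hd h; rewrite !normE -!ofrealM; apply;
    rewrite ltcR.
- have [r r0 ->] := ltC_ofreal e0.
  have [d d0 Hd] := H r r0; exists (ofreal d); first by rewrite ltcR.
  by move=> h; rewrite !normE -ofrealM ltcR lecR; exact: Hd.
Qed.

Lemma cvg_clim (u : nat -> C) l : u @ \oo --> l <-> clim u l.
Proof.
split.
- move=> /cvgrPdist_le H e e0.
  have [|N _ HN] := H (ofreal e); first by rewrite ltcR.
  exists N => n Nn; rewrite nrm_sub -lecR; exact: HN.
- move=> H; apply/cvgrPdist_le => _ /ltC_ofreal[e e0 ->].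
  have [N HN] := H e e0; exists N => // n Nn.
  by rewrite normE lecR nrm_sub; exact: HN.
Qed.

Lemma derivableP1 f z : derivable f z 1 <-> exists l, cder f z l.
Proof.
split=> [/derivableP H|[l /is_derive_cder[]//]].
by exists ('D_1 f z); apply/is_derive_cder.
Qed.

Lemma derive1_cder f z l : cder f z l -> derive1 f z = l.
Proof. by move/is_derive_cder => [_ <-]; rewrite derive1E. Qed.

Lemma cder_uniq f z l m : cder f z l -> cder f z m -> l = m.
Proof. by move=> /derive1_cder <- /derive1_cder <-. Qed.

Lemma cder_eql f z l m : cder f z l -> l = m -> cder f z m.
Proof. by move=> H <-. Qed.

Lemma cder_near f g z l : (exists2 d : R, 0 < d & forall h, nrm h < d ->
  f (z + h) = g (z + h)) -> cder f z l -> cder g z l.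
Proof.
move=> [d d0 H] Hf e e0; have [d' d'0 Hd'] := Hf e e0.
exists (Num.min d d'); first by rewrite lt_min d0.
move=> h; rewrite lt_min => /andP[h1 h2].
by rewrite -H// -[X in g X]addr0 -H ?nrm0// addr0; exact: Hd'.
Qed.

Lemma cder_ext f g z l : f =1 g -> cder f z l -> cder g z l.
Proof. by move=> H; apply: cder_near; exists 1. Qed.

(** Quadratic remainders are what explicit computations produce: for the inverse, for termwise
    differentiated series and for the Bernoulli function. *)
Lemma cder_sqr f z l (K d : R) : 0 < d ->
  (forall h, nrm h < d -> nrm (f (z + h) - f z - l * h) <= K * nrm h ^+ 2) ->
  cder f z l.
Proof.
move=> d0 H e e0.
have K1 : 0 < `|K| + 1 by rewrite ltr_wpDl.
exists (Num.min d (e / (`|K| + 1))); first by rewrite lt_min d0 divr_gt0.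
move=> h; rewrite lt_min => /andP[h1 h2].
apply: le_trans (H h h1) _.
rewrite expr2 mulrA ler_wpM2r ?nrm_ge0//.
move: h2; rewrite ltr_pdivlMr// => h2.
have := ler_norm K; have := nrm_ge0 h; nra.
Qed.

Lemma cder_cst c z : cder (fun=> c) z 0.
Proof. by apply: (@cder_sqr _ _ _ 0 1) => // h _; rewrite subrr mul0r subrr nrm0 mul0r. Qed.

Lemma cder_id z : cder (fun x => x) z 1.
Proof.
apply: (@cder_sqr _ _ _ 0 1) => // h _.
by rewrite (_ : _ - _ = 0) ?nrm0 ?mul0r//; ring.
Qed.

Lemma cder_cont f z l : cder f z l -> ccont f z.
Proof.
move=> H e e0; have [d d0 Hd] := H 1 ltr01.
have K0 : 0 < nrm l + 1 by rewrite ltr_wpDl ?nrm_ge0.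
exists (Num.min d (e / (nrm l + 1))); first by rewrite lt_min d0 divr_gt0.
move=> h; rewrite lt_min ltr_pdivlMr// => /andP[/Hd h1 h2].
have := nrmD (f (z + h) - f z - l * h) (l * h); rewrite subrK nrmM => h3.
by lra.
Qed.

Lemma cderD f g z l m : cder f z l -> cder g z m ->
  cder (fun x => f x + g x) z (l + m).
Proof.
move=> Hf Hg e e0; have e2 : 0 < e / 2 by lra.
have [d d0 Hd] := Hf _ e2; have [d' d'0 Hd'] := Hg _ e2.
exists (Num.min d d'); first by rewrite lt_min d0.
move=> h; rewrite lt_min => /andP[/Hd h1 /Hd' h2].
have -> : f (z + h) + g (z + h) - (f z + g z) - (l + m) * h =
  (f (z + h) - f z - l * h) + (g (z + h) - g z - m * h) by ring.
by apply: le_trans (nrmD _ _) _; lra.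
Qed.

Lemma cderM f g z l m : cder f z l -> cder g z m ->
  cder (fun x => f x * g x) z (l * g z + f z * m).
Proof.
move=> Hf Hg e e0.
pose A := nrm (g z) + 1 + nrm l + nrm (f z) + 1.
have [n1 n2 n3] : [/\ 0 <= nrm (g z), 0 <= nrm l & 0 <= nrm (f z)]
  by rewrite !nrm_ge0.
have A0 : 0 < A by rewrite /A; lra.
pose e1 := Num.min 1 (e / A).
have e10 : 0 < e1 by rewrite /e1 lt_min ltr01 divr_gt0.
have e11 : e1 <= 1 by rewrite /e1 ge_min lexx.
have e1A : e1 * A <= e by rewrite -ler_pdivlMr// /e1 ge_min lexx orbT.
have [d d0 Hd] := Hf _ e10; have [d' d'0 Hd'] := Hg _ e10.
have [d2 d20 Hd2] := cder_cont Hg e10.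
exists (Num.min d (Num.min d' d2)); first by rewrite !lt_min d0 d'0.
move=> h; rewrite !lt_min => /and3P[/Hd h1 /Hd' h2 /Hd2 h3].
have -> : f (z + h) * g (z + h) - f z * g z - (l * g z + f z * m) * h =
  (f (z + h) - f z - l * h) * g (z + h) + (l * h * (g (z + h) - g z)
  + f z * (g (z + h) - g z - m * h)) by ring.
have h4 : nrm (g (z + h)) <= nrm (g z) + e1.
  by have := nrmD (g (z + h) - g z) (g z); rewrite subrK; lra.
apply: le_trans (nrmD _ _) _.
apply: (@le_trans _ _ (e1 * nrm h * (nrm (g z) + e1) + (nrm l * nrm h * e1 + nrm (f z) * (e1 * nrm h)))).
  apply: lerD; first by rewrite nrmM ler_pM ?nrm_ge0.
  apply: le_trans (nrmD _ _) _; rewrite !nrmM.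
  by apply: lerD; rewrite ler_wpM2l ?mulr_ge0 ?nrm_ge0.
have := nrm_ge0 h => h0.
have -> : e1 * nrm h * (nrm (g z) + e1) +
  (nrm l * nrm h * e1 + nrm (f z) * (e1 * nrm h)) =
  e1 * (nrm (g z) + e1 + nrm l + nrm (f z)) * nrm h by ring.
rewrite ler_wpM2r//; apply: le_trans e1A; rewrite ler_wpM2l ?(ltW e10)// /A.
by lra.
Qed.

Lemma cder_comp f g z l m : cder g z l -> cder f (g z) m ->
  cder (fun x => f (g x)) z (m * l).
Proof.
move=> Hg Hf e e0.
pose A := nrm l + 1 + nrm m.
have [n1 n2] : 0 <= nrm l /\ 0 <= nrm m by rewrite !nrm_ge0.
have A0 : 0 < A by rewrite /A; lra.
pose e1 := Num.min 1 (e / A).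
have e10 : 0 < e1 by rewrite /e1 lt_min ltr01 divr_gt0.
have e11 : e1 <= 1 by rewrite /e1 ge_min lexx.
have e1A : e1 * A <= e by rewrite -ler_pdivlMr// /e1 ge_min lexx orbT.
have [d d0 Hd] := Hf _ e10; have [d' d'0 Hd'] := Hg _ e10.
have d2' : 0 < d / 2 by lra.
have [d2 d20 Hd2] := cder_cont Hg d2'.
exists (Num.min d' d2); first by rewrite !lt_min d'0.
move=> h; rewrite !lt_min => /andP[/Hd' h2 /Hd2 h3].
have /Hd : nrm (g (z + h) - g z) < d by lra.
rewrite subrKC => h4.
have -> : f (g (z + h)) - f (g z) - m * l * h =
  (f (g (z + h)) - f (g z) - m * (g (z + h) - g z)) +
   m * (g (z + h) - g z - l * h) by ring.
apply: le_trans (nrmD _ _) _; rewrite nrmM.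
have h5 : nrm (g (z + h) - g z) <= (nrm l + e1) * nrm h.
  have := nrmD (g (z + h) - g z - l * h) (l * h).
  by rewrite subrK nrmM mulrDl; lra.
have := nrm_ge0 h => h0.
apply: (@le_trans _ _ (e1 * ((nrm l + e1) * nrm h) + nrm m * (e1 * nrm h))).
  apply: lerD; last by rewrite ler_wpM2l.
  by apply: le_trans h4 _; rewrite ler_wpM2l// ltW.
have -> : e1 * ((nrm l + e1) * nrm h) + nrm m * (e1 * nrm h) =
  e1 * (nrm l + e1 + nrm m) * nrm h by ring.
rewrite ler_wpM2r//; apply: le_trans e1A; rewrite ler_wpM2l ?(ltW e10)// /A.
by lra.
Qed.

Lemma cder_inv z : z != 0 -> cder (fun x => x^-1) z (- z^-1 ^+ 2).
Proof.
move=> z0; have nz : 0 < nrm z by rewrite nrm_gt0.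
apply: (@cder_sqr _ _ _ (2 / nrm z ^+ 3) (nrm z / 2)); first by rewrite divr_gt0.
move=> h hz.
have hb : nrm z / 2 <= nrm (z + h) by have := nrm_geB z h; lra.
have zh0 : z + h != 0 by rewrite -nrm_gt0; lra.
have -> : (z + h)^-1 - z^-1 - - z^-1 ^+ 2 * h = h ^+ 2 / (z ^+ 2 * (z + h)).
  by field; rewrite z0 zh0.
rewrite !(nrmM, nrmX, nrmV) mulrC; apply: ler_wpM2r; first exact: sqr_ge0.
have -> : 2 / nrm z ^+ 3 = (nrm z ^+ 2 * (nrm z / 2))^-1.
  by field; rewrite gt_eqF.
rewrite lef_pV2 ?posrE ?mulr_gt0 ?exprn_gt0 ?divr_gt0//; last by lra.
by rewrite ler_wpM2l ?exprn_ge0 ?nrm_ge0.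
Qed.

Lemma cderN f z l : cder f z l -> cder (fun x => - f x) z (- l).
Proof.
move=> H; have := cderM (cder_cst (-1) z) H.
by rewrite mul0r add0r mulN1r; apply: cder_ext => x; rewrite mulN1r.
Qed.

Lemma cderB f g z l m : cder f z l -> cder g z m ->
  cder (fun x => f x - g x) z (l - m).
Proof. by move=> Hf /cderN Hg; exact: cderD. Qed.

Lemma cderZ c f z l : cder f z l -> cder (fun x => c * f x) z (c * l).
Proof. by move=> H; have := cderM (cder_cst c z) H; rewrite mul0r add0r. Qed.

Lemma cderV f z l : f z != 0 -> cder f z l ->
  cder (fun x => (f x)^-1) z (- l / f z ^+ 2).
Proof.
move=> f0 H; have := cder_comp H (cder_inv f0).
by rewrite exprVn mulNr mulrC -mulNr.
Qed.

Lemma cder_div f g z l m : g z != 0 -> cder f z l -> cder g z m ->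
  cder (fun x => f x / g x) z ((l * g z - f z * m) / g z ^+ 2).
Proof.
move=> g0 Hf Hg; apply: cder_eql (cderM Hf (cderV g0 Hg)) _.
by field.
Qed.

Lemma cder_sum (I : Type) (r : seq I) (P : pred I) (F : I -> C -> C) (l : I -> C) z :
  (forall i, P i -> cder (F i) z (l i)) ->
  cder (fun x => \sum_(i <- r | P i) F i x) z (\sum_(i <- r | P i) l i).
Proof.
move=> H; elim: r => [|i r IH].
  rewrite big_nil; apply: cder_ext (cder_cst 0 z) => x; by rewrite big_nil.
rewrite big_cons; case: ifPn => Pi.
  by apply: cder_ext (cderD (H i Pi) IH) => x; rewrite big_cons Pi.
by apply: cder_ext IH => x; rewrite big_cons (negbTE Pi).
Qed.

Lemma cderX f z l n : cder f z l ->
  cder (fun x => f x ^+ n) z (n%:R * f z ^+ n.-1 * l).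
Proof.
move=> H; elim: n => [|[|n] IH].
- by rewrite !mul0r; apply: cder_ext (cder_cst 1 z) => x; rewrite expr0.
- by rewrite expr0 !mul1r; apply: cder_ext H => x; rewrite expr1.
apply: cder_eql; first by
  apply: cder_ext (cderM H IH) => x; rewrite -exprS.
by rewrite /= !mulrSr !exprS; ring.
Qed.

Lemma hol_derivable f z l : cder f z l -> derivable f z 1.
Proof. by move=> H; apply/derivableP1; exists l. Qed.

Lemma clim_uniq u l m : clim u l -> clim u m -> l = m.
Proof.
move=> Hl Hm; apply/eqP; rewrite -subr_eq0 -nrm_eq0; apply/eqP/le_anti.
rewrite nrm_ge0 andbT; apply/ler_addgt0Pl => e e0; rewrite addr0.
have e2 : 0 < e / 2 by lra.
have [N HN] := Hl _ e2; have [N' HN'] := Hm _ e2.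
have := HN _ (leq_maxl N N'); have := HN' _ (leq_maxr N N').
move=> h1 h2; have -> : l - m = (u (maxn N N') - m) - (u (maxn N N') - l) by ring.
by apply: le_trans (nrmB _ _) _; lra.
Qed.

Lemma climD u v l m : clim u l -> clim v m -> clim (fun n => u n + v n) (l + m).
Proof.
move=> Hl Hm e e0; have e2 : 0 < e / 2 by lra.
have [N HN] := Hl _ e2; have [N' HN'] := Hm _ e2.
exists (maxn N N') => n; rewrite geq_max => /andP[/HN h1 /HN' h2].
have -> : u n + v n - (l + m) = (u n - l) + (v n - m) by ring.
by apply: le_trans (nrmD _ _) _; lra.
Qed.

Lemma climZ c u l : clim u l -> clim (fun n => c * u n) (c * l).
Proof.
move=> Hl e e0; have c0 : 0 < nrm c + 1 by rewrite ltr_wpDl ?nrm_ge0.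
have [|N HN] := Hl (e / (nrm c + 1)); first by rewrite divr_gt0.
exists N => n /HN; rewrite -mulrBr nrmM ler_pdivlMr// => h.
by have := nrm_ge0 (u n - l); lra.
Qed.

Lemma clim_cst c : clim (fun=> c) c.
Proof. by move=> e e0; exists 0%N => n _; rewrite subrr nrm0 ltW. Qed.

Lemma clim_ext u v l : u =1 v -> clim u l -> clim v l.
Proof. by move=> H Hu e e0; have [N HN] := Hu e e0; exists N => n; rewrite -H; exact: HN. Qed.

Lemma climB u v l m : clim u l -> clim v m -> clim (fun n => u n - v n) (l - m).
Proof.
move=> Hl Hm; have := climD Hl (climZ (-1) Hm); rewrite mulN1r.
by apply: clim_ext => n; rewrite mulN1r.
Qed.

Lemma clim_shift u l k : clim u l -> clim (fun n => u (n + k)%N) l.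
Proof.
move=> H e /H[N HN]; exists N => n Nn; apply: HN.
exact: leq_trans Nn (leq_addr _ _).
Qed.

Lemma clim_nrm_le u l (M : R) : clim u l -> (exists N, forall n, (N <= n)%N -> nrm (u n) <= M) -> nrm l <= M.
Proof.
move=> H [N0 HM]; apply/ler_addgt0Pl => e e0; have [N HN] := H e e0.
have := HN _ (leq_maxl N N0); have := HM _ (leq_maxr N N0).
set v := u _ => h1 h2; have -> : l = v - (v - l) by ring.
by apply: le_trans (nrmB _ _) _; lra.
Qed.

Lemma clim_cauchy (u : nat -> C) :
  (forall e : R, 0 < e -> exists N, forall m n, (N <= m)%N -> (N <= n)%N ->
     nrm (u m - u n) <= e) -> exists l, clim u l.
Proof.
move=> H.
have HR (p : C -> R) : (forall z w, `|p z - p w| <= nrm (z - w)) ->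
    exists l : R, forall e, 0 < e -> exists N, forall n, (N <= n)%N -> `|p (u n) - l| <= e.
  move=> Hp.
  have : cauchy (p \o u @ \oo).
    apply/cauchyP => e e0; have e2 : 0 < e / 2 by lra.
    have [N HN] := H _ e2.
    exists (p (u N)), N => // n /= Nn.
    rewrite /ball /=; apply: le_lt_trans (Hp _ _) _.
    by apply: le_lt_trans (HN _ _ _ _) _ => //; lra.
  move=> /cauchy_cvgP /cvg_ex[l /cvgrPdist_le Hl]; exists l => e e0.
  by have [N _ HN] := Hl e e0; exists N => n Nn; rewrite distrC; exact: HN.
have [a Ha] := HR (@complex.Re R) ltac:(by move=> z w; rewrite -cReN -cReD normRe_le).
have [b Hb] := HR (@complex.Im R) ltac:(by move=> z w; rewrite -cImN -cImD normIm_le).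
exists (a +i* b)%C => e e0; have e2 : 0 < e / 2 by lra.
have [N1 H1] := Ha _ e2; have [N2 H2] := Hb _ e2.
exists (maxn N1 N2) => n; rewrite geq_max => /andP[/H1 h1 /H2 h2].
apply: le_trans (nrm_le_split _) _.
by rewrite cReD cImD cReN cImN /=; lra.
Qed.

End Basics.

(** * The exponential function *)

Section Exp.
Variable R : realType.
Local Notation C := (cplx R).
Implicit Types (z w : C).

Lemma is_derive_real (f : R -> R) (l : R) : is_derive (0 : R) 1 f l ->
  forall e, 0 < e -> exists2 d : R, 0 < d &
    forall h, `|h| < d -> `|f h - f 0 - l * h| <= e * `|h|.
Proof.
move=> /is_deriveP H e /H[d d0 Hd]; exists d => // h hd.
by have := Hd h hd; rewrite add0r.
Qed.

Lemma cexpE z : cexp z = (expR (complex.Re z) * cos (complex.Im z) +i*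
  (expR (complex.Re z) * sin (complex.Im z)))%C.
Proof. by apply: cplxP; rewrite /= mul0r ?subr0 ?addr0. Qed.

Local Opaque cexp.

Lemma Re_cexp z : complex.Re (cexp z) = expR (complex.Re z) * cos (complex.Im z).
Proof. by rewrite cexpE. Qed.
Lemma Im_cexp z : complex.Im (cexp z) = expR (complex.Re z) * sin (complex.Im z).
Proof. by rewrite cexpE. Qed.

Lemma cexpD z w : cexp (z + w) = cexp z * cexp w.
Proof.
apply: cplxP.
  by rewrite cReM !Re_cexp !Im_cexp cReD cImD expRD cosD; ring.
by rewrite cImM !Re_cexp !Im_cexp cReD cImD expRD sinD; ring.
Qed.

Lemma cexp0 : cexp (0 : C) = 1.
Proof. by apply: cplxP; rewrite ?Re_cexp ?Im_cexp /= expR0 ?cos0 ?sin0 mul1r. Qed.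

Lemma nrm_cexp z : nrm (cexp z) = expR (complex.Re z).
Proof.
apply/eqP; rewrite -(@eqrXn2 _ 2) ?nrm_ge0 ?expR_ge0//; apply/eqP.
by rewrite nrm_sqr Re_cexp Im_cexp !exprMn -mulrDr cos2Dsin2 mulr1.
Qed.

Lemma cexp_neq0 z : cexp z != 0.
Proof. by rewrite -nrm_gt0 nrm_cexp expR_gt0. Qed.

Lemma cexpN z : cexp (- z) = (cexp z)^-1.
Proof.
apply: (mulfI (cexp_neq0 z)); rewrite -cexpD subrr cexp0.
by rewrite divff ?cexp_neq0.
Qed.

(** The addition formula reduces the derivative everywhere to this point, where the real [expR],
    [cos] and [sin] are expanded to first order. *)
Lemma cexp_der0 : cder (@cexp R) 0 1.
Proof.
move=> e e0.
(* The error is at most 6 e1 |h| in the real part and 5 e1 |h| in the imaginary part; a product of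
   two factors bounded by 2 |h| counts for 4 e1 |h|, because |h| < e1. *)
pose e1 := Num.min 1 (e / 16).
have e10 : 0 < e1 by rewrite /e1 lt_min ltr01; lra.
have [e11 e1e] : e1 <= 1 /\ e1 <= e / 16 by rewrite /e1 !ge_min !lexx orbT.
clearbody e1.
have [d1 d10 H1] := is_derive_real (is_derive_expR 0) e10.
have [d2 d20 H2] := is_derive_real (is_derive_cos 0) e10.
have [d3 d30 H3] := is_derive_real (is_derive_sin 0) e10.
exists (Num.min e1 (Num.min d1 (Num.min d2 d3))).
  by rewrite !lt_min e10 d10 d20.
move=> h; rewrite !lt_min => /and4P[h0 h1 h2 h3].
set x := complex.Re h; set y := complex.Im h.
have hx : `|x| <= nrm h := normRe_le h.
have hy : `|y| <= nrm h := normIm_le h.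
have := H1 x (le_lt_trans hx h1); have := H2 y (le_lt_trans hy h2).
have := H3 y (le_lt_trans hy h3).
rewrite expR0 sin0 cos0 oppr0 mul0r ?subr0 ?addr0 !mul1r.
set s := sin y; set c := cos y; set E := expR x => Hs Hc HE.
rewrite add0r cexp0 ?mul1r.
have nh := nrm_ge0 h.
have hs : `|s - y| <= e1 * nrm h by apply: le_trans Hs _; rewrite ler_wpM2l ?(ltW e10).
have hc : `|c - 1| <= e1 * nrm h by apply: le_trans Hc _; rewrite ler_wpM2l ?(ltW e10).
have hE : `|E - 1 - x| <= e1 * nrm h by apply: le_trans HE _; rewrite ler_wpM2l ?(ltW e10).
have key (a b : R) : `|a| <= 2 * nrm h -> `|b| <= 2 * nrm h -> `|a * b| <= 4 * e1 * nrm h.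
  move=> ha hb; rewrite normrM; apply: le_trans (ler_pM _ _ ha hb) _ => //.
  nra.
have e1h : e1 * nrm h <= nrm h by nra.
have hc' : `|c - 1| <= 2 * nrm h by lra.
have hE' : `|E - 1| <= 2 * nrm h.
  by have := ler_normD (E - 1 - x) x; rewrite subrK; lra.
have hs' : `|s| <= 2 * nrm h.
  by have := ler_normD (s - y) y; rewrite subrK; lra.
have k1 := key _ _ hE' hc'; have k2 := key _ _ hE' hs'.
apply: le_trans (nrm_le_split _) _.
rewrite !(cReD, cImD, cReN, cImN) Re_cexp Im_cexp /= -/x -/y -/E -/c -/s.
have -> : E * c - 1 - x = (E - 1) * (c - 1) + ((E - 1 - x) + (c - 1)) by ring.
have -> : E * s - 0 - y = (E - 1) * s + (s - y) by ring.
have := ler_normD ((E - 1) * (c - 1)) (E - 1 - x + (c - 1)).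
have := ler_normD (E - 1 - x) (c - 1).
have := ler_normD ((E - 1) * s) (s - y).
have : e1 * nrm h <= e / 16 * nrm h by rewrite ler_wpM2r.
have : 0 <= e * nrm h by rewrite mulr_ge0 ?(ltW e0).
lra.
Qed.

Lemma cder_cexp z : cder (@cexp R) z (cexp z).
Proof.
have H : cder (fun h : C => cexp z * cexp h) 0 (cexp z).
  by have := cderZ (cexp z) cexp_der0; rewrite mulr1.
move=> e /H[d d0 Hd]; exists d => // h /Hd.
by rewrite add0r cexp0 mulr1 cexpD.
Qed.

Local Notation "'tpi'" := (2 * pi : R).

Lemma twopi_gt0 : 0 < tpi. Proof. by rewrite mulr_gt0 ?pi_gt0. Qed.

Lemma twopii_neq0 : twopii R != 0.
Proof. by apply/eqP => /(congr1 (@complex.Im R)) /= /eqP; rewrite gt_eqF ?twopi_gt0. Qed.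

Lemma e2piiD z w : e2pii (z + w) = e2pii z * e2pii w.
Proof. by rewrite /e2pii mulrDr cexpD. Qed.
Lemma e2pii0 : e2pii (0 : C) = 1.
Proof. by rewrite /e2pii mulr0 cexp0. Qed.
Lemma e2piiN z : e2pii (- z) = (e2pii z)^-1.
Proof. by rewrite /e2pii mulrN cexpN. Qed.
Lemma e2piiB z w : e2pii (z - w) = e2pii z / e2pii w.
Proof. by rewrite e2piiD e2piiN. Qed.
Lemma e2pii_neq0 z : e2pii z != 0.
Proof. exact: cexp_neq0. Qed.
Lemma Re_twopii z : complex.Re (twopii R * z) = - (tpi * complex.Im z).
Proof. by rewrite cReM /=; ring. Qed.
Lemma Im_twopii z : complex.Im (twopii R * z) = tpi * complex.Re z.
Proof. by rewrite cImM /=; ring. Qed.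
Lemma nrm_e2pii z : nrm (e2pii z) = expR (- (tpi * complex.Im z)).
Proof. by rewrite /e2pii nrm_cexp Re_twopii. Qed.
Lemma e2pii1 : e2pii (1 : C) = 1.
Proof.
apply: cplxP; rewrite ?Re_cexp ?Im_cexp Re_twopii Im_twopii /= mulr0 oppr0 expR0 mul1r mulr1 mulr_natl.
  by rewrite cos2pi.
by rewrite sin2pi.
Qed.
Lemma e2pii_natM n z : e2pii (n%:R * z) = e2pii z ^+ n.
Proof.
elim: n => [|n IH]; first by rewrite mul0r e2pii0 expr0.
by rewrite -natr1 mulrDl mul1r e2piiD IH exprSr.
Qed.
Lemma e2pii_nat n : e2pii (n%:R : C) = 1.
Proof. by rewrite -[n%:R]mulr1 e2pii_natM e2pii1 expr1n. Qed.
Lemma e2pii_int (m : int) : e2pii (m%:~R : C) = 1.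
Proof.
case: m => n; first exact: e2pii_nat.
by rewrite NegzE mulrNz e2piiN e2pii_nat invr1.
Qed.
Lemma e2piiD1 z : e2pii (z + 1) = e2pii z.
Proof. by rewrite e2piiD e2pii1 mulr1. Qed.
Lemma e2piiDint z (m : int) : e2pii (z + m%:~R) = e2pii z.
Proof. by rewrite e2piiD e2pii_int mulr1. Qed.
Lemma cder_e2pii z : cder (@e2pii R) z (twopii R * e2pii z).
Proof.
have H := cderZ (twopii R) (cder_id z).
have := cder_comp H (cder_cexp _); rewrite mulr1 mulrC; exact.
Qed.
Lemma qpowE n (tau : C) : qpow n%:R tau = e2pii tau ^+ n.
Proof. by rewrite /qpow ofreal_nat e2pii_natM. Qed.
Lemma nrm_e2pii_lt1 z : uhp R z -> nrm (e2pii z) < 1.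
Proof.
rewrite /uhp /= => H; rewrite nrm_e2pii expR_lt1 oppr_lt0.
by rewrite mulr_gt0 ?twopi_gt0.
Qed.

Lemma e2pii_eq1 z : e2pii z = 1 -> exists m : int, z = m%:~R.
Proof.
move=> H; pose m := Num.floor (complex.Re z); exists m.
have y0 : complex.Im z = 0.
  have : expR (- (tpi * complex.Im z)) = expR 0 by rewrite -nrm_e2pii H nrm1 expR0.
  move=> /expR_inj/eqP.
  by rewrite oppr_eq0 mulf_eq0 gt_eqF ?twopi_gt0//= => /eqP.
pose t := complex.Re z - m%:~R.
have t0 : 0 <= t by rewrite subr_ge0 floor_le_tmp.
have t1 : t < 1 by have := floorD1_gt (complex.Re z); rewrite -/m /t intrD; lra.
have zt : z - m%:~R = ofreal t.
  have -> : (m%:~R : C) = ofreal m%:~R by rewrite /ofreal rmorph_int.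
  by apply: cplxP; rewrite (cReD, cImD) (cReN, cImN) /= ?y0 ?subr0.
have : e2pii (ofreal t) = 1 by rewrite -zt -mulrNz e2piiDint.
move=> /(congr1 (@complex.Re R)); rewrite Re_cexp Re_twopii Im_twopii /=.
rewrite mulr0 oppr0 expR0 mul1r => Hc.
have pi0 := pi_gt0 R.
suff t00 : t = 0 by apply/eqP; rewrite -subr_eq0 zt t00.
(* [cos] is injective on [0, pi] only, so a fractional part above 1/2 is reflected to 1 - t. *)
have [h|h] := leP t (1/2).
  have := @cos_inj R (tpi * t) 0; rewrite !in_itv /= cos0 Hc lexx (ltW pi0).
  have -> : 0 <= tpi * t <= pi by apply/andP; split; nra.
  by move=> /(_ erefl erefl erefl)/eqP; rewrite mulf_eq0 gt_eqF ?twopi_gt0//= => /eqP.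
have := @cos_inj R (tpi * (1 - t)) 0; rewrite !in_itv /= cos0 lexx (ltW pi0).
have -> : 0 <= tpi * (1 - t) <= pi by apply/andP; split; nra.
have -> : cos (tpi * (1 - t)) = 1.
  by rewrite -[RHS]Hc -[RHS]cosN -[RHS]cosD2pi; congr cos; rewrite -[pi *+ 2]mulr_natl; ring.
move=> /(_ erefl erefl erefl)/eqP; rewrite mulf_eq0 gt_eqF ?twopi_gt0//=.
by rewrite subr_eq0 => /eqP t1'; rewrite -t1' ltxx in t1.
Qed.

Lemma e2pii_surj w : w != 0 -> exists z, e2pii z = w.
Proof.
move=> w0; have r0 : 0 < nrm w by rewrite nrm_gt0.
have [y Hy] := expR_total r0.
pose u := w / ofreal (nrm w).
have rc : ofreal (nrm w) != 0 by rewrite -nrm_gt0 nrm_ofreal gtr0_norm.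
have wE : w = ofreal (nrm w) * u by rewrite /u mulrC divfK.
have u1 : nrm u = 1.
  by rewrite /u nrmM nrmV nrm_ofreal gtr0_norm// divff// gt_eqF.
have := nrm_sqr u; rewrite u1 expr1n.
set a := complex.Re u; set b := complex.Im u => ab.
have ha : -1 <= a <= 1 by apply/andP; split; nra.
have [t [ct st]] : exists t : R, cos t = a /\ sin t = b.
  have ca : cos (acos a) = a by apply: acosK; rewrite in_itv.
  have sa : sin (acos a) = `|b|.
    by rewrite sin_acos// -sqrtr_sqr; congr Num.sqrt; lra.
  have [b0|b0] := leP 0 b; first by exists (acos a); rewrite ca sa ger0_norm.
  by exists (- acos a); rewrite cosN sinN ca sa ltr0_norm// opprK.
have tp := twopi_gt0; have tp0 : tpi != 0 by rewrite gt_eqF.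
exists (t / tpi +i* (- y / tpi))%C.
apply: cplxP; rewrite ?Re_cexp ?Im_cexp Re_twopii Im_twopii /=.
  have -> : - (tpi * (- y / tpi)) = y by rewrite mulNr mulrN opprK mulrC divfK.
  have -> : tpi * (t / tpi) = t by rewrite mulrC divfK.
  by rewrite Hy ct [in RHS]wE cReM /= mul0r subr0.
have -> : - (tpi * (- y / tpi)) = y by rewrite mulNr mulrN opprK mulrC divfK.
have -> : tpi * (t / tpi) = t by rewrite mulrC divfK.
by rewrite Hy st [in RHS]wE cImM /= mul0r addr0.
Qed.

Lemma e2pii_surj_uhp w : w != 0 -> nrm w < 1 -> exists2 z, uhp R z & e2pii z = w.
Proof.
move=> /e2pii_surj[z <-] H; exists z => //; move: H.
rewrite nrm_e2pii expR_lt1 oppr_lt0 pmulr_rgt0 ?twopi_gt0//.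
Qed.

End Exp.

(** * Goursat's theorem *)

Section Bisection.
Variable R : realType.
Local Notation C := (cplx R).

Lemma geom_small (r e : R) : 0 <= r < 1 -> 0 < e ->
  exists N, forall n, (N <= n)%N -> r ^+ n <= e.
Proof.
move=> /andP[r0 r1] e0; have : `|r| < 1 by rewrite ger0_norm.
move=> /cvg_expr /cvgrPdist_le /(_ e e0)[N _ HN]; exists N => n Nn.
have := HN n Nn; rewrite /= sub0r normrN ger0_norm ?exprn_ge0//.
Qed.

Lemma nested (a b : nat -> R) : (forall n, a n <= a n.+1) -> (forall n, b n.+1 <= b n) ->
  (forall n, a n <= b n) -> exists u, forall n, a n <= u <= b n.
Proof.
move=> Ha Hb ab.
have Ha' : {homo a : m n / (m <= n)%N >-> m <= n} by apply/nondecreasing_seqP.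
have Hb' : {homo b : m n / (m <= n)%N >-> n <= m} by apply/nonincreasing_seqP.
have amb m n : a m <= b n.
  apply: le_trans (Ha' _ _ (leq_maxl m n)) _.
  exact: le_trans (ab _) (Hb' _ _ (leq_maxr m n)).
exists (sup (range a)) => n; apply/andP; split.
  apply: ub_le_sup; last by exists n.
  by exists (b 0%N) => _ [m _ <-].
by apply: ge_sup; [exists (a 0%N), 0%N | move=> _ [m _ <-]].
Qed.

Definition quad_in (x1 x2 y1 y2 : R) (r : R * R * (R * R)) :=
  [/\ x1 <= r.1.1, r.1.1 <= r.1.2, r.1.2 <= x2 &
   [/\ y1 <= r.2.1, r.2.1 <= r.2.2 & r.2.2 <= y2]].

(* Compactness of a rectangle, in the form of an induction principle by
   repeated quartering. *)
Lemma rect_ind (Q : R -> R -> R -> R -> Prop) (x1 x2 y1 y2 : R) :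
  x1 <= x2 -> y1 <= y2 ->
  (forall a b c d, x1 <= a -> a <= b -> b <= x2 -> y1 <= c -> c <= d -> d <= y2 ->
    let m := (a + b) / 2 in let n := (c + d) / 2 in
    Q a m c n -> Q m b c n -> Q a m n d -> Q m b n d -> Q a b c d) ->
  (forall u v, x1 <= u <= x2 -> y1 <= v <= y2 -> exists2 e : R, 0 < e &
    forall a b c d, x1 <= a -> a <= u <= b -> b <= x2 ->
      y1 <= c -> c <= v <= d -> d <= y2 ->
      b - a < e -> d - c < e -> Q a b c d) ->
  Q x1 x2 y1 y2.
Proof.
move=> x12 y12 Hq Hl; apply: contrapT => nQ.
pose bad (r : R * R * (R * R)) := ~ Q r.1.1 r.1.2 r.2.1 r.2.2.
pose hv (s : R * R) (k : bool) := if k then (s.1, (s.1 + s.2) / 2) else ((s.1 + s.2) / 2, s.2).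
(* The hypotheses on r stand under the existential so that [choice] yields a total function to
   iterate. *)
have step r : exists r', quad_in x1 x2 y1 y2 r -> bad r -> bad r' /\
    exists k k', r' = (hv r.1 k, hv r.2 k').
  have [[br ri]|H] := pselect (bad r /\ quad_in x1 x2 y1 y2 r); last first.
    by exists r => ri br; exfalso; apply: H.
  apply: contrapT => H; apply: br.
  have HH k k' : Q (hv r.1 k).1 (hv r.1 k).2 (hv r.2 k').1 (hv r.2 k').2.
    apply: contrapT => nn; apply: H; exists (hv r.1 k, hv r.2 k') => _ _; split => //.
    by exists k, k'.
  case: ri => h1 h2 h3 [h4 h5 h6].
  have H1 := HH true true; have H2 := HH false true.
  have H3 := HH true false; have H4 := HH false false.
  exact: Hq.
have [nx Hnx] := choice step.
pose s n := iter n nx ((x1, x2), (y1, y2)).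
have Hs n : quad_in x1 x2 y1 y2 (s n) /\ bad (s n).
  elim: n => [|n [IH1 IH2]]; first by split => //; split; rewrite /= ?lexx.
  have [b1 [k [k' E]]] := Hnx _ IH1 IH2.
  split => //; rewrite /s iterS -/(s n) E; move: IH1; rewrite /quad_in.
  case: (s n) => [[a b] [c d]] /= [h1 h2 h3 [h4 h5 h6]].
  by case: k {E}; case: k' => /=; split => //; (try split => //); lra.
have Hn n : exists k k', s n.+1 = (hv (s n).1 k, hv (s n).2 k').
  by have [b1 b2] := Hs n; have [_ H] := Hnx _ b1 b2.
have [u Hu] : exists u, forall n, (s n).1.1 <= u <= (s n).1.2.
  apply: nested => n.
  - have [k [k' ->]] := Hn n; have [[_ h _ _] _] := Hs n.
    by case: k => /=; lra.
  - have [k [k' ->]] := Hn n; have [[_ h _ _] _] := Hs n.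
    by case: k => /=; lra.
  - by have [[_ h _ _] _] := Hs n.
have [v Hv] : exists u, forall n, (s n).2.1 <= u <= (s n).2.2.
  apply: nested => n.
  - have [k [k' ->]] := Hn n; have [[_ _ _ [_ h _]] _] := Hs n.
    by case: k' => /=; lra.
  - have [k [k' ->]] := Hn n; have [[_ _ _ [_ h _]] _] := Hs n.
    by case: k' => /=; lra.
  - by have [[_ _ _ [_ h _]] _] := Hs n.
have [e e0 He] := Hl u v (Hu 0%N) (Hv 0%N).
have len n : (s n).1.2 - (s n).1.1 = (x2 - x1) * 2^-1 ^+ n /\
             (s n).2.2 - (s n).2.1 = (y2 - y1) * 2^-1 ^+ n.
  elim: n => [|n [IH1 IH2]]; first by rewrite !expr0 !mulr1.
  have [k [k' ->]] := Hn n; rewrite exprSr !mulrA -IH1 -IH2.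
  by split; [case: k|case: k'] => /=; field.
(* The added 1 keeps [K] positive for a degenerate rectangle; segments are treated as such
   rectangles later. *)
pose K := (x2 - x1) + (y2 - y1) + 1.
have K0 : 0 < K by rewrite /K; lra.
have [||N HN] := @geom_small 2^-1 (e / (2 * K)); [by apply/andP; split; lra|by rewrite divr_gt0 ?mulr_gt0|].
have := HN N (leqnn N); rewrite ler_pdivlMr ?mulr_gt0// => HN'.
have [[h1 h2 h3 [h4 h5 h6]] bd] := Hs N; apply: bd.
have [l1 l2] := len N.
have p0 : 0 <= 2^-1 ^+ N :> R by rewrite exprn_ge0.
by apply: He => //; rewrite ?l1 ?l2 /K in HN' *; nra.
Qed.

End Bisection.

(** * Integrals along segments and Goursat's theorem on rectangles *)

Section Segments.
Variable R : realType.
Local Notation C := (cplx R).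
Implicit Types (f g : C -> C) (a b z w : C).

Definition mk (x y : R) : C := (x +i* y)%C.

Lemma mkE z : mk (complex.Re z) (complex.Im z) = z. Proof. by case: z. Qed.
Definition mid a b : C := mk ((complex.Re a + complex.Re b) / 2)
                             ((complex.Im a + complex.Im b) / 2).

Lemma midE a b : mid a b = (a + b) / 2.
Proof.
have -> : (2^-1 : C) = ofreal 2^-1 by rewrite ofrealV ofreal_nat.
by apply: cplxP; rewrite ?(cReM, cImM) ?(cReD, cImD) /=; ring.
Qed.

(** The left Riemann sum over 2^n equal pieces of the segment, divided by b - a. The recursion by
    halves fits the bisection principle. *)
Fixpoint avg (n : nat) f a b : C :=
  if n is n'.+1 then (avg n' f a (mid a b) + avg n' f (mid a b) b) / 2 else f a.

(** Only the diagonal from a to b is sampled, but hypotheses are put on the whole rectangle; for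
    horizontal and vertical segments the two coincide. *)
Definition inrect a b z := [/\ complex.Re a <= complex.Re z, complex.Re z <= complex.Re b,
  complex.Im a <= complex.Im z & complex.Im z <= complex.Im b].
Definition leC a b := complex.Re a <= complex.Re b /\ complex.Im a <= complex.Im b.

Lemma inrect_l a b z : inrect a (mid a b) z -> leC a b -> inrect a b z.
Proof. by move=> [h1 h2 h3 h4] [h5 h6]; split => //; move: h2 h4; rewrite /=; lra. Qed.
Lemma inrect_r a b z : inrect (mid a b) b z -> leC a b -> inrect a b z.
Proof. by move=> [h1 h2 h3 h4] [h5 h6]; split => //; move: h1 h3; rewrite /=; lra. Qed.
Lemma leC_l a b : leC a b -> leC a (mid a b).
Proof. by rewrite /leC /= => -[]; split; lra. Qed.
Lemma leC_r a b : leC a b -> leC (mid a b) b.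
Proof. by rewrite /leC /= => -[]; split; lra. Qed.
Lemma inrect_a a b : leC a b -> inrect a b a.
Proof. by move=> [h1 h2]; split. Qed.

Lemma avg_le2 n f g a b (M : R) : leC a b ->
  (forall z, inrect a b z -> nrm (f z - g z) <= M) ->
  nrm (avg n f a b - avg n g a b) <= M.
Proof.
elim: n a b => [|n IH] a b ab H /=; first by apply: H; exact: inrect_a.
have h1 := IH a (mid a b) (leC_l ab) (fun z zi => H z (inrect_l zi ab)).
have h2 := IH (mid a b) b (leC_r ab) (fun z zi => H z (inrect_r zi ab)).
move: h1 h2; set s := avg n _ _ _; set t := avg n _ _ _; set s' := avg n _ _ _; set t' := avg n _ _ _.
move=> h1 h2; have -> : (s + s') / 2 - (t + t') / 2 = ((s - t) + (s' - t')) / 2 by ring.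
rewrite nrmM nrmV nrm_nat; have := nrmD (s - t) (s' - t'); lra.
Qed.

Lemma avg_cst n c a b : avg n (fun=> c) a b = c.
Proof. by elim: n a b => [//|n IH] a b /=; rewrite !IH; field. Qed.

Lemma avg_le n f a b c (M : R) : leC a b ->
  (forall z, inrect a b z -> nrm (f z - c) <= M) -> nrm (avg n f a b - c) <= M.
Proof. by move=> ab H; rewrite -[c in _ - c](avg_cst n c a b); exact: avg_le2. Qed.

Lemma avg_ext n f g a b : leC a b -> (forall z, inrect a b z -> f z = g z) ->
  avg n f a b = avg n g a b.
Proof.
move=> ab H; apply/eqP; rewrite -subr_eq0 -nrm_eq0 eq_le nrm_ge0 andbT.
by apply: avg_le2 => // z /H ->; rewrite subrr nrm0.
Qed.

Lemma avgD n f g a b : avg n (fun z => f z + g z) a b = avg n f a b + avg n g a b.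
Proof. by elim: n a b => [//|n IH] a b /=; rewrite !IH; ring. Qed.

Lemma avgZ n c f a b : avg n (fun z => c * f z) a b = c * avg n f a b.
Proof. by elim: n a b => [//|n IH] a b /=; rewrite !IH; ring. Qed.

Lemma avg_shift n f a b w : avg n f (a + w) (b + w) = avg n (fun z => f (z + w)) a b.
Proof.
elim: n a b => [//|n IH] a b /=.
have -> : mid (a + w) (b + w) = mid a b + w by rewrite !midE; field.
by rewrite !IH.
Qed.

Lemma avg_id n a b : avg n id a b = a + (b - a) / 2 * (1 - 2^-1 ^+ n).
Proof.
elim: n a b => [|n IH] a b /=; first by rewrite expr0; ring.
by rewrite !IH !midE exprS; field.
Qed.

Definition acvg f a b := exists l, clim (fun n => avg n f a b) l.
(* The integral along the segment [a, b], a limit of dyadic averages. *)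
Definition sint f a b : C := (b - a) * xget 0 [set l | clim (fun n => avg n f a b) l].

Lemma sintE f a b l : clim (fun n => avg n f a b) l -> sint f a b = (b - a) * l.
Proof.
move=> H; rewrite /sint; case: xgetP => [x _ Hx|/(_ l)//].
by rewrite (clim_uniq Hx H).
Qed.

Lemma acvg_cont f a b : leC a b -> (forall z, inrect a b z -> ccont f z) -> acvg f a b.
Proof.
move=> [ab1 ab2] H; apply: clim_cauchy => e e0.
rewrite -[a]mkE -[b]mkE.
pose Q (x1 x2 y1 y2 : R) := exists N, forall m n, (N <= m)%N -> (N <= n)%N ->
  nrm (avg m f (mk x1 y1) (mk x2 y2) - avg n f (mk x1 y1) (mk x2 y2)) <= e.
apply: (@rect_ind R Q) => //.
(* The diagonal meets two of the four quarters along a segment, so the other two hypotheses are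
   dropped. The successor appears because an average of order n+1 is made of averages of order n on
   the halves. *)
- move=> x1 x2 y1 y2 _ _ _ _ _ _ m n [N1 H1] _ _ [N2 H2].
  exists (maxn N1 N2).+1 => -[//|p] [//|q]; rewrite !ltnS !geq_max => /andP[p1 p2] /andP[q1 q2].
  move: (H1 p q p1 q1) (H2 p q p2 q2) => /=.
  rewrite /mid /= -/m -/n.
  set s := avg p _ _ _; set t := avg q _ _ _; set s' := avg p _ _ _; set t' := avg q _ _ _.
  move=> h1 h2; have -> : (s + s') / 2 - (t + t') / 2 = ((s - t) + (s' - t')) / 2 by ring.
  rewrite nrmM nrmV nrm_nat; have := nrmD (s - t) (s' - t'); lra.
- move=> u v Hu Hv.
  have Hin : inrect a b (mk u v).
    by move: Hu Hv => /andP[? ?] /andP[? ?]; split.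
  have [|d d0 Hd] := H (mk u v) Hin (e / 2); first by lra.
  exists (d / 2); first by lra.
  move=> x1 x2 y1 y2 _ /andP[u1 u2] _ _ /andP[v1 v2] _ h1 h2; exists 0%N => m n _ _.
  have Hz z : inrect (mk x1 y1) (mk x2 y2) z -> nrm (f z - f (mk u v)) <= e / 2.
    move=> [/= z1 z2 z3 z4]; rewrite -[z](subrKC (mk u v)); apply: Hd.
    apply: le_lt_trans (nrm_le_split _) _; rewrite cReD cImD cReN cImN /=.
    have : `|complex.Re z - u| < d / 2 by rewrite ltr_norml; lra.
    have : `|complex.Im z - v| < d / 2 by rewrite ltr_norml; lra.
    lra.
  have Lxy : leC (mk x1 y1) (mk x2 y2) by split => /=; lra.
  have k1 := avg_le m Lxy Hz; have k2 := avg_le n Lxy Hz.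
  set s := avg m _ _ _ in k1 *; set t := avg n _ _ _ in k2 *.
  have -> : s - t = (s - f (mk u v)) - (t - f (mk u v)) by ring.
  by apply: le_trans (nrmB _ _) _; lra.
Qed.

Lemma sint_half f a b : acvg f a (mid a b) -> acvg f (mid a b) b ->
  sint f a b = sint f a (mid a b) + sint f (mid a b) b.
Proof.
move=> [l Hl] [m Hm]; rewrite (sintE Hl) (sintE Hm).
have H : clim (fun n => avg n f a b) ((l + m) / 2).
  have := climZ 2^-1 (climD Hl Hm); rewrite mulrC => H e /H[N HN].
  by exists N.+1 => -[//|n] /HN; rewrite /= mulrC.
by rewrite (sintE H) midE; field.
Qed.

Lemma sintD f g a b : acvg f a b -> acvg g a b ->
  sint (fun z => f z + g z) a b = sint f a b + sint g a b.
Proof.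
move=> [l Hl] [m Hm]; rewrite (sintE Hl) (sintE Hm) -mulrDr; apply: sintE.
by apply: clim_ext (climD Hl Hm) => n; rewrite avgD.
Qed.

Lemma sintZ c f a b : acvg f a b -> sint (fun z => c * f z) a b = c * sint f a b.
Proof.
move=> [l Hl]; rewrite (sintE Hl) mulrCA; apply: sintE.
by apply: clim_ext (climZ c Hl) => n; rewrite avgZ.
Qed.

Lemma sint_ext f g a b : leC a b -> (forall z, inrect a b z -> f z = g z) ->
  sint f a b = sint g a b.
Proof.
move=> ab H; rewrite /sint; congr (_ * xget _ _); apply/funext => l.
apply/propext; split; apply: clim_ext => n; apply: avg_ext => // z /H //.
Qed.

Lemma sint_le f a b (M : R) : leC a b -> acvg f a b ->
  (forall z, inrect a b z -> nrm (f z) <= M) -> nrm (sint f a b) <= nrm (b - a) * M.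
Proof.
move=> ab [l Hl] H; rewrite (sintE Hl) nrmM ler_wpM2l ?nrm_ge0//.
apply: (clim_nrm_le Hl); exists 0%N => n _.
by rewrite -[avg _ _ _ _]subr0; apply: avg_le => // z /H; rewrite subr0.
Qed.

Lemma clim_half : clim (fun n => 2^-1 ^+ n : C) 0.
Proof.
move=> e e0; have [||N HN] := @geom_small R 2^-1 e => //; first by apply/andP; split; lra.
by exists N => n /HN; rewrite subr0 nrmX nrmV nrm_nat.
Qed.

(** The midpoint rule is exact on linear functions. This integrates the tangent in Goursat's theorem
    and the constant 1 in the Fourier theorem. *)
Lemma sint_lin c d a b :
  acvg (fun z => c + d * z) a b /\
  sint (fun z => c + d * z) a b = (b - a) * (c + d * ((a + b) / 2)).
Proof.
have H : clim (fun n => avg n (fun z => c + d * z) a b) (c + d * ((a + b) / 2)).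
  have -> : c + d * ((a + b) / 2) = c + d * ((b - a) / 2 * (1 - 0) + a) by field.
  have := climD (clim_cst c) (climZ d (climD (climZ ((b - a) / 2) (climB (clim_cst 1) clim_half)) (clim_cst a))).
  by apply: clim_ext => n; rewrite (avgD n (fun=> c)) avg_cst avgZ avg_id [a + _]addrC.
by split; [exists (c + d * ((a + b) / 2)) | apply: sintE].
Qed.

Definition bd f (x1 x2 y1 y2 : R) :=
  sint f (mk x1 y1) (mk x2 y1) + sint f (mk x2 y1) (mk x2 y2)
  - sint f (mk x1 y2) (mk x2 y2) - sint f (mk x1 y1) (mk x1 y2).

Lemma mid_h x1 x2 y : mid (mk x1 y) (mk x2 y) = mk ((x1 + x2) / 2) y.
Proof. by apply: cplxP => //=; field. Qed.
Lemma mid_v x y1 y2 : mid (mk x y1) (mk x y2) = mk x ((y1 + y2) / 2).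
Proof. by apply: cplxP => //=; field. Qed.

Definition rhol f (x1 x2 y1 y2 : R) :=
  forall x y, x1 <= x <= x2 -> y1 <= y <= y2 -> exists l, cder f (mk x y) l.
Definition rcont f (x1 x2 y1 y2 : R) :=
  forall x y, x1 <= x <= x2 -> y1 <= y <= y2 -> ccont f (mk x y).

Lemma acvg_rcont f x1 x2 y1 y2 (a b c d : R) : rcont f x1 x2 y1 y2 ->
  x1 <= a -> a <= b -> b <= x2 -> y1 <= c -> c <= d -> d <= y2 ->
  acvg f (mk a c) (mk b d).
Proof.
move=> H h1 h2 h3 h4 h5 h6; apply: acvg_cont => // z [/= z1 z2 z3 z4].
by rewrite -[z]mkE; apply: H; apply/andP; split; lra.
Qed.

Lemma bd_quarter f x1 x2 y1 y2 : x1 <= x2 -> y1 <= y2 -> rcont f x1 x2 y1 y2 ->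
  let m := (x1 + x2) / 2 in let n := (y1 + y2) / 2 in
  bd f x1 x2 y1 y2 = bd f x1 m y1 n + bd f m x2 y1 n + bd f x1 m n y2 + bd f m x2 n y2.
Proof.
move=> x12 y12 H m n.
have [hm1 hm2 hn1 hn2] : [/\ x1 <= m, m <= x2, y1 <= n & n <= y2].
  by rewrite /m /n; split; lra.
rewrite /bd (@sint_half f (mk x1 y1) (mk x2 y1)) ?mid_h -/m;
  try by apply: (acvg_rcont H); rewrite ?lexx.
rewrite (@sint_half f (mk x1 y2) (mk x2 y2)) ?mid_h -/m;
  try by apply: (acvg_rcont H); rewrite ?lexx.
rewrite (@sint_half f (mk x1 y1) (mk x1 y2)) ?mid_v -/n;
  try by apply: (acvg_rcont H); rewrite ?lexx.
rewrite (@sint_half f (mk x2 y1) (mk x2 y2)) ?mid_v -/n;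
  try by apply: (acvg_rcont H); rewrite ?lexx.
ring.
Qed.

Lemma rhol_cont f x1 x2 y1 y2 : rhol f x1 x2 y1 y2 -> rcont f x1 x2 y1 y2.
Proof. by move=> H x y hx hy; have [l Hl] := H x y hx hy; exact: cder_cont Hl. Qed.

Lemma nrm_mk_h (x1 x2 y : R) : x1 <= x2 -> nrm (mk x2 y - mk x1 y) = x2 - x1.
Proof.
move=> h; have -> : mk x2 y - mk x1 y = ofreal (x2 - x1).
  by apply: cplxP => //=; rewrite subrr.
by rewrite nrm_ofreal ger0_norm// subr_ge0.
Qed.
Lemma nrm_mk_v (x y1 y2 : R) : y1 <= y2 -> nrm (mk x y2 - mk x y1) = y2 - y1.
Proof.
move=> h; rewrite /nrm /= subrr expr0n add0r sqrtr_sqr ger0_norm// subr_ge0//.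
Qed.

(** A bound proportional to the sum of the squares of the sides is exactly additive under
    quartering. It therefore passes from small rectangles, where differentiability gives it, to the
    whole one. *)
Theorem goursat f x1 x2 y1 y2 : x1 <= x2 -> y1 <= y2 -> rhol f x1 x2 y1 y2 ->
  bd f x1 x2 y1 y2 = 0.
Proof.
move=> x12 y12 H; have Hc := rhol_cont H.
apply/eqP; rewrite -nrm_eq0 eq_le nrm_ge0 andbT.
apply/ler_addgt0Pl => e e0; rewrite addr0.
pose K := ((x2 - x1) ^+ 2 + (y2 - y1) ^+ 2) + 1.
have K0 : 0 < K by rewrite ltr_wpDl// addr_ge0 ?sqr_ge0.
suff : nrm (bd f x1 x2 y1 y2) <= e / K * ((x2 - x1) ^+ 2 + (y2 - y1) ^+ 2).
  move/le_trans; apply; rewrite -mulrA ler_piMr ?(ltW e0)//.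
  by rewrite ler_pdivrMl// mulr1 lerDl.
have eK : 0 < e / K by rewrite divr_gt0.
pose Q (a b c d : R) := nrm (bd f a b c d) <= e / K * ((b - a) ^+ 2 + (d - c) ^+ 2).
apply: (@rect_ind R Q) => //.
- move=> a b c d h1 h2 h3 h4 h5 h6 m n q1 q2 q3 q4.
  rewrite /Q (@bd_quarter f a b c d)//; last first.
    by move=> x y /andP[? ?] /andP[? ?]; apply: Hc; apply/andP; split; lra.
  rewrite -/m -/n; move: q1 q2 q3 q4; rewrite /Q.
  set b1 := bd _ _ _ _ _; set b2 := bd _ _ _ _ _; set b3 := bd _ _ _ _ _; set b4 := bd _ _ _ _ _.
  have := nrmD (b1 + b2 + b3) b4; have := nrmD (b1 + b2) b3; have := nrmD b1 b2.
  rewrite /m /n => t1 t2 t3 q1 q2 q3 q4.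
  suff E : e / K * ((b - a) ^+ 2 + (d - c) ^+ 2) =
     e / K * (((a + b) / 2 - a) ^+ 2 + ((c + d) / 2 - c) ^+ 2) +
     e / K * ((b - (a + b) / 2) ^+ 2 + ((c + d) / 2 - c) ^+ 2) +
     e / K * (((a + b) / 2 - a) ^+ 2 + (d - (c + d) / 2) ^+ 2) +
     e / K * ((b - (a + b) / 2) ^+ 2 + (d - (c + d) / 2) ^+ 2) by rewrite E; lra.
  by field; rewrite gt_eqF.
- move=> u v Hu Hv; have [l Hl] := H u v Hu Hv.
  (* With sides s and t the perimeter is 2(s+t) and the remainder on it is at most e/K/4 (s+t); then
     (s+t)^2 <= 2(s^2+t^2) gives the claim. *)
  have e4 : 0 < e / K / 4 by lra.
  have [d0 d00 Hd] := Hl _ e4; exists (d0 / 2); first by lra.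
  move=> a b c d h1 /andP[h2 h3] h4 h5 /andP[h6 h7] h8 h9 h10.
  pose z0 := mk u v.
  (* [p] is the tangent of f at z0; by [sint_lin] its four boundary integrals cancel, so only the
     remainder [r] counts. *)
  pose p z := (f z0 - l * z0) + l * z.
  pose r z := f z + (-1) * p z.
  have rc : rcont r a b c d.
    move=> x y /andP[? ?] /andP[? ?].
    have [||m Hm] := H x y; try by apply/andP; split; lra.
    have := cderD Hm (cderZ (-1) (cderD (cder_cst (f z0 - l * z0) (mk x y)) (cderZ l (cder_id _)))).
    exact: cder_cont.
  have fc : rcont f a b c d.
    by move=> x y /andP[? ?] /andP[? ?]; apply: Hc; apply/andP; split; lra.
  have rE (a1 b1 c1 d1 : R) : a <= a1 -> a1 <= b1 -> b1 <= b -> c <= c1 -> c1 <= d1 -> d1 <= d ->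
      sint f (mk a1 c1) (mk b1 d1) = sint r (mk a1 c1) (mk b1 d1) +
        (mk b1 d1 - mk a1 c1) * ((f z0 - l * z0) + l * ((mk a1 c1 + mk b1 d1) / 2)).
    move=> k1 k2 k3 k4 k5 k6.
    have [pc pE] := sint_lin (f z0 - l * z0) l (mk a1 c1) (mk b1 d1).
    rewrite -pE -sintD//; last exact: (acvg_rcont rc).
    by apply: sint_ext => // z _; rewrite /r /p; ring.
  have rb (a1 b1 c1 d1 : R) : a <= a1 -> a1 <= b1 -> b1 <= b -> c <= c1 -> c1 <= d1 -> d1 <= d ->
      nrm (sint r (mk a1 c1) (mk b1 d1)) <= nrm (mk b1 d1 - mk a1 c1) * (e / K / 4 * ((b - a) + (d - c))).
    move=> k1 k2 k3 k4 k5 k6.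
    apply: sint_le => //; first exact: (acvg_rcont rc).
    move=> z [/= z1 z2 z3 z4].
    have -> : r z = f (z0 + (z - z0)) - f z0 - l * (z - z0).
      by rewrite subrKC /r /p; ring.
    have zz : nrm (z - z0) <= (b - a) + (d - c).
      apply: le_trans (nrm_le_split _) _; rewrite cReD cImD cReN cImN /=.
      have : `|complex.Re z - u| <= b - a by rewrite ler_norml; lra.
      have : `|complex.Im z - v| <= d - c by rewrite ler_norml; lra.
      lra.
    apply: le_trans (Hd _ _) _; first by lra.
    by rewrite ler_wpM2l// ltW.
  have ab : a <= b by lra.
  have cd : c <= d by lra.
  have B1 := rb a b c c (lexx _) ab (lexx _) (lexx _) (lexx _) cd.
  have B2 := rb b b c d ab (lexx _) (lexx _) (lexx _) cd (lexx _).
  have B3 := rb a b d d (lexx _) ab (lexx _) cd (lexx _) (lexx _).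
  have B4 := rb a a c d (lexx _) (lexx _) ab (lexx _) cd (lexx _).
  rewrite /Q /bd !rE//.
  move: B1 B2 B3 B4; rewrite !nrm_mk_h// !nrm_mk_v//.
  set s1 := sint _ _ _; set s2 := sint _ _ _; set s3 := sint _ _ _; set s4 := sint _ _ _.
  have -> : mk b d = mk b c + mk a d - mk a c.
    by apply: cplxP; rewrite /=; ring.
  move=> B1 B2 B3 B4.
  set X := (X in nrm X).
  have -> : X = (s1 + s2) - (s3 + s4) by rewrite /X; field.
  have := nrmB (s1 + s2) (s3 + s4); have := nrmD s1 s2; have := nrmD s3 s4 => t1 t2 t3.
  have : nrm (s1 + s2 - (s3 + s4)) <= 2 * ((b - a) + (d - c)) * (e / K / 4 * (b - a + (d - c))) by lra.
  move/le_trans; apply.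
  have -> : 2 * (b - a + (d - c)) * (e / K / 4 * (b - a + (d - c))) = e / K * ((b - a + (d - c)) ^+ 2 / 2) by field; rewrite gt_eqF.
  rewrite ler_wpM2l ?(ltW eK)//.
  have := sqr_ge0 ((b - a) - (d - c)); rewrite !expr2; lra.
Qed.

End Segments.

(** * Fourier expansions of periodic holomorphic functions *)

Section Qexp.
Variable R : realType.
Local Notation C := (cplx R).
Implicit Types (f g : C -> C) (z w : C).
Local Notation "'tpi'" := (2 * pi : R).

Lemma cont_bounded f x1 x2 y1 y2 : x1 <= x2 -> y1 <= y2 -> rcont f x1 x2 y1 y2 ->
  exists M : R, forall x y, x1 <= x <= x2 -> y1 <= y <= y2 -> nrm (f (mk x y)) <= M.
Proof.
move=> x12 y12 H.
pose Q (a b c d : R) := exists M : R, forall x y, a <= x <= b -> c <= y <= d -> nrm (f (mk x y)) <= M.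
apply: (@rect_ind R Q) => //.
- move=> a b c d _ _ _ _ _ _ m n [M1 H1] [M2 H2] [M3 H3] [M4 H4].
  exists (Num.max (Num.max M1 M2) (Num.max M3 M4)) => x y /andP[xa xb] /andP[yc yd].
  rewrite !le_max.
  have [xm|xm] := leP x m; have [yn|yn] := leP y n.
  + by rewrite H1 ?xa ?yc.
  + by rewrite H3 ?orbT// ?xa ?yd ?andbT// ltW.
  + by rewrite H2 ?orbT// ?xb ?yc ?andbT// ltW.
  + by rewrite H4 ?orbT// ?xb ?yd ?andbT// ltW.
- move=> u v Hu Hv; have [|d d0 Hd] := H u v Hu Hv 1; first exact: ltr01.
  exists (d / 2); first by lra.
  move=> a b c e _ /andP[h1 h2] _ _ /andP[h3 h4] _ h5 h6.
  exists (nrm (f (mk u v)) + 1) => x y /andP[xa xb] /andP[yc yd].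
  have := Hd (mk x y - mk u v); rewrite subrKC => Hx.
  have := nrmD (f (mk x y) - f (mk u v)) (f (mk u v)); rewrite subrK.
  suff : nrm (f (mk x y) - f (mk u v)) <= 1 by lra.
  apply: Hx; apply: le_lt_trans (nrm_le_split _) _.
  have : `|x - u| < d / 2 by rewrite ltr_norml; lra.
  have : `|y - v| < d / 2 by rewrite ltr_norml; lra.
  by move=> /=; lra.
Qed.

(** Bisection of a rectangle of height zero is compactness of the segment. *)
Lemma cont_unif_line (h : C -> C) (y0 e : R) : rcont h 0 1 y0 y0 -> 0 < e ->
  exists2 d : R, 0 < d & forall x y, 0 <= x <= 1 -> `|y - y0| < d ->
    nrm (h (mk x y) - h (mk x y0)) <= e.
Proof.
move=> H e0.
pose Q (a b c d : R) := exists2 r : R, 0 < r & forall x y, a <= x <= b -> `|y - y0| < r ->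
    nrm (h (mk x y) - h (mk x y0)) <= e.
apply: (@rect_ind R Q 0 1 y0 y0) => //.
- move=> a b c d _ _ _ _ _ _ m n [r1 r10 H1] [r2 r20 H2] _ _.
  exists (Num.min r1 r2); first by rewrite lt_min r10.
  move=> x y /andP[xa xb]; rewrite lt_min => /andP[h1 h2].
  have [xm|xm] := leP x m; first by apply: H1; rewrite ?xa.
  by apply: H2 => //; rewrite xb ltW.
- move=> u v Hu Hv; have e2 : 0 < e / 2 by lra.
  have [d d0 Hd] := H u v Hu Hv _ e2.
  have vy : v = y0 by apply/eqP; rewrite eq_le; move: Hv => /andP[-> ->].
  subst v; exists (d / 2); first by lra.
  move=> a b c d' _ /andP[h1 h2] _ _ _ _ h5 _; exists (d / 2); first by lra.
  move=> x y /andP[xa xb] hy.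
  have hx : `|x - u| < d / 2 by rewrite ltr_norml; lra.
  have K (y' : R) : `|y' - y0| < d / 2 -> nrm (h (mk x y') - h (mk u y0)) <= e / 2.
    move=> hy'; rewrite -[mk x y'](subrKC (mk u y0)); apply: Hd.
    by apply: le_lt_trans (nrm_le_split _) _ => /=; lra.
  have k1 := K y hy; have k2 : nrm (h (mk x y0) - h (mk u y0)) <= e / 2.
    by apply: K; rewrite subrr normr0; lra.
  have -> : h (mk x y) - h (mk x y0) = (h (mk x y) - h (mk u y0)) - (h (mk x y0) - h (mk u y0)) by ring.
  by apply: le_trans (nrmB _ _) _; lra.
Qed.

Lemma leC_line (y : R) : leC (mk 0 y) (mk 1 y).
Proof. by split => /=; rewrite ?lexx ?ler01. Qed.

Lemma line_len (y : R) : mk 1 y - mk 0 y = 1.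
Proof. by apply: cplxP => /=; rewrite ?subr0 ?subrr. Qed.

Lemma inrect_line (y : R) z : inrect (mk 0 y) (mk 1 y) z ->
  exists2 x : R, 0 <= x <= 1 & z = mk x y.
Proof.
move=> [/= h1 h2 h3 h4]; exists (complex.Re z); first by rewrite h1.
by rewrite -{1}[z]mkE; congr mk; apply/eqP; rewrite eq_le h3 h4.
Qed.

Lemma acvg_line (h : C -> C) (y : R) : rcont h 0 1 y y -> acvg h (mk 0 y) (mk 1 y).
Proof. by move=> H; apply: (acvg_rcont H); rewrite ?lexx ?ler01. Qed.

Lemma line_le (h : C -> C) (y M : R) : rcont h 0 1 y y ->
  (forall x, 0 <= x <= 1 -> nrm (h (mk x y)) <= M) -> nrm (sint h (mk 0 y) (mk 1 y)) <= M.
Proof.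
move=> H HM; have := @sint_le _ h _ _ M (leC_line y) (acvg_line H).
rewrite line_len nrm1 mul1r; apply.
by move=> z /inrect_line[x hx ->]; exact: HM.
Qed.

(** In Goursat's theorem for a rectangle of width 1 the vertical sides cancel by periodicity. *)
Lemma line_const (h : C -> C) (y1 y2 : R) : y1 <= y2 -> rhol h 0 1 y1 y2 ->
  (forall y, y1 <= y <= y2 -> h (mk 1 y) = h (mk 0 y)) ->
  sint h (mk 0 y1) (mk 1 y1) = sint h (mk 0 y2) (mk 1 y2).
Proof.
move=> y12 H per; have := goursat ler01 y12 H; rewrite /bd.
suff -> : sint h (mk 1 y1) (mk 1 y2) = sint h (mk 0 y1) (mk 0 y2).
  by move=> E; apply/eqP; rewrite -subr_eq0 -E; apply/eqP; ring.
have L : leC (mk 0 y1) (mk 0 y2) by split => /=.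
have s1 (y : R) : mk 1 y = mk 0 y + 1 by apply: cplxP => /=; ring.
rewrite /sint !s1; have -> : mk 0 y2 + 1 - (mk 0 y1 + 1) = mk 0 y2 - mk 0 y1 by ring.
congr (_ * xget _ _); apply/funext => l.
have E n : avg n h (mk 0 y1 + 1) (mk 0 y2 + 1) = avg n h (mk 0 y1) (mk 0 y2).
  rewrite avg_shift; apply: avg_ext => // z [/= h1 h2 h3 h4].
  have x0 : complex.Re z = 0 by apply/eqP; rewrite eq_le h1 h2.
  rewrite -[z]mkE x0 -s1; apply: per; by rewrite h3.
by apply/propext; split; apply: clim_ext => n; rewrite E.
Qed.

Lemma line_close (h : C -> C) (y0 e : R) : (exists2 r : R, 0 < r & forall y, `|y - y0| < r -> rcont h 0 1 y y) ->
  0 < e ->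
  exists2 d : R, 0 < d & forall y, `|y - y0| < d ->
    nrm (sint h (mk 0 y) (mk 1 y) - sint h (mk 0 y0) (mk 1 y0)) <= e.
Proof.
move=> [r r0 H] e0; have H0 : rcont h 0 1 y0 y0 by apply: H; rewrite subrr normr0.
have [d d0 Hd] := cont_unif_line H0 e0; exists (Num.min d r).
  by rewrite lt_min d0.
move=> y; rewrite lt_min => /andP[yd yr].
have [l Hl] := acvg_line (H y yr); have [m Hm] := acvg_line H0.
rewrite (sintE Hl) (sintE Hm) !line_len !mul1r.
apply: (clim_nrm_le (climB Hl Hm)); exists 0%N => n _.
pose w := mk 0 (y - y0).
have -> : mk 0 y = mk 0 y0 + w by apply: cplxP => /=; ring.
have -> : mk 1 y = mk 1 y0 + w by apply: cplxP => /=; ring.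
rewrite avg_shift; apply: avg_le2; first exact: leC_line.
move=> z /inrect_line[x hx ->].
have -> : mk x y0 + w = mk x y by apply: cplxP => /=; ring.
exact: Hd.
Qed.

Definition ker (n : int) z : C := e2pii (- (n%:~R * z)).

Lemma cder_ker n z : exists l, cder (ker n) z l.
Proof.
eexists; apply: (cder_comp (f := @e2pii R)); last exact: cder_e2pii.
exact: cderN (cderZ _ (cder_id z)).
Qed.

Lemma ker1 n z : ker n (z + 1) = ker n z.
Proof.
by rewrite /ker mulrDr mulr1 opprD -mulrNz e2piiDint.
Qed.

Lemma nrm_ker n z : nrm (ker n z) = expR (tpi * n%:~R * complex.Im z).
Proof.
rewrite /ker nrm_e2pii cImN; congr expR.
have -> : (n%:~R : C) = ofreal n%:~R by rewrite /ofreal rmorph_int.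
rewrite cImM cRe_ofreal cIm_ofreal; ring.
Qed.

Lemma ker_pred n z : ker (n - 1) z = e2pii z * ker n z.
Proof. by rewrite /ker intrD mulrDl opprD e2piiD mulrC; congr (e2pii _ * _); rewrite mulN1r opprK. Qed.

Definition fcoef f (n : int) (y : R) : C := sint (fun z => f z * ker n z) (mk 0 y) (mk 1 y).

Lemma rcont_mul f n x1 x2 y1 y2 : rhol f x1 x2 y1 y2 -> rhol (fun z => f z * ker n z) x1 x2 y1 y2.
Proof.
move=> H x y hx hy; have [l Hl] := H x y hx hy; have [m Hm] := cder_ker n (mk x y).
by eexists; exact: cderM Hl Hm.
Qed.

(** Stated with [f] merely continuous, since the divided difference in the Fourier theorem is not
    known to be differentiable at its singular points. *)
Lemma ccontM f g z l : ccont f z -> cder g z l -> ccont (fun x => f x * g x) z.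
Proof.
move=> Hf /cder_cont Hg e e0.
pose A := nrm (g z) + 1 + nrm (f z).
have [n1 n2] : 0 <= nrm (g z) /\ 0 <= nrm (f z) by rewrite !nrm_ge0.
have A0 : 0 < A by rewrite /A; lra.
pose e1 := Num.min 1 (e / A).
have e10 : 0 < e1 by rewrite /e1 lt_min ltr01 divr_gt0.
have e11 : e1 <= 1 by rewrite /e1 ge_min lexx.
have e1A : e1 * A <= e by rewrite -ler_pdivlMr// /e1 ge_min lexx orbT.
clearbody e1.
have [d d0 Hd] := Hf _ e10; have [d' d'0 Hd'] := Hg _ e10.
exists (Num.min d d'); first by rewrite lt_min d0.
move=> h; rewrite lt_min => /andP[/Hd h1 /Hd' h2].
have -> : f (z + h) * g (z + h) - f z * g z =
  (f (z + h) - f z) * g (z + h) + f z * (g (z + h) - g z) by ring.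
have h4 : nrm (g (z + h)) <= nrm (g z) + e1.
  by have := nrmD (g (z + h) - g z) (g z); rewrite subrK; lra.
apply: le_trans (nrmD _ _) _; rewrite !nrmM.
have : nrm (f (z + h) - f z) * nrm (g (z + h)) <= e1 * (nrm (g z) + e1).
  by apply: ler_pM; rewrite ?nrm_ge0.
have : nrm (f z) * nrm (g (z + h) - g z) <= nrm (f z) * e1 by rewrite ler_wpM2l.
by move: e1A; rewrite /A; nra.
Qed.

Lemma rcont_ker f n x1 x2 y1 y2 : rcont f x1 x2 y1 y2 -> rcont (fun z => f z * ker n z) x1 x2 y1 y2.
Proof.
move=> H x y hx hy; have [m Hm] := cder_ker n (mk x y).
exact: ccontM (H x y hx hy) Hm.
Qed.

Lemma fcoef_le f n (y M : R) : rcont f 0 1 y y ->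
  (forall x, 0 <= x <= 1 -> nrm (f (mk x y)) <= M) ->
  nrm (fcoef f n y) <= M * expR (tpi * n%:~R * y).
Proof.
move=> H HM; apply: line_le; first exact: rcont_ker.
by move=> x hx; rewrite nrmM nrm_ker ler_wpM2r ?expR_ge0// HM.
Qed.

Lemma expR_archi (c e : R) : 0 < c -> 0 < e -> exists2 Y : R, 0 < Y &
  forall y, Y <= y -> expR (- (c * y)) <= e.
Proof.
move=> c0 e0; exists (1 + e^-1 / c); first by rewrite ltr_wpDr// ltW// divr_gt0 ?invr_gt0.
move=> y hy; rewrite expRN -[e]invrK lef_pV2 ?posrE ?invr_gt0 ?expR_gt0//.
apply: le_trans (expR_ge1Dx _).
have : c * (1 + e^-1 / c) <= c * y by rewrite ler_wpM2l// ltW.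
rewrite mulrDr mulrCA divff ?gt_eqF// !mulr1; lra.
Qed.

Lemma int_sign (n : int) : n != 0 -> exists s : R, (s = 1 \/ s = -1) /\ 1 <= s * n%:~R.
Proof.
move=> n0; have [h|h] := leP 0 n.
  exists 1; split; first by left.
  by rewrite mul1r ler1z; move: n0 h; lia.
exists (-1); split; first by right.
by rewrite mulN1r -mulrNz ler1z; move: h; lia.
Qed.

(** For nonzero n the integral does not depend on the height and is bounded by exp(2 pi n y), which
    tends to 0 as y goes to infinity on the side opposite to the sign of n. No primitive of the
    exponential is used. *)
Lemma fcoef_one n (y : R) : fcoef (fun=> 1) n y = (n == 0)%:R.
Proof.
have [->|n0] := eqVneq n 0.
  rewrite /fcoef (@sint_ext _ _ (fun z => 1 + 0 * z)); last 2 first.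
  - exact: leC_line.
  - by move=> z _; rewrite /ker mul0r oppr0 e2pii0; ring.
  by rewrite (sint_lin 1 0 _ _).2 line_len mul0r addr0 mul1r.
have H (y1 y2 : R) : y1 <= y2 -> fcoef (fun=> 1) n y1 = fcoef (fun=> 1) n y2.
  move=> y12; apply: line_const => //.
    by apply: rcont_mul => x y' _ _; exists 0; exact: cder_cst.
  move=> y' _; have -> : mk 1 y' = mk 0 y' + 1 by apply: cplxP => /=; ring.
  by rewrite ker1.
have H' (y1 y2 : R) : fcoef (fun=> 1) n y1 = fcoef (fun=> 1) n y2.
  by have [/H|/ltW/H] := leP y1 y2.
apply/eqP; rewrite -nrm_eq0 eq_le nrm_ge0 andbT.
apply/ler_addgt0Pl => e e0; rewrite addr0.
have [s [Hs sn]] := int_sign n0.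
have [Y Y0 HY] := expR_archi (twopi_gt0 R) e0.
rewrite (H' y (- (s * Y))).
apply: le_trans (@fcoef_le _ _ _ 1 _ _) _.
- by move=> x y' _ _; exact: cder_cont (cder_cst 1 _).
- by move=> x _; rewrite nrm1.
rewrite mul1r; apply: le_trans (HY (s * n%:~R * Y) _); last by rewrite ler_peMl// ltW.
have -> : tpi * n%:~R * - (s * Y) = - (tpi * (s * n%:~R * Y)) by ring.
exact: lexx.
Qed.

(** The quotient of increments tends to the quotient of derivatives: this makes the divided
    difference of f with respect to q continuous where its denominator vanishes. *)
Lemma ratio_lim (u v : C -> C) z l m : cder u z l -> cder v z m -> m != 0 ->
  forall e : R, 0 < e -> exists2 d : R, 0 < d & forall h, nrm h < d -> h != 0 ->
   v (z + h) - v z != 0 /\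
   nrm ((u (z + h) - u z) / (v (z + h) - v z) - l / m) <= e.
Proof.
move=> Hu Hv m0 e e0.
have nm : 0 < nrm m by rewrite nrm_gt0.
have nl := nrm_ge0 l.
pose K := 2 * (nrm m + nrm l) / nrm m ^+ 2.
have K0 : 0 < K by rewrite /K divr_gt0 ?exprn_gt0 ?mulr_gt0//; lra.
pose t := Num.min (nrm m / 2) (e / K).
have t0 : 0 < t by rewrite /t lt_min; apply/andP; split; [lra | exact: divr_gt0].
have [tm tK] : t <= nrm m / 2 /\ t * K <= e.
  by split; last rewrite -ler_pdivlMr//; rewrite /t ge_min lexx ?orbT.
clearbody t.
have [d d0 Hd] := Hu _ t0; have [d' d'0 Hd'] := Hv _ t0.
exists (Num.min d d'); first by rewrite lt_min d0.
move=> h; rewrite lt_min => /andP[/Hd h1 /Hd' h2] h0.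
have nh : 0 < nrm h by rewrite nrm_gt0.
set U := u (z + h) - u z in h1 *; set V := v (z + h) - v z in h2 *.
have hV : nrm m * nrm h / 2 <= nrm V.
  have := nrm_geB (m * h) (V - m * h); rewrite subrKC nrmM; nra.
have V0 : V != 0 by rewrite -nrm_gt0; apply: lt_le_trans hV; rewrite divr_gt0 ?mulr_gt0.
split => //.
have -> : U / V - l / m = (m * (U - l * h) - l * (V - m * h)) / (m * V).
  by field; rewrite m0 V0.
rewrite nrmM nrmV nrmM ler_pdivrMr; last by rewrite mulr_gt0 ?nrm_gt0.
apply: le_trans (nrmB _ _) _; rewrite !nrmM.
have : nrm m * nrm (U - l * h) + nrm l * nrm (V - m * h) <= (nrm m + nrm l) * (t * nrm h).
  by rewrite mulrDl lerD// ler_wpM2l// ltW.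
move/le_trans; apply.
have : e * (nrm m * (nrm m * nrm h / 2)) <= e * (nrm m * nrm V).
  by rewrite !ler_wpM2l ?(ltW e0) ?(ltW nm).
apply: le_trans.
have -> : (nrm m + nrm l) * (t * nrm h) = t * K * (nrm m * (nrm m * nrm h / 2)).
  by rewrite /K; field; rewrite gt_eqF.
by rewrite ler_wpM2r// mulr_ge0 ?divr_ge0 ?mulr_ge0 ?ltW.
Qed.

End Qexp.

(** * Convergence of the Fourier series *)

Section QexpThm.
Variable R : realType.
Local Notation C := (cplx R).
Implicit Types (f g : C -> C) (z w : C).
Local Notation "'tpi'" := (2 * pi : R).

Definition hol f := forall z, uhp R z -> exists l, cder f z l.
Definition per1 f := forall z, uhp R z -> f (z + 1) = f z.
Definition psum (a : nat -> C) (w : C) (N : nat) : C := \sum_(n < N) a n * w ^+ n.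

Lemma psumS a w N : psum a w N.+1 = psum a w N + a N * w ^+ N.
Proof. by rewrite /psum big_ord_recr. Qed.

Lemma hol_rhol f (x1 x2 y1 y2 : R) : 0 < y1 -> hol f -> rhol f x1 x2 y1 y2.
Proof. by move=> y0 H x y _ /andP[h _]; apply: H; rewrite /uhp /=; lra. Qed.

Lemma uhp_mk (x y : R) : uhp R (mk x y) = (0 < y) :> Prop. Proof. by []. Qed.

Lemma uhp_real z (t : R) : uhp R z -> uhp R (z + ofreal t).
Proof. by rewrite /uhp /= cImD /= addr0. Qed.

Lemma uhp1 z : uhp R z -> uhp R (z + 1).
Proof. exact: uhp_real. Qed.

Lemma per_nat f n z : per1 f -> uhp R z -> f (z + n%:R) = f z.
Proof.
move=> P Hz; elim: n => [|n IH]; first by rewrite addr0.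
by rewrite -natr1 addrA P// -ofreal_nat; exact: uhp_real.
Qed.

Lemma ofreal_int (m : int) : ofreal (m%:~R : R) = m%:~R.
Proof. by rewrite /ofreal rmorph_int. Qed.

Lemma per_int f (m : int) z : per1 f -> uhp R z -> f (z + m%:~R) = f z.
Proof.
move=> P Hz; case: m => n; first exact: per_nat.
rewrite NegzE mulrNz -[in RHS](subrK n.+1%:R z).
rewrite (per_nat _ P)// -ofreal_nat -ofrealN; exact: uhp_real.
Qed.

Lemma fcoef_const f n (y1 y2 : R) : hol f -> per1 f -> 0 < y1 -> 0 < y2 ->
  fcoef f n y1 = fcoef f n y2.
Proof.
move=> Hf Pf.
have H (a b : R) : a <= b -> 0 < a -> fcoef f n a = fcoef f n b.
  move=> ab a0; apply: line_const => //; first exact/rcont_mul/hol_rhol.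
  move=> y /andP[ya _].
  have -> : mk 1 y = mk 0 y + 1 by apply: cplxP => /=; ring.
  by rewrite ker1 Pf// /uhp /=; lra.
by move=> a0 b0; have [/H->|/ltW/H->] := leP y1 y2.
Qed.

Section At.
Variables (f : C -> C) (t0 : C).
Hypotheses (Hf : hol f) (Pf : per1 f) (Ht : uhp R t0).
Hypothesis gf : forall e : R, 0 < e -> exists Y : R, forall z, Y <= complex.Im z ->
  nrm (f z) <= e * expR (tpi * complex.Im z).

Let q0 := e2pii t0.
Let y0 := complex.Im t0.
Let L := derive1 f t0 / (twopii R * q0).
(** The divided difference of f in the variable q, continued by df/dq at the translates of t0. From
    f = f(t0) + (q - q0) g the Fourier coefficients satisfy a_n = f(t0) [n = 0] + b_(n-1) - q0 b_n,
    whose sums telescope at q0. Continuity of g at t0 is enough for this. *)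
Let g (z : C) : C := if e2pii z == q0 then L else (f z - f t0) / (e2pii z - q0).

Let q00 : q0 != 0. Proof. exact: e2pii_neq0. Qed.

Let eqq z : e2pii z = q0 -> exists m : int, z = t0 + m%:~R.
Proof.
move=> E; have [|m Hm] := @e2pii_eq1 _ (z - t0).
  by rewrite e2piiB E divff.
by exists m; rewrite -Hm subrKC.
Qed.

Let fg z : uhp R z -> f z = f t0 + (e2pii z - q0) * g z.
Proof.
move=> Hz; rewrite /g; case: eqP => [E|/eqP E].
  by rewrite E subrr mul0r addr0; have [m ->] := eqq E; rewrite per_int.
by field; rewrite subr_eq0.
Qed.

Let gper : per1 g.
Proof. by move=> z Hz; rewrite /g e2piiD1 Pf. Qed.

Let ghol_off z : uhp R z -> e2pii z != q0 -> exists l, cder g z l.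
Proof.
move=> Hz E; have [l Hl] := Hf Hz.
have He := cderB (cder_e2pii z) (cder_cst q0 z).
have E' : e2pii z - q0 != 0 by rewrite subr_eq0.
have := @cder_div R (fun x => f x - f t0) (fun x => e2pii x - q0) z _ _ E' (cderB Hl (cder_cst (f t0) z)) He; set m := (X in cder _ _ X) => Hm.
exists m; apply: cder_near Hm.
have p0 : 0 < nrm (e2pii z - q0) / 2 by rewrite divr_gt0// nrm_gt0.
have [d d0 Hd] := cder_cont (cder_e2pii z) p0.
exists d => // h /Hd hd; rewrite /g; case: eqP => // E2.
by move: hd; rewrite E2 nrm_sub leNgt => /negP[]; lra.
Qed.

Let gcont z : uhp R z -> ccont g z.
Proof.
move=> Hz; have [E|E] := eqVneq (e2pii z) q0; last first.
  by have [l Hl] := ghol_off Hz E; exact: cder_cont Hl.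
have [m zE] := eqq E; move=> e e0.
have [l Hl] := Hf Ht.
have K0 : twopii R * q0 != 0 by rewrite mulf_neq0 ?twopii_neq0.
have [d d0 Hd] := ratio_lim Hl (cder_e2pii t0) K0 e0.
exists (Num.min d y0); first by rewrite lt_min d0 /y0; exact: Ht.
move=> h; rewrite lt_min => /andP[hd hy].
have uh : uhp R (t0 + h).
  rewrite /uhp /= cImD -/y0; have := normIm_le h; rewrite ler_norml; lra.
rewrite {2}/g E eqxx {1}/g.
case: eqP => [E2|/eqP E2]; first by rewrite subrr nrm0 ltW.
have h0 : h != 0 by apply: contraNneq E2 => ->; rewrite addr0 E.
have [_] := Hd h hd h0; rewrite -/q0 /L (derive1_cder Hl).
by rewrite zE addrAC per_int// e2piiDint.
Qed.

Let b (n : int) (y : R) := fcoef g n y.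

Let grcont (y1 y2 : R) : 0 < y1 -> rcont g 0 1 y1 y2.
Proof. by move=> h x y _ /andP[h1 _]; apply: gcont; rewrite uhp_mk; lra. Qed.

(** Strictly above and strictly below the height of t0 this is [line_const]; the two sides are
    joined by continuity of the line integral, in place of a removable singularity theorem. *)
Let bconst n (y : R) : 0 < y -> b n y = b n y0.
Proof.
move=> yp; apply/eqP; rewrite -subr_eq0 -nrm_eq0 eq_le nrm_ge0 andbT.
apply/ler_addgt0Pl => e e0; rewrite addr0.
have y0p : 0 < y0 by exact: Ht.
have [|d d0 Hd] := @line_close _ (fun z => g z * ker n z) y0 e _ e0.
  exists y0 => // y' hy'; apply/rcont_ker/grcont.
  by move: hy'; rewrite ltr_norml; lra.
have [H|H] := ltP `|y - y0| d; first exact: Hd.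
have hh (u v : R) : 0 < u -> u <= v -> (v < y0 \/ y0 < u) -> b n u = b n v.
  move=> u0 uv hv; apply: line_const => //.
    apply: rcont_mul => x w _ hw; apply: ghol_off; first by rewrite uhp_mk; lra.
    apply/negP => /eqP/(congr1 (@nrm R)); rewrite !nrm_e2pii => /expR_inj /eqP.
    rewrite eqr_opp /= => /eqP /(mulfI (lt0r_neq0 (twopi_gt0 R))).
    rewrite -/y0; case: hv; lra.
  move=> w hw; have -> : mk 1 w = mk 0 w + 1 by apply: cplxP => /=; ring.
  by rewrite ker1 gper// /uhp /=; lra.
have [yl|yl] := leP y y0.
  have yy : y <= y0 - d by move: H; rewrite distrC ger0_norm ?subr_ge0//; lra.
  rewrite (hh y (y0 - d / 2)); [|by []|by lra|left; lra].
  by apply: Hd; rewrite addrC addKr normrN gtr0_norm; lra.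
have yy : y0 + d <= y by move: H; rewrite gtr0_norm ?subr_gt0//; lra.
rewrite -(hh (y0 + d / 2) y); [|by lra|by lra|right; lra].
by apply: Hd; rewrite addrC addKr gtr0_norm; lra.
Qed.

(** The growth hypothesis makes g equal to o(1/q), and the kernel of index -1 contributes a factor
    q; so the integral tends to 0 as the height grows. *)
Let bN1 (y : R) : 0 < y -> b (-1) y = 0.
Proof.
move=> yp; rewrite bconst//; apply/eqP; rewrite -nrm_eq0 eq_le nrm_ge0 andbT.
apply/ler_addgt0Pl => e e0; rewrite addr0.
have nq : 0 < nrm q0 by rewrite nrm_gt0.
(* The two terms of f - f(t0) give 2 e1, and dividing by q - q0, of modulus at least |q0|/2, gives
   e. *)
pose e1 := e * nrm q0 / 4.
have e10 : 0 < e1 by rewrite /e1 divr_gt0 ?mulr_gt0.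
have [Y1 H1] := gf e10.
have F0 : 0 < nrm (f t0) + 1 by rewrite ltr_wpDl ?nrm_ge0.
have [Y2 Y20 H2] := expR_archi (twopi_gt0 R) (divr_gt0 e10 F0).
have q20 : 0 < nrm q0 / 2 by rewrite divr_gt0.
have [Y3 Y30 H3] := expR_archi (twopi_gt0 R) q20.
pose v := Num.max Y1 (Num.max Y2 Y3).
have [v1 v2 v3] : [/\ Y1 <= v, Y2 <= v & Y3 <= v] by rewrite /v !le_max !lexx !orbT.
have vp : 0 < v by lra.
rewrite -(bconst _ vp).
apply: le_trans (@fcoef_le _ _ _ _ (e * expR (tpi * v)) _ _) _; [exact: grcont| |].
  move=> x _; have qv : nrm (e2pii (mk x v)) <= nrm q0 / 2 by rewrite nrm_e2pii /=; exact: H3.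
  have nz : e2pii (mk x v) != q0.
    by apply: contraTneq qv => ->; rewrite -ltNge; lra.
  rewrite /g (negbTE nz) nrmM nrmV.
  have dq : nrm q0 / 2 <= nrm (e2pii (mk x v) - q0).
    by have := nrm_geB q0 (- e2pii (mk x v)); rewrite nrmN nrm_sub; lra.
  rewrite ler_pdivrMr; last by lra.
  apply: le_trans (nrmB _ _) _.
  have h1 : nrm (f (mk x v)) <= e1 * expR (tpi * v) by have := H1 (mk x v) v1.
  have h2 : nrm (f t0) <= e1 * expR (tpi * v).
    have := H2 v v2; rewrite expRN ler_pdivlMr// => h2.
    have Ep := expR_gt0 (tpi * v).
    have : (expR (tpi * v))^-1 * (nrm (f t0) + 1) * expR (tpi * v) <= e1 * expR (tpi * v).
      by rewrite ler_wpM2r// ltW.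
    by rewrite mulrAC mulVf ?gt_eqF// mul1r; lra.
  apply: le_trans (lerD h1 h2) _.
  have -> : e1 * expR (tpi * v) + e1 * expR (tpi * v) = e * expR (tpi * v) * (nrm q0 / 2).
    by rewrite /e1; field.
  by rewrite ler_wpM2l// mulr_ge0 ?expR_ge0// ltW.
rewrite -[X in X <= _]mulrA -expRD (_ : _ + _ = 0) ?expR0 ?mulr1//.
by rewrite intrN; ring.
Qed.

Let coef_rec n : fcoef f n 1 = f t0 * (n == 0)%:R + b (n - 1) 1 - q0 * b n 1.
Proof.
have c1 (h : C -> C) m : rcont h 0 1 1 1 -> acvg (fun z => h z * ker m z) (mk 0 1) (mk 1 1).
  by move=> Hh; apply/acvg_line/rcont_ker.
have one : rcont (fun=> 1 : C) 0 1 1 1 by move=> x y _ _; exact: cder_cont (cder_cst 1 _).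
have A1 := c1 _ n one.
have A2 := c1 _ (n - 1) (@grcont 1 1 ltr01).
have A3 := c1 _ n (@grcont 1 1 ltr01).
have acZ h c : acvg h (mk 0 1) (mk 1 1) -> acvg (fun z => c * h z) (mk 0 1) (mk 1 1).
  by move=> [l Hl]; exists (c * l); apply: clim_ext (climZ c Hl) => m; rewrite avgZ.
have acD h h' : acvg h (mk 0 1) (mk 1 1) -> acvg h' (mk 0 1) (mk 1 1) ->
    acvg (fun z => h z + h' z) (mk 0 1) (mk 1 1).
  by move=> [l Hl] [m Hm]; exists (l + m); apply: clim_ext (climD Hl Hm) => p; rewrite avgD.
rewrite -(fcoef_one n 1) /b /fcoef -mulNr -(sintZ (f t0) A1) -(sintZ (- q0) A3).
rewrite -sintD; [|exact: acZ|exact: A2].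
rewrite -sintD; [|by apply: acD => //; exact: acZ|exact: acZ].
apply: sint_ext; first exact: leC_line.
move=> z /inrect_line[x hx ->]; rewrite [in LHS]fg; last by rewrite uhp_mk.
by rewrite ker_pred; ring.
Qed.

(** By the recursion and b_(-1) = 0 the partial sum up to N is f(t0) - b_N q0^(N+1), so only the
    decay of the last term is at stake. *)
Lemma qexp_at : clim (psum (fun n => fcoef f n%:Z 1) q0) (f t0).
Proof.
have y0p : 0 < y0 by exact: Ht.
have S N : psum (fun n => fcoef f n%:Z 1) q0 N.+1 = f t0 - b N%:Z 1 * q0 ^+ N.+1.
  elim: N => [|N IH].
    by rewrite /psum big_ord_recr big_ord0 /= coef_rec eqxx sub0r bN1// expr0 (mulr1 (f t0)); ring.
  rewrite psumS IH coef_rec.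
  have -> : (N.+1%:Z : int) - 1 = N%:Z by lia.
  have -> : (N.+1%:Z == 0 :> int) = false by [].
  by rewrite (mulr0 (f t0)) [in RHS]exprS; ring.
(* At half the height of t0 the bound on b_n is M r^(-n) with r^2 = |q0|, so b_n q0^(n+1) decays
   geometrically. *)
pose y1 := y0 / 2; have y1p : 0 < y1 by rewrite /y1 divr_gt0.
have [M HM] := cont_bounded ler01 (lexx y1) (@grcont y1 y1 y1p).
have M0 : 0 <= M by apply: le_trans (HM 0 y1 _ _); rewrite ?nrm_ge0 ?lexx ?ler01.
pose r := expR (- (tpi * y1)).
have r1 : 0 <= r < 1 by rewrite /r expR_ge0 expR_lt1 oppr_lt0 mulr_gt0// twopi_gt0.
move=> e e0; have M1 : 0 < M + 1 by lra.
have [N HN] := geom_small r1 (divr_gt0 e0 M1).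
exists N.+1 => -[//|n]; rewrite ltnS => Nn; rewrite S.
have -> : f t0 - b n%:Z 1 * q0 ^+ n.+1 - f t0 = - (b n%:Z 1 * q0 ^+ n.+1) by ring.
rewrite nrmN nrmM nrmX (bconst _ ltr01) -(bconst _ y1p).
have HM' x : 0 <= x <= 1 -> nrm (g (mk x y1)) <= M by move=> hx; apply: HM; rewrite ?lexx.
have Hb := @fcoef_le _ g n%:Z y1 M (@grcont y1 y1 y1p) HM'.
have Hq : nrm q0 = r ^+ 2.
  by rewrite /q0 nrm_e2pii -expRM_natl /y1 -/y0; congr expR; field.
have Hr : expR (tpi * n%:~R * y1) = (r ^+ n)^-1.
  by rewrite /r -expRM_natl -expRN; congr expR; ring.
rewrite Hr in Hb; rewrite Hq -exprM mul2n -addnn exprD.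
have rn : 0 < r ^+ n by rewrite exprn_gt0 ?expR_gt0.
have := HN n Nn; rewrite ler_pdivlMr// => Hn.
have r0 : 0 <= r ^+ n.+1 by rewrite exprn_ge0 ?expR_ge0.
have r1' : r ^+ n.+1 <= r ^+ n.
  by rewrite exprS ger_pMl//; case/andP: r1 => _ /ltW.
apply: le_trans (ler_wpM2r (mulr_ge0 r0 r0) Hb) _.
apply: (@le_trans _ _ (M / r ^+ n * (r ^+ n * r ^+ n))).
  by rewrite ler_wpM2l ?mulr_ge0 ?invr_ge0 ?(ltW rn)// ler_pM.
rewrite mulrA divfK ?gt_eqF//; nra.
Qed.

End At.

(** The growth condition reads f = o(1/q) and excludes negative powers of q. The last clause is
    Cauchy's estimate on the line of height y. *)
Theorem qexp_exists f : hol f -> per1 f ->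
  (forall e : R, 0 < e -> exists Y : R, forall z, Y <= complex.Im z ->
     nrm (f z) <= e * expR (tpi * complex.Im z)) ->
  exists a : nat -> C, (forall z, uhp R z -> clim (psum a (e2pii z)) (f z)) /\
   forall n (y M : R), 0 < y -> (forall x : R, 0 <= x <= 1 -> nrm (f (mk x y)) <= M) ->
     nrm (a n) <= M * expR (tpi * n%:R * y).
Proof.
move=> Hf Pf gf; exists (fun n => fcoef f n%:Z 1); split=> [z Hz|n y M y0 HM].
  exact: qexp_at.
rewrite (@fcoef_const f _ 1 y)//.
by apply: fcoef_le => //; apply/rhol_cont/hol_rhol.
Qed.

End QexpThm.

(** * Power series *)

Section PowerSeries.
Variable R : realType.
Local Notation C := (cplx R).
Implicit Types (f g : C -> C) (z w : C).
Local Notation "'tpi'" := (2 * pi : R).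

Lemma series_dom (v : nat -> C) (m : nat -> R) (B : R) :
  (forall n, nrm (v n) <= m n) -> (forall N, \sum_(n < N) m n <= B) ->
  exists l, clim (fun N => \sum_(n < N) v n) l.
Proof.
move=> Hv HB.
have m0 n : 0 <= m n by exact: le_trans (nrm_ge0 _) (Hv n).
pose s N := \sum_(n < N) m n.
have sD N k : s (N + k)%N = s N + \sum_(i < k) m (N + i)%N.
  by rewrite /s big_split_ord.
have hs : has_sup (range s).
  by split; [exists (s 0%N), 0%N | exists B => _ [N _ <-]; exact: HB].
apply: clim_cauchy => e e0.
have e2 : 0 < e / 2 by lra.
have [_ [N _ <-] HN] := sup_adherent e2 hs.
exists N.
have K n : (N <= n)%N -> nrm (\sum_(i < n) v i - \sum_(i < N) v i) <= e / 2.
  move=> Nn; rewrite -(subnKC Nn) big_split_ord /= addrAC subrr add0r.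
  apply: le_trans (nrm_sum _ _ _) _.
  apply: (@le_trans _ _ (\sum_(i < n - N) m (N + i)%N)); first by apply: ler_sum => i _.
  have : s (N + (n - N))%N <= sup (range s).
    by apply: ub_le_sup; [case: hs | exists (N + (n - N))%N].
  by rewrite sD; lra.
move=> p q Np Nq.
have h1 := K p Np; have h2 := K q Nq.
set S := \sum_(i < N) v i in h1 h2.
have -> : \sum_(i < p) v i - \sum_(i < q) v i =
  (\sum_(i < p) v i - S) - (\sum_(i < q) v i - S) by ring.
by apply: le_trans (nrmB _ _) _; lra.
Qed.

(** Termwise differentiation by summing the quadratic remainders of the terms; convergence of the
    derived series is needed at z only. *)
Lemma cder_series (u : nat -> C -> C) f z (d : nat -> C) l (M : nat -> R) (B r : R) :
  0 < r -> (forall N, \sum_(n < N) M n <= B) ->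
  (forall n h, nrm h < r -> nrm (u n (z + h) - u n z - d n * h) <= M n * nrm h ^+ 2) ->
  (forall h, nrm h < r -> clim (fun N => \sum_(n < N) u n (z + h)) (f (z + h))) ->
  clim (fun N => \sum_(n < N) d n) l -> cder f z l.
Proof.
move=> r0 HB Hu Hf Hd; apply: (@cder_sqr _ _ _ _ B r) => // h hr.
have Hz : clim (fun N => \sum_(n < N) u n z) (f z).
  by have := Hf 0; rewrite nrm0 addr0; apply.
have := climB (climB (Hf h hr) Hz) (climZ h Hd).
rewrite [h * l]mulrC => H; apply: (clim_nrm_le H); exists 0%N => N _.
rewrite mulr_sumr -!sumrB.
apply: le_trans (nrm_sum _ _ _) _.
apply: (@le_trans _ _ (\sum_(n < N) M n * nrm h ^+ 2)).
  by apply: ler_sum => i _; rewrite [h * _]mulrC; exact: Hu.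
by rewrite -mulr_suml ler_wpM2r ?sqr_ge0.
Qed.

Lemma sum_geom1 (x : R) N : 0 <= x < 1 -> \sum_(n < N) x ^+ n <= (1 - x)^-1.
Proof.
move=> /andP[x0 x1].
have E : (1 - x) * \sum_(n < N) x ^+ n = 1 - x ^+ N.
  elim: N => [|N IH]; first by rewrite big_ord0 expr0; ring.
  by rewrite big_ord_recr /= mulrDr IH exprS; ring.
have h : 0 < 1 - x by lra.
by rewrite -[leRHS]mul1r ler_pdivlMr// mulrC E gerBl exprn_ge0.
Qed.

Lemma sum_geom2 (x : R) N : 0 <= x < 1 -> \sum_(n < N) n.+1%:R * x ^+ n <= (1 - x)^-1 ^+ 2.
Proof.
move=> x01; have /andP[x0 x1] := x01.
have E : (1 - x) * \sum_(n < N) n.+1%:R * x ^+ n = \sum_(n < N) x ^+ n - N%:R * x ^+ N.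
  elim: N => [|N IH]; first by rewrite !big_ord0 mul0r; ring.
  by rewrite !big_ord_recr /= mulrDr IH exprS -!natr1; ring.
have h : 0 < 1 - x by lra.
rewrite exprSr expr1 ler_pdivlMr// mulrC E.
by apply: le_trans (sum_geom1 N x01); rewrite gerBl mulr_ge0 ?exprn_ge0.
Qed.

Lemma sum_geom3 (x : R) N : 0 <= x < 1 ->
  \sum_(n < N) n%:R ^+ 2 * x ^+ n <= 2 * (1 - x)^-1 ^+ 3.
Proof.
move=> x01; have /andP[x0 x1] := x01.
(* Summation by parts with n^2 - (n-1)^2 = 2n - 1; the [+ 1] corrects the term n = 0. *)
have E : (1 - x) * \sum_(n < N) n%:R ^+ 2 * x ^+ n =
    \sum_(n < N) (2 * (n%:R * x ^+ n) - x ^+ n) + 1 - ((N%:R - 1) ^+ 2 * x ^+ N).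
  elim: N => [|N IH]; first by rewrite !big_ord0 sub0r sqrrN expr1n; ring.
  by rewrite !big_ord_recr /= mulrDr IH [x ^+ N.+1]exprS -[N.+1%:R]natr1; ring.
have h : 0 < 1 - x by lra.
have [N0|N0] := posnP N.
  by rewrite N0 big_ord0 mulr_ge0// exprn_ge0// invr_ge0 ltW.
rewrite (exprSr _ 2) mulrA ler_pdivlMr// mulrC E.
have := sum_geom2 N x01; set A := \sum_(n < N) _; set B := \sum_(n < N) _ => HA.
have : B + 1 <= 2 * A.
  rewrite /A /B -(prednK N0); set k := N.-1.
  rewrite !big_ord_recl /= !expr0.
  have : \sum_(i < k) (2 * ((bump 0 i)%:R * x ^+ bump 0 i) - x ^+ bump 0 i) <= 2 * \sum_(i < k) ((bump 0 i).+1%:R * x ^+ bump 0 i).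
    rewrite mulr_sumr; apply: ler_sum => i _.
    have : 0 <= x ^+ bump 0 i by rewrite exprn_ge0.
    by rewrite -natr1; lra.
  lra.
have : 0 <= (N%:R - 1) ^+ 2 * x ^+ N by rewrite mulr_ge0 ?sqr_ge0 ?exprn_ge0.
lra.
Qed.

Lemma clim_bounded (u : nat -> C) l : clim u l -> exists2 K : R, 0 < K & forall n, nrm (u n) <= K.
Proof.
move=> /(_ 1 ltr01)[N HN].
exists (nrm l + 1 + \sum_(i < N) nrm (u i)).
  by rewrite ltr_pwDl ?sumr_ge0//; [rewrite ltr_wpDl ?nrm_ge0|move=> i _; exact: nrm_ge0].
move=> n; have [nN|Nn] := ltnP n N.
  rewrite (bigD1 (Ordinal nN))//= addrCA lerDl addr_ge0 ?addr_ge0 ?nrm_ge0 ?sumr_ge0//.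
  by move=> i _; exact: nrm_ge0.
have := HN n Nn; have := nrmD (u n - l) l; rewrite subrK.
have : 0 <= \sum_(i < N) nrm (u i) by apply: sumr_ge0 => i _; exact: nrm_ge0.
lra.
Qed.

Lemma psum_terms (a : nat -> C) w l : clim (psum a w) l ->
  exists2 K : R, 0 < K & forall n, nrm (a n) * nrm w ^+ n <= K.
Proof.
move=> /clim_bounded[K K0 HK]; exists (K + K); first by rewrite addr_gt0.
move=> n; rewrite -nrmX -nrmM.
have -> : a n * w ^+ n = psum a w n.+1 - psum a w n by rewrite psumS; ring.
by apply: le_trans (nrmB _ _) _; rewrite lerD.
Qed.

Definition dcoef (a : nat -> C) n := n.+1%:R * a n.+1.

(** Multiplying by [s ^+ 2] avoids the exponent n - 2 in the Taylor bound n^2 s^(n-2) |h|^2. *)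
Lemma pow_rem (z h : C) (s : R) n : 0 <= s -> nrm z <= s -> nrm (z + h) <= s ->
  nrm ((z + h) ^+ n - z ^+ n - n%:R * z ^+ n.-1 * h) * s ^+ 2 <=
  n%:R ^+ 2 * s ^+ n * nrm h ^+ 2.
Proof.
move=> s0 zs zhs; elim: n => [|n IH].
  by rewrite !expr0 !mul0r subrr subr0 nrm0 mul0r expr2 !mul0r.
have -> : (z + h) ^+ n.+1 - z ^+ n.+1 - n.+1%:R * z ^+ n.+1.-1 * h =
  (z + h) * ((z + h) ^+ n - z ^+ n - n%:R * z ^+ n.-1 * h) + n%:R * z ^+ n.-1 * h ^+ 2.
  case: n {IH} => [|n] /=; first by rewrite !expr0; ring.
  by rewrite !exprS -!natr1; ring.
set D := _ - _ - _ in IH *.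
apply: (@le_trans _ _ ((s * nrm D + n%:R * nrm z ^+ n.-1 * nrm h ^+ 2) * s ^+ 2)).
  rewrite ler_wpM2r ?sqr_ge0//; apply: le_trans (nrmD _ _) _.
  by rewrite !nrmM !nrmX nrm_nat lerD2r ler_wpM2r ?nrm_ge0.
rewrite mulrDl.
have h1 : s * nrm D * s ^+ 2 <= n%:R ^+ 2 * s ^+ n.+1 * nrm h ^+ 2.
  have := ler_wpM2l s0 IH; rewrite [s ^+ n.+1]exprS; lra.
have h2 : n%:R * nrm z ^+ n.-1 * nrm h ^+ 2 * s ^+ 2 <= n%:R * s ^+ n.+1 * nrm h ^+ 2.
  case: n {IH h1 D} => [|n]; first by rewrite !mul0r.
  have -> : n.+1%:R * s ^+ n.+2 * nrm h ^+ 2 = n.+1%:R * s ^+ n * nrm h ^+ 2 * s ^+ 2.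
    by rewrite !exprS; ring.
  rewrite ler_wpM2r ?sqr_ge0// ler_wpM2r ?sqr_ge0// ler_wpM2l//=.
  by rewrite lerXn2r ?nnegrE ?nrm_ge0.
apply: le_trans (lerD h1 h2) _.
have -> : n.+1%:R ^+ 2 * s ^+ n.+1 * nrm h ^+ 2 = n%:R ^+ 2 * s ^+ n.+1 * nrm h ^+ 2 +
  n%:R * s ^+ n.+1 * nrm h ^+ 2 + n.+1%:R * (s ^+ n.+1 * nrm h ^+ 2) by rewrite -!natr1; ring.
by rewrite lerDl mulr_ge0// mulr_ge0 ?exprn_ge0 ?nrm_ge0.
Qed.

Definition ps_on (a : nat -> C) (r : R) f := forall w, nrm w < r -> clim (psum a w) (f w).

(** The coefficients are controlled at radius t and the remainders estimated at s < t, so that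
    powers of s/t dominate. *)
Lemma ps_sub (a : nat -> C) (r : R) f w : ps_on a r f -> nrm w < r ->
  exists s t K : R, [/\ nrm w < s, s < t, t < r, 0 < K & forall n, nrm (a n) * t ^+ n <= K].
Proof.
move=> H wr; have w0 := nrm_ge0 w.
pose t := nrm w + (r - nrm w) / 2; pose s := nrm w + (r - nrm w) / 3.
have t0 : 0 < t by rewrite /t; lra.
have : nrm (ofreal t) < r by rewrite nrm_ofreal gtr0_norm// /t; lra.
move=> /H/psum_terms[K K0]; rewrite nrm_ofreal gtr0_norm// => HK.
by exists s, t, K; split => //; rewrite /s /t; lra.
Qed.

Lemma ps_der (a : nat -> C) (r : R) f : ps_on a r f ->
  forall w, nrm w < r -> exists2 l, clim (psum (dcoef a) w) l & cder f w l.
Proof.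
move=> H w wr; have [s [t [K [ws st tr K0 HK]]]] := ps_sub H wr.
have s0 : 0 < s by apply: le_lt_trans ws; exact: nrm_ge0.
have t0 : 0 < t by lra.
pose x := s / t.
have x01 : 0 <= x < 1 by rewrite /x divr_ge0 ?(ltW s0) ?(ltW t0)//= ltr_pdivrMr ?mul1r.
have HK' n : nrm (a n) * s ^+ n <= K * x ^+ n.
  rewrite /x expr_div_n mulrA ler_pdivlMr ?exprn_gt0// mulrAC ler_wpM2r ?exprn_ge0 ?(ltW s0)//.
have [l Hl] : exists l, clim (psum (dcoef a) w) l.
  apply: (@series_dom (fun n => dcoef a n * w ^+ n) (fun n => K / t * (n.+1%:R * x ^+ n)) (K / t * (1 - x)^-1 ^+ 2)).
    move=> n; rewrite /dcoef !nrmM nrmX nrm_nat.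
    rewrite mulrCA -mulrA ler_wpM2l//.
    have h1 := HK n.+1.
    have h2 : nrm (a n.+1) * nrm w ^+ n <= nrm (a n.+1) * s ^+ n.
      by rewrite ler_wpM2l ?nrm_ge0// lerXn2r ?nnegrE ?nrm_ge0 ?(ltW s0)// ltW.
    apply: le_trans h2 _; rewrite /x expr_div_n.
    have -> : K / t * (s ^+ n / t ^+ n) = K / t ^+ n.+1 * s ^+ n.
      by rewrite exprS; field; rewrite ?expf_neq0 ?gt_eqF.
    by rewrite ler_wpM2r ?exprn_ge0 ?(ltW s0)// ler_pdivlMr ?exprn_gt0.
  move=> N; rewrite -mulr_sumr ler_wpM2l ?divr_ge0 ?(ltW K0) ?(ltW t0)//.
  exact: sum_geom2.
exists l => //.
pose d n := a n * (n%:R * w ^+ n.-1).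
have Hd : clim (fun N => \sum_(n < N) d n) l.
  move=> e /Hl[N HN]; exists N.+1 => -[//|n]; rewrite ltnS => /HN.
  congr (nrm (_ - _) <= _); rewrite [RHS]big_ord_recl /d mul0r mulr0 add0r.
  by apply: eq_bigr => i _; rewrite /dcoef /= mulrCA mulrA.
apply: (@cder_series (fun n w => a n * w ^+ n) f w d l
  (fun n => K / s ^+ 2 * (n%:R ^+ 2 * x ^+ n)) (K / s ^+ 2 * (2 * (1 - x)^-1 ^+ 3)) (s - nrm w)).
- lra.
- move=> N; rewrite -mulr_sumr ler_wpM2l ?divr_ge0 ?sqr_ge0 ?(ltW K0)//.
  exact: sum_geom3.
- move=> n h hs; have hws : nrm (w + h) <= s by have := nrmD w h; lra.
  have -> : a n * (w + h) ^+ n - a n * w ^+ n - d n * h =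
     a n * ((w + h) ^+ n - w ^+ n - n%:R * w ^+ n.-1 * h) by rewrite /d; ring.
  have := @pow_rem w h s n (ltW s0) (ltW ws) hws.
  set D := nrm (_ - _ - _) => HD; rewrite nrmM -/D.
  have -> : K / s ^+ 2 * (n%:R ^+ 2 * x ^+ n) * nrm h ^+ 2 =
     (n%:R ^+ 2 * nrm h ^+ 2 * (K * x ^+ n)) / s ^+ 2 by ring.
  rewrite ler_pdivlMr ?exprn_gt0// -[X in X <= _]mulrA.
  have : nrm (a n) * (D * s ^+ 2) <= nrm (a n) * (n%:R ^+ 2 * s ^+ n * nrm h ^+ 2).
    by rewrite ler_wpM2l ?nrm_ge0.
  move/le_trans; apply.
  have -> : nrm (a n) * (n%:R ^+ 2 * s ^+ n * nrm h ^+ 2) = n%:R ^+ 2 * nrm h ^+ 2 * (nrm (a n) * s ^+ n) by ring.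
  apply: ler_wpM2l; last exact: HK'.
  by apply: mulr_ge0; exact: sqr_ge0.
- by move=> h hs; apply: H; have := nrmD w h; lra.
- exact: Hd.
Qed.

End PowerSeries.

(** * Local theory of holomorphic functions *)

Section Analytic.
Variable R : realType.
Local Notation C := (cplx R).
Implicit Types (f g : C -> C) (z w : C).
Local Notation "'tpi'" := (2 * pi : R).

Lemma clim0_psum (a : nat -> C) : clim (psum a 0) (a 0%N).
Proof.
move=> e e0; exists 1%N => -[//|n] _; rewrite /psum big_ord_recl expr0 mulr1 big1.
  by rewrite addr0 subrr nrm0 ltW.
by move=> i _; rewrite expr0n mulr0.
Qed.

Lemma ps_on0 (a : nat -> C) (r : R) f : 0 < r -> ps_on a r f -> f 0 = a 0%N.
Proof.
move=> r0 H; have := H 0; rewrite nrm0 => /(_ r0) H0.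
exact: clim_uniq H0 (clim0_psum a).
Qed.

Lemma ps_cont (a : nat -> C) (r : R) f w : ps_on a r f -> nrm w < r -> ccont f w.
Proof. by move=> H /(ps_der H)[l _ /cder_cont]. Qed.

Lemma ps_factor (a : nat -> C) (r : R) f m : ps_on a r f -> (forall k, (k < m)%N -> a k = 0) ->
  exists u, ps_on (fun k => a (k + m)%N) r u /\ forall w, nrm w < r -> f w = w ^+ m * u w.
Proof.
move=> H am.
have E w N : psum a w (N + m)%N = w ^+ m * psum (fun k => a (k + m)%N) w N.
  elim: N => [|N IH].
    by rewrite /psum big_ord0 mulr0 big1// => i _; rewrite am ?mul0r ?ltn_ord.
  by rewrite addSn !psumS IH exprD; ring.
exists (fun w => if w == 0 then a m else f w / w ^+ m); split=> w wr.
  case: eqP => [->|/eqP w0]; first exact: (clim0_psum (fun k => a (k + m)%N)).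
  have wm : w ^+ m != 0 by rewrite expf_neq0.
  have := climZ (w ^- m) (clim_shift m (H w wr)); rewrite [_ * f w]mulrC.
  by apply: clim_ext => N; rewrite E mulKf.
case: eqP => [w0|/eqP w0]; last by rewrite mulrC divfK ?expf_neq0.
move: wr; rewrite {}w0 nrm0 => r0; rewrite (ps_on0 r0 H).
by case: m am {E} => [|m] am; rewrite ?expr0 ?mul1r// expr0n mul0r am.
Qed.

Lemma ps_nz (a : nat -> C) (r : R) f m : 0 < r -> ps_on a r f -> a m != 0 ->
  exists2 d : R, 0 < d & forall w, w != 0 -> nrm w < d -> f w != 0.
Proof.
move=> r0 H am.
have ex : exists m, a m != 0 by exists m.
case: (ex_minnP ex) => k ak kmin {am m ex}.
have am j : (j < k)%N -> a j = 0.
  by move=> jk; apply/eqP/negP => /negP /kmin; rewrite leqNgt jk.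
have [u [Hu fu]] := ps_factor H am.
have u0 := ps_on0 r0 Hu; rewrite add0n in u0.
have nu : 0 < nrm (u 0) / 2 by rewrite divr_gt0// nrm_gt0 u0.
have n0 : nrm (0 : C) < r by rewrite nrm0.
have [d d0 Hd] := ps_cont Hu n0 nu.
exists (Num.min d r); first by rewrite lt_min d0.
move=> w w0; rewrite lt_min => /andP[/Hd]; rewrite add0r => h wr.
rewrite fu// mulf_neq0 ?expf_neq0//.
apply: contraTneq h => ->; rewrite sub0r nrmN -ltNge; lra.
Qed.

(** The centre is excluded because a function of q = e(z) is never known at q = 0. *)
Lemma ps_uniq0 (a : nat -> C) (r : R) f : 0 < r -> ps_on a r f ->
  (exists2 d : R, 0 < d & forall w, w != 0 -> nrm w < d -> f w = 0) -> forall n, a n = 0.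
Proof.
move=> r0 H [d d0 Hd] n; apply/eqP/negP => /negP an.
have [d' d'0 Hd'] := ps_nz r0 H an.
pose t := Num.min d d' / 2.
have t0 : 0 < t by rewrite divr_gt0// lt_min d0.
have [t1 t2] : t < d /\ t < d'.
  have : Num.min d d' <= d by rewrite ge_min lexx.
  have : Num.min d d' <= d' by rewrite ge_min lexx orbT.
  by move: t0; rewrite /t; split; lra.
have nt : nrm (ofreal t) = t by rewrite nrm_ofreal gtr0_norm.
have tn : ofreal t != 0 by rewrite -nrm_gt0 nt.
by have := Hd' (ofreal t) tn; rewrite nt => /(_ t2); rewrite Hd ?nt ?eqxx.
Qed.

Lemma ps_B (a b : nat -> C) (r : R) f g : ps_on a r f -> ps_on b r g ->
  ps_on (fun n => a n - b n) r (fun w => f w - g w).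
Proof.
move=> Hf Hg w wr; apply: clim_ext (climB (Hf w wr) (Hg w wr)) => N.
by rewrite /psum -sumrB; apply: eq_bigr => i _; rewrite mulrBl.
Qed.

(** [phi], that is f(z0 + r e(t)), is holomorphic of period 1 on the upper half-plane and bounded
    near infinity, so its Fourier series is a power series in w = r e(t). The estimate of the
    coefficients is that of [qexp_exists] at the height where |w| = s. *)
Lemma local_ps f z0 (r : R) : 0 < r ->
  (forall w, nrm w < r -> exists l, cder f (z0 + w) l) ->
  exists a, ps_on a r (fun w => f (z0 + w)) /\
   forall n (s M : R), 0 < s -> s < r -> (forall w, nrm w = s -> nrm (f (z0 + w)) <= M) ->
     nrm (a n) <= M / s ^+ n.
Proof.
move=> r0 H; have rc : ofreal r != 0 by rewrite -nrm_gt0 nrm_ofreal normr_gt0 gt_eqF.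
have nr : nrm (ofreal r) = r by rewrite nrm_ofreal gtr0_norm.
pose phi t := f (z0 + ofreal r * e2pii t).
have Hphi : hol phi.
  move=> t Ht; have [|l Hl] := H (ofreal r * e2pii t).
    by rewrite nrmM nr gtr_pMr// nrm_e2pii_lt1.
  exists (l * (0 + ofreal r * (twopii R * e2pii t))).
  have Hg := cderD (cder_cst z0 t) (cderZ (ofreal r) (cder_e2pii t)).
  exact: (@cder_comp _ f _ _ _ _ Hg Hl).
have Pphi : per1 phi by move=> t _; rewrite /phi e2piiD1.
have [|l0 Hl0] := H 0; first by rewrite nrm0.
have [d d0 Hd] := cder_cont Hl0 ltr01.
have [|a [Ha1 Ha2]] := qexp_exists Hphi Pphi.
  move=> e e0.
  have F0 : 0 < nrm (f z0) + 1 by rewrite ltr_wpDl ?nrm_ge0.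
  have [Y1 Y10 H1] := expR_archi (twopi_gt0 R) (divr_gt0 e0 F0).
  have dr : 0 < d / (2 * r) by rewrite divr_gt0 ?mulr_gt0.
  have [Y2 Y20 H2] := expR_archi (twopi_gt0 R) dr.
  exists (Num.max Y1 Y2) => z; rewrite ge_max => /andP[/H1 h1 /H2 h2].
  have : nrm (ofreal r * e2pii z) < d.
    rewrite nrmM nr nrm_e2pii; move: h2; rewrite ler_pdivlMr ?mulr_gt0//; nra.
  move=> /Hd; rewrite addr0 => h3.
  have : nrm (phi z) <= nrm (f z0) + 1.
    by rewrite /phi; have := nrmD (f (z0 + ofreal r * e2pii z) - f z0) (f z0); rewrite subrK; lra.
  move/le_trans; apply; move: h1; rewrite expRN ler_pdivlMr// mulrC.
  by rewrite ler_pdivrMr ?expR_gt0.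
(* The centre is not of the form r e(t); its value is found by comparing two functions continuous
   there. *)
have b0 : a 0%N = f z0.
  pose F w := if w == 0 then a 0%N else f (z0 + ofreal r * w).
  have HF : ps_on a 1 F.
    move=> w w1; rewrite /F; case: eqP => [->|/eqP w0]; first exact: clim0_psum.
    by have [t Ht <-] := e2pii_surj_uhp w0 w1; exact: Ha1.
  apply/eqP; rewrite -subr_eq0 -nrm_eq0 eq_le nrm_ge0 andbT.
  apply/ler_addgt0Pl => e e0; rewrite addr0; have e2 : 0 < e / 2 by lra.
  have n0 : nrm (0 : C) < 1 by rewrite nrm0.
  have [d1 d10 Hd1] := ps_cont HF n0 e2.
  have [d2 d20 Hd2] := cder_cont Hl0 e2.
  pose t := Num.min (d1 / 2) (d2 / (2 * r)).
  have t0 : 0 < t by rewrite /t lt_min; apply/andP; split; rewrite divr_gt0 ?mulr_gt0.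
  have [t1 t2] : t <= d1 / 2 /\ t <= d2 / (2 * r).
    by split; rewrite /t ge_min lexx ?orbT.
  have nt : nrm (ofreal t) = t by rewrite nrm_ofreal gtr0_norm.
  have tn : ofreal t != 0 by rewrite -nrm_gt0 nt.
  have := Hd1 (ofreal t); rewrite add0r nt /F eqxx (negbTE tn) => /(_ ltac:(lra)) h1.
  have := Hd2 (ofreal r * ofreal t); rewrite addr0 nrmM nr nt => /(_ _) h2.
  have {}h2 : nrm (f (z0 + ofreal r * ofreal t) - f z0) <= e / 2.
    by apply: h2; move: t2; rewrite ler_pdivlMr ?mulr_gt0//; nra.
  set v := f (z0 + _) in h1 h2; have -> : a 0%N - f z0 = (v - f z0) - (v - a 0%N) by ring.
  by apply: le_trans (nrmB _ _) _; lra.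
have E w N : psum (fun n => a n / ofreal r ^+ n) w N = psum a (w / ofreal r) N.
  by apply: eq_bigr => i _; rewrite expr_div_n; ring.
exists (fun n => a n / ofreal r ^+ n); split.
  move=> w wr; apply: (@clim_ext _ (psum a (w / ofreal r))) => [N|]; first by rewrite E.
  have [->|w0] := eqVneq w 0; first by rewrite mul0r addr0 -b0; exact: clim0_psum.
  have [||t Ht tw] := @e2pii_surj_uhp _ (w / ofreal r).
  - by rewrite mulf_neq0 ?invr_neq0.
  - by rewrite nrmM nrmV nr ltr_pdivrMr ?mul1r.
  by have := Ha1 t Ht; rewrite /phi tw [ofreal r * _]mulrC divfK.
move=> n s M s0 sr HM; rewrite nrmM nrmV nrmX nr.
have rn : 0 < r ^+ n by rewrite exprn_gt0.
rewrite ler_pdivrMr//.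
have sr0 : 0 < s / r by rewrite divr_gt0.
have [x Hx] := expR_total sr0.
have x0 : x < 0 by rewrite -expR_lt1 Hx ltr_pdivrMr ?mul1r.
have tp := twopi_gt0 R.
pose y := - x / tpi.
have yE : tpi * y = - x by rewrite /y mulrC divfK ?gt_eqF.
have y0 : 0 < y by rewrite divr_gt0 ?oppr_gt0.
have := Ha2 n y M y0; rewrite [tpi * n%:R]mulrC -mulrA yE mulrN -mulNr mulNr -mulrN expRM_natl expRN Hx.
rewrite exprVn expr_div_n invf_div mulrA => K; rewrite [X in _ <= X]mulrAC; apply: K.
move=> t _; rewrite /phi; apply: HM.
by rewrite nrmM nr nrm_e2pii /= yE opprK Hx mulrC divfK ?gt_eqF.
Qed.

Lemma ball_uhp z h : uhp R z -> nrm h < complex.Im z -> uhp R (z + h).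
Proof. by rewrite /uhp /= cImD; have := normIm_le h; rewrite ler_norml; lra. Qed.

Lemma hol_derivable_uhp f : hol f <-> holomorphic_uhp f.
Proof. by split=> H z Hz; [have [l] := H z Hz; exact: hol_derivable | apply/derivableP1/H]. Qed.

Lemma hol_cder f z : hol f -> uhp R z -> cder f z (derive1 f z).
Proof. by move=> H /H[l Hl]; rewrite (derive1_cder Hl). Qed.

Lemma hol_local f z : hol f -> uhp R z -> forall w, nrm w < complex.Im z -> exists l, cder f (z + w) l.
Proof. by move=> H Hz w hw; apply/H/ball_uhp. Qed.

Lemma cder_shift f z w l : cder (fun v => f (z + v)) w l -> cder f (z + w) l.
Proof. by move=> H e /H[d d0 Hd]; exists d => // h /Hd; rewrite addrA. Qed.

Lemma hol_derive1 f : hol f -> hol (derive1 f).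
Proof.
move=> H z Hz; have [a [Ha _]] := local_ps Hz (hol_local H Hz).
have Hd : ps_on (dcoef a) (complex.Im z) (fun w => derive1 f (z + w)).
  by move=> w wr; have [l Hl /cder_shift/derive1_cder ->] := ps_der Ha wr.
have [|l _ Hl] := @ps_der _ _ _ _ Hd 0; first by rewrite nrm0.
by exists l; rewrite -[z]addr0; exact: cder_shift.
Qed.

Lemma cauchy_deriv f z (r M : R) : hol f -> 0 < r -> r < complex.Im z ->
  (forall w, nrm w = r -> nrm (f (z + w)) <= M) -> nrm (derive1 f z) <= M / r.
Proof.
move=> H r0 rz HM; have Hz : uhp R z by exact: lt_trans rz.
have [a [Ha Hb]] := local_ps Hz (hol_local H Hz).
have [|l Hl Hc] := @ps_der _ _ _ _ Ha 0; first by rewrite nrm0.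
have := cder_shift Hc; rewrite addr0 => /derive1_cder ->.
rewrite (clim_uniq Hl (clim0_psum _)) /dcoef mul1r.
by have := Hb 1%N r M r0 rz HM; rewrite expr1.
Qed.

Lemma rhp_nrm (v : C) : (0 < complex.Re v) = (nrm (v - 1) < nrm (v + 1)).
Proof.
rewrite -[nrm _ < _](@ltr_pXn2r _ 2)// ?nnegrE ?nrm_ge0// !nrm_sqr !cReD !cImD !cReN !cImN /= oppr0 !addr0.
by apply/idP/idP; nra.
Qed.

(* The conformal map from the unit disc onto the upper half-plane sending 0 to
   [t] makes a single power series valid on the whole of the half-plane. *)
Definition cay (t w : C) : C :=
  ofreal (complex.Re t) + mk 0 (complex.Im t) * ((1 + w) / (1 - w)).

Lemma one_sub_neq0 w : nrm w < 1 -> 1 - w != 0.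
Proof. by move=> h; rewrite subr_eq0 eq_sym; apply: contraTneq h => ->; rewrite nrm1 ltxx. Qed.

Lemma cay_uhp t w : uhp R t -> nrm w < 1 -> uhp R (cay t w).
Proof.
move=> Ht h; have w1 := one_sub_neq0 h.
have h0 : 0 < complex.Re ((1 + w) / (1 - w)).
  rewrite rhp_nrm.
  have -> : (1 + w) / (1 - w) - 1 = w * (2 / (1 - w)) by field.
  have -> : (1 + w) / (1 - w) + 1 = 2 / (1 - w) by field.
  by rewrite nrmM gtr_pMl// nrm_gt0 mulf_neq0 ?invr_neq0 ?pnatr_eq0.
by rewrite /uhp /= /cay cImD cImM /= mul0r !add0r mulr_gt0.
Qed.

Definition cayV (t z : C) : C := (z - t) / (z - conjc t).

Lemma cayV_den t z : uhp R t -> uhp R z -> z - conjc t != 0.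
Proof.
move=> Ht Hz; apply/eqP => /(congr1 (@complex.Im R)) /=; rewrite cImD cImN.
by case: t Ht => a b; rewrite /uhp /= opprK; move: Hz; rewrite /uhp /=; lra.
Qed.

Lemma cayVK t z : uhp R t -> uhp R z -> nrm (cayV t z) < 1 /\ cay t (cayV t z) = z.
Proof.
move=> Ht Hz; have d0 := cayV_den Ht Hz.
have tt : t - conjc t = 2 * mk 0 (complex.Im t).
  by case: t {Ht d0} => a b; apply: cplxP; rewrite ?(cReM, cImM) /= ; ring.
have m0 : mk 0 (complex.Im t) != 0.
  by apply/eqP => /(congr1 (@complex.Im R)) /= E; move: Ht; rewrite /uhp /= E ltxx.
have rt : ofreal (complex.Re t) = t - mk 0 (complex.Im t).
  by apply: cplxP => /=; rewrite ?(cReD, cImD) ?(cReN, cImN) /=; ring.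
have e1 : 1 - cayV t z = 2 * mk 0 (complex.Im t) / (z - conjc t).
  by rewrite -tt /cayV; field.
have two0 : (2 : C) != 0 by rewrite pnatr_eq0.
have c1 : conjc t = t - 2 * mk 0 (complex.Im t) by rewrite -tt; ring.
split; last first.
  rewrite /cay e1 rt /cayV; move: d0; rewrite c1; set m := mk _ _ in m0 * => d0.
  by field; rewrite m0 d0.
rewrite /cayV nrmM nrmV ltr_pdivrMr ?nrm_gt0// mul1r.
rewrite -(@ltr_pXn2r _ 2)// ?nnegrE ?nrm_ge0// !nrm_sqr !cReD !cImD !cReN !cImN.
case: t Ht {d0 tt m0 rt e1 c1} => a b; move: Hz; rewrite /uhp /=; nra.
Qed.

Lemma cder_cay t w : nrm w < 1 -> exists l, cder (cay t) w l.
Proof.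
move=> h; have w1 := one_sub_neq0 h.
eexists; apply: cderD; first exact: cder_cst.
apply: cderZ; apply: cder_div => //.
  exact: cderD (cder_cst _ _) (cder_id _).
exact: cderB (cder_cst _ _) (cder_id _).
Qed.

Lemma hol_disc f t : hol f -> uhp R t -> exists a, ps_on a 1 (fun w => f (cay t w)).
Proof.
move=> H Ht.
have [|a [Ha _]] := @local_ps (fun w => f (cay t w)) 0 1 ltr01.
  move=> w; rewrite add0r => hw; have [l Hl] := H _ (cay_uhp Ht hw).
  by have [m Hm] := cder_cay t hw; eexists; exact: cder_comp Hm Hl.
by exists a => w hw; have := Ha w hw; rewrite add0r.
Qed.

Lemma cont_cayV t : uhp R t -> ccont (cayV t) t.
Proof.
move=> Ht; apply: cder_cont; apply: cder_div; first exact: cayV_den.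
  exact: cderB (cder_id _) (cder_cst _ _).
exact: cderB (cder_id _) (cder_cst _ _).
Qed.

Lemma zero_or_isolated f t : hol f -> uhp R t ->
  eq_uhp f (fun=> 0) \/
  exists2 d : R, 0 < d & forall h, h != 0 -> nrm h < d -> uhp R (t + h) /\ f (t + h) != 0.
Proof.
move=> H Ht; have [a Ha] := hol_disc H Ht.
have [az|/existsNP[m /eqP am]] := pselect (forall n, a n = 0).
  left => z Hz; have [w1 zE] := cayVK Ht Hz; rewrite -zE.
  apply: (clim_uniq (Ha _ w1)); apply: clim_ext (clim_cst 0) => N.
  by rewrite /psum big1// => i _; rewrite az mul0r.
right; have [d d0 Hd] := ps_nz ltr01 Ha am.
have [d1 d10 Hd1] := cont_cayV Ht (divr_gt0 d0 (ltr0n _ 2)).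
exists (Num.min d1 (complex.Im t)); first by rewrite lt_min d10; exact: Ht.
move=> h h0; rewrite lt_min => /andP[/Hd1 h1 h2].
have uh := ball_uhp Ht h2; split => //.
have [w1 zE] := cayVK Ht uh; rewrite -zE; apply: Hd.
  rewrite /cayV addrAC subrr add0r mulf_neq0 ?invr_neq0//; exact: cayV_den.
by move: h1; rewrite {2}/cayV subrr mul0r subr0; lra.
Qed.

Lemma hol_identity f t : hol f -> uhp R t ->
  (exists2 d : R, 0 < d & forall h, nrm h < d -> f (t + h) = 0) -> eq_uhp f (fun=> 0).
Proof.
move=> H Ht [d d0 Hd]; have [//|[d' d'0 Hd']] := zero_or_isolated H Ht.
pose s := Num.min d d' / 2.
have s0 : 0 < s by rewrite divr_gt0// lt_min d0.
have [s1 s2] : s < d /\ s < d'.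
  have : Num.min d d' <= d by rewrite ge_min lexx.
  have : Num.min d d' <= d' by rewrite ge_min lexx orbT.
  by move: s0; rewrite /s; split; lra.
have ns : nrm (ofreal s) = s by rewrite nrm_ofreal gtr0_norm.
have [||_] := Hd' (ofreal s); rewrite ?ns// -?nrm_gt0 ?ns//.
by rewrite nrm_gt0 Hd ?ns ?eqxx.
Qed.

Lemma hol_mul_eq0 f g : hol f -> hol g -> (forall z, uhp R z -> f z * g z = 0) ->
  eq_uhp f (fun=> 0) \/ eq_uhp g (fun=> 0).
Proof.
move=> Hf Hg H; have Hi : uhp R (mk 0 1) by rewrite uhp_mk.
have [|[d d0 Hd]] := zero_or_isolated Hf Hi; first by left.
have [|[d' d'0 Hd']] := zero_or_isolated Hg Hi; first by right.
pose s := Num.min d d' / 2.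
have s0 : 0 < s by rewrite divr_gt0// lt_min d0.
have [s1 s2] : s < d /\ s < d'.
  have : Num.min d d' <= d by rewrite ge_min lexx.
  have : Num.min d d' <= d' by rewrite ge_min lexx orbT.
  by move: s0; rewrite /s; split; lra.
have ns : nrm (ofreal s) = s by rewrite nrm_ofreal gtr0_norm.
have sn : ofreal s != 0 by rewrite -nrm_gt0 ns.
have [|u h1] := Hd _ sn; first by rewrite ns.
have [|_ h2] := Hd' _ sn; first by rewrite ns.
by have /eqP := H _ u; rewrite mulf_eq0 (negbTE h1) (negbTE h2).
Qed.

Lemma ps_der0 (a : nat -> C) (r : R) f : ps_on a r f ->
  (forall w, nrm w < r -> cder f w 0) -> forall w, nrm w < r -> f w = a 0%N.
Proof.
move=> Ha H w wr; have r0 : 0 < r by apply: le_lt_trans wr; exact: nrm_ge0.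
have Hd : ps_on (dcoef a) r (fun=> 0).
  by move=> v vr; have [l Hl Hc] := ps_der Ha vr; rewrite -(cder_uniq Hc (H v vr)).
have d0 := ps_uniq0 r0 Hd (ex_intro2 _ _ r r0 (fun _ _ _ => erefl)).
apply: clim_uniq (Ha w wr) _ => e e0; exists 1%N => -[//|n] _.
rewrite /psum big_ord_recl expr0 mulr1 big1 ?addr0 ?subrr ?nrm0 ?ltW// => i _.
have /eqP := d0 i; rewrite /dcoef mulf_eq0 pnatr_eq0 /= => /eqP ->.
by rewrite mul0r.
Qed.

Lemma hol_const_near f t (r : R) : 0 < r -> (forall w, nrm w < r -> cder f (t + w) 0) ->
  forall w, nrm w < r -> f (t + w) = f t.
Proof.
move=> r0 H w wr.
have [|a [Ha _]] := @local_ps f t r r0; first by move=> v vr; exists 0; exact: H.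
have K : forall w, nrm w < r -> f (t + w) = a 0%N.
  apply: (ps_der0 Ha) => v vr e e0; have [d d0 Hd] := H v vr e e0.
  by exists d => // h /Hd; rewrite addrA.
by rewrite K// -[in RHS](addr0 t) K ?nrm0.
Qed.

Lemma hol_const f t : (forall z, uhp R z -> cder f z 0) -> uhp R t ->
  eq_uhp f (fun=> f t).
Proof.
move=> H Ht z Hz; apply/eqP; rewrite -subr_eq0; apply/eqP.
pose g z := f z - f t.
have Hg : hol g by move=> v Hv; exists (0 - 0); apply: cderB (H v Hv) (cder_cst _ _).
apply: (@hol_identity g t) => //; exists (complex.Im t) => // h hh.
rewrite /g (@hol_const_near f t (complex.Im t)) ?subrr// => w wr.
exact/H/ball_uhp.
Qed.

(** Adds the point q = 0, so that behaviour at the cusp becomes continuity at the centre of a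
    disc. *)
Lemma qexp_ps (a : nat -> C) f : (forall z, uhp R z -> clim (psum a (e2pii z)) (f z)) ->
  exists F, ps_on a 1 F /\ forall z, uhp R z -> F (e2pii z) = f z.
Proof.
move=> H; exists (fun w => xget 0 [set l | clim (psum a w) l]); split.
  move=> w wr; suff : exists l, [set l | clim (psum a w) l] l by exact: xgetPex.
  have [->|w0] := eqVneq w 0; first by exists (a 0%N); exact: clim0_psum.
  by have [t Ht <-] := e2pii_surj_uhp w0 wr; exists (f t); exact: H.
move=> z Hz; have h : clim (psum a (e2pii z)) (f z) by exact: H.
have : [set l | clim (psum a (e2pii z)) l] (xget 0 [set l | clim (psum a (e2pii z)) l]).
  by apply: xgetPex; exists (f z).
by move=> /clim_uniq; apply.
Qed.

Lemma qexp_uniq0 (a : nat -> C) : (forall z, uhp R z -> clim (psum a (e2pii z)) 0) ->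
  forall n, a n = 0.
Proof.
move=> H; have [F [HF FE]] := qexp_ps H.
apply: (ps_uniq0 ltr01 HF); exists 1 => // w w0 w1.
by have [t Ht <-] := e2pii_surj_uhp w0 w1; exact: FE.
Qed.

End Analytic.

(** * The modular group *)

Section SL2.

Definition mx2 (a b c d : int) : 'M[int]_2 :=
  \matrix_(i < 2, j < 2) (if i == 0 then if j == 0 then a else b
                          else if j == 0 then c else d).
Definition matS := mx2 0 (-1) 1 0.
Definition matTV := mx2 1 (-1) 0 1.

Lemma ord2 (i : 'I_2) : i = 0 \/ i = 1.
Proof. by case: i => [[|[|//]] h]; [left|right]; apply: val_inj. Qed.

Lemma mx2E a b c d : [/\ mx2 a b c d 0 0 = a, mx2 a b c d 0 1 = b,
  mx2 a b c d 1 0 = c & mx2 a b c d 1 1 = d].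
Proof. by split; rewrite mxE. Qed.

Lemma mx2_eta (g : 'M[int]_2) : g = mx2 (g 0 0) (g 0 1) (g 1 0) (g 1 1).
Proof.
by apply/matrixP => i j; rewrite mxE; case: (ord2 i) => ->; case: (ord2 j) => ->.
Qed.

Lemma mulmx2 (g h : 'M[int]_2) i j : (g *m h) i j = g i 0 * h 0 j + g i 1 * h 1 j.
Proof.
rewrite mxE big_ord_recl big_ord1.
by have -> : lift ord0 ord0 = 1 :> 'I_2 by exact: val_inj.
Qed.

Lemma det2 (g : 'M[int]_2) : \det g = g 0 0 * g 1 1 - g 0 1 * g 1 0.
Proof.
rewrite (expand_det_row _ ord0) big_ord_recl big_ord1 /cofactor !det_mx11 !mxE.
have e (i j i' j' : 'I_2) : val i = val i' -> val j = val j' -> g i j = g i' j'.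
  by move=> /val_inj -> /val_inj ->.
transitivity (g 0 0 * (1 * g 1 1) + g 0 1 * (-1 * g 1 0)); last by ring.
by congr (_ * (_ * _) + _ * (_ * _)); try exact: e.
Qed.

Lemma mul_mx2 a b c d a' b' c' d' : mx2 a b c d *m mx2 a' b' c' d' =
  mx2 (a * a' + b * c') (a * b' + b * d') (c * a' + d * c') (c * b' + d * d').
Proof.
apply/matrixP => i j; rewrite mulmx2 !mxE.
by case: (ord2 i) => ->; case: (ord2 j) => ->.
Qed.

Lemma det_mx2 a b c d : \det (mx2 a b c d) = a * d - b * c.
Proof. by rewrite det2; have [-> -> -> ->] := mx2E a b c d. Qed.

Lemma matTE : matT = mx2 1 1 0 1.
Proof. by apply/matrixP => i j; rewrite !mxE; case: (ord2 i) => ->; case: (ord2 j) => ->. Qed.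

Lemma mx2_id : 1%:M = mx2 1 0 0 1.
Proof. by apply/matrixP => i j; rewrite !mxE; case: (ord2 i) => ->; case: (ord2 j) => ->. Qed.

Lemma SL2ZE g : (g \in SL2Z) = (\det g == 1). Proof. by []. Qed.

Lemma SL2Z_mul g h : g \in SL2Z -> h \in SL2Z -> g *m h \in SL2Z.
Proof. by rewrite !SL2ZE det_mulmx => /eqP -> /eqP ->. Qed.
Lemma SL2Z1 : 1%:M \in SL2Z. Proof. by rewrite SL2ZE det1. Qed.
Lemma SL2ZS : matS \in SL2Z. Proof. by rewrite SL2ZE det_mx2. Qed.
Lemma SL2ZT : matT \in SL2Z. Proof. by rewrite SL2ZE matTE det_mx2. Qed.
Lemma SL2ZTV : matTV \in SL2Z. Proof. by rewrite SL2ZE det_mx2. Qed.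

(** Euclid's algorithm on the first column: a power of T reduces a modulo c, and S exchanges the two
    rows up to sign, so |c| decreases. Negative powers of T require their own case. *)
Lemma SL2Z_ind (Q : 'M[int]_2 -> Prop) : Q 1%:M ->
  (forall g, g \in SL2Z -> Q g -> Q (matS *m g)) ->
  (forall g, g \in SL2Z -> Q g -> Q (matT *m g)) ->
  (forall g, g \in SL2Z -> Q g -> Q (matTV *m g)) ->
  forall g, g \in SL2Z -> Q g.
Proof.
move=> Q1 QS QT QV.
pose q a b c d := Q (mx2 a b c d).
have qS (a b c d : int) : a * d - b * c = 1 -> q a b c d -> q (- c) (- d) a b.
  move=> D /(QS _ _); rewrite SL2ZE det_mx2 D => /(_ isT); rewrite mul_mx2 /q.
  by congr (Q (mx2 _ _ _ _)); ring.
have qT (a b c d : int) : a * d - b * c = 1 -> q a b c d -> q (a + c) (b + d) c d.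
  move=> D /(QT _ _); rewrite SL2ZE det_mx2 D => /(_ isT); rewrite matTE mul_mx2 /q.
  by congr (Q (mx2 _ _ _ _)); ring.
have qV (a b c d : int) : a * d - b * c = 1 -> q a b c d -> q (a - c) (b - d) c d.
  move=> D /(QV _ _); rewrite SL2ZE det_mx2 D => /(_ isT); rewrite mul_mx2 /q.
  by congr (Q (mx2 _ _ _ _)); ring.
have qTn (a b c d : int) (n : nat) : a * d - b * c = 1 -> q a b c d -> q (a + n%:Z * c) (b + n%:Z * d) c d.
  move=> D; elim: n => [|n IH] H; first by rewrite !mul0r !addr0.
  have := qT _ _ _ _ _ (IH H).
  have -> : (a + n%:Z * c) * d - (b + n%:Z * d) * c = 1 by rewrite -D; ring.
  by move=> /(_ erefl); congr (q _ _ _ _); rewrite intS; ring.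
have qVn (a b c d : int) (n : nat) : a * d - b * c = 1 -> q a b c d -> q (a - n%:Z * c) (b - n%:Z * d) c d.
  move=> D; elim: n => [|n IH] H; first by rewrite !mul0r !subr0.
  have := qV _ _ _ _ _ (IH H).
  have -> : (a - n%:Z * c) * d - (b - n%:Z * d) * c = 1 by rewrite -D; ring.
  by move=> /(_ erefl); congr (q _ _ _ _); rewrite intS; ring.
have qZ (a b c d m : int) : a * d - b * c = 1 -> q a b c d -> q (a + m * c) (b + m * d) c d.
  case: m => n D H; first exact: qTn.
  by rewrite NegzE !mulNr; exact: qVn.
suff main n (a b c d : int) : (`|c|%N < n)%N -> a * d - b * c = 1 -> q a b c d.
  move=> g; rewrite SL2ZE det2 => /eqP D; rewrite [g]mx2_eta.
  by apply: (main (`|g 1%R 0%R|%N.+1)).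
elim: n a b c d => [//|n IH] a b c d cn D.
(* Here a = d = 1 or a = d = -1, and the matrix is a power of T times 1 or S^2. *)
have [c0|c0] := eqVneq c 0.
  subst c; rewrite mulr0 subr0 in D.
  have q1 : q 1 0 0 1 by rewrite /q -mx2_id.
  have qm : q (-1) 0 0 (-1).
    have := qS _ _ _ _ _ (qS _ _ _ _ _ q1); rewrite oppr0; apply; lia.
  have [[a1 d1]|[a1 d1]] : (a = 1 /\ d = 1) \/ (a = -1 /\ d = -1).
    have := congr1 absz D; rewrite abszM => /eqP; rewrite muln_eq1 => /andP[/eqP a1 /eqP d1].
    have [A|A] : a = 1 \/ a = -1 by lia.
      by left; split => //; rewrite A mul1r in D.
    by right; split => //; rewrite A mulN1r in D; lia.
    by have := qZ 1 0 0 1 b erefl q1; rewrite mulr0 addr0 add0r mulr1 a1 d1; apply.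
  by have := qZ (-1) 0 0 (-1) (- b) erefl qm; rewrite mulr0 addr0 add0r mulrN1 opprK a1 d1; apply.
pose k := (a %/ c)%Z; pose r := (a %% c)%Z.
have ar : a = k * c + r by exact: divz_eq.
have rr : 0 <= r < `|c| by rewrite modz_ge0//= ltz_mod.
have H : q c d (- r) (- (b - k * d)).
  apply: IH; first by move: cn rr; lia.
  by rewrite -D ar; ring.
have D2 : c * - (b - k * d) - d * - r = 1 by rewrite -D ar; ring.
have := qS _ _ _ _ D2 H; rewrite !opprK => H2.
have D3 : r * d - (b - k * d) * c = 1 by rewrite -D2; ring.
by have := qZ _ _ _ _ k D3 H2; congr (q _ _ _ _); rewrite ?ar; ring.
Qed.

Variable R : realType.
Local Notation C := (cplx R).
Implicit Types (z t : C) (g h : 'M[int]_2).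

Lemma detC g : g \in SL2Z -> (g 0 0)%:~R * (g 1 1)%:~R - (g 0 1)%:~R * (g 1 0)%:~R = 1 :> C.
Proof. by rewrite SL2ZE det2 => /eqP /(congr1 (fun m : int => m%:~R : C)); rewrite rmorphB !rmorphM. Qed.

Lemma Im_intM (m : int) z : complex.Im (m%:~R * z) = m%:~R * complex.Im z.
Proof. by rewrite -ofreal_int cImM /=; ring. Qed.
Lemma Re_intM (m : int) z : complex.Re (m%:~R * z) = m%:~R * complex.Re z.
Proof. by rewrite -ofreal_int cReM /=; ring. Qed.
Lemma Im_int (m : int) : complex.Im (m%:~R : C) = 0.
Proof. by rewrite -ofreal_int. Qed.

Lemma autom_neq0 g t : g \in SL2Z -> uhp R t -> autom_factor g t != 0.
Proof.
move=> /detC D Ht; apply/eqP => E; move: (E) => /(congr1 (@complex.Im R)).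
rewrite /autom_factor cImD Im_intM Im_int addr0 => /eqP.
have yn : complex.Im t != 0 by rewrite gt_eqF.
rewrite mulf_eq0 (negbTE yn) orbF intr_eq0 => /eqP c0.
move: E D; rewrite /autom_factor c0 mul0r add0r => ->.
by rewrite !mulr0 subr0 => /eqP; rewrite eq_sym oner_eq0.
Qed.

Lemma Im_moebius g t : g \in SL2Z -> uhp R t ->
  complex.Im (moebius g t) = complex.Im t / nrm (autom_factor g t) ^+ 2.
Proof.
move=> gS Ht; have j0 := autom_neq0 gS Ht.
have n0 : nrm (autom_factor g t) ^+ 2 != 0 by rewrite expf_neq0// nrm_eq0.
have E : moebius g t * ofreal (nrm (autom_factor g t) ^+ 2) =
    ((g 0 0)%:~R * t + (g 0 1)%:~R) * conjc (autom_factor g t).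
  have -> : ofreal (nrm (autom_factor g t) ^+ 2) = autom_factor g t * conjc (autom_factor g t).
    apply: cplxP; rewrite ?(cReM, cImM) nrm_sqr; case: (autom_factor g t) => x y /=; ring.
  by rewrite /moebius mulrA divfK.
have D := detC gS; move/(congr1 (@complex.Re R)): D.
rewrite -!ofreal_int -!ofrealM -ofrealN -ofrealD /= => D.
apply: (mulIf n0); rewrite divfK//.
have := congr1 (@complex.Im R) E; rewrite cImM /= mulr0 add0r => ->.
rewrite cImM cReD cImD Re_intM Im_intM Im_int -!ofreal_int /= addr0.
rewrite /autom_factor -!ofreal_int; case: t {Ht j0 n0 E} => x y /=.
transitivity (((g 0 0)%:~R * (g 1 1)%:~R - (g 0 1)%:~R * (g 1 0)%:~R) * y).
  by ring.
by rewrite D mul1r.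
Qed.

Lemma moebius_uhp g t : g \in SL2Z -> uhp R t -> uhp R (moebius g t).
Proof.
move=> gS Ht; rewrite /uhp /= Im_moebius// divr_gt0// exprn_gt0// nrm_gt0.
exact: autom_neq0.
Qed.

Lemma autom_mul g h t : g \in SL2Z -> h \in SL2Z -> uhp R t ->
  autom_factor (g *m h) t = autom_factor g (moebius h t) * autom_factor h t.
Proof.
move=> gS hS Ht; have j0 := autom_neq0 hS Ht.
have E : moebius h t * autom_factor h t = (h 0 0)%:~R * t + (h 0 1)%:~R by rewrite /moebius divfK.
transitivity ((g 1 0)%:~R * (moebius h t * autom_factor h t) + (g 1 1)%:~R * autom_factor h t).
  by rewrite E /autom_factor !mulmx2 !rmorphD !rmorphM /=; ring.
by rewrite [autom_factor g _]/autom_factor; ring.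
Qed.

Lemma moebius_mul g h t : g \in SL2Z -> h \in SL2Z -> uhp R t ->
  moebius (g *m h) t = moebius g (moebius h t).
Proof.
move=> gS hS Ht; have j0 := autom_neq0 hS Ht.
have j1 := autom_neq0 gS (moebius_uhp hS Ht).
have E : moebius h t * autom_factor h t = (h 0 0)%:~R * t + (h 0 1)%:~R by rewrite /moebius divfK.
have E2 : moebius g (moebius h t) * autom_factor g (moebius h t) =
    (g 0 0)%:~R * moebius h t + (g 0 1)%:~R by rewrite /moebius divfK.
apply: (mulIf (mulf_neq0 j1 j0)); rewrite [in RHS]mulrA E2 -[in LHS]autom_mul//.
rewrite {1}/moebius divfK; last by rewrite autom_mul// mulf_neq0.
by rewrite mulrDl -mulrA E !mulmx2 /autom_factor !rmorphD !rmorphM /=; ring.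
Qed.

Lemma moebius_S t : moebius matS t = - t^-1.
Proof.
rewrite /moebius /autom_factor; have [-> -> -> ->] := mx2E 0 (-1) 1 0.
by rewrite mul0r add0r rmorphN1 mulN1r mul1r addr0.
Qed.
Lemma autom_S t : autom_factor matS t = t.
Proof. by rewrite /autom_factor; have [_ _ -> ->] := mx2E 0 (-1) 1 0; rewrite mul1r addr0. Qed.
Lemma moebius_T t : moebius matT t = t + 1.
Proof.
rewrite /moebius /autom_factor matTE; have [-> -> -> ->] := mx2E 1 1 0 1.
by rewrite mul1r mul0r add0r divr1.
Qed.
Lemma autom_T t : autom_factor matT t = 1.
Proof. by rewrite /autom_factor matTE; have [_ _ -> ->] := mx2E 1 1 0 1; rewrite mul0r add0r. Qed.
Lemma moebius_TV t : moebius matTV t = t - 1.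
Proof.
rewrite /moebius /autom_factor; have [-> -> -> ->] := mx2E 1 (-1) 0 1.
by rewrite mul1r mul0r add0r divr1 rmorphN1.
Qed.
Lemma autom_TV t : autom_factor matTV t = 1.
Proof. by rewrite /autom_factor; have [_ _ -> ->] := mx2E 1 (-1) 0 1; rewrite mul0r add0r. Qed.
Lemma moebius_1 t : moebius 1%:M t = t.
Proof.
rewrite /moebius /autom_factor mx2_id; have [-> -> -> ->] := mx2E 1 0 0 1.
by rewrite mul1r mul0r add0r addr0 divr1.
Qed.
Lemma autom_1 t : autom_factor 1%:M t = 1.
Proof. by rewrite /autom_factor mx2_id; have [_ _ -> ->] := mx2E 1 0 0 1; rewrite mul0r add0r. Qed.

Lemma cder_autom g t : cder (autom_factor g) t (g 1 0)%:~R.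
Proof.
have := cderD (cderZ (g 1 0)%:~R (cder_id t)) (cder_cst (g 1 1)%:~R t).
by rewrite mulr1 addr0.
Qed.

Lemma cder_moebius g t : g \in SL2Z -> uhp R t ->
  cder (moebius g) t (autom_factor g t ^- 2).
Proof.
move=> gS Ht; have j0 := autom_neq0 gS Ht.
have H := cder_div j0 (cderD (cderZ (g 0 0)%:~R (cder_id t)) (cder_cst (g 0 1)%:~R t)) (cder_autom g t).
apply: (cder_eql H).
rewrite -[RHS]mul1r; congr (_ * _); rewrite -[RHS](detC gS) /autom_factor; ring.
Qed.

End SL2.

(** * The quasi-modular Eisenstein series P *)

Section Lambert.
Variable R : realType.
Local Notation C := (cplx R).
Implicit Types (q t z w tau : C).

(* [sigma1 0] is 1, not 0. *)
Definition sigma_coef (n : nat) : C := if n is m.+1 then (sigma1 m.+1)%:R else 0.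

Lemma sigma1E M n : (0 < n <= M)%N -> sigma1 n = (\sum_(d < M | d.+1 %| n) d.+1)%N.
Proof.
move=> /andP[n0 nM]; rewrite /sigma1.
transitivity (\sum_(d <- iota 1 M | d %| n) d)%N; last first.
  rewrite -[1%N]addn0 iotaDl big_map -(subn0 M) -/(index_iota 0 M).
  by rewrite big_mkord subn0.
rewrite -[RHS]big_filter; apply: perm_big; apply: uniq_perm.
- exact: divisors_uniq.
- by rewrite filter_uniq// iota_uniq.
- move=> d; rewrite mem_filter mem_iota -dvdn_divisors//.
  case dn : (d %| n)%N => //=; rewrite add1n ltnS.
  by rewrite (dvdn_gt0 n0 dn) (leq_trans (dvdn_leq n0 dn) nM).
Qed.

Lemma sigma1_le n : (sigma1 n.+1 <= n.+1 ^ 2)%N.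
Proof.
rewrite (@sigma1E n.+1) ?leqnn//; apply: (@leq_trans (\sum_(d < n.+1) n.+1)%N); last first.
  by rewrite sum_nat_const card_ord -mulnn.
by rewrite big_mkcond /=; apply: leq_sum => i _; case: ifP => // _; rewrite ltn_ord.
Qed.

Lemma sigma_coef_conv q : nrm q < 1 -> exists l, clim (psum sigma_coef q) l.
Proof.
move=> q1; apply: (@series_dom _ (fun n => sigma_coef n * q ^+ n) (fun n => n%:R ^+ 2 * nrm q ^+ n)).
  case=> [|n]; first by rewrite mul0r nrm0 mulr_ge0 ?exprn_ge0 ?nrm_ge0.
  rewrite nrmM nrmX nrm_nat ler_wpM2r ?exprn_ge0 ?nrm_ge0//.
  by rewrite -natrX ler_nat sigma1_le.
by move=> N; apply: sum_geom3; rewrite nrm_ge0.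
Qed.

Lemma sum_dvd M d (f : nat -> C) :
  \sum_(N < M | (d.+1 %| N.+1)%N) f N.+1 = \sum_(n < M | (n.+1 * d.+1 <= M)%N) f (n.+1 * d.+1)%N.
Proof.
transitivity (\sum_(N < M) \sum_(n < M) (if (N.+1 == n.+1 * d.+1)%N then f N.+1 else 0)).
  rewrite big_mkcond /=; apply: eq_bigr => N _; case: ifPn => [dv|ndv].
    have q0 : (0 < N.+1 %/ d.+1)%N by rewrite divn_gt0// dvdn_leq.
    have nM : ((N.+1 %/ d.+1).-1 < M)%N.
      by rewrite -ltnS (prednK q0) ltnS (leq_trans (leq_div _ _)) ?ltn_ord.
    have E : (N.+1 = (N.+1 %/ d.+1).-1.+1 * d.+1)%N.
      by rewrite (prednK q0) divnK.
    rewrite (bigD1 (Ordinal nM))//= -E eqxx big1 ?addr0// => i /eqP ine.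
    case: eqP => // E2; exfalso; apply: ine; apply: val_inj => /=.
    by move: E2; rewrite {1}E => /eqP; rewrite eqn_pmul2r// => /eqP[->].
  rewrite big1// => i _; case: eqP => // E; exfalso; move/negP: ndv; apply.
  by rewrite E dvdn_mull.
rewrite exchange_big /= [RHS]big_mkcond /=; apply: eq_bigr => n _.
case: ifPn => [le|nle].
  have h : ((n.+1 * d.+1).-1 < M)%N by rewrite prednK// muln_gt0.
  rewrite (bigD1 (Ordinal h))// eqxx big1 => [|i /eqP ine]; first exact: addr0.
  case: eqP => // E2; exfalso; apply: ine; apply: val_inj.
  exact: (congr1 predn E2).
rewrite big1// => i _; case: eqP => // E; exfalso; move/negP: nle; apply.
by rewrite -E ltn_ord.
Qed.

Lemma psum_sigma_coef q M : psum sigma_coef q M.+1 =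
  \sum_(d < M) \sum_(n < M | (n.+1 * d.+1 <= M)%N) d.+1%:R * q ^+ (n.+1 * d.+1).
Proof.
rewrite /psum big_ord_recl /= mul0r add0r.
transitivity (\sum_(N < M) \sum_(d < M | (d.+1 %| N.+1)%N) d.+1%:R * q ^+ N.+1).
  apply: eq_bigr => N _; rewrite /sigma_coef (@sigma1E M) ?ltn_ord// natr_sum mulr_suml.
  exact: eq_bigr.
rewrite (exchange_big_dep xpredT)//=; apply: eq_bigr => d _.
exact: (sum_dvd M d (fun N => d.+1%:R * q ^+ N)).
Qed.

Lemma geom2_closed (X : C) M : (1 - X) ^+ 2 * \sum_(d < M) d.+1%:R * X ^+ d =
  1 - M.+1%:R * X ^+ M + M%:R * X ^+ M.+1.
Proof.
elim: M => [|M IH]; first by rewrite big_ord0 mulr0 expr0 mul0r; ring.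
by rewrite big_ord_recr /= mulrDr IH [X ^+ M.+2]exprS [X ^+ M.+1]exprS -[M.+2%:R]natr1 -[M.+1%:R]natr1; ring.
Qed.

(** Both partial sums are compared with the square sum [S M] of d q^(nd) over n, d <= M. It differs
    from the part nd <= M, and from the rows summed over all d, by O(s^M) with s the square root of
    |q|: writing |q|^(nd) as s^(nd) s^(nd), one factor is small when nd > M and the other remains
    summable. *)
Lemma lambert q l : nrm q < 1 -> clim (psum sigma_coef q) l ->
  clim (fun N => \sum_(n < N) q ^+ n.+1 / (1 - q ^+ n.+1) ^+ 2) l.
Proof.
move=> q1 Hl.
set x := fun n => q ^+ n.+1 / (1 - q ^+ n.+1) ^+ 2.
set r := nrm q in q1 *; have r0 : 0 <= r by exact: nrm_ge0.
pose s := Num.sqrt r.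
have s0 : 0 <= s by exact: sqrtr_ge0.
have ss : s ^+ 2 = r by rewrite sqr_sqrtr.
have s1 : s < 1 by rewrite /s -sqrtr1 ltr_sqrt.
have s01 : 0 <= s < 1 by rewrite s0.
pose S M : C := \sum_(d < M) \sum_(n < M) d.+1%:R * q ^+ (n.+1 * d.+1).
pose K := (1 - s)^-1 ^+ 3.
have i0 : 0 < (1 - s)^-1 by rewrite invr_gt0; lra.
have K0 : 0 < K by rewrite exprn_gt0.
have sle n : s ^+ n <= 1 by rewrite exprn_ile1// ltW.
have h1 M : nrm (psum sigma_coef q M.+1 - S M) <= s ^+ M * K.
  have -> : psum sigma_coef q M.+1 - S M = - \sum_(d < M) \sum_(n < M | ~~ (n.+1 * d.+1 <= M)%N) d.+1%:R * q ^+ (n.+1 * d.+1).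
    rewrite psum_sigma_coef /S -sumrB -sumrN; apply: eq_bigr => d _.
    by rewrite [X in _ - X](bigID (fun n : 'I_M => (n.+1 * d.+1 <= M)%N)) /=; ring.
  rewrite nrmN; apply: le_trans (nrm_sum _ _ _) _.
  apply: (@le_trans _ _ (\sum_(d < M) s ^+ M * (d.+1%:R * s ^+ d) * (1 - s)^-1)).
    apply: ler_sum => d _; apply: le_trans (nrm_sum _ _ _) _.
    apply: (@le_trans _ _ (\sum_(n < M) s ^+ M * (d.+1%:R * s ^+ d) * s ^+ n)); last first.
      rewrite -mulr_sumr ler_wpM2l ?sum_geom1//.
      by rewrite !mulr_ge0 ?exprn_ge0.
    rewrite big_mkcond /=; apply: ler_sum => n _; case: ifPn => [|_]; last first.
      by rewrite !mulr_ge0 ?exprn_ge0.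
    rewrite -ltnNge => Mn; rewrite nrmM nrmX nrm_nat -/r -ss -exprM mul2n -addnn exprD.
    rewrite [X in _ <= X * _]mulrCA -!mulrA ler_wpM2l//.
    rewrite ler_pM ?exprn_ge0//; first by rewrite ler_wiXn2l ?(ltW s1)// ltnW.
    rewrite -exprD ler_wiXn2l ?(ltW s1)//; clear; nia.
  rewrite -mulr_suml -mulr_sumr -mulrA ler_wpM2l ?exprn_ge0//.
  rewrite /K exprSr ler_wpM2r ?(ltW i0)//.
  exact: sum_geom2.
have Xr n : nrm (q ^+ n.+1) <= r.
  by rewrite nrmX exprS ler_piMr// exprn_ile1// ltW.
have nX n : 1 - r <= nrm (1 - q ^+ n.+1).
  by have := nrm_geB 1 (- q ^+ n.+1); rewrite nrmN nrm1; have := Xr n; lra.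
have rs : r <= s by rewrite -ss expr2 ler_piMr// ltW.
have X0 n : 1 - q ^+ n.+1 != 0 by rewrite -nrm_gt0; apply: lt_le_trans (nX n); lra.
have h2 M : nrm (\sum_(n < M) x n - S M) <= s ^+ M * (2 * K * (1 - s)^-1 ^+ 2).
  rewrite /S exchange_big /= -sumrB; apply: le_trans (nrm_sum _ _ _) _.
  have E (n : 'I_M) : x n - \sum_(d < M) d.+1%:R * q ^+ (n.+1 * d.+1) =
      (q ^+ n.+1) ^+ M.+1 * (M.+1%:R - M%:R * q ^+ n.+1) / (1 - q ^+ n.+1) ^+ 2.
    rewrite /x; have -> : \sum_(d < M) d.+1%:R * q ^+ (n.+1 * d.+1) =
        q ^+ n.+1 * \sum_(d < M) d.+1%:R * (q ^+ n.+1) ^+ d.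
      rewrite mulr_sumr; apply: eq_bigr => d _.
      by rewrite exprM exprS mulrCA.
    set X := q ^+ n.+1; have X0' : (1 - X) ^+ 2 != 0 by rewrite expf_neq0// X0.
    apply: (mulIf X0'); rewrite mulrBl !divfK// -mulrA [_ * (1 - X) ^+ 2]mulrC geom2_closed.
    by rewrite [X ^+ M.+1]exprS; ring.
  apply: (@le_trans _ _ (\sum_(n < M) s ^+ M * (2 * (1 - s)^-1 ^+ 2 * (1 - s)^-1 ^+ 2) * s ^+ n)); last first.
    rewrite -mulr_sumr; apply: le_trans (ler_wpM2l _ (sum_geom1 M s01)) _.
      by rewrite !mulr_ge0 ?exprn_ge0 ?(ltW i0).
    by rewrite /K le_eqVlt; apply/orP; left; apply/eqP; ring.
  apply: ler_sum => n _; rewrite E !nrmM nrmV !nrmX -/r.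
  have c1 : nrm (M.+1%:R - M%:R * q ^+ n.+1) <= 2 * M.+1%:R.
    apply: le_trans (nrmB _ _) _; rewrite nrmM !nrm_nat.
    have := Xr n; have := nrm_ge0 (q ^+ n.+1); rewrite -natr1.
    have : 0 <= M%:R :> R by []. nra.
  have c2 : (nrm (1 - q ^+ n.+1) ^+ 2)^-1 <= (1 - s)^-1 ^+ 2.
    rewrite exprVn lef_pV2 ?posrE ?exprn_gt0 ?nrm_gt0//; last by lra.
    rewrite lerXn2r ?nnegrE ?nrm_ge0//; first by lra.
    by apply: le_trans (nX n); lra.
  have c3 : M.+1%:R * s ^+ M <= (1 - s)^-1 ^+ 2.
    apply: le_trans (sum_geom2 M.+1 s01); rewrite big_ord_recr /= lerDr.
    by apply: sumr_ge0 => i _; rewrite mulr_ge0 ?exprn_ge0.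
  have c4 : (r ^+ n.+1) ^+ M.+1 <= s ^+ M * s ^+ M * s ^+ n.
    rewrite -ss -!exprM -!exprD ler_wiXn2l ?(ltW s1)//; clear; nia.
  apply: (@le_trans _ _ (s ^+ M * s ^+ M * s ^+ n * (2 * M.+1%:R) * (1 - s)^-1 ^+ 2)).
    by do 2 (apply: ler_pM => //; rewrite ?mulr_ge0 ?invr_ge0 ?exprn_ge0 ?nrm_ge0//).
  have -> : s ^+ M * s ^+ M * s ^+ n * (2 * M.+1%:R) * (1 - s)^-1 ^+ 2 =
    (s ^+ M * 2 * s ^+ n * (1 - s)^-1 ^+ 2) * (M.+1%:R * s ^+ M) by ring.
  apply: le_trans (ler_wpM2l _ c3) _.
    by rewrite !mulr_ge0 ?exprn_ge0 ?(ltW i0).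
  by rewrite le_eqVlt; apply/orP; left; apply/eqP; ring.
pose L := K + 2 * K * (1 - s)^-1 ^+ 2.
have L0 : 0 < L by rewrite addr_gt0 ?mulr_gt0 ?exprn_gt0.
move=> e e0; have e2 : 0 < e / 2 by lra.
have [N1 H1] := Hl _ e2; have [N2 H2] := geom_small s01 (divr_gt0 e2 L0).
exists (maxn N1 N2) => M; rewrite geq_max => /andP[M1 /H2].
rewrite ler_pdivlMr// => hM.
have := H1 M.+1 (leqW M1); have := h1 M; have := h2 M.
set A := \sum_(n < M) x n; set B := psum sigma_coef q M.+1; set D := S M => k1 k2 k3.
have -> : A - l = (A - D) - (B - D) + (B - l) by ring.
have := nrmD ((A - D) - (B - D)) (B - l); have := nrmB (A - D) (B - D).
move: hM; rewrite /L; lra.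
Qed.

Definition sigma_gen q : C := xget 0 [set l | clim (psum sigma_coef q) l].

Lemma sigma_gen_clim q : nrm q < 1 -> clim (psum sigma_coef q) (sigma_gen q).
Proof. by move=> /sigma_coef_conv; exact: xgetPex. Qed.

Lemma eisPE tau : uhp R tau -> eisP tau = - 12^-1 + 2 * sigma_gen (e2pii tau).
Proof.
move=> Ht; rewrite /eisP; congr (_ + _ * _); apply: cvg_lim => //.
apply/cvg_clim => e /(sigma_gen_clim (nrm_e2pii_lt1 Ht))[N HN]; exists N => n Nn.
have := HN n.+1 (leqW Nn); congr (nrm (_ - _) <= _).
rewrite /psum big_ord_recl /= mul0r add0r.
by rewrite /series /= big_mkord; apply: eq_bigr => i _; rewrite qpowE.
Qed.

Lemma sigma_gen_ps : ps_on sigma_coef 1 sigma_gen.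
Proof. by move=> w; exact: sigma_gen_clim. Qed.

Lemma eisP_hol : hol (@eisP R).
Proof.
move=> z Hz; have [l _ Hl] := ps_der sigma_gen_ps (nrm_e2pii_lt1 Hz).
have H := cderD (cder_cst (- 12^-1) z) (cderZ 2 (cder_comp (cder_e2pii z) Hl)).
eexists; apply: cder_near H; exists (complex.Im z) => // h hh.
by rewrite eisPE//; exact: ball_uhp.
Qed.

Lemma eisP_per : per1 (@eisP R).
Proof. by move=> z Hz; rewrite !eisPE ?e2piiD1//; exact: uhp1. Qed.

End Lambert.

(** * Zeta functions of lattices as q-series *)

Section Eisenstein2.
Variable R : realType.
Local Notation C := (cplx R).
Implicit Types (q t z w tau : C) (f : C -> C).
Local Notation e := (@e2pii R).

Lemma ps_taylor (a : nat -> C) (r : R) f m : 0 < r -> ps_on a r f ->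
  exists K d : R, [/\ 0 < K, 0 < d, d <= r & forall w, nrm w < d ->
    nrm (f w - psum a w m) <= K * nrm w ^+ m].
Proof.
move=> r0 H.
have E w N : psum a w (N + m)%N - psum a w m = w ^+ m * psum (fun k => a (k + m)%N) w N.
  elim: N => [|N IH]; first by rewrite subrr /psum big_ord0 mulr0.
  by rewrite addSn !psumS addrAC IH exprD; ring.
pose u w := if w == 0 then a m else (f w - psum a w m) / w ^+ m.
have Hu : ps_on (fun k => a (k + m)%N) r u.
  move=> w wr; rewrite /u; case: eqP => [->|/eqP w0].
    exact: (clim0_psum (fun k => a (k + m)%N)).
  have wm : w ^+ m != 0 by rewrite expf_neq0.
  have := climZ (w ^- m) (climB (clim_shift m (H w wr)) (clim_cst (psum a w m))).
  rewrite [_ * (f w - _)]mulrC; apply: clim_ext => N; rewrite E mulKf//.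
have n0 : nrm (0 : C) < r by rewrite nrm0.
have [d d0 Hd] := ps_cont Hu n0 ltr01.
exists (nrm (u 0) + 1 + nrm (f 0 - psum a 0 m)), (Num.min d r); split.
- by have := nrm_ge0 (u 0); have := nrm_ge0 (f 0 - psum a 0 m); lra.
- by rewrite lt_min d0.
- by rewrite ge_min lexx orbT.
move=> w; rewrite lt_min => /andP[/Hd]; rewrite add0r => h wr.
have [w0|w0] := eqVneq w 0.
  rewrite w0 nrm0; case: m {E Hu n0 h Hd} u => [|m] u.
    by rewrite expr0 mulr1 lerDr addr_ge0 ?nrm_ge0.
  rewrite (ps_on0 r0 H) /psum big_ord_recl expr0 mulr1 big1 ?addr0 ?subrr ?nrm0.
    by rewrite expr0n mulr0.
  by move=> i _; rewrite expr0n mulr0.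
have wm : w ^+ m != 0 by rewrite expf_neq0.
have -> : f w - psum a w m = u w * w ^+ m by rewrite /u (negbTE w0) divfK.
rewrite nrmM nrmX ler_wpM2r ?exprn_ge0 ?nrm_ge0//.
have := nrmD (u w - u 0) (u 0); rewrite subrK.
have := nrm_ge0 (f 0 - psum a 0 m); lra.
Qed.

(** The coefficients come from exp' = exp, that is (n+1) a_(n+1) = a_n. Order four is needed because
    [cder_bern] divides by w (exp w - 1), which costs two orders, and wants a quadratic
    remainder. *)
Lemma cexp_taylor : exists K d : R, [/\ 0 < K, 0 < d & forall w, nrm w < d ->
  nrm (cexp w - (1 + w + w ^+ 2 / 2 + w ^+ 3 / 6)) <= K * nrm w ^+ 4].
Proof.
have [|a [Ha _]] := @local_ps R (@cexp R) 0 2 (ltr0n _ 2).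
  by move=> w _; exists (cexp (0 + w)); exact: cder_cexp.
have {}Ha : ps_on a 2 (@cexp R) by move=> w /Ha; rewrite add0r.
have Hd : ps_on (dcoef a) 2 (@cexp R).
  by move=> w w2; have [l Hl Hc] := ps_der Ha w2; rewrite (cder_uniq (cder_cexp w) Hc).
have Hz := ps_B Hd Ha.
have D n : dcoef a n = a n.
  apply/eqP; rewrite -subr_eq0; apply/eqP; move: n.
  by apply: (ps_uniq0 (ltr0n _ 2) Hz); exists 1 => // w _ _; rewrite subrr.
have a0 : a 0%N = 1 by rewrite -(ps_on0 (ltr0n _ 2) Ha) cexp0.
have a1 : a 1%N = 1 by have := D 0%N; rewrite /dcoef mul1r a0.
have n2 : (2 : C) != 0 by rewrite pnatr_eq0.
have n3 : (3 : C) != 0 by rewrite pnatr_eq0.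
have a2 : a 2%N = 2^-1 by apply: (mulfI n2); rewrite divff//; have := D 1%N; rewrite /dcoef a1.
have a3 : a 3%N = 6^-1.
  apply: (mulfI n3); have := D 2%N; rewrite /dcoef a2 => ->.
  by field.
have [K [d [K0 d0 _ H]]] := ps_taylor 4 (ltr0n R 2) Ha.
exists K, d; split => // w /H; rewrite /psum !big_ord_recr big_ord0 /= a0 a1 a2 a3.
by congr (nrm (_ - _) <= _); ring.
Qed.

(** The generating function of the Bernoulli numbers from B_2 on, divided by w. Its slope B_2/2 =
    1/12 is the origin of the constant term of P. *)
Definition bern w : C := if w == 0 then 0 else 2^-1 + (cexp w - 1)^-1 - w^-1.

Lemma cder_bern : cder bern 0 (12^-1).
Proof.
have [K [d [K0 d0 HK]]] := cexp_taylor.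
have h2 : 0 < 2^-1 :> R by lra.
have [d1 d10 Hd1] := @cexp_der0 R _ h2.
(* The numerator found below is at most (1/24 + 1/72 + 2K) |w|^4, and |w E| is at least |w|^2/2. *)
apply: (@cder_sqr _ _ _ _ (2 * (1 + 2 * K)) (Num.min 1 (Num.min d d1))).
  by rewrite !lt_min ltr01 d0.
move=> w; rewrite !lt_min => /and3P[w1 /HK hr /Hd1]; rewrite add0r cexp0 mul1r => hE.
have [->|w0] := eqVneq w 0.
  by rewrite ?addr0 subrr mulr0 subr0 !nrm0 expr0n mulr0.
have nw : 0 < nrm w by rewrite nrm_gt0.
rewrite ?add0r /bern eqxx (negbTE w0) subr0.
set r := cexp w - _ in hr.
set E := cexp w - 1 in hE *.
have nE : nrm w / 2 <= nrm E.
  by have := nrm_geB w (E - w); rewrite subrKC; lra.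
have E0 : E != 0 by rewrite -nrm_gt0; lra.
have n12 : (12 : C) != 0 by rewrite pnatr_eq0.
have -> : 2^-1 + E^-1 - w^-1 - 12^-1 * w =
  (w ^+ 4 / 24 - w ^+ 5 / 72 + r * (w / 2 - 1 - w ^+ 2 / 12)) / (w * E).
  have rE : r = E - w - w ^+ 2 / 2 - w ^+ 3 / 6 by rewrite /r /E; ring.
  by rewrite rE; field; rewrite E0 w0.
rewrite nrmM nrmV ler_pdivrMr; last by rewrite nrm_gt0 mulf_neq0.
have nn (n : nat) : nrm (w ^+ 4 / n%:R) = nrm w ^+ 4 / n%:R by rewrite nrmM nrmV nrmX nrm_nat.
have b1 : nrm (w ^+ 4 / 24) <= nrm w ^+ 4 / 24 by rewrite nn.
have w4 : 0 <= nrm w ^+ 4 by rewrite exprn_ge0 ?nrm_ge0.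
have b2 : nrm (w ^+ 5 / 72) <= nrm w ^+ 4 / 72.
  rewrite nrmM nrmV nrm_nat nrmX exprSr ler_wpM2r ?invr_ge0// ler_piMr// ltW//.
have b3 : nrm (w / 2 - 1 - w ^+ 2 / 12) <= 2.
  apply: le_trans (nrmB _ _) _; have := nrmB (w / 2) 1.
  have -> : nrm (w ^+ 2 / 12) = nrm w ^+ 2 / 12 by rewrite nrmM nrmV nrm_nat nrmX.
  rewrite [nrm (w / 2)]nrmM nrmV nrm_nat nrm1 => h.
  have : nrm w ^+ 2 <= 1 by rewrite exprn_ile1 ?nrm_ge0// ltW.
  lra.
have b4 : nrm (r * (w / 2 - 1 - w ^+ 2 / 12)) <= K * nrm w ^+ 4 * 2.
  by rewrite nrmM ler_pM ?nrm_ge0.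
apply: le_trans (nrmD _ _) _.
have := nrmB (w ^+ 4 / 24) (w ^+ 5 / 72) => b5.
have : (1 + 2 * K) * nrm w ^+ 4 <= 2 * (1 + 2 * K) * nrm w ^+ 2 * nrm (w * E).
  rewrite nrmM.
  have -> : (1 + 2 * K) * nrm w ^+ 4 = 2 * (1 + 2 * K) * nrm w ^+ 2 * (nrm w * (nrm w / 2)) by field.
  rewrite ler_wpM2l//; first by rewrite !mulr_ge0 ?exprn_ge0 ?nrm_ge0//; lra.
  by rewrite ler_wpM2l ?nrm_ge0.
lra.
Qed.

Definition bern_twopii z : C := bern (twopii R * z).

Lemma cder_bern_twopii : cder bern_twopii 0 (12^-1 * twopii R).
Proof.
have H := cderZ (twopii R) (cder_id 0); rewrite mulr1 in H.
by apply: (cder_comp H); rewrite mulr0; exact: cder_bern.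
Qed.

(** The terms of t d/dt log of the product of the 1 - q^n/t over n >= 1, one half of a theta
    product. *)
Definition lerch_term q t n : C := q ^+ n.+1 / (t - q ^+ n.+1).
Definition lerch q t : C := xget 0 [set l | clim (fun N => \sum_(n < N) lerch_term q t n) l].

Lemma good_lb q t : nrm q < 1 -> t != 0 -> (forall n, t != q ^+ n.+1) ->
  exists2 c : R, 0 < c & forall n, c <= nrm (t - q ^+ n.+1).
Proof.
move=> q1 t0 H; have nt : 0 < nrm t by rewrite nrm_gt0.
have [||N HN] := @geom_small R (nrm q) (nrm t / 2); [by rewrite nrm_ge0|by lra|].
have [c [c0 c1 Hc]] : exists c : R, [/\ 0 < c, c <= nrm t / 2 & forall n, (n < N)%N -> c <= nrm (t - q ^+ n.+1)].
  elim: N {HN} => [|N [c [c0 c1 Hc]]]; first by exists (nrm t / 2); split => //; lra.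
  exists (Num.min c (nrm (t - q ^+ N.+1))); split.
  - by rewrite lt_min c0 nrm_gt0 subr_eq0 H.
  - by rewrite ge_min c1.
  - move=> n; rewrite ltnS leq_eqVlt => /orP[/eqP->|/Hc h]; first by rewrite ge_min lexx orbT.
    by rewrite ge_min h.
exists c => // n; have [/Hc//|Nn] := ltnP n N.
have := HN n.+1 (leqW Nn); rewrite -nrmX.
have := nrm_geB t (- q ^+ n.+1); rewrite nrmN; lra.
Qed.

Lemma lerch_spec q t (c : R) : nrm q < 1 -> 0 < c -> (forall n, c <= nrm (t - q ^+ n.+1)) ->
  clim (fun N => \sum_(n < N) lerch_term q t n) (lerch q t).
Proof.
move=> q1 c0 Hc; apply: xgetPex.
apply: (@series_dom R (lerch_term q t) (fun n => c^-1 * nrm q ^+ n) (c^-1 * (1 - nrm q)^-1)).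
  move=> n; rewrite /lerch_term nrmM nrmV nrmX mulrC; apply: ler_pM.
  - by rewrite invr_ge0 nrm_ge0.
  - by rewrite exprn_ge0 ?nrm_ge0.
  - by rewrite lef_pV2 ?posrE//; exact: lt_le_trans (Hc n).
  - by rewrite exprS ler_piMl ?exprn_ge0 ?nrm_ge0// ltW.
by move=> N; rewrite -mulr_sumr ler_wpM2l ?invr_ge0 ?(ltW c0)// sum_geom1// nrm_ge0.
Qed.

Lemma nrm4 (x y z w : C) : nrm (x * y ^+ 2 * z * w ^+ 2) = nrm x * nrm y ^+ 2 * nrm z * nrm w ^+ 2.
Proof. by rewrite nrmM nrmX; congr (_ * _); rewrite nrmM; congr (_ * _); rewrite nrmM nrmX. Qed.

Lemma lerch_cder q t l : nrm q < 1 -> t != 0 -> (forall n, t != q ^+ n.+1) ->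
  clim (fun N => \sum_(n < N) - (q ^+ n.+1 / (t - q ^+ n.+1) ^+ 2)) l -> cder (lerch q) t l.
Proof.
move=> q1 t0 H Hl; have [c c0 Hc] := good_lb q1 t0 H.
have c2 : 0 < c / 2 by lra.
have Hh h n : nrm h < c / 2 -> c / 2 <= nrm (t + h - q ^+ n.+1).
  move=> hc; have := Hc n; have := nrm_geB (t - q ^+ n.+1) h; rewrite addrAC; lra.
apply: (@cder_series R (fun n t => lerch_term q t n) (lerch q) t (fun n => - (q ^+ n.+1 / (t - q ^+ n.+1) ^+ 2)) l
  (fun n => (c / 2)^-1 ^+ 3 * nrm q ^+ n) ((c / 2)^-1 ^+ 3 * (1 - nrm q)^-1) (c / 2)) => //.
- by move=> N; rewrite -mulr_sumr ler_wpM2l ?exprn_ge0 ?invr_ge0 ?(ltW c2)// sum_geom1// nrm_ge0.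
- move=> n h hc; rewrite /lerch_term.
  have k1 := Hh h n hc; have k2 : c / 2 <= nrm (t - q ^+ n.+1) by have := Hc n; lra.
  set a := q ^+ n.+1 in k1 k2 *.
  have d1 : t + h - a != 0 by rewrite -nrm_gt0; lra.
  have d2 : t - a != 0 by rewrite -nrm_gt0; lra.
  have -> : a / (t + h - a) - a / (t - a) - - (a / (t - a) ^+ 2) * h =
    (t + h - a)^-1 * (t - a)^-1 ^+ 2 * a * h ^+ 2 by field; rewrite d1 d2.
  rewrite nrm4 !nrmV ler_wpM2r ?exprn_ge0 ?nrm_ge0//.
  apply: ler_pM; rewrite ?mulr_ge0 ?exprn_ge0 ?invr_ge0 ?nrm_ge0//; last first.
    by rewrite /a nrmX exprS ler_piMl ?exprn_ge0 ?nrm_ge0// ltW.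
  rewrite [(c / 2)^-1 ^+ 3]exprS; apply: ler_pM; rewrite ?exprn_ge0 ?invr_ge0 ?nrm_ge0//.
    by rewrite lef_pV2 ?posrE//; lra.
  rewrite lerXn2r ?nnegrE ?invr_ge0 ?nrm_ge0 ?(ltW c2)//.
  by rewrite lef_pV2 ?posrE//; lra.
- by move=> h hc; apply: (lerch_spec q1 c2) => n; exact: Hh.
Qed.

Lemma lerch_der_ex q t : nrm q < 1 -> t != 0 -> (forall n, t != q ^+ n.+1) ->
  exists l, cder (lerch q) t l.
Proof.
move=> q1 t0 H; have [c c0 Hc] := good_lb q1 t0 H.
suff [l Hl] : exists l, clim (fun N => \sum_(n < N) - (q ^+ n.+1 / (t - q ^+ n.+1) ^+ 2)) l.
  by exists l; exact: lerch_cder.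
apply: (@series_dom R (fun n => - (q ^+ n.+1 / (t - q ^+ n.+1) ^+ 2))
  (fun n => c^-1 ^+ 2 * nrm q ^+ n) (c^-1 ^+ 2 * (1 - nrm q)^-1)).
  move=> n; rewrite nrmN nrmM nrmV !nrmX mulrC exprVn; apply: ler_pM.
  - by rewrite invr_ge0 exprn_ge0 ?nrm_ge0.
  - by rewrite exprn_ge0 ?nrm_ge0.
  - have nc := lt_le_trans c0 (Hc n).
    by rewrite lef_pV2 ?posrE ?exprn_gt0// lerXn2r ?nnegrE ?nrm_ge0 ?(ltW c0).
  - by rewrite exprS ler_piMl ?exprn_ge0 ?nrm_ge0// ltW.
by move=> N; rewrite -mulr_sumr ler_wpM2l ?exprn_ge0 ?invr_ge0 ?(ltW c0)// sum_geom1// nrm_ge0.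
Qed.

Lemma lerch_mul q t : q != 0 -> nrm q < 1 -> t != 0 -> (forall n, t != q ^+ n) ->
  lerch q (t * q) = (t - 1)^-1 + lerch q t.
Proof.
move=> q0 q1 t0 H.
have [c c0 Hc] := good_lb q1 t0 (fun n => H n.+1).
have tq0 : t * q != 0 by rewrite mulf_neq0.
have Hq n : t * q != q ^+ n.+1.
  by apply/eqP => E; move/eqP: (H n); apply; apply: (mulIf q0); rewrite E exprSr.
have [c' c'0 Hc'] := good_lb q1 tq0 Hq.
have L1 := clim_shift 1 (lerch_spec q1 c'0 Hc').
have L2 := climD (clim_cst (t - 1)^-1) (lerch_spec q1 c0 Hc).
apply: clim_uniq L1 _; apply: clim_ext L2 => N.
rewrite addn1 big_ord_recl; congr (_ + _).
  have t1 : t - 1 != 0 by rewrite subr_eq0; have := H 0%N; rewrite expr0.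
  have -> : lerch_term q (t * q) ord0 = q / ((t - 1) * q) by rewrite /lerch_term /= expr1 mulrBl mul1r.
  by field; rewrite q0 t1.
apply: eq_bigr => i _.
have d1 : t - q ^+ i.+1 != 0 by rewrite subr_eq0.
have -> : lerch_term q (t * q) (lift ord0 i) = q ^+ i.+1 * q / ((t - q ^+ i.+1) * q).
  by rewrite /lerch_term /= /bump /= add1n mulrBl -exprSr.
by rewrite /lerch_term; field; rewrite q0 d1.
Qed.

Definition lattice tau z := exists m n : int, z = m%:~R + n%:~R * tau.

Lemma lattice_small tau z : uhp R tau -> lattice tau z -> nrm z < 1 -> nrm z < complex.Im tau -> z = 0.
Proof.
move=> Ht [m [n E]] z1 zt.
have n0 : n = 0.
  have := le_lt_trans (normIm_le z) zt.
  rewrite E cImD Im_int Im_intM add0r normrM (gtr0_norm Ht) gtr_pMl// -intr_norm.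
  by rewrite ltrz1; lia.
subst n; rewrite mul0r addr0 in E.
have := le_lt_trans (normRe_le z) z1.
rewrite E -ofreal_int /= -intr_norm ltrz1 => h.
by have -> : m = 0 by lia.
Qed.

Lemma latticeB tau z w : lattice tau z -> lattice tau w -> lattice tau (z - w).
Proof.
move=> [m [n ->]] [m' [n' ->]]; exists (m - m'), (n - n').
by rewrite !rmorphB /=; ring.
Qed.
Lemma lattice1 tau : lattice tau 1. Proof. by exists 1, 0; rewrite mul0r addr0. Qed.
Lemma latticet tau : lattice tau tau. Proof. by exists 0, 1; rewrite mul1r add0r. Qed.
Lemma lattice0 tau : lattice tau 0. Proof. by exists 0, 0; rewrite mul0r addr0. Qed.
Lemma latticeN tau z : lattice tau z -> lattice tau (- z).
Proof. by move=> H; rewrite -sub0r; apply: latticeB => //; exact: lattice0. Qed.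
Lemma latticeD tau z w : lattice tau z -> lattice tau w -> lattice tau (z + w).
Proof. by move=> H1 H2; rewrite -[w]opprK; apply: latticeB => //; exact: latticeN. Qed.
Lemma latticeDr tau z w : lattice tau w -> lattice tau (z + w) <-> lattice tau z.
Proof. by move=> H; split=> [h|h]; [rewrite -(addrK w z); exact: latticeB | exact: latticeD]. Qed.

(** Distinct lattice points are at least 2d apart, so at most one lies within d of z, and a smaller
    radius avoids it. *)
Lemma near_off tau z : uhp R tau -> ~ lattice tau z ->
  exists2 d : R, 0 < d & forall h, nrm h < d -> ~ lattice tau (z + h).
Proof.
move=> Ht Hz; pose d := Num.min 1 (complex.Im tau) / 2.
have d0 : 0 < d by rewrite divr_gt0// lt_min ltr01.
have [d1 d2] : 2 * d <= 1 /\ 2 * d <= complex.Im tau.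
  by rewrite /d mulrC divfK// !ge_min !lexx orbT.
clearbody d.
have [[h [hd Hh]]|N] := pselect (exists h, nrm h < d /\ lattice tau (z + h)); last first.
  by exists d => // h hd L; apply: N; exists h.
have h0 : h != 0 by apply/eqP => E; apply: Hz; move: Hh; rewrite E addr0.
exists (Num.min d (nrm h)); first by rewrite lt_min d0 nrm_gt0.
move=> k; rewrite lt_min => /andP[kd kh] L.
have := latticeB Hh L; rewrite opprD addrACA subrr add0r => Ld.
have hk : nrm (h - k) < 2 * d by have := nrmB h k; lra.
have /eqP := lattice_small Ht Ld (lt_le_trans hk d1) (lt_le_trans hk d2).
by rewrite subr_eq0 => /eqP E; move: kh; rewrite E ltxx.
Qed.

Lemma off_e tau z n : ~ lattice tau z -> e z != e tau ^+ n.
Proof.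
move=> H; apply/eqP; rewrite -e2pii_natM => E; apply: H.
have [|m Hm] := @e2pii_eq1 R (z - n%:R * tau).
  by rewrite e2piiB E divff ?e2pii_neq0.
by exists m, n%:Z; rewrite -Hm subrK.
Qed.

Definition lerch_odd tau z : C := lerch (e tau) (e z) - lerch (e tau) (e (- z)).
(* Up to a factor and a linear term, the Weierstrass zeta function of Z + Z tau. *)
Definition qzeta tau z : C := 2^-1 + (e z - 1)^-1 + lerch_odd tau z.

Lemma off_1 tau z : ~ lattice tau z -> e z - 1 != 0.
Proof. by move=> /(off_e 0); rewrite expr0 subr_eq0. Qed.

Lemma cder_eN z : cder (fun x => e (- x)) z (twopii R * e (- z) * (- 1)).
Proof. exact: cder_comp (cderN (cder_id z)) (cder_e2pii (- z)). Qed.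

Lemma qzeta_hol tau z : uhp R tau -> ~ lattice tau z -> exists l, cder (qzeta tau) z l.
Proof.
move=> Ht H; have q1 := nrm_e2pii_lt1 Ht.
have HN : ~ lattice tau (- z) by move=> /latticeN; rewrite opprK.
have [l1 H1] := lerch_der_ex q1 (e2pii_neq0 z) (fun n => off_e n.+1 H).
have [l2 H2] := lerch_der_ex q1 (e2pii_neq0 (- z)) (fun n => off_e n.+1 HN).
eexists; apply: cderD.
  apply: cderD; first exact: cder_cst.
  apply: cderV; first exact: off_1 H.
  exact: cderB (cder_e2pii z) (cder_cst 1 z).
apply: cderB; first exact: cder_comp (cder_e2pii z) H1.
exact: cder_comp (cder_eN z) H2.
Qed.

Lemma qzeta1 tau z : qzeta tau (z + 1) = qzeta tau z.
Proof. by rewrite /qzeta /lerch_odd opprD e2piiD1 -[e (- z - 1)]e2piiD1 subrK. Qed.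

Lemma qzetat tau z : uhp R tau -> ~ lattice tau z -> qzeta tau (z + tau) = qzeta tau z - 1.
Proof.
move=> Ht H; have q1 := nrm_e2pii_lt1 Ht.
have H' : ~ lattice tau (z + tau) by rewrite latticeDr//; exact: latticet.
have HN : ~ lattice tau (- (z + tau)) by move=> /latticeN; rewrite opprK.
have E1 := lerch_mul (e2pii_neq0 tau) q1 (e2pii_neq0 z) (fun n => off_e n H).
have E2 := lerch_mul (e2pii_neq0 tau) q1 (e2pii_neq0 (- (z + tau))) (fun n => off_e n HN).
rewrite -e2piiD in E1; rewrite -e2piiD opprD subrK in E2.
rewrite /qzeta /lerch_odd E1 E2 -opprD e2piiN.
have d1 := off_1 H'; have d2 := off_1 H; have d3 := e2pii_neq0 (z + tau).
have d4 : (e (z + tau))^-1 - 1 != 0 by rewrite -e2piiN; exact: off_1 HN.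
have F : (e (z + tau) - 1)^-1 + ((e (z + tau))^-1 - 1)^-1 = -1.
  set X := e (z + tau) in d1 d3 d4 *.
  have -> : X^-1 - 1 = - (X - 1) / X by field.
  by field; rewrite d3 d1.
have -> : (e (z + tau) - 1)^-1 = -1 - ((e (z + tau))^-1 - 1)^-1.
  by rewrite -[LHS](addrK ((e (z + tau))^-1 - 1)^-1) F.
ring.
Qed.

(** The derivative of [lerch] at t = 1 is minus a Lambert series, which is how the divisor sums of P
    enter. *)
Lemma cder_lerch_odd tau : uhp R tau -> cder (lerch_odd tau) 0 (- 2 * twopii R * sigma_gen (e tau)).
Proof.
move=> Ht; have q1 := nrm_e2pii_lt1 Ht.
have H1 n : (1 : C) != e tau ^+ n.+1.
  apply/negP => /eqP /(congr1 (@nrm R)); rewrite nrm1 nrmX => E.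
  have : nrm (e tau) ^+ n.+1 < 1 by rewrite exprn_ilt1 ?nrm_ge0.
  by rewrite -E ltxx.
have L : clim (fun N => \sum_(n < N) - (e tau ^+ n.+1 / (1 - e tau ^+ n.+1) ^+ 2)) (- sigma_gen (e tau)).
  have := climZ (-1) (lambert q1 (sigma_gen_clim q1)); rewrite mulN1r.
  by apply: clim_ext => N; rewrite mulN1r sumrN.
have P := lerch_cder q1 (oner_neq0 _) H1 L.
have A1 : cder (fun z => lerch (e tau) (e z)) 0 (- sigma_gen (e tau) * (twopii R * e 0)).
  by apply: (cder_comp (cder_e2pii 0)); rewrite e2pii0.
have A2 : cder (fun z => lerch (e tau) (e (- z))) 0 (- sigma_gen (e tau) * (twopii R * e (- 0) * (- 1))).
  by apply: (cder_comp (cder_eN 0)); rewrite oppr0 e2pii0.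
by apply: (cder_eql (cderB A1 A2)); rewrite oppr0 e2pii0; ring.
Qed.

End Eisenstein2.

(** * Transformation laws of P and of the modular derivative *)

Section EisS.
Variable R : realType.
Local Notation C := (cplx R).
Implicit Types (q t z w : C) (f : C -> C).
Local Notation e := (@e2pii R).

Section Fixed.
Variable tau : C.
Hypothesis Ht : uhp R tau.
Let t0 : tau != 0.
Proof. by apply: contraTneq Ht => ->; rewrite /uhp /= ltxx. Qed.
Let tau' := - tau^-1.
Let Ht' : uhp R tau'.
Proof. by rewrite /tau' -moebius_S; apply: moebius_uhp => //; exact: SL2ZS. Qed.

(** The substitution z / tau carries the lattice of tau to that of -1/tau. Both zeta terms have
    residue 1/(2 pi i) at 0, so the poles cancel; the term z / tau cancels the increments 1/tau
    along 1 and 1 along tau. *)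
Let defect z : C := qzeta tau' (z / tau) / tau - qzeta tau z - z / tau.
(** The value 0 at lattice points is the continuous one, as [bern] and [lerch_odd] vanish at 0. *)
Let defect_ext z : C := if pselect (lattice tau z) then 0 else defect z.

Let lattice_dual z : lattice tau' (z / tau) <-> lattice tau z.
Proof.
split=> [[m [n E]]|[m [n ->]]].
  exists (- n), m; rewrite -[z](divfK t0) E /tau' rmorphN /=; by field.
by exists n, (- m); rewrite /tau' rmorphN /=; field.
Qed.

Let defect_ext__off z : ~ lattice tau z -> defect_ext z = defect z.
Proof. by rewrite /defect_ext; case: pselect. Qed.
Let defect_ext__on z : lattice tau z -> defect_ext z = 0.
Proof. by rewrite /defect_ext; case: pselect. Qed.

Let defect_ext_1 z : defect_ext (z + 1) = defect_ext z.
Proof.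
have [L|L] := pselect (lattice tau z).
  by rewrite !defect_ext__on// latticeDr//; exact: lattice1.
have L1 : ~ lattice tau (z + 1) by rewrite latticeDr//; exact: lattice1.
have L2 : ~ lattice tau' ((z + 1) / tau) by rewrite lattice_dual.
rewrite (defect_ext__off L) (defect_ext__off L1) /defect qzeta1.
have E : z / tau = (z + 1) / tau + tau' by rewrite /tau'; field.
rewrite E (qzetat Ht' L2); move: (qzeta tau' _) (qzeta tau z) => X Y.
by rewrite /tau'; field.
Qed.

Let defect_ext_t z : defect_ext (z + tau) = defect_ext z.
Proof.
have [L|L] := pselect (lattice tau z).
  by rewrite !defect_ext__on// latticeDr//; exact: latticet.
have L1 : ~ lattice tau (z + tau) by rewrite latticeDr//; exact: latticet.
rewrite (defect_ext__off L) (defect_ext__off L1) /defect (qzetat Ht L).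
have -> : (z + tau) / tau = z / tau + 1 by field.
rewrite qzeta1; move: (qzeta tau' _) (qzeta tau z) => X Y.
by field.
Qed.

Let defect_ext_i (n : int) z : defect_ext (z + n%:~R) = defect_ext z.
Proof.
have H k w : defect_ext (w + k%:R) = defect_ext w.
  by elim: k => [|k IH]; rewrite ?addr0// -natr1 addrA defect_ext_1.
case: n => n; first exact: H.
by rewrite NegzE mulrNz -[in RHS](subrK n.+1%:R z) H.
Qed.

Let defect_ext_ti (n : int) z : defect_ext (z + n%:~R * tau) = defect_ext z.
Proof.
have H k w : defect_ext (w + k%:R * tau) = defect_ext w.
  by elim: k => [|k IH]; rewrite ?mul0r ?addr0// -natr1 mulrDl mul1r addrA defect_ext_t.
case: n => n; first exact: H.
by rewrite NegzE mulrNz mulNr -[in RHS](subrK (n.+1%:R * tau) z) H.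
Qed.

Let cder_dv z : cder (fun x => x / tau) z tau^-1.
Proof.
have := cderZ tau^-1 (cder_id z); rewrite mulr1.
by apply: cder_ext => x; rewrite mulrC.
Qed.

Let defect_hol z : ~ lattice tau z -> exists l, cder defect z l.
Proof.
move=> L; have L' : ~ lattice tau' (z / tau) by rewrite lattice_dual.
have [l1 H1] := qzeta_hol Ht' L'; have [l2 H2] := qzeta_hol Ht L.
eexists; apply: cderB; last exact: cder_dv.
apply: cderB; last exact: H2.
apply: (cder_comp _ (cder_dv _)).
exact: (cder_comp (cder_dv z) H1).
Qed.

(** Since P = -1/12 + 2 [sigma_gen], this is -2 pi i P(-1/tau)/tau^2 + 2 pi i P(tau) - 1/tau, and
    its vanishing is the law of P under S. *)
Let kappa : C := (12^-1 * twopii R - 2 * twopii R * sigma_gen (e tau')) / tau ^+ 2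
  - (12^-1 * twopii R - 2 * twopii R * sigma_gen (e tau)) - tau^-1.

(** [defect] with each 1/2 + 1/(e(z) - 1) replaced by its regular part, the poles having cancelled.
    It is defined at 0 and agrees with [defect_ext] nearby. *)
Let b0 z : C := (bern_twopii (z / tau) + lerch_odd tau' (z / tau)) / tau - (bern_twopii z + lerch_odd tau z) - z / tau.

Let cder_b0 : cder b0 0 kappa.
Proof.
have H1 : cder (fun x => bern_twopii x + lerch_odd tau' x) (0 / tau) (12^-1 * twopii R - 2 * twopii R * sigma_gen (e tau')).
  by rewrite mul0r; apply: (cder_eql (cderD (@cder_bern_twopii R) (cder_lerch_odd Ht'))); ring.
have H2 : cder (fun x => bern_twopii x + lerch_odd tau x) 0 (12^-1 * twopii R - 2 * twopii R * sigma_gen (e tau)).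
  by apply: (cder_eql (cderD (@cder_bern_twopii R) (cder_lerch_odd Ht))); ring.
have H3 := cder_comp (cder_comp (cder_dv 0) H1) (cder_dv _).
apply: (cder_eql (cderB (cderB H3 H2) (cder_dv 0))).
rewrite /kappa; move: (sigma_gen _) (sigma_gen _) (twopii R) => X Y p.
by field.
Qed.

Let cder_defect_ext0 : cder defect_ext 0 kappa.
Proof.
apply: cder_near cder_b0.
exists (Num.min 1 (complex.Im tau)); first by rewrite lt_min ltr01; exact: Ht.
move=> h; rewrite lt_min add0r => /andP[h1 h2].
have [->|h0] := eqVneq h 0.
  rewrite defect_ext__on; last exact: lattice0.
  have hh0 : bern_twopii (0 : C) = 0 by rewrite /bern_twopii /bern mulr0 eqxx.
  have rr0 s : lerch_odd s 0 = 0 by rewrite /lerch_odd oppr0 subrr.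
  by rewrite /b0 mul0r hh0 !rr0 addr0 mul0r !subr0.
have L : ~ lattice tau h by move=> L; move/eqP: h0; apply; exact: (lattice_small Ht).
rewrite (defect_ext__off L) /b0 /defect /qzeta /bern_twopii /bern.
have p0 := twopii_neq0 R.
have n1 : twopii R * h != 0 by rewrite mulf_neq0.
have n2 : twopii R * (h / tau) != 0 by rewrite !mulf_neq0 ?invr_neq0.
rewrite (negbTE n1) (negbTE n2) -/(e2pii h) -/(e2pii (h / tau)).
move: (e h - 1)^-1 (e (h / tau) - 1)^-1 (lerch_odd tau h) (lerch_odd tau' (h / tau)) p0 => x y X Y.
move: (twopii R) => p p0.
by field; rewrite t0 h0 p0.
Qed.

Let defect_ext__hol : hol defect_ext.
Proof.
move=> z Hz; have [L|L] := pselect (lattice tau z); last first.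
  have [l Hl] := defect_hol L; exists l; apply: cder_near Hl.
  have [d d0 Hd] := near_off Ht L; exists d => // h /Hd h1.
  by rewrite defect_ext__off.
have [m [n E]] := L; exists kappa.
have H h : defect_ext (z + h) = defect_ext h by rewrite E addrC addrA defect_ext_ti defect_ext_i.
have Hz0 : defect_ext z = defect_ext 0 by rewrite -(H 0) addr0.
move=> eps e0; have [d d0 Hd] := cder_defect_ext0 e0; exists d => // h /Hd.
by rewrite add0r H Hz0.
Qed.

Let defect_ext__bound : exists M : R, forall z, uhp R z -> nrm (defect_ext z) <= M.
Proof.
have y0 : 0 < complex.Im tau by exact: Ht.
set y := complex.Im tau in y0.
have yy : y <= 2 * y by lra.
have rc : rcont defect_ext 0 1 y (2 * y) by apply/rhol_cont/hol_rhol.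
have [M HM] := cont_bounded ler01 yy rc; exists M => z Hz.
(* Translating by 1 - n rather than -n puts the imaginary part into [y, 2y), so the compact
   rectangle stays inside the half-plane. *)
pose n := Num.floor (complex.Im z / y); pose z1 := z + (1 - n)%:~R * tau.
pose m := Num.floor (complex.Re z1); pose z2 := z1 - m%:~R.
have -> : defect_ext z = defect_ext z2 by rewrite /z2 /z1 -mulrNz defect_ext_i defect_ext_ti.
have n1 : n%:~R <= complex.Im z / y by exact: floor_le_tmp.
have n2 : complex.Im z / y < n%:~R + 1 by have := floorD1_gt (complex.Im z / y); rewrite -/n intrD.
rewrite ler_pdivlMr// in n1; rewrite ltr_pdivrMr// in n2.
have I2 : complex.Im z2 = complex.Im z + (1 - n%:~R) * y.
  by rewrite /z2 /z1 cImD cImN Im_int cImD Im_intM -/y intrD intrN; ring.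
have m1 : m%:~R <= complex.Re z1 by exact: floor_le_tmp.
have m2 : complex.Re z1 < m%:~R + 1 by have := floorD1_gt (complex.Re z1); rewrite -/m intrD.
have R2 : complex.Re z2 = complex.Re z1 - m%:~R by rewrite /z2 cReD cReN -ofreal_int.
rewrite -[z2]mkE; apply: HM; rewrite ?I2 ?R2; apply/andP; split; lra.
Qed.

(** Liouville's theorem by Fourier series: period 1 and boundedness give a q-expansion, and period
    tau gives a_n (e(tau)^n - 1) = 0, hence a_n = 0 for n > 0. *)
Let kappa0 : kappa = 0.
Proof.
have [M HM] := defect_ext__bound.
have [|a [Ha _]] := qexp_exists defect_ext__hol (fun z _ => defect_ext_1 z).
  move=> eps e0.
  have M0 : 0 <= M by apply: le_trans (HM tau Ht); exact: nrm_ge0.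
  have M1 : 0 < M + 1 by lra.
  have [Y Y0 HY] := expR_archi (twopi_gt0 R) (divr_gt0 e0 M1).
  exists Y => z hz; have Hz : uhp R z by rewrite /uhp /=; lra.
  have := HY _ hz; rewrite expRN ler_pdivlMr// mulrC ler_pdivrMr ?expR_gt0// => h.
  by have := HM z Hz; lra.
have Hb : forall z, uhp R z -> clim (psum (fun n => a n * e tau ^+ n - a n) (e z)) 0.
  move=> z Hz; have Hzt : uhp R (z + tau).
    by move: Hz Ht; rewrite /uhp /= cImD; lra.
  have := climB (Ha _ Hzt) (Ha _ Hz); rewrite defect_ext_t subrr.
  apply: clim_ext => N; rewrite /psum -sumrB; apply: eq_bigr => i _.
  by rewrite e2piiD exprMn; ring.
have an n : a n.+1 = 0.
  have /eqP := qexp_uniq0 Hb n.+1.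
  rewrite -[X in _ - X]mulr1 -mulrBr mulf_eq0 => /orP[/eqP//|].
  rewrite subr_eq0 => /eqP /(congr1 (@nrm R)); rewrite nrmX nrm1 => E.
  have : nrm (e tau) ^+ n.+1 < 1 by rewrite exprn_ilt1 ?nrm_ge0// nrm_e2pii_lt1.
  by rewrite E ltxx.
have Bc z : uhp R z -> defect_ext z = a 0%N.
  move=> Hz; apply: clim_uniq (Ha z Hz) _ => eps e0; exists 1%N => -[//|N] _.
  rewrite /psum big_ord_recl expr0 mulr1 big1 ?addr0 ?subrr ?nrm0 ?ltW// => i _.
  by rewrite an mul0r.
(* Constancy is known on the upper half-plane only, so the derivative at 0 is moved by the period
   tau to an inner point. *)
have Hk : cder defect_ext tau kappa.
  have H h : defect_ext (tau + h) = defect_ext h by rewrite addrC defect_ext_t.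
  have H0 : defect_ext tau = defect_ext 0 by rewrite -(H 0) addr0.
  move=> eps e0; have [d d0 Hd] := cder_defect_ext0 e0; exists d => // h /Hd.
  by rewrite add0r H H0.
apply: (cder_uniq Hk); apply: cder_near (cder_cst (a 0%N) tau).
exists (complex.Im tau) => // h hh0; rewrite Bc//; exact: ball_uhp.
Qed.

Lemma eisP_S : eisP (- tau^-1) = tau ^+ 2 * eisP tau - tau / twopii R.
Proof.
have := kappa0; rewrite /kappa !eisPE//.
move: (sigma_gen _) (sigma_gen _) (twopii_neq0 R) => s s'.
move: (twopii R) => p p0 K.
have n12 : (12 : C) != 0 by rewrite pnatr_eq0.
apply/eqP; rewrite -subr_eq0; apply/eqP.
transitivity (- tau ^+ 2 / p * 0); last by rewrite mulr0.
by rewrite -K; field; rewrite t0 p0.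
Qed.

End Fixed.

Lemma eisP_law g t : g \in SL2Z -> uhp R t ->
  eisP (moebius g t) = autom_factor g t ^+ 2 * eisP t -
    (g 1 0)%:~R * autom_factor g t / twopii R.
Proof.
move=> gS; move: t.
have step s : s \in SL2Z -> (forall t, uhp R t ->
   eisP (moebius s t) = autom_factor s t ^+ 2 * eisP t - (s 1 0)%:~R * autom_factor s t / twopii R) ->
   forall h, h \in SL2Z -> (forall t, uhp R t ->
   eisP (moebius h t) = autom_factor h t ^+ 2 * eisP t - (h 1 0)%:~R * autom_factor h t / twopii R) ->
   forall t, uhp R t ->
   eisP (moebius (s *m h) t) = autom_factor (s *m h) t ^+ 2 * eisP t - ((s *m h) 1 0)%:~R * autom_factor (s *m h) t / twopii R.
  move=> sS Hs h hS Hh t Ht; have j0 := autom_neq0 hS Ht.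
  have Ht' := moebius_uhp hS Ht.
  rewrite moebius_mul// autom_mul// Hs// Hh// mulmx2 rmorphD !rmorphM /=.
  have E : autom_factor h t * autom_factor s (moebius h t) =
      (s 1 0)%:~R * ((h 0 0)%:~R * t + (h 0 1)%:~R) + (s 1 1)%:~R * autom_factor h t.
    by rewrite [autom_factor s _]/autom_factor /moebius; field.
  have D := detC R hS.
  (* The cocycle rule for lower left entries; det h = 1 enters here. *)
  have F : autom_factor s (moebius h t) * (h 1 0)%:~R * autom_factor h t + (s 1 0)%:~R =
      ((s 1 0)%:~R * (h 0 0)%:~R + (s 1 1)%:~R * (h 1 0)%:~R) * autom_factor h t.
    have -> : autom_factor s (moebius h t) * (h 1 0)%:~R * autom_factor h t =
      (h 1 0)%:~R * (autom_factor h t * autom_factor s (moebius h t)) by ring.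
    rewrite E -[X in _ + X = _]mulr1 -[X in _ + _ * X = _]D /autom_factor; ring.
  set J := autom_factor h t in E F j0 *; set K := autom_factor s _ in E F *.
  have p0 := twopii_neq0 R.
  transitivity ((K * J) ^+ 2 * eisP t - (K * (h 1 0)%:~R * J + (s 1 0)%:~R) * K / twopii R).
    by move: (eisP t) (twopii R)^-1 => P p; ring.
  by rewrite F; move: (eisP t) (twopii R)^-1 => P p; ring.
apply: (SL2Z_ind (Q := fun g => forall t, uhp R t ->
   eisP (moebius g t) = autom_factor g t ^+ 2 * eisP t - (g 1 0)%:~R * autom_factor g t / twopii R)) => //.
- move=> t _; rewrite moebius_1 autom_1 expr1n mul1r mx2_id.
  by have [_ _ -> _] := mx2E 1 0 0 1; rewrite !mul0r subr0.
- move=> h hS Hh; apply: step => //; first exact: SL2ZS.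
  move=> t Ht; rewrite moebius_S autom_S eisP_S//.
  by have [_ _ -> _] := mx2E 0 (-1) 1 0; rewrite mul1r.
- move=> h hS Hh; apply: step => //; first exact: SL2ZT.
  move=> t Ht; rewrite moebius_T autom_T expr1n mul1r (eisP_per Ht) matTE.
  by have [_ _ -> _] := mx2E 1 1 0 1; rewrite !mul0r subr0.
- move=> h hS Hh; apply: step => //; first exact: SL2ZTV.
  move=> t Ht; rewrite moebius_TV autom_TV expr1n mul1r.
  have [_ _ -> _] := mx2E 1 (-1) 0 1; rewrite !mul0r subr0.
  rewrite -[in RHS](subrK 1 t) eisP_per//.
  by have := moebius_uhp SL2ZTV Ht; rewrite moebius_TV.
Qed.

(* The anomaly of P under the group compensates that of the derivative. *)
Lemma modD_law (k : int) f h g : g \in SL2Z -> hol f -> hol h ->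
  (forall t, uhp R t -> f (moebius g t) = autom_factor g t ^ k * h t) ->
  forall t, uhp R t ->
    modD k f (moebius g t) = autom_factor g t ^ (k + 2) * modD k h t.
Proof.
move=> gS Hf Hh H t Ht.
have j0 := autom_neq0 gS Ht; have Ht' := moebius_uhp gS Ht.
have p0 := twopii_neq0 R.
have D1 := cder_comp (cder_moebius gS Ht) (hol_cder Hf Ht').
have Dk : cder (fun x => autom_factor g x ^ k) t (k%:~R * autom_factor g t ^ (k - 1) * (g 1 0)%:~R).
  case: k {H} => n.
    apply: (cder_eql (cderX n (cder_autom g t))).
    case: n => [|n]; first by rewrite !mul0r.
    by have -> : (n.+1%:Z - 1 = n%:Z) by lia.
  have jn : autom_factor g t ^+ n.+1 != 0 by rewrite expf_neq0.
  have HV := @cderV R (fun x => autom_factor g x ^+ n.+1) t _ jn (cderX n.+1 (cder_autom g t)).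
  apply: (cder_eql (cder_ext (fun x => erefl (autom_factor g x ^ Negz n)) HV)).
  have -> : Negz n - 1 = Negz n.+1 by lia.
  rewrite /= NegzE mulrNz.
  have -> : autom_factor g t ^ Negz n.+1 = (autom_factor g t ^+ n.+2)^-1 by [].
  by rewrite [_ ^+ n.+2]exprS [_ ^+ n.+1]exprS; field; rewrite j0 expf_neq0.
have D2 := cderM Dk (hol_cder Hh Ht).
have D3 := cder_uniq (cder_near _ D1) D2.
have {D3} E : derive1 f (moebius g t) / autom_factor g t ^+ 2 =
  k%:~R * autom_factor g t ^ (k - 1) * (g 1 0)%:~R * h t + autom_factor g t ^ k * derive1 h t.
  apply: D3; exists (complex.Im t) => // x hx; apply: H; exact: ball_uhp.
have E' : derive1 f (moebius g t) = autom_factor g t ^+ 2 * (k%:~R * autom_factor g t ^ (k - 1) * (g 1 0)%:~R * h t + autom_factor g t ^ k * derive1 h t).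
  by rewrite -E mulrC divfK// expf_neq0.
rewrite /modD E' eisP_law// H//.
rewrite !expfzDr//; set J := autom_factor g t in j0 *.
have -> : J ^ 1 = J by [].
have -> : J ^ (-1) = J^-1 by [].
clearbody J; move: (J ^ k) (twopii R) p0 (eisP t) (h t) (derive1 h t) => X p p0 P a b.
move: k%:~R (g 1 0)%:~R => K c.
by field; rewrite p0 j0.
Qed.

End EisS.

(** * Modular forms *)

Section ModForms.
Variable R : realType.
Local Notation C := (cplx R).
Implicit Types (z t w : C) (f g h : C -> C) (k l : int).
Local Notation e := (@e2pii R).
Local Notation "'tpi'" := (2 * pi : R).

Definition qcoefs (a : nat -> C) f := forall z, uhp R z -> clim (psum a (e z)) (f z).

Lemma has_qexpP (a : nat -> C) f : has_qexp a f <-> qcoefs a f.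
Proof.
have E z : series (fun n => a n * qpow n%:R z) = psum a (e z).
  by apply/funext => N; rewrite /series /= big_mkord; apply: eq_bigr => i _; rewrite qpowE.
split=> H z Hz; first by apply/cvg_clim; rewrite -E; exact: H.
by rewrite E; apply/cvg_clim; exact: H.
Qed.

Definition slash k f := forall s, s \in SL2Z -> forall t, uhp R t ->
  f (moebius s t) = autom_factor s t ^ k * f t.

(* [nrm (e z) < d] describes a neighbourhood of i oo. *)
Definition bdd f := exists M d : R, 0 < d /\ forall z, uhp R z -> nrm (e z) < d -> nrm (f z) <= M.

Lemma near_inf (d : R) : 0 < d -> exists2 Y : R, 0 < Y & forall z, Y <= complex.Im z -> nrm (e z) < d.
Proof.
move=> d0; have d2 : 0 < d / 2 by lra.
have [Y Y0 HY] := expR_archi (twopi_gt0 R) d2.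
by exists Y => // z /HY; rewrite nrm_e2pii; lra.
Qed.

Lemma slash_per k f : slash k f -> per1 f.
Proof.
move=> H z Hz; have := H _ SL2ZT z Hz.
by rewrite moebius_T autom_T exp1rz mul1r.
Qed.

(** The bound is asked on a strip of width 1, where |z| is comparable to Im z; periodicity extends
    it. There (2y/(m+1))^(m+1) <= exp(2y) beats the power y^m. *)
Lemma growth_small f (M : R) (m : nat) (Y : R) : (forall z, Y <= complex.Im z -> 0 <= complex.Re z <= 1 ->
   nrm (f z) <= M * (1 + nrm z) ^+ m) -> per1 f ->
  forall eps : R, 0 < eps -> exists Y' : R, forall z, Y' <= complex.Im z -> nrm (f z) <= eps * expR (tpi * complex.Im z).
Proof.
move=> H P eps e0.
pose M' := `|M| + 1; have M'0 : 0 < M' by rewrite /M' ltr_wpDl.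
have Me : 0 < eps / M' by rewrite divr_gt0.
pose L := m.+1%:R ^+ m.+1 : R.
have L0 : 0 < L by rewrite exprn_gt0.
exists (Num.max Y (Num.max 2 (L / (eps / M')))) => z; rewrite !ge_max => /and3P[h1 h2 h3].
have Hz : uhp R z by rewrite /uhp /=; lra.
pose n := Num.floor (complex.Re z); pose z1 := z - n%:~R.
have fz : f z = f z1 by rewrite -[z](subrK n%:~R) per_int// /z1 -mulrNz -ofreal_int; exact: uhp_real.
have I1 : complex.Im z1 = complex.Im z by rewrite /z1 cImD cImN Im_int subr0.
have R1 : complex.Re z1 = complex.Re z - n%:~R by rewrite /z1 cReD cReN -ofreal_int.
have n1 : n%:~R <= complex.Re z by exact: floor_le_tmp.
have n2 : complex.Re z < n%:~R + 1 by have := floorD1_gt (complex.Re z); rewrite -/n intrD.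
have R01 : 0 <= complex.Re z1 <= 1 by rewrite R1; apply/andP; split; lra.
have := H z1; rewrite I1 => /(_ h1 R01) hf; rewrite fz.
set y := complex.Im z in h1 h2 h3 *.
have nz : 1 + nrm z1 <= 2 * y.
  have := nrm_le_split z1; rewrite I1 (ger0_norm (_ : 0 <= complex.Re z1)); last by case/andP: R01.
  rewrite ger0_norm; last by rewrite /y; lra.
  by case/andP: R01; rewrite -/y; lra.
have nz1 := nrm_ge0 z1.
have y0 : 0 <= 2 * y by lra.
have hp : (1 + nrm z1) ^+ m <= (2 * y) ^+ m by rewrite lerXn2r ?nnegrE//; lra.
have hM : nrm (f z1) <= M' * (2 * y) ^+ m.
  apply: le_trans hf _; apply: (@le_trans _ _ (M' * (1 + nrm z1) ^+ m)).
    by rewrite ler_wpM2r ?exprn_ge0//; [lra | rewrite /M'; have := ler_norm M; lra].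
  by rewrite ler_wpM2l// ltW.
apply: le_trans hM _; rewrite -ler_pdivlMl// mulrA [M'^-1 * _]mulrC.
have pe : 2 * y <= tpi * y by have := pi_ge2 R; nra.
have e1 : ((2 * y) / m.+1%:R) ^+ m.+1 <= expR (tpi * y).
  apply: (@le_trans _ _ (expR (2 * y))); last by rewrite ler_expR.
  have -> : expR (2 * y) = expR (2 * y / m.+1%:R) ^+ m.+1.
    by rewrite -expRM_natl; congr expR; rewrite [RHS]mulrC divfK// pnatr_eq0.
  rewrite lerXn2r ?nnegrE ?expR_ge0//; first by rewrite divr_ge0.
  by apply: le_trans (expR_ge1Dx _); rewrite lerDr ler01.
have e2 : (2 * y) ^+ m * (2 * y / L) <= expR (tpi * y).
  apply: le_trans e1; rewrite expr_div_n -/L mulrA -exprSr lexx//.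
rewrite ler_pdivrMr// in h3.
have Lk : 1 <= eps / M' * (2 * y / L).
  by rewrite !mulrA ler_pdivlMr// mul1r; move: h3; nra.
have p0 : 0 <= (2 * y) ^+ m by rewrite exprn_ge0.
apply: (@le_trans _ _ (eps / M' * ((2 * y) ^+ m * (2 * y / L)))); last by rewrite ler_wpM2l// ltW.
by rewrite mulrCA -[X in X <= _]mulr1 ler_wpM2l.
Qed.

Lemma bdd_small f : per1 f -> bdd f ->
  forall eps : R, 0 < eps -> exists Y' : R, forall z, Y' <= complex.Im z -> nrm (f z) <= eps * expR (tpi * complex.Im z).
Proof.
move=> P [M [d [d0 H]]]; have [Y Y0 HY] := near_inf d0.
apply: (@growth_small f M 0 Y) => // z hz _; rewrite expr0 mulr1.
apply: H; last exact: HY.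
by rewrite /uhp /=; lra.
Qed.

Lemma qexp_of_bdd f : hol f -> per1 f -> bdd f -> exists a, qcoefs a f.
Proof.
by move=> Hf Pf Bf; have [a [Ha _]] := qexp_exists Hf Pf (bdd_small Pf Bf); exists a.
Qed.

Lemma bdd_of_qexp (a : nat -> C) f : qcoefs a f -> bdd f.
Proof.
move=> H; have [F [HF FE]] := qexp_ps H.
have n0 : nrm (0 : C) < 1 by rewrite nrm0.
have [d d0 Hd] := ps_cont HF n0 ltr01.
exists (nrm (F 0) + 1), d; split => // z Hz zd; rewrite -FE//.
have := Hd (e z) zd; rewrite add0r => h.
by have := nrmD (F (e z) - F 0) (F 0); rewrite subrK; lra.
Qed.

Lemma modular_formP k f : modular_form k f <-> [/\ hol f, slash k f & bdd f].
Proof.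
have E s t : s \in SL2Z -> uhp R t -> (autom_factor s t ^ (- k) * f (moebius s t) = f t) <->
    (f (moebius s t) = autom_factor s t ^ k * f t).
  move=> sS Ht; have j0 : autom_factor s t ^ k != 0 by rewrite expfz_neq0// autom_neq0.
  by split=> [<-|->]; rewrite mulrA -?invr_expz ?mulfV ?mulVf// mul1r.
split=> [[H1 H2 [a /has_qexpP Ha]]|[H1 H2 H3]].
  split; [exact/hol_derivable_uhp | by move=> s sS t Ht; apply/E/H2 | exact: bdd_of_qexp Ha].
split; first exact/hol_derivable_uhp.
  by move=> s sS t Ht; apply/E => //; exact: H2.
by have [a Ha] := qexp_of_bdd H1 (slash_per H2) H3; exists a; apply/has_qexpP.
Qed.

Lemma mf_hol k f : modular_form k f -> hol f. Proof. by case/modular_formP. Qed.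
Lemma mf_slash k f : modular_form k f -> slash k f. Proof. by case/modular_formP. Qed.
Lemma mf_q k f : modular_form k f -> exists a, qcoefs a f.
Proof. by case=> _ _ [a /has_qexpP]; exists a. Qed.

Lemma hol_eq f g : eq_uhp f g -> hol f -> hol g.
Proof.
move=> E H z Hz; have [l Hl] := H z Hz; exists l; apply: cder_near Hl.
by exists (complex.Im z) => // h hh; apply/E/ball_uhp.
Qed.

Lemma eq_uhp_sym f g : eq_uhp f g -> eq_uhp g f.
Proof. by move=> E z Hz; rewrite E. Qed.

Lemma mf_eq k f g : eq_uhp f g -> modular_form k f -> modular_form k g.
Proof.
move=> E /modular_formP[H1 H2 [M [d [d0 H3]]]]; apply/modular_formP; split.
- exact: hol_eq E H1.
- by move=> s sS t Ht; rewrite -!E ?H2//; exact: moebius_uhp.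
- by exists M, d; split => // z Hz zd; rewrite -E// H3.
Qed.

Lemma hol_add f g : hol f -> hol g -> hol (fun z => f z + g z).
Proof. by move=> H1 H2 z Hz; have [l Hl] := H1 z Hz; have [m Hm] := H2 z Hz; exists (l + m); exact: cderD. Qed.
Lemma hol_mul f g : hol f -> hol g -> hol (fun z => f z * g z).
Proof. by move=> H1 H2 z Hz; have [l Hl] := H1 z Hz; have [m Hm] := H2 z Hz; eexists; exact: cderM Hl Hm. Qed.
Lemma hol_cst (c : C) : hol (fun=> c). Proof. by move=> z _; exists 0; exact: cder_cst. Qed.
Lemma hol_sum (I : finType) (F : I -> C -> C) : (forall i, hol (F i)) -> hol (fun z => \sum_i F i z).
Proof.
move=> H z Hz; have : forall i, exists c : C, cder (F i) z c by move=> i; exact: H.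
by move=> /choice[l Hl]; exists (\sum_i l i); apply: cder_sum => i _; exact: Hl.
Qed.
Lemma hol_exp f n : hol f -> hol (fun z => f z ^+ n).
Proof. by move=> H z /H[l Hl]; eexists; exact: cderX Hl. Qed.
Lemma hol_inv f : hol f -> (forall z, uhp R z -> f z != 0) -> hol (fun z => (f z)^-1).
Proof. by move=> H H0 z Hz; have [l Hl] := H z Hz; eexists; apply: cderV Hl; exact: H0. Qed.
Lemma hol_prod (I : finType) (F : I -> C -> C) : (forall i, hol (F i)) -> hol (fun z => \prod_i F i z).
Proof.
move=> H; elim: (index_enum I) => [|i r IH].
  by apply: hol_eq (@hol_cst 1) => z _; rewrite big_nil.
by apply: hol_eq (hol_mul (H i) IH) => z _; rewrite big_cons.
Qed.

Lemma bdd_add f g : bdd f -> bdd g -> bdd (fun z => f z + g z).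
Proof.
move=> [M [d [d0 H]]] [M' [d' [d'0 H']]]; exists (M + M'), (Num.min d d'); split.
  by rewrite lt_min d0.
move=> z Hz; rewrite lt_min => /andP[h1 h2].
by apply: le_trans (nrmD _ _) _; rewrite lerD ?H ?H'.
Qed.
Lemma bdd_mul f g : bdd f -> bdd g -> bdd (fun z => f z * g z).
Proof.
move=> [M [d [d0 H]]] [M' [d' [d'0 H']]]; exists (M * M'), (Num.min d d'); split.
  by rewrite lt_min d0.
move=> z Hz; rewrite lt_min => /andP[h1 h2].
by rewrite nrmM ler_pM ?nrm_ge0 ?H ?H'.
Qed.
Lemma bdd_cst (c : C) : bdd (fun=> c). Proof. by exists (nrm c), 1; split. Qed.

Lemma mf_mul k l f g : modular_form k f -> modular_form l g -> modular_form (k + l) (fun z => f z * g z).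
Proof.
move=> /modular_formP[A1 A2 A3] /modular_formP[B1 B2 B3]; apply/modular_formP; split.
- exact: hol_mul.
- move=> s sS t Ht; rewrite A2// B2// expfzDr ?autom_neq0//; ring.
- exact: bdd_mul.
Qed.
Lemma mf_add k f g : modular_form k f -> modular_form k g -> modular_form k (fun z => f z + g z).
Proof.
move=> /modular_formP[A1 A2 A3] /modular_formP[B1 B2 B3]; apply/modular_formP; split.
- exact: hol_add.
- by move=> s sS t Ht; rewrite A2// B2// mulrDr.
- exact: bdd_add.
Qed.
Lemma mf_cst c : modular_form 0 (fun=> c : C).
Proof.
apply/modular_formP; split; [exact: hol_cst| |exact: bdd_cst].
by move=> s sS t Ht; rewrite expr0z mul1r.
Qed.
Lemma mf_scale k c f : modular_form k f -> modular_form k (fun z => c * f z).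
Proof. by move=> H; have := mf_mul (mf_cst c) H; rewrite add0r. Qed.
Lemma mf_sub k f g : modular_form k f -> modular_form k g -> modular_form k (fun z => f z - g z).
Proof.
move=> Hf Hg; apply: mf_eq (mf_add Hf (mf_scale (-1) Hg)) => z _.
by rewrite mulN1r.
Qed.
Lemma mf0 k : modular_form k (fun=> 0 : C).
Proof.
apply/modular_formP; split; [exact: hol_cst| |exact: bdd_cst].
by move=> s sS t Ht; rewrite mulr0.
Qed.
Lemma mf_exp k f n : modular_form k f -> modular_form (n%:Z * k) (fun z => f z ^+ n).
Proof.
move=> H; elim: n => [|n IH].
  by rewrite mul0r; apply: mf_eq (mf_cst 1) => z _; rewrite expr0.
have -> : n.+1%:Z * k = k + n%:Z * k by rewrite intS mulrDl mul1r.
by apply: mf_eq (mf_mul H IH) => z _; rewrite exprS.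
Qed.
(** Part of the reduction to the fundamental domain: if Im t < 1/2, translation to |Re t| <= 1/2
    gives |t|^2 <= 1/2, and then S at least doubles the imaginary part. *)
Lemma reduce_half t : uhp R t -> exists2 s, s \in SL2Z & 2^-1 <= complex.Im (moebius s t).
Proof.
move=> Ht.
have [n Hn] : exists n : nat, 2^-1 <= 2 ^+ n * complex.Im t.
  have [||N HN] := @geom_small R 2^-1 (2 * complex.Im t).
  - by apply/andP; split; lra.
  - by rewrite mulr_gt0//; exact: Ht.
  exists N; have := HN N (leqnn N); rewrite exprVn.
  have p2 : 0 < 2 ^+ N :> R by rewrite exprn_gt0.
  rewrite -[X in X <= _]mul1r ler_pdivrMr//; lra.
elim: n t Ht Hn => [|n IH] t Ht Hn.
  by exists 1%:M; [exact: SL2Z1 | rewrite moebius_1; move: Hn; rewrite expr0 mul1r].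
have [h|h] := leP 2^-1 (complex.Im t).
  by exists 1%:M; [exact: SL2Z1 | rewrite moebius_1].
pose m := Num.floor (complex.Re t + 2^-1).
pose s1 := mx2 1 (- m) 0 1.
have s1S : s1 \in SL2Z by rewrite SL2ZE det_mx2 mulr0 subr0.
have m1 : m%:~R <= complex.Re t + 2^-1 by exact: floor_le_tmp.
have m2 : complex.Re t + 2^-1 < m%:~R + 1 by have := floorD1_gt (complex.Re t + 2^-1); rewrite -/m intrD.
have E1 : moebius s1 t = t - m%:~R.
  rewrite /moebius /autom_factor; have [-> -> -> ->] := mx2E 1 (- m) 0 1.
  by rewrite mul1r mul0r add0r divr1 rmorphN.
have I1 : complex.Im (moebius s1 t) = complex.Im t by rewrite E1 cImD cImN Im_int subr0.
have R1 : complex.Re (moebius s1 t) = complex.Re t - m%:~R by rewrite E1 cReD cReN -ofreal_int.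
have H1 := moebius_uhp s1S Ht.
have H2 := moebius_uhp SL2ZS H1.
have I2 := Im_moebius SL2ZS H1; rewrite autom_S in I2.
have ns : nrm (moebius s1 t) ^+ 2 <= 2^-1.
  rewrite nrm_sqr I1 R1; have : 0 <= complex.Im t by apply: ltW; exact: Ht.
  nra.
have n0 : 0 < nrm (moebius s1 t) ^+ 2.
  rewrite exprn_gt0// nrm_gt0; apply: contraTneq H1 => ->; by rewrite /uhp /= ltxx.
have Hn2 : 2^-1 <= 2 ^+ n * complex.Im (moebius matS (moebius s1 t)).
  apply: le_trans Hn _; rewrite exprS -mulrA mulrCA ler_wpM2l ?exprn_ge0//.
  rewrite I2 I1 ler_pdivlMr//; have : 0 <= complex.Im t by apply: ltW; exact: Ht.
  nra.
have [s sS Hs] := IH _ H2 Hn2.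
exists (s *m (matS *m s1)); first by rewrite !SL2Z_mul// SL2ZS.
by rewrite !moebius_mul// ?SL2Z_mul// SL2ZS.
Qed.

Lemma ps_bounded (a : nat -> C) f (r : R) : ps_on a 1 f -> 0 <= r < 1 ->
  exists M : R, forall w, nrm w <= r -> nrm (f w) <= M.
Proof.
move=> H /andP[r0 r1].
have nr : nrm (ofreal r) = r by rewrite nrm_ofreal ger0_norm.
have [|s [t [K [rs st t1 K0 HK]]]] := @ps_sub _ _ _ _ (ofreal r) H; first by rewrite nr.
rewrite nr in rs; have t0 : 0 < t by lra.
have x01 : 0 <= s / t < 1 by rewrite divr_ge0 ?ltr_pdivrMr ?mul1r//; lra.
exists (K * (1 - s / t)^-1) => w wr.
have w1 : nrm w < 1 by lra.
apply: (clim_nrm_le (H w w1)); exists 0%N => N _.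
apply: le_trans (nrm_sum _ _ _) _.
apply: (@le_trans _ _ (\sum_(n < N) K * (s / t) ^+ n)); last first.
  by rewrite -mulr_sumr ler_wpM2l ?(ltW K0)// sum_geom1.
apply: ler_sum => n _; rewrite nrmM nrmX expr_div_n mulrA ler_pdivlMr ?exprn_gt0//.
have tn : 0 <= t ^+ n by rewrite exprn_ge0// ltW.
have wn : nrm w ^+ n <= s ^+ n by rewrite lerXn2r ?nnegrE ?nrm_ge0//; lra.
rewrite mulrAC; apply: ler_pM => //; [by rewrite mulr_ge0 ?nrm_ge0 | by rewrite exprn_ge0 ?nrm_ge0].
Qed.

(* Hecke's bound: |f|^2 y^k is invariant, hence bounded, and for k < 0 this
   forces the Fourier coefficients to vanish when y tends to 0. *)
Lemma mf_neg k f : modular_form k f -> k < 0 -> eq_uhp f (fun=> 0).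
Proof.
move=> Hf k0; have [H1 H2 H3] := (modular_formP k f).1 Hf.
pose m := `|k|%N; have km : k = - m%:Z by lia.
have m0 : (0 < m)%N by lia.
have [M0 HM0] : exists M : R, forall z, 2^-1 <= complex.Im z -> nrm (f z) <= M.
  have [a Ha] := mf_q Hf; have [F [HF FE]] := qexp_ps Ha.
  pose r := expR (- (tpi * 2^-1)).
  have r1 : 0 <= r < 1.
    by rewrite /r expR_ge0 expR_lt1 oppr_lt0 mulr_gt0 ?twopi_gt0.
  have [M HM] := ps_bounded HF r1; exists M => z hz.
  rewrite -FE; last by rewrite /uhp /=; lra.
  by apply: HM; rewrite nrm_e2pii ler_expR lerN2 ler_pM2l ?twopi_gt0.
(* The factor 2^m makes up for y^m when y is only known to be at least 1/2. *)
pose K := M0 ^+ 2 * 2 ^+ m.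
have HK t : uhp R t -> nrm (f t) ^+ 2 <= K * complex.Im t ^+ m.
  move=> Ht; have [s sS Hs] := reduce_half Ht.
  have j0 := autom_neq0 sS Ht.
  have nj : 0 < nrm (autom_factor s t) by rewrite nrm_gt0.
  have := H2 s sS t Ht; rewrite km -invr_expz => E.
  have E' : f t = autom_factor s t ^+ m * f (moebius s t).
    by rewrite E mulrA mulfV ?mul1r// expf_neq0.
  rewrite E' nrmM nrmX exprMn.
  have Im1 : complex.Im t = complex.Im (moebius s t) * nrm (autom_factor s t) ^+ 2.
    by rewrite Im_moebius// divfK// gt_eqF ?exprn_gt0.
  have -> : complex.Im t ^+ m = complex.Im (moebius s t) ^+ m * (nrm (autom_factor s t) ^+ m) ^+ 2.
    by rewrite Im1 exprMn -!exprM mulnC.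
  set y := complex.Im (moebius s t) in Hs *.
  have f2 : nrm (f (moebius s t)) ^+ 2 <= M0 ^+ 2.
    by rewrite lerXn2r ?nnegrE ?nrm_ge0 ?HM0//; apply: le_trans (HM0 _ Hs); exact: nrm_ge0.
  have y2 : 1 <= (2 * y) ^+ m by rewrite exprn_ege1//; lra.
  have b1 : nrm (f (moebius s t)) ^+ 2 <= K * y ^+ m.
    rewrite /K -mulrA -exprMn; apply: le_trans f2 _.
    by rewrite ler_peMr// sqr_ge0.
  set J := nrm (autom_factor s t) in nj *.
  have J0 : 0 <= (J ^+ m) ^+ 2 by rewrite sqr_ge0.
  have := ler_wpM2l J0 b1; lra.
have Pf := slash_per H2.
have [a [Ha Hb]] := qexp_exists H1 Pf (bdd_small Pf H3).
suff a0 n : a n = 0.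
  move=> z Hz; apply: clim_uniq (Ha z Hz) _; apply: clim_ext (clim_cst 0) => N.
  by rewrite /psum big1// => i _; rewrite a0 mul0r.
apply/eqP; rewrite -nrm_eq0 -sqrf_eq0 eq_le sqr_ge0 andbT.
have K0 : 0 <= K by rewrite /K mulr_ge0 ?sqr_ge0 ?exprn_ge0.
pose E := expR (tpi * n%:R) ^+ 2; have E0 : 0 < E by rewrite exprn_gt0// expR_gt0.
(* Cauchy's estimate at height y <= 1 gives K y^m exp(4 pi n), and y^m <= y because m > 0. *)
have main (y : R) : 0 < y -> y <= 1 -> nrm (a n) ^+ 2 <= (K * E) * y.
  move=> y0 y1.
  have B0 : 0 <= K * y ^+ m by rewrite mulr_ge0// exprn_ge0// ltW.
  have := Hb n y (Num.sqrt (K * y ^+ m)) y0.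
  have -> : (forall x, 0 <= x <= 1 -> nrm (f (mk x y)) <= Num.sqrt (K * y ^+ m)) <-> True.
    split=> // _ x _; rewrite -[leLHS]ger0_norm ?nrm_ge0// -sqrtr_sqr ler_wsqrtr//.
    exact: (HK (mk x y)).
  move=> /(_ I) h.
  have h' : nrm (a n) <= Num.sqrt (K * y ^+ m) * expR (tpi * n%:R).
    apply: le_trans h _; rewrite ler_wpM2l ?sqrtr_ge0// ler_expR ler_piMr//.
    by rewrite mulr_ge0// ltW// twopi_gt0.
  have : nrm (a n) ^+ 2 <= (Num.sqrt (K * y ^+ m) * expR (tpi * n%:R)) ^+ 2.
    by rewrite lerXn2r ?nnegrE ?nrm_ge0// mulr_ge0 ?sqrtr_ge0 ?expR_ge0.
  rewrite exprMn sqr_sqrtr// => /le_trans; apply.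
  rewrite -/E mulrAC; apply: ler_wpM2l; first exact: (mulr_ge0 K0 (ltW E0)).
  have ym j : (0 < j)%N -> y ^+ j <= y.
    by case: j => // j _; rewrite exprS ler_piMr ?(ltW y0)// exprn_ile1// ltW.
  exact: ym.
apply/ler_addgt0Pl => eps e0; rewrite addr0.
have KE : 0 < K * E + 1 by rewrite ltr_wpDl// mulr_ge0// ltW.
pose y := Num.min 1 (eps / (K * E + 1)).
have y0 : 0 < y by rewrite lt_min ltr01 divr_gt0.
have [y1 y2] : y <= 1 /\ y <= eps / (K * E + 1) by split; rewrite ge_min lexx ?orbT.
apply: le_trans (main y y0 y1) _; move: y2; rewrite ler_pdivlMr// => y2.
clearbody y; lra.
Qed.

End ModForms.

(** * The forms Delta, E_4 and E_6 *)

Section Delta.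
Variable R : realType.
Local Notation C := (cplx R).
Implicit Types (z t w : C) (f g h : C -> C) (k : int).
Local Notation e := (@e2pii R).
Local Notation "'tpi'" := (2 * pi : R).

Definition cusp_lim f (c : C) := forall eps : R, 0 < eps -> exists2 d : R, 0 < d &
  forall z, uhp R z -> nrm (e z) < d -> nrm (f z - c) <= eps.

Lemma exists_near (d : R) : 0 < d -> exists2 z, uhp R z & nrm (e z) < d.
Proof.
move=> /near_inf[Y Y0 HY]; exists (mk 0 Y) => //; exact: HY.
Qed.

Lemma cusp_lim_uniq f (c c' : C) : cusp_lim f c -> cusp_lim f c' -> c = c'.
Proof.
move=> H H'; apply/eqP; rewrite -subr_eq0 -nrm_eq0 eq_le nrm_ge0 andbT.
apply/ler_addgt0Pl => eps e0; rewrite addr0; have e2 : 0 < eps / 2 by lra.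
have [d d0 Hd] := H _ e2; have [d' d'0 Hd'] := H' _ e2.
have [|z Hz] := @exists_near (Num.min d d'); first by rewrite lt_min d0.
rewrite lt_min => /andP[/(Hd z Hz) h1 /(Hd' z Hz) h2].
have -> : c - c' = (f z - c') - (f z - c) by ring.
by apply: le_trans (nrmB _ _) _; lra.
Qed.

Lemma cusp_lim_eq f g (c : C) : eq_uhp f g -> cusp_lim f c -> cusp_lim g c.
Proof. by move=> E H eps /H[d d0 Hd]; exists d => // z Hz zd; rewrite -E// Hd. Qed.

Lemma cusp_lim_cst (c : C) : cusp_lim (fun=> c) c.
Proof. by move=> eps e0; exists 1 => // z _ _; rewrite subrr nrm0 ltW. Qed.

Lemma cusp_limD f g (c c' : C) : cusp_lim f c -> cusp_lim g c' -> cusp_lim (fun z => f z + g z) (c + c').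
Proof.
move=> H H' eps e0; have e2 : 0 < eps / 2 by lra.
have [d d0 Hd] := H _ e2; have [d' d'0 Hd'] := H' _ e2.
exists (Num.min d d'); first by rewrite lt_min d0.
move=> z Hz; rewrite lt_min => /andP[/(Hd z Hz) h1 /(Hd' z Hz) h2].
have -> : f z + g z - (c + c') = (f z - c) + (g z - c') by ring.
by apply: le_trans (nrmD _ _) _; lra.
Qed.

Lemma cusp_limM f g (c c' : C) : cusp_lim f c -> cusp_lim g c' -> cusp_lim (fun z => f z * g z) (c * c').
Proof.
move=> H H' eps e0.
pose A := nrm c + nrm c' + 1.
have [n1 n2] : 0 <= nrm c /\ 0 <= nrm c' by rewrite !nrm_ge0.
have A0 : 0 < A by rewrite /A; lra.
pose e1 := Num.min 1 (eps / A).
have e10 : 0 < e1 by rewrite /e1 lt_min ltr01 divr_gt0.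
have e11 : e1 <= 1 by rewrite /e1 ge_min lexx.
have e1A : e1 * A <= eps by rewrite -ler_pdivlMr// /e1 ge_min lexx orbT.
clearbody e1.
have [d d0 Hd] := H _ e10; have [d' d'0 Hd'] := H' _ e10.
exists (Num.min d d'); first by rewrite lt_min d0.
move=> z Hz; rewrite lt_min => /andP[/(Hd z Hz) h1 /(Hd' z Hz) h2].
have -> : f z * g z - c * c' = (f z - c) * (g z - c') + (f z - c) * c' + c * (g z - c') by ring.
apply: le_trans (nrmD _ _) _; apply: le_trans (lerD (nrmD _ _) (lexx _)) _; rewrite !nrmM.
have p1 : nrm (f z - c) * nrm (g z - c') <= e1 * 1.
  by apply: ler_pM; rewrite ?nrm_ge0//; lra.
have p2 : nrm (f z - c) * nrm c' <= e1 * nrm c' by rewrite ler_wpM2r.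
have p3 : nrm c * nrm (g z - c') <= nrm c * e1 by rewrite ler_wpM2l.
by move: e1A; rewrite /A; lra.
Qed.

Lemma cusp_limX f (c : C) n : cusp_lim f c -> cusp_lim (fun z => f z ^+ n) (c ^+ n).
Proof.
move=> H; elim: n => [|n IH]; first exact: (@cusp_lim_eq (fun=> 1) _ _ _ (@cusp_lim_cst 1)).
by rewrite exprS; apply: cusp_lim_eq (cusp_limM H IH) => z _; rewrite exprS.
Qed.

(** The expansion a + b q + O(q^2) at the cusp as an estimate, so that it passes to products before
    a q-expansion is known. Two coefficients suffice to see that E_4^3 - E_6^2 is not zero. *)
Definition qjet f (a b : C) := exists K d : R, [/\ 0 <= K, 0 < d & forall z, uhp R z -> nrm (e z) < d ->
  nrm (f z - (a + b * e z)) <= K * nrm (e z) ^+ 2].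

Lemma qjet_of_q (a : nat -> C) f : qcoefs a f -> qjet f (a 0%N) (a 1%N).
Proof.
move=> /qexp_ps[F [HF FE]]; have [K [d [K0 d0 _ H]]] := ps_taylor 2 ltr01 HF.
exists K, d; split => //; first exact: ltW.
move=> z Hz /H; rewrite FE// /psum !big_ord_recl big_ord0 /= expr0 expr1 mulr1 addr0.
by [].
Qed.

Lemma qjet_eq f g (a b : C) : eq_uhp f g -> qjet f a b -> qjet g a b.
Proof. by move=> E [K [d [K0 d0 H]]]; exists K, d; split => // z Hz zd; rewrite -E// H. Qed.

Lemma qjetD f g (a b a' b' : C) : qjet f a b -> qjet g a' b' -> qjet (fun z => f z + g z) (a + a') (b + b').
Proof.
move=> [K [d [K0 d0 H]]] [K' [d' [K'0 d'0 H']]].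
exists (K + K'), (Num.min d d'); split; rewrite ?addr_ge0 ?lt_min ?d0//.
move=> z Hz; rewrite lt_min => /andP[/(H z Hz) h1 /(H' z Hz) h2].
have -> : f z + g z - (a + a' + (b + b') * e z) = (f z - (a + b * e z)) + (g z - (a' + b' * e z)) by ring.
by apply: le_trans (nrmD _ _) _; rewrite mulrDl; lra.
Qed.

Lemma qjet_cst (c : C) : qjet (fun=> c) c 0.
Proof. by exists 0, 1; split => // z _ _; rewrite mul0r addr0 subrr nrm0 mul0r. Qed.

Lemma qjetM f g (a b a' b' : C) : qjet f a b -> qjet g a' b' ->
  qjet (fun z => f z * g z) (a * a') (a * b' + b * a').
Proof.
move=> [K [d [K0 d0 H]]] [K' [d' [K'0 d'0 H']]].
pose L := K * K' + K * (nrm a' + nrm b') + K' * (nrm a + nrm b) + nrm b * nrm b'.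
have [n1 n2] : 0 <= nrm a /\ 0 <= nrm b by rewrite !nrm_ge0.
have [n3 n4] : 0 <= nrm a' /\ 0 <= nrm b' by rewrite !nrm_ge0.
have L0 : 0 <= L by rewrite /L !addr_ge0 ?mulr_ge0 ?addr_ge0.
exists L, (Num.min d (Num.min d' 1)); split; rewrite ?lt_min ?d0 ?d'0 ?ltr01//.
move=> z Hz; rewrite !lt_min => /and3P[/(H z Hz) h1 /(H' z Hz) h2 q1].
set q := e z in h1 h2 q1 *.
set u := f z - _ in h1; set v := g z - _ in h2.
have -> : f z * g z - (a * a' + (a * b' + b * a') * q) =
  u * v + u * (a' + b' * q) + v * (a + b * q) + (b * b') * q ^+ 2.
  by rewrite /u /v; ring.
have q0 := nrm_ge0 q.
have Q0 : 0 <= nrm q ^+ 2 by rewrite sqr_ge0.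
have Q1 : nrm q ^+ 2 <= 1 by rewrite exprn_ile1// ltW.
have s1 : nrm (a' + b' * q) <= nrm a' + nrm b'.
  by apply: le_trans (nrmD _ _) _; rewrite nrmM lerD2l ler_piMr// ltW.
have s2 : nrm (a + b * q) <= nrm a + nrm b.
  by apply: le_trans (nrmD _ _) _; rewrite nrmM lerD2l ler_piMr// ltW.
have p1 : nrm (u * v) <= K * K' * nrm q ^+ 2.
  rewrite nrmM; apply: (@le_trans _ _ (K * nrm q ^+ 2 * (K' * nrm q ^+ 2))).
    by rewrite ler_pM ?nrm_ge0.
  have -> : K * nrm q ^+ 2 * (K' * nrm q ^+ 2) = K * K' * nrm q ^+ 2 * nrm q ^+ 2 by ring.
  by rewrite ler_piMr// !mulr_ge0.
have p2 : nrm (u * (a' + b' * q)) <= K * nrm q ^+ 2 * (nrm a' + nrm b').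
  by rewrite nrmM ler_pM ?nrm_ge0.
have p3 : nrm (v * (a + b * q)) <= K' * nrm q ^+ 2 * (nrm a + nrm b).
  by rewrite nrmM ler_pM ?nrm_ge0.
have p4 : nrm (b * b' * q ^+ 2) = nrm b * nrm b' * nrm q ^+ 2 by rewrite nrmM nrmX nrmM.
have t1 := nrmD (u * v + u * (a' + b' * q) + v * (a + b * q)) (b * b' * q ^+ 2).
have t2 := nrmD (u * v + u * (a' + b' * q)) (v * (a + b * q)).
have t3 := nrmD (u * v) (u * (a' + b' * q)).
by rewrite /L; lra.
Qed.

Lemma qjet_eql f (a b a' b' : C) : qjet f a b -> a = a' -> b = b' -> qjet f a' b'.
Proof. by move=> H <- <-. Qed.

Lemma qjetZ f (c a b : C) : qjet f a b -> qjet (fun z => c * f z) (c * a) (c * b).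
Proof. by move=> H; apply: (qjet_eql (qjetM (qjet_cst c) H)); ring. Qed.

Lemma qjet_cusp_lim f (a b : C) : qjet f a b -> cusp_lim f a.
Proof.
move=> [K [d [K0 d0 H]]] eps e0.
have L0 : 0 < K + nrm b + 1 by have := nrm_ge0 b; lra.
exists (Num.min d (Num.min 1 (eps / (K + nrm b + 1)))).
  by rewrite !lt_min d0 ltr01 divr_gt0.
move=> z Hz; rewrite !lt_min ltr_pdivlMr// => /and3P[/(H z Hz) h1 h2 h3].
have := nrmD (f z - (a + b * e z)) (b * e z).
rewrite opprD addrA subrK nrmM => h4.
have q0 := nrm_ge0 (e z); have b0 := nrm_ge0 b.
have : K * nrm (e z) ^+ 2 <= K * nrm (e z).
  by rewrite ler_wpM2l// expr2 ler_piMr// ltW.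
move: h1; rewrite opprD addrA => h1; nra.
Qed.

Lemma qjet_uniq0 f (b : C) : (forall z, uhp R z -> f z = 0) -> qjet f 0 b -> b = 0.
Proof.
move=> f0 [K [d [K0 d0 H]]].
apply/eqP; rewrite -nrm_eq0 eq_le nrm_ge0 andbT.
apply/ler_addgt0Pl => eps e0; rewrite addr0.
have K1 : 0 < K + 1 by lra.
have [|z Hz] := @exists_near (Num.min d (eps / (K + 1))); first by rewrite lt_min d0 divr_gt0.
rewrite lt_min ltr_pdivlMr// => /andP[/(H z Hz) h1 h2].
have q0 : 0 < nrm (e z) by rewrite nrm_gt0 e2pii_neq0.
move: h1; rewrite f0// !add0r nrmN nrmM expr2 mulrA ler_pM2r// => h1; lra.
Qed.

Lemma qjet_uniq f (a b a' b' : C) : qjet f a b -> qjet f a' b' -> a = a' /\ b = b'.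
Proof.
move=> H H'; have E := cusp_lim_uniq (qjet_cusp_lim H) (qjet_cusp_lim H'); split => //; subst a'.
apply/eqP; rewrite -subr_eq0; apply/eqP.
have := qjetD H (qjetZ (-1) H'); rewrite !mulN1r subrr.
by apply: qjet_uniq0 => z _; rewrite mulN1r subrr.
Qed.

Definition theta f z : C := (twopii R)^-1 * derive1 f z.

Lemma theta_q (a : nat -> C) f : qcoefs a f -> hol f /\ qcoefs (fun n => n%:R * a n) (theta f).
Proof.
move=> /qexp_ps[F [HF FE]].
have K z : uhp R z -> exists2 l, clim (psum (dcoef a) (e z)) l & cder f z (l * (twopii R * e z)).
  move=> Hz; have [l Hl Hc] := ps_der HF (nrm_e2pii_lt1 Hz); exists l => //.
  apply: cder_near (cder_comp (cder_e2pii z) Hc).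
  by exists (complex.Im z) => // h hh; apply: FE; exact: ball_uhp.
split=> z Hz; have [l Hl Hc] := K z Hz; first by exists (l * (twopii R * e z)).
rewrite /theta (derive1_cder Hc).
have -> : (twopii R)^-1 * (l * (twopii R * e z)) = e z * l.
  by field; exact: twopii_neq0.
move=> eps e0; have [N HN] := climZ (e z) Hl e0.
exists N.+1 => -[//|n] /HN; congr (nrm (_ - _) <= _).
rewrite /psum [RHS]big_ord_recl mul0r mul0r add0r mulr_sumr; apply: eq_bigr => i _.
rewrite lift0 /dcoef [e z ^+ i.+1]exprS; ring.
Qed.

Lemma qjet_theta f (a b : C) : hol f -> per1 f -> bdd f -> qjet f a b -> qjet (theta f) 0 b.
Proof.
move=> H1 H2 H3 H; have [c Hc] := qexp_of_bdd H1 H2 H3.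
have [_ <-] := qjet_uniq (qjet_of_q Hc) H.
by have [_ /qjet_of_q] := theta_q Hc; rewrite mul0r mul1r.
Qed.

Lemma hol_theta f : hol f -> hol (theta f).
Proof. by move=> H; apply: hol_mul; [exact: hol_cst | exact: hol_derive1]. Qed.

Definition sigma_log_coef (n : nat) : C := sigma_coef R n / n%:R.

Lemma sigma_log_coef_conv w : nrm w < 1 -> exists l, clim (psum sigma_log_coef w) l.
Proof.
move=> w1; apply: (@series_dom _ (fun n => sigma_log_coef n * w ^+ n) (fun n => n%:R ^+ 2 * nrm w ^+ n)).
  case=> [|n]; first by rewrite /sigma_log_coef mul0r mul0r nrm0 mulr_ge0 ?exprn_ge0 ?nrm_ge0.
  rewrite nrmM nrmX ler_wpM2r ?exprn_ge0 ?nrm_ge0// /sigma_log_coef nrmM nrmV !nrm_nat.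
  apply: (@le_trans _ _ (sigma1 n.+1)%:R); last by rewrite -natrX ler_nat sigma1_le.
  by rewrite ler_piMr// invf_le1 ?ltr0n// ler1n.
by move=> N; apply: sum_geom3; rewrite nrm_ge0.
Qed.

(* [Delta] is [q exp(-24 sum sigma_1(n) q^n / n)], which is visibly nonzero and has
   logarithmic derivative [-12 P]. *)
Definition sigma_log w : C := xget 0 [set l | clim (psum sigma_log_coef w) l].
Lemma sigma_log_ps : ps_on sigma_log_coef 1 sigma_log.
Proof. by move=> w /sigma_log_coef_conv; exact: xgetPex. Qed.

Lemma sigma_log_der w : nrm w < 1 -> exists2 l, cder sigma_log w l & w * l = sigma_gen w.
Proof.
move=> w1; have [l Hl Hc] := ps_der sigma_log_ps w1; exists l => //.
apply: clim_uniq (sigma_gen_clim w1) => eps e0; have [N HN] := climZ w Hl e0.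
exists N.+1 => -[//|n] /HN; congr (nrm (_ - _) <= _).
rewrite /psum [RHS]big_ord_recl mul0r add0r mulr_sumr; apply: eq_bigr => i _.
rewrite lift0 /dcoef /sigma_log_coef [w ^+ i.+1]exprS mulrA [_ * (_ / _)]mulrCA divff ?pnatr_eq0// mulr1; ring.
Qed.

Definition Delta z : C := e z * cexp (- 24 * sigma_log (e z)).

Lemma Delta_neq0 z : Delta z != 0.
Proof. exact: mulf_neq0 (e2pii_neq0 _) (cexp_neq0 _). Qed.

Lemma Delta_per : per1 Delta.
Proof. by move=> z _; rewrite /Delta e2piiD1. Qed.

Lemma Delta_cder z : uhp R z -> cder Delta z (twopii R * (- 12 * eisP z) * Delta z).
Proof.
move=> Hz; have [l Hl E] := sigma_log_der (nrm_e2pii_lt1 Hz).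
have H1 := cder_comp (cder_comp (cder_e2pii z) (cderZ (- 24) Hl)) (cder_cexp _).
apply: (cder_eql (cderM (cder_e2pii z) H1)).
rewrite /Delta eisPE// -E.
have n12 : (12 : C) != 0 by rewrite pnatr_eq0.
move: (cexp (- 24 * sigma_log (e z))) => x; move: (e z) (twopii R) => y p.
by field.
Qed.

Lemma Delta_hol : hol Delta.
Proof. by move=> z Hz; eexists; exact: Delta_cder. Qed.

(** The quotient of the two sides has derivative zero by [eisP_S], and it equals 1 at i, which is
    fixed by S and has i^12 = 1. *)
Lemma Delta_S t : uhp R t -> Delta (- t^-1) = t ^+ 12 * Delta t.
Proof.
have SE z : uhp R z -> uhp R (- z^-1).
  by move=> Hz; rewrite -moebius_S; apply: moebius_uhp => //; exact: SL2ZS.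
pose v z := z ^+ 12 * Delta z.
have nz z : uhp R z -> z != 0 by move=> Hz; apply: contraTneq Hz => ->; rewrite /uhp /= ltxx.
have v0 z : uhp R z -> v z != 0 by move=> Hz; exact: mulf_neq0 (expf_neq0 _ (nz z Hz)) (Delta_neq0 z).
pose phi z := Delta (- z^-1) / v z.
have H0 z : uhp R z -> cder phi z 0.
  move=> Hz; have z0 := nz z Hz.
  have H1 := cder_comp (cderN (cder_inv z0)) (Delta_cder (SE z Hz)).
  have H2 := cderM (cderX 12 (cder_id z)) (Delta_cder Hz).
  apply: (cder_eql (@cder_div _ (fun z => Delta (- z^-1)) v _ _ _ (v0 z Hz) H1 H2)).
  rewrite eisP_S// /v; move: (Delta (- z^-1)) (Delta z) (Delta_neq0 z) (eisP z) (twopii_neq0 R) => x y y0 P.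
  move: (twopii R) => p p0.
  by rewrite /=; field; rewrite y0 p0 z0.
move=> Ht; have Hi : uhp R (mk 0 1) by rewrite uhp_mk.
have := hol_const H0 Hi Ht.
have i2 : mk 0 1 ^+ 2 = -1 :> C by apply: cplxP; rewrite expr2 ?(cReM, cImM) /=; ring.
have iV : - (mk 0 1)^-1 = mk 0 1 :> C.
  have i0 : mk 0 1 != 0 :> C by exact: nz.
  by apply: (mulfI i0); rewrite mulrN divff// -expr2 i2.
have i12 : mk 0 1 ^+ 12 = 1 :> C by rewrite (_ : 12 = 2 * 6)%N// exprM i2 -signr_odd.
rewrite {2}/phi /v iV i12 mul1r divff ?Delta_neq0// => E.
have vt := v0 t Ht; rewrite -/(v t) -[RHS]mul1r -E /phi divfK//.
Qed.

Lemma slash_gen k f : (forall t, uhp R t -> f (- t^-1) = t ^ k * f t) -> per1 f -> slash k f.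
Proof.
move=> HS HP.
have step s : s \in SL2Z -> (forall t, uhp R t -> f (moebius s t) = autom_factor s t ^ k * f t) ->
   forall h : 'M[int]_2, h \in SL2Z -> (forall t, uhp R t -> f (moebius h t) = autom_factor h t ^ k * f t) ->
   forall t, uhp R t -> f (moebius (s *m h) t) = autom_factor (s *m h) t ^ k * f t.
  move=> sS Hs h hS Hh t Ht.
  by rewrite moebius_mul// autom_mul// Hs ?Hh ?expfzMl ?mulrA//; exact: moebius_uhp.
apply: (SL2Z_ind (Q := fun s => forall t, uhp R t -> f (moebius s t) = autom_factor s t ^ k * f t)).
- by move=> t _; rewrite moebius_1 autom_1 exp1rz mul1r.
- move=> h hS Hh; apply: (step _ SL2ZS _ h hS Hh) => t Ht.
  by rewrite moebius_S autom_S HS.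
- move=> h hS Hh; apply: (step _ SL2ZT _ h hS Hh) => t Ht.
  by rewrite moebius_T autom_T exp1rz mul1r HP.
- move=> h hS Hh; apply: (step _ SL2ZTV _ h hS Hh) => t Ht.
  rewrite moebius_TV autom_TV exp1rz mul1r.
  rewrite -[in RHS](subrK 1 t) HP//.
  by have := moebius_uhp SL2ZTV Ht; rewrite moebius_TV.
Qed.

Lemma Delta_slash : slash 12 Delta.
Proof.
apply: slash_gen; last exact: Delta_per.
by move=> t Ht; rewrite Delta_S.
Qed.

Lemma Delta_lb : exists2 d : R, 0 < d & forall z, uhp R z -> nrm (e z) < d ->
  expR (-1) * nrm (e z) <= nrm (Delta z) <= expR 1 * nrm (e z).
Proof.
have n0 : nrm (0 : C) < 1 by rewrite nrm0.
have G0 : sigma_log 0 = 0 by rewrite (ps_on0 ltr01 sigma_log_ps) /sigma_log_coef mul0r.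
(* This keeps the exponent -24 [sigma_log] within [-1, 1] in real part. *)
have e24 : 0 < 24^-1 :> R by lra.
have [d d0 Hd] := ps_cont sigma_log_ps n0 e24.
exists d => // z Hz /Hd; rewrite add0r G0 subr0 => h.
rewrite /Delta nrmM nrm_cexp [nrm (e z) * _]mulrC.
have hR : `|complex.Re (- 24 * sigma_log (e z))| <= 1.
  apply: le_trans (normRe_le _) _; rewrite nrmM nrmN nrm_nat; lra.
move: hR; rewrite ler_norml => /andP[h1 h2].
by rewrite !ler_wpM2r ?nrm_ge0// ler_expR.
Qed.

Lemma Delta_cusp_lim0 : cusp_lim Delta 0.
Proof.
move=> eps e0; have [d d0 Hd] := Delta_lb.
exists (Num.min d (eps / expR 1)); first by rewrite lt_min d0 divr_gt0 ?expR_gt0.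
move=> z Hz; rewrite lt_min ltr_pdivlMr ?expR_gt0// => /andP[/(Hd z Hz)/andP[_ h1] h2].
by rewrite subr0; lra.
Qed.

Lemma cusp_lim_bdd f (c : C) : cusp_lim f c -> bdd f.
Proof.
move=> /(_ 1 ltr01)[d d0 Hd]; exists (nrm c + 1), d; split => // z Hz /(Hd z Hz) h.
by have := nrmD (f z - c) c; rewrite subrK; lra.
Qed.

Lemma Delta_mf : modular_form 12 Delta.
Proof. by apply/modular_formP; split; [exact: Delta_hol|exact: Delta_slash|exact: cusp_lim_bdd Delta_cusp_lim0]. Qed.

Lemma mf_cusp_lim k f : modular_form k f -> exists c, cusp_lim f c.
Proof. by move=> /mf_q[a /qjet_of_q/qjet_cusp_lim]; exists (a 0%N). Qed.

(** [Delta] has no zero in the half-plane and is comparable to q at the cusp, so the quotient stays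
    holomorphic and bounded there. *)
Lemma cusp_div k f : modular_form k f -> cusp_lim f 0 ->
  exists h, modular_form (k - 12) h /\ forall z, uhp R z -> f z = Delta z * h z.
Proof.
move=> Hf f0; have [H1 H2 _] := (modular_formP k f).1 Hf.
exists (fun z => f z / Delta z); split; last by move=> z _; rewrite mulrC divfK// Delta_neq0.
apply/modular_formP; split.
- by apply: hol_mul => //; apply: hol_inv; [exact: Delta_hol | move=> z _; exact: Delta_neq0].
- move=> s sS t Ht; rewrite H2// Delta_slash//.
  have j0 := autom_neq0 sS Ht.
  have j12 : autom_factor s t ^ 12 != 0 by rewrite expfz_neq0.
  have -> : autom_factor s t ^ (k - 12) = autom_factor s t ^ k / autom_factor s t ^ 12.
    by rewrite invr_expz -expfzDr.
  move: (autom_factor s t ^ 12) j12 (autom_factor s t ^ k) (Delta t) (Delta_neq0 t) => x x0 y u u0.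
  by field; rewrite x0 u0.
- have [a Ha] := mf_q Hf.
  have [K [d [K0 d0 H]]] := qjet_of_q Ha.
  have a0 : a 0%N = 0 by exact: cusp_lim_uniq (qjet_cusp_lim (qjet_of_q Ha)) f0.
  have [d' d'0 H'] := Delta_lb.
  exists ((K + nrm (a 1%N)) / expR (-1)), (Num.min 1 (Num.min d d')); split; first by rewrite !lt_min ltr01 d0.
  move=> z Hz; rewrite !lt_min => /and3P[h0 /(H z Hz) h1 /(H' z Hz)/andP[h2 _]].
  have D0 : 0 < nrm (Delta z) by rewrite nrm_gt0; exact: Delta_neq0.
  rewrite nrmM nrmV ler_pdivrMr//.
  have E0 := expR_gt0 (-1 : R).
  have q0 := nrm_ge0 (e z); have b0 := nrm_ge0 (a 1%N).
  have b1 : nrm (f z) <= (K + nrm (a 1%N)) * nrm (e z).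
    move: h1; rewrite a0 add0r => h1; have := nrmD (f z - a 1%N * e z) (a 1%N * e z).
    rewrite subrK nrmM; have : K * nrm (e z) ^+ 2 <= K * nrm (e z).
      by rewrite ler_wpM2l// expr2 ler_piMr// ltW.
    lra.
  apply: le_trans b1 _.
  have : (K + nrm (a 1%N)) / expR (-1) * (expR (-1) * nrm (e z)) <= (K + nrm (a 1%N)) / expR (-1) * nrm (Delta z).
    by rewrite ler_wpM2l// divr_ge0 ?addr_ge0 ?(ltW E0).
  by rewrite mulrA divfK// gt_eqF.
Qed.

Lemma eisP_qjet : qjet (@eisP R) (- 12^-1) 2.
Proof.
have [K [d [K0 d0 _ H]]] := ps_taylor 2 ltr01 (@sigma_gen_ps R).
have S : qjet (fun z => sigma_gen (e z)) 0 1.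
  exists K, d; split => //; first exact: ltW.
  move=> z Hz /H; rewrite /psum !big_ord_recl big_ord0 /= mul0r expr1 !add0r addr0.
  by have -> : sigma1 1 = 1%N by rewrite /sigma1 /= big_seq1.
have := qjetD (qjet_cst (- 12^-1)) (qjetZ 2 S); rewrite mulr0 addr0 add0r mulr1.
by apply: qjet_eq => z Hz; rewrite eisPE.
Qed.

Lemma eisP_bdd : bdd (@eisP R). Proof. exact: cusp_lim_bdd (qjet_cusp_lim eisP_qjet). Qed.

(** Ramanujan's identity theta E_2 = (E_2^2 - E_4)/12 with E_2 = -12 P, taken as a definition:
    modularity then follows by differentiating the law of P. *)
Definition E4 z : C := 144 * (eisP z ^+ 2 + theta (@eisP R) z).

Lemma E4_qjet : qjet E4 1 240.
Proof.
have Q := qjetD (qjetM eisP_qjet eisP_qjet) (qjet_theta (@eisP_hol R) (@eisP_per R) eisP_bdd eisP_qjet).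
apply: qjet_eq (qjet_eql (qjetZ 144 Q) _ _) => [z _||].
- by rewrite /E4 expr2.
- by have n12 : (12 : C) != 0 by [rewrite pnatr_eq0]; field.
- by have n12 : (12 : C) != 0 by [rewrite pnatr_eq0]; field.
Qed.

Lemma E4_hol : hol E4.
Proof.
apply: hol_mul; first exact: hol_cst.
by apply: hol_add; [apply/hol_exp/eisP_hol | apply/hol_theta/eisP_hol].
Qed.

Lemma E4_slash : slash 4 E4.
Proof.
move=> s sS t Ht; have j0 := autom_neq0 sS Ht; have Ht' := moebius_uhp sS Ht.
have p0 := twopii_neq0 R.
have D1 := cder_comp (cder_moebius sS Ht) (hol_cder (@eisP_hol R) Ht').
have D2 := cderB (cderM (cderX 2 (cder_autom s t)) (hol_cder (@eisP_hol R) Ht))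
  (cderZ ((s 1 0)%:~R / twopii R) (cder_autom s t)).
have E : derive1 (@eisP R) (moebius s t) / autom_factor s t ^+ 2 =
    2 * autom_factor s t * (s 1 0)%:~R * eisP t + autom_factor s t ^+ 2 * derive1 (@eisP R) t
    - (s 1 0)%:~R / twopii R * (s 1 0)%:~R.
  have := cder_uniq (cder_near _ D1) D2; rewrite expr1; apply.
  exists (complex.Im t) => // x hx; rewrite eisP_law//; last exact: ball_uhp.
  by congr (_ - _); rewrite mulrAC.
have E' : derive1 (@eisP R) (moebius s t) = autom_factor s t ^+ 2 * (2 * autom_factor s t * (s 1 0)%:~R * eisP t + autom_factor s t ^+ 2 * derive1 (@eisP R) t
    - (s 1 0)%:~R / twopii R * (s 1 0)%:~R).
  by rewrite -E mulrC divfK// expf_neq0.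
rewrite /E4 /theta E' eisP_law//.
have -> : autom_factor s t ^ 4 = autom_factor s t ^+ 4 by [].
move: (autom_factor s t) (eisP t) (derive1 (@eisP R) t) (s 1 0)%:~R (twopii R) p0 => J P D c p p0.
by field.
Qed.

Lemma E4_mf : modular_form 4 E4.
Proof. by apply/modular_formP; split; [exact: E4_hol|exact: E4_slash|exact: cusp_lim_bdd (qjet_cusp_lim E4_qjet)]. Qed.

(** Likewise from theta E_4 = (E_2 E_4 - E_6)/3. *)
Definition E6 z : C := - 3 * modD 4 E4 z.

Lemma E6_qjet : qjet E6 1 (- 504).
Proof.
have P4 := slash_per E4_slash.
have T := qjet_theta E4_hol P4 (cusp_lim_bdd (qjet_cusp_lim E4_qjet)) E4_qjet.
have Q := qjetD T (qjetZ (4%:~R) (qjetM eisP_qjet E4_qjet)).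
apply: qjet_eq (qjet_eql (qjetZ (- 3) Q) _ _) => [z _||].
- by rewrite /E6 /modD mulrA.
- have n12 : (12 : C) != 0 by rewrite pnatr_eq0.
  by have -> : (4%:~R : C) = 4 by []; field.
- have n12 : (12 : C) != 0 by rewrite pnatr_eq0.
  by have -> : (4%:~R : C) = 4 by []; field.
Qed.

Lemma modD_hol k f : hol f -> hol (modD k f).
Proof.
move=> H; apply: hol_add; first by apply: hol_mul; [exact: hol_cst|exact: hol_derive1].
by apply: hol_mul => //; apply: hol_mul; [exact: hol_cst|exact: eisP_hol].
Qed.

Lemma E6_mf : modular_form 6 E6.
Proof.
apply/modular_formP; split; last exact: cusp_lim_bdd (qjet_cusp_lim E6_qjet).
  by apply: hol_mul; [exact: hol_cst | apply/modD_hol/E4_hol].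
move=> s sS t Ht; rewrite /E6 (@modD_law _ 4 E4 E4)//; try exact: E4_hol.
  by rewrite mulrCA.
exact: E4_slash.
Qed.

(** The quotient by [Delta] has weight 0; minus its value at the cusp it is divisible by [Delta]
    once more, and the new quotient has negative weight. The q-coefficient 1728 shows that the
    constant is not zero. *)
Lemma E4_E6_Delta : exists2 c : C, c != 0 & forall z, uhp R z -> E4 z ^+ 3 - E6 z ^+ 2 = c * Delta z.
Proof.
have A := qjetM (qjetM E4_qjet E4_qjet) E4_qjet; have B := qjetM E6_qjet E6_qjet.
have Q : qjet (fun z => E4 z ^+ 3 - E6 z ^+ 2) 0 1728.
  apply: qjet_eq (qjet_eql (qjetD A (qjetZ (-1) B)) _ _) => [z _||]; ring.
have M : modular_form 12 (fun z => E4 z ^+ 3 - E6 z ^+ 2).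
  apply: mf_sub; first exact: (mf_exp 3 E4_mf).
  exact: (mf_exp 2 E6_mf).
have [h [Hh E]] := cusp_div M (qjet_cusp_lim Q).
rewrite subrr in Hh.
have [c Hc] := mf_cusp_lim Hh.
have Mh := mf_sub Hh (mf_cst c).
have h0 : cusp_lim (fun z => h z - c) 0.
  by have := cusp_limD Hc (cusp_lim_cst (- c)); rewrite subrr.
have [h' [Hh' E']] := cusp_div Mh h0.
have hc z : uhp R z -> h z = c.
  move=> Hz; apply/eqP; rewrite -subr_eq0 E'// (mf_neg Hh')//.
  by rewrite mulr0.
exists c; last by move=> z Hz; rewrite E// hc// mulrC.
apply/eqP => c0.
have Z z : uhp R z -> E4 z ^+ 3 - E6 z ^+ 2 = 0.
  by move=> Hz; rewrite E// hc// c0; exact: mulr0.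
by have /eqP := qjet_uniq0 Z Q; rewrite pnatr_eq0.
Qed.

Lemma mf_weight0 f : modular_form 0 f -> exists c, eq_uhp f (fun=> c).
Proof.
move=> Hh; have [c Hc] := mf_cusp_lim Hh; exists c => z Hz.
have h0 : cusp_lim (fun z => f z - c) 0.
  by have := cusp_limD Hc (cusp_lim_cst (- c)); rewrite subrr.
have [h' [Hh' E']] := cusp_div (mf_sub Hh (mf_cst c)) h0.
by apply/eqP; rewrite -subr_eq0 E'// (mf_neg Hh')// mulr0.
Qed.

End Delta.

(** * Divisibility of modular forms *)

Section Factorial.
Variable R : realType.
Local Notation C := (cplx R).
Implicit Types (z t w : C) (f g h : C -> C) (k : int).
Local Notation e := (@e2pii R).

Lemma mf_weight k l f : modular_form k f -> k = l -> modular_form l f.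
Proof. by move=> H <-. Qed.

Lemma mf_odd k f : modular_form k f -> odd `|k|%N -> eq_uhp f (fun=> 0).
Proof.
move=> H ok z Hz.
have sS : mx2 (-1) 0 0 (-1) \in SL2Z by rewrite SL2ZE det_mx2.
have := mf_slash H sS Hz; rewrite /moebius /autom_factor.
have [-> -> -> ->] := mx2E (-1) 0 0 (-1).
rewrite mul0r add0r addr0 rmorphN1 mulN1r invrN1 mulrN1 opprK => E.
have h1 : ((-1) ^ k : C) = -1.
  case: k ok {H E} => n ok.
    by rewrite -exprnP -signr_odd (ok : odd n) expr1.
  have -> : ((-1) ^ (Negz n) : C) = ((-1) ^+ n.+1)^-1 by [].
  by rewrite -signr_odd (ok : odd n.+1) expr1 invrN1.
have : f z *+ 2 = 0 by rewrite mulr2n {1}E h1 mulN1r addNr.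
by move/eqP; rewrite mulrn_eq0 /= => /eqP.
Qed.

Lemma cusp_small k f : modular_form k f -> cusp_lim f 0 -> k < 12 -> eq_uhp f (fun=> 0).
Proof.
move=> H f0 k12; have [h [Hh E]] := cusp_div H f0.
by move=> z Hz; rewrite E// (mf_neg Hh) ?mulr0//; lia.
Qed.

Lemma cusp_lim_sub1 f m (c : C) : cusp_lim f c -> cusp_lim m 1 -> cusp_lim (fun z => f z - c * m z) 0.
Proof.
move=> Hf Hm; have := cusp_limD Hf (cusp_limM (cusp_lim_cst (- c)) Hm).
by rewrite mulr1 subrr; apply: cusp_lim_eq => z _; rewrite mulNr.
Qed.

Lemma E4_cusp_lim : cusp_lim (@E4 R) 1. Proof. exact: qjet_cusp_lim (E4_qjet R). Qed.
Lemma E6_cusp_lim : cusp_lim (@E6 R) 1. Proof. exact: qjet_cusp_lim (E6_qjet R). Qed.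

(** If a is the value at the cusp, then f^2 = a^2 E_4 and f^3 = a^3 E_6, because a form of weight
    below 12 vanishing at the cusp is zero. Comparing sixth powers gives a^6 (E_4^3 - E_6^2) = 0, so
    a = 0. *)
Lemma mf_two f : modular_form 2 f -> eq_uhp f (fun=> 0).
Proof.
move=> H; have [a Ha] := mf_cusp_lim H.
have A : eq_uhp (fun z => f z ^+ 2 - a ^+ 2 * E4 z) (fun=> 0).
  have Hm : modular_form 4 (fun z => f z ^+ 2 - a ^+ 2 * E4 z).
    exact: mf_sub (mf_weight (mf_exp 2 H) _) (mf_scale (a ^+ 2) (E4_mf R)).
  exact: (cusp_small Hm (cusp_lim_sub1 (cusp_limX 2 Ha) E4_cusp_lim)).
have B : eq_uhp (fun z => f z ^+ 3 - a ^+ 3 * E6 z) (fun=> 0).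
  have Hm : modular_form 6 (fun z => f z ^+ 3 - a ^+ 3 * E6 z).
    exact: mf_sub (mf_weight (mf_exp 3 H) _) (mf_scale (a ^+ 3) (E6_mf R)).
  exact: (cusp_small Hm (cusp_lim_sub1 (cusp_limX 3 Ha) E6_cusp_lim)).
have [c c0 HD] := E4_E6_Delta R.
suff a0 : a = 0 by rewrite a0 in Ha; exact: cusp_small H Ha _.
have Hi : uhp R (mk 0 1) by rewrite uhp_mk.
have := A _ Hi; have := B _ Hi; have := HD _ Hi.
have D0 := Delta_neq0 (mk 0 1 : C).
move: (f _) (E4 _) (E6 _) (Delta _) D0 => F X Y D D0 H1 /eqP; rewrite subr_eq0 => /eqP H2 /eqP.
rewrite subr_eq0 => /eqP H3.
have : a ^+ 6 * (c * D) = 0.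
  rewrite -H1; transitivity ((a ^+ 2 * X) ^+ 3 - (a ^+ 3 * Y) ^+ 2); first by ring.
  by rewrite -H2 -H3; ring.
move=> E; apply: contra_eq E => a0; exact: mulf_neq0 (expf_neq0 6 a0) (mulf_neq0 c0 D0).
Qed.

Lemma monomial (j : nat) : j != 1%N -> exists a b : nat, (2 * a + 3 * b = j)%N.
Proof.
move=> j1; case oj : (odd j).
  exists ((j - 3)./2), 1%N; have := odd_double_half (j - 3).
  have j3 : (3 <= j)%N by case: j j1 oj => [|[|[|j]]].
  rewrite oddB// oj /= add0n -mul2n => ->; by rewrite muln1 subnK.
by exists (j./2), 0%N; rewrite muln0 addn0 mul2n even_halfK// oj.
Qed.

Lemma monomial_mf (a b : nat) : modular_form (2 * (2 * a + 3 * b)%N%:Z) (fun z : C => E4 z ^+ a * E6 z ^+ b) /\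
  cusp_lim (fun z : C => E4 z ^+ a * E6 z ^+ b) 1.
Proof.
split; last by have := cusp_limM (cusp_limX a E4_cusp_lim) (cusp_limX b E6_cusp_lim); rewrite !expr1n mulr1.
by apply: mf_weight (mf_mul (mf_exp a (E4_mf R)) (mf_exp b (E6_mf R))) _; lia.
Qed.

Definition mf_dvd k l f g := exists h, modular_form (l - k) h /\ forall z, uhp R z -> g z = f z * h z.

Lemma mf_dvd0 k l f g : eq_uhp g (fun=> 0) -> mf_dvd k l f g.
Proof. by move=> H; exists (fun=> 0); split; [exact: mf0 | move=> z Hz; rewrite H// mulr0]. Qed.

(** Subtracting from f the multiple c P m, with m a monomial in E_4 and E_6 of weight k - 2p and c
    the value of f at the cusp, leaves a form divisible by [Delta]. The quotient again vanishes at z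
    and has weight k - 12, so induction applies. *)
Lemma prime_descent (p : nat) (P : C -> C) z : uhp R z -> (p = 2 \/ p = 3 \/ p = 6)%N ->
  modular_form (2 * p%:Z) P -> cusp_lim P 1 -> P z = 0 ->
  (forall a b : nat, ((2 * a + 3 * b < p)%N \/ (2 * a + 3 * b = p.+1)%N) -> E4 z ^+ a * E6 z ^+ b != 0) ->
  forall k f, modular_form k f -> f z = 0 -> mf_dvd (2 * p%:Z) k P f.
Proof.
move=> Hz Hp HP P1 Pz Hs.
suff main n k f : (k < n%:Z) -> modular_form k f -> f z = 0 -> mf_dvd (2 * p%:Z) k P f.
  by move=> k f; apply: (main (`|k|%N.+1)); lia.
elim: n k f => [|n IH] k f kn Hf fz; first by apply/mf_dvd0/(mf_neg Hf).
have [k0|k0] := ltP k 0; first by apply/mf_dvd0/(mf_neg Hf).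
case ok : (odd `|k|%N); first by apply/mf_dvd0/(mf_odd Hf).
pose j := (`|k|./2)%N.
have kj : k = 2 * j%:Z.
  have := odd_double_half `|k|; rewrite ok add0n -/j -mul2n; lia.
have [j1|j1] := eqVneq j 1%N.
  by apply/mf_dvd0/mf_two; apply: mf_weight Hf _; rewrite kj j1.
have [c Hc] := mf_cusp_lim Hf.
(* In these cases m would have negative weight or weight 2 and does not exist. But then f is a
   multiple of one monomial, which is nonzero at z by hypothesis, so f = 0. *)
have [small|large] := boolP ((j < p)%N || (j == p.+1)).
  have [a [b ab]] := monomial j1.
  have [Mm M1] := monomial_mf a b; rewrite ab -kj in Mm.
  have := cusp_div (mf_sub Hf (mf_scale c Mm)) (cusp_lim_sub1 Hc M1).
  move=> [h [Hh E]].
  have h0 : eq_uhp h (fun=> 0).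
    have [k12|k12] := ltP (k - 12) 0; first exact: mf_neg Hh k12.
    apply: mf_two; apply: mf_weight Hh _.
    by move: small => /orP[h1|/eqP h1]; case: Hp => [|[]] hp; lia.
  have fm w : uhp R w -> f w = c * (E4 w ^+ a * E6 w ^+ b).
    by move=> Hw; apply/eqP; rewrite -subr_eq0 E// h0// mulr0.
  have /eqP := fm z Hz; rewrite fz eq_sym mulf_eq0 (negbTE (Hs a b _)) ?orbF.
    by move=> /eqP c0; apply: mf_dvd0 => w Hw; rewrite fm// c0 mul0r.
  by rewrite ab; move: small => /orP[->|/eqP ->]; [left|right].
move: large; rewrite negb_or -leqNgt => /andP[pj jp].
have jp1 : (j - p)%N != 1%N by apply/eqP; move/eqP: jp; lia.
have [a [b ab]] := monomial jp1.
have [Mm M1] := monomial_mf a b; rewrite ab in Mm.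
set m := (fun w => _) in Mm M1.
have MPm : modular_form k (fun w => P w * m w).
  by apply: mf_weight (mf_mul HP Mm) _; lia.
have M2 : cusp_lim (fun w => P w * m w) 1 by have := cusp_limM P1 M1; rewrite mulr1.
have [h [Hh E]] := cusp_div (mf_sub Hf (mf_scale c MPm)) (cusp_lim_sub1 Hc M2).
have hz : h z = 0.
  have /eqP := E z Hz; rewrite fz Pz mul0r mulr0 subr0 eq_sym mulf_eq0.
  by rewrite (negbTE (Delta_neq0 z)) => /eqP.
have kn' : k - 12 < n%:Z by lia.
have [h' [Hh' E']] := IH _ _ kn' Hh hz.
exists (fun w => c * m w + Delta w * h' w); split.
  apply: mf_add; first by apply: mf_scale; apply: mf_weight Mm _; lia.
  by apply: mf_weight (mf_mul (Delta_mf R) Hh') _; lia.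
move=> w Hw; apply/eqP; rewrite -subr_eq0; apply/eqP.
have := E w Hw; rewrite E'//.
move: (f w) (P w) (m w) (Delta w) (h' w) => F X Y D H' K.
transitivity (F - c * (X * Y) - D * (X * H')); first by ring.
by rewrite K subrr.
Qed.

(* [None] is the point at infinity. *)
Definition valid_point (pt : option C) := if pt is Some z then uhp R z else True.
Definition vanishes (pt : option C) f := if pt is Some z then f z = 0 else cusp_lim f 0.

Definition nonzero f := ~ eq_uhp f (fun=> 0).

Lemma prime_at (pt : option C) : valid_point pt -> exists (p : nat) (P : C -> C),
  [/\ (0 < p)%N, modular_form (2 * p%:Z) P, nonzero P, vanishes pt P &
    forall k f, modular_form k f -> vanishes pt f -> mf_dvd (2 * p%:Z) k P f].
Proof.
case: pt => [z|] /= Hz; last first.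
  exists 6%N, (@Delta R); split => //.
  - exact: Delta_mf.
  - move=> /(_ (mk 0 1)); rewrite uhp_mk => /(_ ltr01)/eqP.
    by rewrite (negbTE (Delta_neq0 _)).
  - exact: Delta_cusp_lim0.
  - by move=> k f Hf f0; exact: cusp_div.
have nzct f : cusp_lim f 1 -> nonzero f.
  move=> H H0; have := cusp_lim_uniq H (cusp_lim_eq (eq_uhp_sym H0) (cusp_lim_cst 0)).
  by move/eqP; rewrite oner_eq0.
have [c c0 HD] := E4_E6_Delta R.
have D0 : E4 z ^+ 3 - E6 z ^+ 2 != 0 by rewrite HD// mulf_neq0// Delta_neq0.
have [z4|z4] := eqVneq (E4 z) 0.
  have z6 : E6 z != 0 by apply: contraNneq D0 => ->; rewrite z4 !expr0n subrr.
  exists 2%N, (@E4 R); split => //; [exact: E4_mf|exact/nzct/E4_cusp_lim|].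
  apply: (prime_descent Hz) => //; [by left|exact: E4_mf|exact: E4_cusp_lim|].
  (* 2a + 3b < 2 or 2a + 3b = 3 leaves powers of E_6 only, and E_6 does not vanish at z. *)
  move=> a b h; have -> : a = 0%N by lia.
  by rewrite expr0 mul1r expf_neq0.
have [z6|z6] := eqVneq (E6 z) 0.
  exists 3%N, (@E6 R); split => //; [exact: E6_mf|exact/nzct/E6_cusp_lim|].
  apply: (prime_descent Hz) => //; [by right; left|exact: E6_mf|exact: E6_cusp_lim|].
  move=> a b h; have -> : b = 0%N by lia.
  by rewrite expr0 mulr1 expf_neq0.
(* [K] is the value at the cusp of the combination vanishing at z, so dividing by it normalizes [P]
   to 1 there. *)
pose K := E6 z ^+ 2 - E4 z ^+ 3.
have K0 : K != 0 by rewrite -oppr_eq0 opprB.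
pose P w := K^-1 * (E6 z ^+ 2 * E4 w ^+ 3 - E4 z ^+ 3 * E6 w ^+ 2).
have HP : modular_form (2 * 6%:Z) P.
  by apply: mf_scale; apply: mf_sub; apply: mf_scale; [exact: (mf_exp 3 (E4_mf R))|exact: (mf_exp 2 (E6_mf R))].
have P1 : cusp_lim P 1.
  have := cusp_limM (cusp_lim_cst K^-1) (cusp_limD (cusp_limM (cusp_lim_cst (E6 z ^+ 2)) (cusp_limX 3 E4_cusp_lim)) (cusp_limM (cusp_lim_cst (- E4 z ^+ 3)) (cusp_limX 2 E6_cusp_lim))).
  rewrite !expr1n !mulr1 mulVf//; apply: cusp_lim_eq => w _.
  by rewrite /P mulNr.
exists 6%N, P; split => //; first exact: nzct.
  by rewrite /= /P mulrC [E6 z ^+ 2 * _]mulrC subrr mul0r.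
apply: (prime_descent Hz) => //; first by right; right.
  by rewrite /P mulrC [E6 z ^+ 2 * _]mulrC subrr mul0r.
by move=> a b _; rewrite mulf_neq0// expf_neq0.
Qed.

Lemma mul_cancel f g h : hol f -> hol g -> hol h -> nonzero f ->
  (forall z, uhp R z -> f z * g z = f z * h z) -> eq_uhp g h.
Proof.
move=> Hf Hg Hh nf H.
have Hd : hol (fun z => g z - h z).
  by apply: hol_add => //; apply: hol_eq (hol_mul (@hol_cst R (-1)) Hh) => z _; rewrite mulN1r.
have H0 z : uhp R z -> f z * (g z - h z) = 0 by move=> Hz; rewrite mulrBr H// subrr.
have [//|E] := hol_mul_eq0 Hf Hd H0.
by move=> z Hz; apply/eqP; rewrite -subr_eq0 E.
Qed.

Lemma vanishes_mul pt k l f g : valid_point pt -> modular_form k f -> modular_form l g ->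
  vanishes pt (fun z => f z * g z) -> vanishes pt f \/ vanishes pt g.
Proof.
case: pt => [z|] /= _ Hf Hg H.
  by move/eqP: H; rewrite mulf_eq0 => /orP[]/eqP; [left|right].
have [c Hc] := mf_cusp_lim Hf; have [c' Hc'] := mf_cusp_lim Hg.
have /esym/eqP := cusp_lim_uniq H (cusp_limM Hc Hc').
by rewrite mulf_eq0 => /orP[]/eqP E; [left|right]; rewrite -E.
Qed.

Lemma vanishes_mulr pt l f g : valid_point pt -> vanishes pt f -> modular_form l g -> vanishes pt (fun z => f z * g z).
Proof.
case: pt => [z|] /= _ H Hg; first by rewrite H mul0r.
by have [c Hc] := mf_cusp_lim Hg; have := cusp_limM H Hc; rewrite mul0r.
Qed.

Lemma vanishes_eq pt f g : valid_point pt -> eq_uhp f g -> vanishes pt f -> vanishes pt g.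
Proof. by case: pt => [z|] /= Hz E H; [rewrite -E | exact: cusp_lim_eq H]. Qed.

Lemma mf_weight_ge0 k f : modular_form k f -> nonzero f -> 0 <= k.
Proof. by move=> H n; have [//|k0] := leP 0 k; case: n; exact: mf_neg H k0. Qed.

(** The inverse of f is then a modular form of weight -k, and nonzero forms have nonnegative
    weight. *)
Lemma no_zero_const k f : modular_form k f -> (forall pt, valid_point pt -> ~ vanishes pt f) ->
  k = 0 /\ exists2 c : C, c != 0 & eq_uhp f (fun=> c).
Proof.
move=> Hf H; have [H1 H2 _] := (modular_formP k f).1 Hf.
have f0 z : uhp R z -> f z != 0 by move=> Hz; apply/eqP; exact: (H (Some z)).
have [c Hc] := mf_cusp_lim Hf.
have c0 : c != 0 by apply/eqP => E; apply: (H None I); rewrite /= -E.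
have Hi : uhp R (mk 0 1) by rewrite uhp_mk.
have nf : nonzero f by move=> /(_ _ Hi)/eqP; rewrite (negbTE (f0 _ Hi)).
have Hv : modular_form (- k) (fun z => (f z)^-1).
  apply/modular_formP; split; first exact: hol_inv.
    by move=> s sS t Ht; rewrite H2// invfM invr_expz.
  have nc : 0 < nrm c / 2 by rewrite divr_gt0// nrm_gt0.
  have [d d0 Hd] := Hc _ nc; exists (nrm c / 2)^-1, d; split => // z Hz /(Hd z Hz) h.
  rewrite nrmV lef_pV2 ?posrE ?nrm_gt0 ?f0//.
  by have := nrm_geB c (f z - c); rewrite subrKC; lra.
have k0 : k = 0.
  have := mf_weight_ge0 Hf nf.
  have nv : nonzero (fun z => (f z)^-1).
    by move=> /(_ _ Hi)/eqP; rewrite invr_eq0 (negbTE (f0 _ Hi)).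
  by have := mf_weight_ge0 Hv nv; lia.
split => //; rewrite k0 in Hf; have [c' Hc'] := mf_weight0 Hf.
by exists c' => //; have := f0 _ Hi; rewrite Hc'.
Qed.

Lemma nonzero_mull f g h : eq_uhp f (fun z => g z * h z) -> nonzero f -> nonzero g.
Proof. by move=> E n H; apply: n => z Hz; rewrite E// H// mul0r. Qed.
Lemma nonzero_mulr f g h : eq_uhp f (fun z => g z * h z) -> nonzero f -> nonzero h.
Proof. by move=> E n H; apply: n => z Hz; rewrite E// H// mulr0. Qed.

(** Common zeros, at the cusp included, are divided out one at a time; each prime form has positive
    weight, so the weight of f bounds the number of steps. *)
Lemma coprime_split k l f g : modular_form k f -> modular_form l g -> nonzero f ->
  exists (m : int) (d x y : C -> C),
   [/\ modular_form m d, modular_form (k - m) x, modular_form (l - m) y &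
   [/\ eq_uhp f (fun z => d z * x z), eq_uhp g (fun z => d z * y z) &
     forall pt, valid_point pt -> vanishes pt x -> vanishes pt y -> False]].
Proof.
move=> Hf Hg nf; have k0 := mf_weight_ge0 Hf nf.
suff main n k' l' f' g' : (k' < n%:Z) -> modular_form k' f' -> modular_form l' g' -> nonzero f' ->
  exists (m : int) (d x y : C -> C),
   [/\ modular_form m d, modular_form (k' - m) x, modular_form (l' - m) y &
   [/\ eq_uhp f' (fun z => d z * x z), eq_uhp g' (fun z => d z * y z) &
     forall pt, valid_point pt -> vanishes pt x -> vanishes pt y -> False]].
  by apply: (main (`|k|%N.+1)) => //; lia.
elim: n k' l' f' g' => [|n IH] a b u v an Hu Hv nu.
  by have := mf_weight_ge0 Hu nu; lia.
have [[pt [Hpt [pu pv]]]|N] := pselect (exists pt, valid_point pt /\ vanishes pt u /\ vanishes pt v); last first.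
  exists 0, (fun=> 1), u, v; split; [exact: mf_cst| | |split].
  - by rewrite subr0.
  - by rewrite subr0.
  - by move=> z _; rewrite mul1r.
  - by move=> z _; rewrite mul1r.
  - by move=> pt Hpt h1 h2; apply: N; exists pt.
have [p [P [p0 HP nP Pv HPd]]] := prime_at Hpt.
have [u1 [Hu1 Eu]] := HPd _ _ Hu pu; have [v1 [Hv1 Ev]] := HPd _ _ Hv pv.
have [|m [d [x [y [Hd Hx Hy [E1 E2 Hcop]]]]]] := IH _ _ _ _ _ Hu1 Hv1 (nonzero_mulr Eu nu).
  by move: p0 an; lia.
exists (2 * p%:Z + m), (fun z => P z * d z), x, y; split.
- exact: mf_mul.
- by apply: mf_weight Hx _; lia.
- by apply: mf_weight Hy _; lia.
- split=> // z Hz; first by rewrite Eu// E1// mulrA.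
  by rewrite Ev// E2// mulrA.
Qed.

(** A zero of x is a zero of y t and not of y, hence of t. It is divided out of x and t together,
    until x has no zero and is constant. *)
Lemma gauss_dvd k l m n (x y s t : C -> C) : modular_form k x -> modular_form l y ->
  modular_form m s -> modular_form n t -> nonzero x ->
  (forall pt, valid_point pt -> vanishes pt x -> vanishes pt y -> False) ->
  eq_uhp (fun z => x z * s z) (fun z => y z * t z) -> mf_dvd k n x t.
Proof.
move=> Hx Hy Hs Ht nx Hc E.
suff main N k' n' (x' t' : C -> C) : (k' < N%:Z) -> modular_form k' x' -> modular_form n' t' -> nonzero x' ->
    (forall pt, valid_point pt -> vanishes pt x' -> vanishes pt y -> False) ->
    eq_uhp (fun z => x' z * s z) (fun z => y z * t' z) -> mf_dvd k' n' x' t'.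
  by apply: (main (`|k|%N.+1)) => //; lia.
elim: N k' n' x' t' => [|N IH] a b u v aN Hu Hv nu cop E'.
  by have := mf_weight_ge0 Hu nu; lia.
have [[pt [Hpt pu]]|none] := pselect (exists pt, valid_point pt /\ vanishes pt u); last first.
  have [|a0 [c c0 uc]] := no_zero_const Hu _.
    by move=> pt Hpt h; apply: none; exists pt.
  exists (fun z => c^-1 * v z); split; first by apply: mf_scale; rewrite a0 subr0.
  by move=> z Hz; rewrite uc// mulVKf.
have [p [P [p0 HP nP Pv HPd]]] := prime_at Hpt.
have pv : vanishes pt v.
  have h1 := vanishes_eq Hpt E' (vanishes_mulr Hpt pu Hs).
  by have [h2|//] := vanishes_mul Hpt Hy Hv h1; case: (cop pt Hpt pu h2).
have [u1 [Hu1 Eu]] := HPd _ _ Hu pu; have [v1 [Hv1 Ev]] := HPd _ _ Hv pv.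
have E1 : eq_uhp (fun z => u1 z * s z) (fun z => y z * v1 z).
  apply: (mul_cancel (mf_hol HP) _ _ nP).
  - exact: hol_mul (mf_hol Hu1) (mf_hol Hs).
  - exact: hol_mul (mf_hol Hy) (mf_hol Hv1).
  - by move=> z Hz; rewrite mulrA -Eu// E'// Ev// mulrCA.
have [||h [Hh Eh]] := IH _ _ _ _ _ Hu1 Hv1 (nonzero_mulr Eu nu) _ E1.
- by move: p0 aN; lia.
- move=> q Hq q1 q2; apply: (cop q Hq) => //.
  apply: (vanishes_eq Hq _ (vanishes_mulr Hq q1 HP)) => z Hz.
  by rewrite Eu// mulrC.
exists h; split; first by apply: mf_weight Hh _; lia.
by move=> z Hz; rewrite Ev// Eh// Eu// mulrA.
Qed.

End Factorial.

(** * Polynomial growth at the cusp *)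

Section Growth.
Variable R : realType.
Local Notation C := (cplx R).
Implicit Types (z t w : C) (f g h : C -> C) (k l : int).
Local Notation e := (@e2pii R).
Local Notation "'tpi'" := (2 * pi : R).

(** A power of |z| and not of Im z, because the terms [cbinom] of a logarithmic expansion are
    polynomials in z and no periodicity confines Re z. *)
Definition poly_growth f := exists (M Y : R) (m : nat), [/\ 0 <= M, 0 < Y &
  forall z, Y <= complex.Im z -> nrm (f z) <= M * (1 + nrm z) ^+ m].

Lemma poly_growth_eq f g : eq_uhp f g -> poly_growth f -> poly_growth g.
Proof.
move=> E [M [Y [m [M0 Y0 H]]]]; exists M, Y, m; split => // z hz; rewrite -E ?H//.
exact: lt_le_trans hz.
Qed.

Lemma poly_growthD f g : poly_growth f -> poly_growth g -> poly_growth (fun z => f z + g z).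
Proof.
move=> [M [Y [m [M0 Y0 H]]]] [M' [Y' [m' [M'0 Y'0 H']]]].
exists (M + M'), (Num.max Y Y'), (maxn m m'); split; rewrite ?addr_ge0 ?lt_max ?Y0// => z.
rewrite ge_max => /andP[/H h1 /H' h2].
have z1 : 1 <= 1 + nrm z by rewrite lerDl nrm_ge0.
apply: le_trans (nrmD _ _) _; rewrite mulrDl; apply: lerD.
  by apply: le_trans h1 _; rewrite ler_wpM2l// ler_weXn2l// leq_maxl.
by apply: le_trans h2 _; rewrite ler_wpM2l// ler_weXn2l// leq_maxr.
Qed.

Lemma poly_growthM f g : poly_growth f -> poly_growth g -> poly_growth (fun z => f z * g z).
Proof.
move=> [M [Y [m [M0 Y0 H]]]] [M' [Y' [m' [M'0 Y'0 H']]]].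
exists (M * M'), (Num.max Y Y'), (m + m')%N; split; rewrite ?mulr_ge0 ?lt_max ?Y0// => z.
rewrite ge_max => /andP[/H h1 /H' h2].
by rewrite nrmM exprD mulrACA ler_pM ?nrm_ge0.
Qed.

Lemma poly_growth_cst (c : C) : poly_growth (fun=> c).
Proof. by exists (nrm c), 1, 0%N; split; rewrite ?nrm_ge0// => z _; rewrite expr0 mulr1. Qed.

Lemma poly_growth_id : poly_growth (fun z => z).
Proof. by exists 1, 1, 1%N; split => // z _; rewrite mul1r lerDr. Qed.

Lemma poly_growth_sum (I : finType) (F : I -> C -> C) : (forall i, poly_growth (F i)) -> poly_growth (fun z => \sum_i F i z).
Proof.
move=> H; suff : poly_growth (fun z => \sum_(i <- index_enum I) F i z) by [].
elim: (index_enum I) => [|i r IH]; first by apply: poly_growth_eq (poly_growth_cst 0) => z _; rewrite big_nil.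
by apply: poly_growth_eq (poly_growthD (H i) IH) => z _; rewrite big_cons.
Qed.

Lemma poly_growth_prod (I : finType) (F : I -> C -> C) : (forall i, poly_growth (F i)) -> poly_growth (fun z => \prod_i F i z).
Proof.
move=> H; suff : poly_growth (fun z => \prod_(i <- index_enum I) F i z) by [].
elim: (index_enum I) => [|i r IH]; first by apply: poly_growth_eq (poly_growth_cst 1) => z _; rewrite big_nil.
by apply: poly_growth_eq (poly_growthM (H i) IH) => z _; rewrite big_cons.
Qed.

Lemma poly_growthX f n : poly_growth f -> poly_growth (fun z => f z ^+ n).
Proof.
move=> H; elim: n => [|n IH]; first exact: poly_growth_cst.
by apply: poly_growth_eq (poly_growthM H IH) => z _; rewrite exprS.
Qed.

Lemma poly_growth_derive1 f : hol f -> poly_growth f -> poly_growth (derive1 f).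
Proof.
move=> Hf [M [Y [m [M0 Y0 H]]]].
exists (M * 2 ^+ m), (Y + 1), m; split; rewrite ?mulr_ge0 ?exprn_ge0//; first by lra.
move=> z hz; have z0 := nrm_ge0 z.
have r1 : 1 < complex.Im z by lra.
rewrite -mulrA -exprMn -[leRHS]divr1; apply: (cauchy_deriv Hf) => // w w1.
have := normIm_le w; rewrite w1 ler_norml => /andP[h1 h2].
apply: le_trans (H _ _) _; first by rewrite cImD; lra.
rewrite ler_wpM2l// lerXn2r ?nnegrE//; [by rewrite addr_ge0// nrm_ge0|by lra|].
by have := nrmD z w; rewrite w1; lra.
Qed.

Lemma bdd_growth f : bdd f -> poly_growth f.
Proof.
move=> [M [d [d0 H]]]; have [Y Y0 HY] := near_inf d0.
exists `|M|, Y, 0%N; split => // z hz; rewrite expr0 mulr1.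
apply: le_trans (ler_norm M); apply: H; last exact: HY.
exact: lt_le_trans hz.
Qed.

Lemma poly_growth_modD k f : hol f -> poly_growth f -> poly_growth (modD k f).
Proof.
move=> Hf P; apply: poly_growthD; first exact: poly_growthM (poly_growth_cst _) (poly_growth_derive1 Hf P).
exact: poly_growthM (poly_growthM (poly_growth_cst _) (bdd_growth (@eisP_bdd R))) P.
Qed.

Lemma modD_iter_hol k j f : hol f -> hol (modD_iter k j f).
Proof. by move=> H; elim: j => //= j; exact: modD_hol. Qed.

Lemma modD_iter_growth k j f : hol f -> poly_growth f -> poly_growth (modD_iter k j f).
Proof. by move=> H P; elim: j => //= j; apply: poly_growth_modD; exact: modD_iter_hol. Qed.

(** Weight-k invariance includes period 1, and polynomial growth is then o(1/q); the resulting
    q-expansion gives boundedness. *)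
Lemma mf_of_growth k f : hol f -> slash k f -> poly_growth f -> modular_form k f.
Proof.
move=> Hf Sf [M [Y [m [M0 Y0 H]]]]; apply/modular_formP; split => //.
have Pf := slash_per Sf.
have [a [Ha _]] := qexp_exists Hf Pf (growth_small (fun z hz _ => H z hz) Pf).
exact: bdd_of_qexp Ha.
Qed.

Lemma nrm_qpow (x : R) z : nrm (qpow x z) = expR (- (tpi * (x * complex.Im z))).
Proof. by rewrite nrm_e2pii cImM cRe_ofreal cIm_ofreal mul0r addr0. Qed.

Lemma laurent_bounded (a : int -> C) (mu : R) h :
  (forall n : int, n%:~R + mu < 0 -> a n = 0) ->
  (forall z, uhp R z -> is_laurent_sum a mu z (h z)) -> poly_growth h.
Proof.
move=> a0 H.
(* Convergence at height 1/2 bounds a_n by K x^(-n); at height at least 1 one has |q|^n <= x^(2n),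
   which leaves a geometric series in x. *)
pose z0 := mk 0 2^-1 : C; have Hz0 : uhp R z0 by rewrite uhp_mk invr_gt0.
have [v1 [v2 [/cvg_clim c1 _ _]]] := H _ Hz0.
pose x := nrm (e z0).
have x0 : 0 <= x := nrm_ge0 _.
have x1 : x < 1 by exact: nrm_e2pii_lt1.
have [K HK] : exists K : R, forall n, nrm (a n%:Z) * x ^+ n <= K.
  have c2 : clim (psum (fun n => a n%:Z) (e z0)) ((qpow mu z0)^-1 * v1).
    apply: clim_ext (climZ _ c1) => N; rewrite /series /= big_mkord mulr_sumr.
    apply: eq_bigr => n _; have -> : qpow (n%:R + mu) z0 = e z0 ^+ n * qpow mu z0.
      by rewrite -qpowE /qpow ofrealD mulrDl e2piiD.
    by rewrite mulrCA [_ * qpow mu z0]mulrC mulKf//; exact: e2pii_neq0.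
  have [K K0 HK] := psum_terms c2; exists K; exact: HK.
have K0 : 0 <= K by apply: le_trans (HK 0%N); rewrite mulr_ge0 ?nrm_ge0.
pose c := expR (- (tpi * mu)).
(* From [N] on the terms of negative index have exponent below 0, so their coefficients vanish and
   the second series is a finite sum. *)
pose N := `|Num.ceil mu|%N.
have ceilN n : (N <= n)%N -> mu < n.+1%:R.
  move=> hn; apply: le_lt_trans (ceil_ge mu) _.
  rewrite -[n.+1%:R]/(n.+1%:Z%:~R) ltr_int; move: hn; rewrite /N; case: (Num.ceil mu) => m; lia.
pose B2 := \sum_(n < N) nrm (a (- n.+1%:Z)).
have e_le1 (s : R) z : 1 <= complex.Im z -> 0 <= s -> nrm (qpow s z) <= nrm (qpow s (mk 0 1)).
  move=> hz s0; rewrite !nrm_qpow ler_expR lerN2 ler_pM2l ?twopi_gt0//= mulr1.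
  by rewrite ler_peMr.
exists (K * c * (1 - x)^-1 + B2), 1, 0%N; split => //.
  rewrite addr_ge0// ?mulr_ge0 ?expR_ge0 ?invr_ge0 ?subr_ge0 ?(ltW x1)//.
  by apply: sumr_ge0 => i _; exact: nrm_ge0.
move=> z hz; rewrite expr0 mulr1.
have Hz : uhp R z by exact: lt_le_trans hz.
have [u1 [u2 [/cvg_clim d1 /cvg_clim d2 ->]]] := H _ Hz.
apply: le_trans (nrmD _ _) _; apply: lerD.
  apply: (clim_nrm_le d1); exists 0%N => M _; rewrite /series /= big_mkord.
  apply: le_trans (nrm_sum _ _ _) _.
  apply: (@le_trans _ _ (\sum_(n < M) K * c * x ^+ n)); last first.
    rewrite -mulr_sumr ler_wpM2l ?mulr_ge0 ?expR_ge0//; apply: sum_geom1.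
    by rewrite x0 x1.
  apply: ler_sum => n _; rewrite nrmM.
  have [hn|hn] := ltP (n%:R + mu) 0.
    by rewrite (a0 n%:Z hn) nrm0 mul0r !mulr_ge0 ?expR_ge0 ?exprn_ge0.
  apply: (@le_trans _ _ (nrm (a n%:Z) * (x ^+ n * x ^+ n * c))).
    rewrite ler_wpM2l ?nrm_ge0//; apply: le_trans (e_le1 _ _ hz hn) _.
    rewrite nrm_qpow /= mulr1 /x nrm_e2pii /= /c -!expRM_natl -!expRD ler_expR.
    by move: (pi : R) => p; lra.
  have -> : nrm (a n%:Z) * (x ^+ n * x ^+ n * c) = nrm (a n%:Z) * x ^+ n * (c * x ^+ n) by ring.
  by rewrite -[leRHS]mulrA ler_wpM2r// mulr_ge0 ?expR_ge0 ?exprn_ge0.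
apply: (clim_nrm_le d2); exists N => M hM; rewrite /series /= big_mkord.
apply: le_trans (nrm_sum _ _ _) _.
rewrite /B2 (big_ord_widen _ (fun n : nat => nrm (a (- n.+1%:Z))) hM) [leRHS]big_mkcond /=.
apply: ler_sum => n _; rewrite nrmM; case: ltnP => hn.
  have [h1|h1] := ltP (- n.+1%:R + mu) 0.
    by rewrite (a0 (- n.+1%:Z)) ?nrm0 ?mul0r// mulrNz.
  rewrite ler_piMr ?nrm_ge0// nrm_qpow -[leRHS]expR0 ler_expR oppr_le0.
  by rewrite mulr_ge0 ?(ltW (twopi_gt0 R))// mulr_ge0// ltW.
by rewrite (a0 (- n.+1%:Z)) ?nrm0 ?mul0r// mulrNz; have := ceilN n hn; lra.
Qed.

End Growth.

(** * Wronskians *)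

Section Wronskian.
Variable R : realType.
Local Notation C := (cplx R).
Implicit Types (z t w : C) (f g h : C -> C) (k l : int).

(** Column j carries the derivative of order [u j]: [id] gives the Wronskian, other choices the
    numerators in Cramer's rule. *)
Definition wmx k n (u : nat -> nat) (fs : nat -> C -> C) z : 'M[C]_n :=
  \matrix_(i < n, j < n) modD_iter k (u j) (fs i) z.

Lemma hol_det n (M : C -> 'M[C]_n) : (forall i j, hol (fun z => M z i j)) -> hol (fun z => \det (M z)).
Proof.
move=> H; apply: hol_sum => s; apply: hol_mul; first exact: hol_cst.
by apply: hol_prod => i; exact: H.
Qed.

Lemma poly_growth_det n (M : C -> 'M[C]_n) : (forall i j, poly_growth (fun z => M z i j)) -> poly_growth (fun z => \det (M z)).
Proof.
move=> H; apply: poly_growth_sum => s; apply: poly_growthM; first exact: poly_growth_cst.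
by apply: poly_growth_prod => i; exact: H.
Qed.

Lemma wmx_hol k n u fs i j : (forall i, (i < n)%N -> hol (fs i)) -> hol (fun z => wmx k n u fs z i j).
Proof. by move=> H; apply: hol_eq (modD_iter_hol k (u j) (H i (ltn_ord i))) => z _; rewrite mxE. Qed.

Lemma hol_cofactor n (M : C -> 'M[C]_n) i j : (forall i j, hol (fun z => M z i j)) ->
  hol (fun z => cofactor (M z) i j).
Proof.
move=> H; apply: hol_mul; first exact: hol_cst.
apply: hol_det => a b; apply: hol_eq (H (lift i a) (lift j b)) => z _.
by rewrite !mxE.
Qed.

Lemma wmx_minor k n fs z : row' ord_max (col' ord_max (wmx k n.+1 id fs z)) = wmx k n id fs z.
Proof. by apply/matrixP => i j; rewrite !mxE !lift_max. Qed.

Lemma modD_cder k f z (l : C) : cder f z l -> modD k f z = (twopii R)^-1 * l + k%:~R * eisP z * f z.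
Proof. by move=> /derive1_cder E; rewrite /modD E. Qed.

(* Where the minor of the first n - 1 functions is nonzero, the last function is a
   combination of the others whose coefficients have zero derivative. *)
Lemma wronskian_dep k n fs : (forall i, (i < n)%N -> hol (fs i)) ->
  (forall z, uhp R z -> \det (wmx k n id fs z) = 0) ->
  exists c : nat -> C, (exists2 i, (i < n)%N & c i != 0) /\
    eq_uhp (fun z => \sum_(i < n) c i * fs i z) (fun=> 0).
Proof.
have Hi : uhp R (mk 0 1) by rewrite uhp_mk.
elim: n => [|n IH] Hf W0; first by have /eqP := W0 _ Hi; rewrite det_mx00 oner_eq0.
have Hf' i : (i < n)%N -> hol (fs i) by move=> h; apply: Hf; exact: ltnW.
have hW := hol_det (fun i j => wmx_hol k id i j Hf').
(* If the smaller Wronskian vanishes identically, the first n functions are already dependent. *)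
have [W'0|] := pselect (forall z, uhp R z -> \det (wmx k n id fs z) = 0).
  have [c [[i ni ci] Hc]] := IH Hf' W'0.
  exists (fun m => if (m < n)%N then c m else 0); split; first by exists i; rewrite ?ni// ltnW.
  move=> z Hz; rewrite big_ord_recr /= ltnn mul0r addr0 -[RHS](Hc z Hz).
  by apply: eq_bigr => m _; rewrite ltn_ord.
move=> /existsNP[t /not_implyP[Ht /eqP Wt]].
have [//|[d d0 Hd]] := zero_or_isolated hW Ht.
  by move=> W'0; rewrite W'0// eqxx in Wt.
pose r := Num.min d (complex.Im t).
have r0 : 0 < r by rewrite lt_min d0.
have near w : nrm w < r -> uhp R (t + w) /\ \det (wmx k n id fs (t + w)) != 0.
  rewrite lt_min => /andP[h1 h2]; split; first exact: ball_uhp.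
  by have [->|w0] := eqVneq w 0; [rewrite addr0 | have [] := Hd w w0 h1].
pose A z := wmx k n id fs z.
pose b z : 'rV[C]_n := \row_j modD_iter k j (fs n) z.
pose c z : 'rV[C]_n := (\det (A z))^-1 *: (b z *m \adj (A z)).
have cA z : \det (A z) != 0 -> c z *m A z = b z.
  by move=> h; rewrite -scalemxAl -mulmxA mul_adj_mx mul_mx_scalar scalerA mulVf// scale1r.
have rowE z j : \det (A z) != 0 -> uhp R z -> (j <= n)%N ->
    modD_iter k j (fs n) z = \sum_(i < n) c z 0 i * modD_iter k j (fs i) z.
  move=> Az Hz; have lo (j' : nat) : (j' < n)%N ->
      modD_iter k j' (fs n) z = \sum_(i < n) c z 0 i * modD_iter k j' (fs i) z.
    move=> h; have := congr1 (fun X : 'rV_n => X 0 (Ordinal h)) (cA z Az).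
    by rewrite !mxE => /esym E; rewrite [LHS]E; apply: eq_bigr => i _; rewrite [A _ _ _]mxE.
  rewrite leq_eqVlt => /orP[/eqP ->|]; last exact: lo.
  (* Orders below n are Cramer's rule. For order n, the row v M can be nonzero in its last entry
     only; multiplied by \adj M it gives 0 because det M = 0, and the last diagonal entry of \adj M
     is the nonzero minor. *)
  pose M := wmx k n.+1 id fs z.
  pose v : 'rV[C]_n.+1 := \row_i oapp (fun i' : 'I_n => - c z 0 i') 1 (insub (val i)).
  have vM (m : 'I_n.+1) : (v *m M) 0 m = modD_iter k m (fs n) z - \sum_(i < n) c z 0 i * modD_iter k m (fs i) z.
    rewrite mxE big_ord_recr /= addrC; congr (_ + _).
      by rewrite [v _ _]mxE [M _ _]mxE /= insubF ?ltnn//= mul1r.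
    by rewrite -sumrN; apply: eq_bigr => i _; rewrite [v _ _]mxE [M _ _]mxE /= valK /= mulNr.
  have : (v *m M *m \adj M) 0 ord_max = 0.
    by rewrite -mulmxA mul_mx_adj W0// raddf0 mulmx0 mxE.
  rewrite mxE big_ord_recr /= big1 ?add0r; last first.
    by move=> i _; rewrite vM /= lo// subrr mul0r.
  move/eqP; rewrite mulf_eq0 vM subr_eq0 /= => /orP[/eqP //|].
  by rewrite !mxE /cofactor wmx_minor addnn -signr_odd odd_double mul1r (negbTE Az).
have c_hol w (i : 'I_n) : nrm w < r -> exists l : C, cder (fun z => c z 0 i) (t + w) l.
  move=> /near[Hw nW].
  have h1 : hol (fun z => (b z *m \adj (A z)) 0 i).
    have : hol (fun z => \sum_(j < n) modD_iter k j (fs n) z * cofactor (A z) i j).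
      apply: hol_sum => j; apply: hol_mul; first by apply: modD_iter_hol; exact: Hf.
      by apply: hol_cofactor => a a'; exact: wmx_hol.
    by apply: hol_eq => z _; rewrite mxE; apply: eq_bigr => j _; rewrite !mxE.
  have [l1 Hl1] := h1 _ Hw; have [l2 Hl2] := hW _ Hw.
  eexists; apply: cder_ext (cderM (cderV nW Hl2) Hl1) => z.
  by rewrite [RHS]mxE.
have c_der0 w : nrm w < r -> forall i, cder (fun z => c z 0 i) (t + w) 0.
  move=> wr; have [Hw nW] := near w wr.
  pose l : 'rV[C]_n := \row_(i < n) (derive1 (fun z => c z 0 i) (t + w)).
  have Hl i : cder (fun z => c z 0 i) (t + w) (l 0 i).
    have [l' Hl'] := c_hol w i wr; rewrite mxE; apply: (cder_eql Hl').
    by rewrite (derive1_cder Hl').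
  suff l0 : l = 0 by move=> i; have := Hl i; rewrite l0 mxE.
  suff lA : l *m A (t + w) = 0.
    have : l *m A (t + w) *m \adj (A (t + w)) = 0 by rewrite lA mul0mx.
    rewrite -mulmxA mul_mx_adj mul_mx_scalar => /eqP.
    by rewrite scaler_eq0 (negbTE nW) => /eqP.
  apply/rowP => j; rewrite !mxE.
  have Hcd : cder (fun z => \sum_(i < n) c z 0 i * modD_iter k j (fs i) z) (t + w)
     (\sum_(i < n) (l 0 i * modD_iter k j (fs i) (t + w) + c (t + w) 0 i * derive1 (modD_iter k j (fs i)) (t + w))).
    by apply: cder_sum => i _; apply: cderM => //; apply: hol_cder => //; apply: modD_iter_hol; exact: Hf'.
  have Hcd' : cder (modD_iter k j (fs n)) (t + w)
     (\sum_(i < n) (l 0 i * modD_iter k j (fs i) (t + w) + c (t + w) 0 i * derive1 (modD_iter k j (fs i)) (t + w))).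
    apply: cder_near Hcd; exists (r - nrm w); first by rewrite subr_gt0.
    move=> v hv; rewrite -addrA; have hr : nrm (w + v) < r.
      by apply: le_lt_trans (nrmD _ _) _; rewrite -ltrBrDl.
    by have [h1 h2] := near _ hr; rewrite rowE// ltnW.
  (* Applying D to the relation of order j and subtracting that of order j+1 leaves the sum of c_i'
     D^j f_i equal to 0 for every j < n, so the row of the c_i' is killed by an invertible
     matrix. *)
  have E1 := rowE (t + w) j.+1 nW Hw (ltn_ord j).
  have E2 := modD_cder (k + (2 * j)%N%:Z) Hcd'.
  have E3 := rowE (t + w) j nW Hw (ltnW (ltn_ord j)).
  rewrite /= E2 E3 in E1; clear E2.
  have p0 : (twopii R)^-1 != 0 by rewrite invr_eq0; exact: twopii_neq0.
  apply: (mulfI p0); rewrite mulr0.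
  transitivity (\sum_(i < n) (twopii R)^-1 * (l 0 i * modD_iter k j (fs i) (t + w))).
    by rewrite mulr_sumr; apply: eq_bigr => i _; rewrite [A _ _ _]mxE.
  move/eqP: E1; rewrite -subr_eq0 !mulr_sumr -big_split -sumrB /= => /eqP E0; rewrite -[RHS]E0.
  apply: eq_bigr => i _; rewrite /modD.
  move: (l 0 i) (c _ 0 i) (derive1 _ _) (modD_iter _ _ _ _) (twopii R)^-1 (eisP _) => a1 a2 a3 a4 a5 a6.
  by move: ((k + _)%:~R : C) => a7; ring.
have c_const w i : nrm w < r -> c (t + w) 0 i = c t 0 i.
  move=> wr; apply: (@hol_const_near R (fun z => c z 0 i) t r r0 _ w wr) => v vr.
  exact: c_der0.
pose cc m : C := oapp (fun i : 'I_n => - c t 0 i) 1 (insub m).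
have ccn : cc n = 1 by rewrite /cc insubF ?ltnn.
exists cc; split; first by exists n; rewrite ?ccn ?oner_neq0.
have hS : hol (fun z => \sum_(i < n.+1) cc i * fs i z).
  by apply: hol_sum => i; apply: hol_mul; [exact: hol_cst | exact: Hf].
apply: (hol_identity hS Ht); exists r => // w wr; have [Hw nW] := near w wr.
rewrite big_ord_recr /= [fs n _](rowE _ 0%N nW Hw (leq0n _)).
rewrite ccn mul1r -big_split /= big1// => i _.
by rewrite c_const// /cc valK /= mulNr addNr.
Qed.

End Wronskian.

(** * Characters of the modular group *)

Section Character.
Variable R : realType.
Local Notation C := (cplx R).

(** In an abelian group S^2 = (ST)^3 becomes S T^3 = 1, and together with S^4 = 1 this gives T^12 =
    1. *)
Lemma character_exp12 (x : 'M[int]_2 -> C) : x 1%:M = 1 ->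
  {in SL2Z &, {morph x : g h / g *m h >-> g * h}} -> forall g, g \in SL2Z -> x g ^+ 12 = 1.
Proof.
move=> x1 xM; have SS := SL2ZS; have ST := SL2ZT; have SV := SL2ZTV.
have S4 : x matS ^+ 4 = 1.
  rewrite -x1 !exprS expr0 mulr1 -!xM ?SL2Z_mul//; congr x.
  by rewrite mx2_id /matS !mul_mx2.
have rel : x matS ^+ 2 = (x matS * x matT) ^+ 3.
  rewrite !exprS expr0 !mulr1 -!xM ?SL2Z_mul//; congr x.
  by rewrite matTE /matS !mul_mx2.
have S0 : x matS != 0 by apply/eqP => E; move/eqP: S4; rewrite E expr0n /= eq_sym oner_eq0.
have T3 : x matS * x matT ^+ 3 = 1.
  apply: (mulfI (expf_neq0 2 S0)); rewrite mulr1 {2}rel exprMn.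
  by move: (x matS) (x matT) => a b; ring.
have S12 : x matS ^+ 12 = 1 by rewrite (exprM _ 4 3) S4 expr1n.
have T12 : x matT ^+ 12 = 1.
  have : (x matS * x matT ^+ 3) ^+ 4 = 1 by rewrite T3 expr1n.
  by rewrite exprMn S4 mul1r -exprM.
have V12 : x matTV ^+ 12 = 1.
  have : x matT * x matTV = 1 by rewrite -xM// -x1; congr x; rewrite mx2_id matTE /matTV mul_mx2.
  by move=> E; rewrite -[LHS]mul1r -{1}T12 -exprMn E expr1n.
apply: SL2Z_ind => [|g gS H|g gS H|g gS H]; first by rewrite x1 expr1n.
- by rewrite xM// exprMn S12 H mulr1.
- by rewrite xM// exprMn T12 H mulr1.
- by rewrite xM// exprMn V12 H mulr1.
Qed.

Lemma expz_sum n (w : 'I_n -> int) (x : C) : x != 0 -> \prod_i x ^ (w i) = x ^ (\sum_i w i).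
Proof. by move=> x0; elim/big_rec2: _ => [|i y s _ ->]; rewrite ?expr0z ?expfzDr. Qed.

End Character.

(** * The differential equation *)

Section Components.
Variables (R : realType) (p : nat) (k : int).
Local Notation C := (cplx R).
Variables (rho : 'M[int]_2 -> 'M[C]_p) (F : C -> 'cV[C]_p).
Implicit Types (z t w : C).
Hypotheses (rhoP : is_repr rho) (HF : log_vvmf k rho F).

Lemma poly_growth_cbinom s : poly_growth (fun z : C => cbinom z s).
Proof.
apply: (@poly_growthM R (fun z => \prod_(i < s) (z - i%:R))); last exact: poly_growth_cst.
by apply: poly_growth_prod => i; apply: poly_growthD (poly_growth_id R) _; exact: poly_growth_cst.
Qed.

Lemma component_hol i : hol (component F i).
Proof. by case: HF => H _ _; apply/hol_derivable_uhp. Qed.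

(** Components are combinations of chain members, which are sums of polynomials in z times the
    series h_s; each h_s is bounded by [laurent_bounded]. *)
Lemma component_growth i : poly_growth (component F i).
Proof.
case: HF => _ _ [N [m [g [[_ _ Hs] Hc]]]].
have [|c Hc'] := Hs (component F i).
  exists (fun j => (j == i)%:R) => z _.
  by rewrite (bigD1 i)//= eqxx mul1r big1 ?addr0// => j /negbTE ->; rewrite mul0r.
apply: poly_growth_eq (eq_uhp_sym Hc') _ => /=; apply: poly_growth_sum => -[b j] /=.
apply: poly_growthM; first exact: poly_growth_cst.
have [mu [h [a [_ Hg Hh Ha]]]] := Hc b.
apply: (@poly_growth_eq R (fun z => \sum_(s < j.+1) cbinom z s * h (j - s)%N z)).
  by move=> z Hz; rewrite Hg.
apply: poly_growth_sum => s; apply: poly_growthM; first exact: poly_growth_cbinom.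
have js : (j - s < m b)%N by apply: leq_ltn_trans (ltn_ord j); exact: leq_subr.
by apply: (laurent_bounded (fun n => Ha _ n js)) => z Hz; exact: Hh.
Qed.

(* Indexing by [nat] lets one adjoin [f] as an extra component. *)
Definition comps (f : C -> C) (i : nat) : C -> C := oapp (component F) f (insub i).

Lemma compsE f (i : 'I_p) : comps f i = component F i.
Proof. by rewrite /comps valK. Qed.
Lemma comps_last f : comps f p = f.
Proof. by rewrite /comps insubF ?ltnn. Qed.

Lemma component_law g i t : g \in SL2Z -> uhp R t ->
  component F i (moebius g t) = autom_factor g t ^ k * \sum_j rho g i j * component F j t.
Proof.
move=> gS Ht; case: HF => _ /(_ g gS t Ht) H _.
have := congr1 (fun X : 'cV_p => X i 0) H; rewrite !mxE => <-.
by rewrite /component mulrA -expfzDr ?autom_neq0// subrr expr0z mul1r.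
Qed.

Lemma modD_lin l (I : finType) (a : I -> C) (u : I -> C -> C) t : (forall i, hol (u i)) -> uhp R t ->
  modD l (fun z => \sum_i a i * u i z) t = \sum_i a i * modD l (u i) t.
Proof.
move=> H Ht.
rewrite (@modD_cder R l _ t (\sum_i a i * derive1 (u i) t)); last first.
  by apply: cder_sum => i _; apply: cderZ; exact: hol_cder.
rewrite !mulr_sumr -big_split; apply: eq_bigr => i _ /=; rewrite /modD.
move: (a i) (derive1 _ _) (u i t) (twopii R)^-1 (eisP _) => a1 a2 a3 a4 a5.
by move: (l%:~R : C) => a6; ring.
Qed.

Lemma modD_iter_law j g i t : g \in SL2Z -> uhp R t ->
  modD_iter k j (component F i) (moebius g t) =
  autom_factor g t ^ (k + (2 * j)%N%:Z) * \sum_l rho g i l * modD_iter k j (component F l) t.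
Proof.
move=> gS; elim: j i t => [|j IH] i t Ht; first by rewrite /= muln0 addr0; exact: component_law.
have Hj l : hol (modD_iter k j (component F l)) by apply: modD_iter_hol; exact: component_hol.
rewrite /= (modD_law gS (Hj i) _ (fun t Ht => IH i t Ht))//; last first.
  by apply: hol_sum => l; apply: hol_mul => //; exact: hol_cst.
rewrite modD_lin//; congr (_ ^ _ * _); lia.
Qed.

(** The default [fun=> 0] is never reached, since the matrix has just p rows. *)
Definition wronsk (u : nat -> nat) z := \det (wmx k p u (comps (fun=> 0)) z).
Definition wronsk_weight (u : nat -> nat) : int := \sum_(j < p) (k + (2 * u j)%N%:Z).

Lemma wronsk_law u g t : g \in SL2Z -> uhp R t ->
  wronsk u (moebius g t) = \det (rho g) * (autom_factor g t ^ wronsk_weight u * wronsk u t).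
Proof.
move=> gS Ht.
have -> : wronsk u (moebius g t) = \det (rho g *m wmx k p u (comps (fun=> 0)) t *m
    diag_mx (\row_(j < p) autom_factor g t ^ (k + (2 * u j)%N%:Z))).
  congr (\det _); apply/matrixP => i j; rewrite mul_mx_diag !mxE compsE modD_iter_law// mulrC.
  by congr (_ * _); apply: eq_bigr => l _; rewrite mxE compsE.
rewrite !det_mulmx det_diag -mulrA; congr (_ * _); rewrite mulrC; congr (_ * _).
rewrite -expz_sum ?autom_neq0//; apply: eq_bigr => j _; by rewrite mxE.
Qed.

Lemma wronsk_hol u : hol (wronsk u).
Proof. by apply: hol_det => i j; apply: wmx_hol => l lp; rewrite (compsE _ (Ordinal lp)); exact: component_hol. Qed.

Lemma wronsk_growth u : poly_growth (wronsk u).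
Proof.
apply: poly_growth_det => i j; apply: (@poly_growth_eq R (modD_iter k (u j) (component F i))).
  by move=> z _; rewrite mxE compsE.
by apply: modD_iter_growth; [exact: component_hol|exact: component_growth].
Qed.

(* The factor [wronsk id ^+ 11] cancels the character [det rho], whose order divides 12. *)
Definition gcoef (u : nat -> nat) z := wronsk id z ^+ 11 * wronsk u z.

Lemma gcoef_mf u : modular_form (11 * wronsk_weight id + wronsk_weight u) (gcoef u).
Proof.
have x12 : forall g, g \in SL2Z -> \det (rho g) ^+ 12 = 1.
  apply: (@character_exp12 R (fun g => \det (rho g))); case: rhoP => _ H1 HM.
    by rewrite H1 det1.
  by move=> g h gS hS; rewrite HM// det_mulmx.
apply: mf_of_growth.
- by apply: hol_mul (wronsk_hol u); apply: hol_exp; exact: wronsk_hol.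
- move=> g gS t Ht; rewrite /gcoef !wronsk_law// expfzDr ?autom_neq0//.
  have -> : autom_factor g t ^ (11 * wronsk_weight id) = (autom_factor g t ^ wronsk_weight id) ^+ 11 by rewrite mulrC -exprz_exp.
  rewrite -[RHS]mul1r -(x12 g gS).
  move: (autom_factor g t ^ wronsk_weight id) (autom_factor g t ^ wronsk_weight u) (\det _) (wronsk _ _) (wronsk _ _) => a b c x y; ring.
- by apply: poly_growthM (wronsk_growth u); apply: poly_growthX; exact: wronsk_growth.
Qed.

Hypothesis HI : lin_indep (component F).

Lemma wronsk_nonzero : nonzero (wronsk id).
Proof.
move=> H.
have [c [[i ip ci] Hc]] : exists c : nat -> C, (exists2 i, (i < p)%N & c i != 0) /\
    eq_uhp (fun z => \sum_(i < p) c i * comps (fun=> 0) i z) (fun=> 0).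
  apply: (@wronskian_dep R k) => // i ip; rewrite (compsE _ (Ordinal ip)); exact: component_hol.
have E : eq_uhp (fun z => \sum_(j < p) c j * component F j z) (fun=> 0).
  by move=> z Hz; rewrite -[RHS](Hc z Hz); apply: eq_bigr => l _; rewrite compsE.
by have /eqP := HI E (Ordinal ip); rewrite (negbTE ci).
Qed.

(** Column s of the Wronskian is exchanged for the derivative of order p, as in Cramer's rule. *)
Definition swap (s : nat) (j : nat) := if j == s then p else j.

Lemma cramer z (i : 'I_p) : wronsk id z * modD_iter k p (component F i) z =
  \sum_(s < p) wronsk (swap s) z * modD_iter k s (component F i) z.
Proof.
pose A := wmx k p id (comps (fun=> 0)) z.
pose b : 'cV[C]_p := \col_i modD_iter k p (component F i) z.
have : A *m (\adj A *m b) = \det A *: b by rewrite mulmxA mul_mx_adj mul_scalar_mx.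
move=> /(congr1 (fun X : 'cV_p => X i 0)); rewrite [RHS]mxE [b _ _]mxE => E.
rewrite -[LHS]E mxE; apply: eq_bigr => s _; rewrite mulrC; congr (_ * _); last by rewrite mxE compsE.
rewrite mxE /wronsk (expand_det_col _ s); apply: eq_bigr => l _; rewrite mulrC; congr (_ * _).
  by rewrite !mxE compsE /swap eqxx.
rewrite !mxE /cofactor; congr (_ * \det _); apply/matrixP => a c; rewrite !mxE /swap.
by rewrite (negbTE (_ : lift s c != s :> nat))// eq_sym; exact: neq_lift.
Qed.

Lemma wronsk_weight_swap (s : 'I_p) : wronsk_weight (swap s) = wronsk_weight id + 2 * (p - s)%N%:Z.
Proof.
rewrite /wronsk_weight (bigD1 s)//= [in RHS](bigD1 s)//= /swap eqxx.
rewrite (eq_bigr (fun j : 'I_p => k + (2 * j)%N%:Z)); last by move=> j /negbTE; rewrite -val_eqE /= => ->.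
move: (\sum_(_ < p | _) _) => S; have := ltn_ord s; lia.
Qed.

(** The coefficient of D^(p-j) is the numerator with column p - j replaced, brought to the other
    side of Cramer's identity. *)
Definition wronsk_mlde (j : nat) z := if j == 0%N then gcoef id z else - gcoef (swap (p - j)) z.

(** [absz] changes nothing once the components are independent: [gcoef id] is then a nonzero form of
    this weight. *)
Definition mlde_weight : nat := absz (12 * wronsk_weight id)%R.

Lemma gcoef_nonzero : nonzero (gcoef id).
Proof.
move=> H; have [|//] := hol_mul_eq0 (hol_exp 11 (wronsk_hol id)) (wronsk_hol id) H; last exact: wronsk_nonzero.
move=> H11; apply: wronsk_nonzero => z Hz; apply/eqP; have := H11 z Hz.
by apply: contra_eqT => w0; exact: expf_neq0 11 w0.
Qed.

Lemma mlde_weightE : mlde_weight%:Z = 12 * wronsk_weight id.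
Proof.
have := mf_weight_ge0 (gcoef_mf id) gcoef_nonzero; rewrite /mlde_weight; lia.
Qed.

Lemma wronsk_mlde_coefs : mlde_coefs p mlde_weight wronsk_mlde.
Proof.
split=> [j jp|]; last exact: gcoef_nonzero.
rewrite PoszD mlde_weightE /wronsk_mlde; have [->|j0] := eqVneq j 0%N.
  by apply: mf_weight (gcoef_mf id) _; lia.
have sp : (p - j < p)%N by move: jp j0; lia.
apply: (@mf_eq R _ (fun z => -1 * gcoef (swap (p - j)) z)); first by move=> z _; rewrite mulN1r.
apply: mf_scale; apply: mf_weight (gcoef_mf _) _.
by rewrite (wronsk_weight_swap (Ordinal sp)) /= subKn//; lia.
Qed.

Lemma wronsk_mlde_sat i : satisfies_mlde p k wronsk_mlde (component F i).
Proof.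
move=> z Hz; rewrite big_ord_recl /= subn0 /wronsk_mlde /= /gcoef -mulrA cramer.
rewrite (reindex_inj rev_ord_inj) /= mulr_sumr -big_split /= big1// => s _.
by rewrite /bump /= add1n mulNr mulrA subrr.
Qed.

(** The coefficients of the equation form a vector in the kernel of the Wronskian matrix of order p
    + 1; multiplying by the adjugate isolates its last entry g_0. *)
Lemma mlde_wronsk g f : hol f -> satisfies_mlde p k g f -> (forall i, satisfies_mlde p k g (component F i)) ->
  forall z, uhp R z -> g 0%N z * \det (wmx k p.+1 id (comps f) z) = 0.
Proof.
move=> Hf Sf SF z Hz; pose M := wmx k p.+1 id (comps f) z.
pose c : 'cV[C]_p.+1 := \col_(s < p.+1) g (p - s)%N z.
have Mc : M *m c = 0.
  apply/matrixP => i o; rewrite !mxE (reindex_inj rev_ord_inj) /=.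
  have E h : satisfies_mlde p k g h -> \sum_(s < p.+1) modD_iter k (p - s) h z * g s z = 0.
    by move=> /(_ z Hz) E0; rewrite -[RHS]E0; apply: eq_bigr => s _; rewrite mulrC.
  transitivity (\sum_(s < p.+1) modD_iter k (p - s) (comps f i) z * g s z).
    apply: eq_bigr => s _; rewrite !mxE /=; have := ltn_ord s => sp.
    by rewrite !subSS subKn.
  apply: E; have [ip|pi] := ltnP i p; first by rewrite (compsE f (Ordinal ip)).
  have -> : (i : nat) = p by apply/eqP; rewrite eqn_leq pi -ltnS ltn_ord.
  by rewrite comps_last.
have : \adj M *m (M *m c) = 0 by rewrite Mc mulmx0.
rewrite mulmxA mul_adj_mx mul_scalar_mx => /(congr1 (fun X : 'cV_p.+1 => X ord_max 0)).
by rewrite !mxE /= subnn mulrC.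
Qed.

Lemma mlde_basis l g : mlde_coefs p l g -> (forall i, satisfies_mlde p k g (component F i)) ->
  is_basis_of (component F) (mlde_solutions p k g).
Proof.
move=> [Hg g0] SF; split => //; first by move=> i; split => //; apply/hol_derivable_uhp; exact: component_hol.
move=> f [/hol_derivable_uhp Hf Sf].
have Hc i : (i < p.+1)%N -> hol (comps f i).
  rewrite ltnS leq_eqVlt => /orP[/eqP ->|ip]; first by rewrite comps_last.
  by rewrite (compsE _ (Ordinal ip)); exact: component_hol.
have W0 : eq_uhp (fun z => \det (wmx k p.+1 id (comps f) z)) (fun=> 0).
  have hW : hol (fun z => \det (wmx k p.+1 id (comps f) z)).
    by apply: hol_det => i j; exact: wmx_hol.
  by have [] := hol_mul_eq0 (mf_hol (Hg 0%N (leq0n _))) hW (mlde_wronsk Hf Sf SF).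
have [c [[i ip ci] Ec]] := wronskian_dep Hc W0.
have Ec' z : uhp R z -> \sum_(i < p) c i * component F i z + c p * f z = 0.
  move=> Hz; have := Ec z Hz; rewrite big_ord_recr /= comps_last => E0; rewrite -[RHS]E0.
  by congr (_ + _); apply: eq_bigr => s _; rewrite compsE.
have cp : c p != 0.
  apply/eqP => cp; have c0 (j : 'I_p) : c j = 0.
    have E : eq_uhp (fun z => \sum_(j < p) c j * component F j z) (fun=> 0).
      by move=> z Hz; have := Ec' z Hz; rewrite cp mul0r addr0.
    exact: HI E j.
  move: ip ci; rewrite ltnS leq_eqVlt => /orP[/eqP ->|ip]; first by rewrite cp eqxx.
  by rewrite (c0 (Ordinal ip)) eqxx.
exists (fun i : 'I_p => - (c p)^-1 * c i) => z Hz; apply: (mulfI cp).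
have /eqP := Ec' z Hz; rewrite addrC addr_eq0 => /eqP ->.
rewrite mulr_sumr -sumrN; apply: eq_bigr => s _.
by rewrite !mulrA mulrN mulfV// mulN1r mulNr.
Qed.

Lemma mlde_solve g i z : uhp R z -> satisfies_mlde p k g (component F i) ->
  g 0%N z * modD_iter k p (component F i) z + \sum_(s < p) g (p - s)%N z * modD_iter k s (component F i) z = 0.
Proof.
move=> Hz /(_ z Hz) E0; rewrite -[RHS]E0 big_ord_recl subn0; congr (_ + _).
rewrite (reindex_inj rev_ord_inj) /=; apply: eq_bigr => s _.
have sp := ltn_ord s; rewrite /bump /=.
by congr (g _ z * modD_iter k _ _ z); lia.
Qed.

Lemma mlde_prop g g' : (forall i, satisfies_mlde p k g (component F i)) ->
  (forall i, satisfies_mlde p k g' (component F i)) ->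
  forall (s : 'I_p) z, uhp R z -> wronsk id z * (g 0%N z * g' (p - s)%N z) = wronsk id z * (g' 0%N z * g (p - s)%N z).
Proof.
move=> H H' s z Hz; pose A := wmx k p id (comps (fun=> 0)) z.
pose v : 'cV[C]_p := \col_(s < p) (g 0%N z * g' (p - s)%N z - g' 0%N z * g (p - s)%N z).
have Av : A *m v = 0.
  apply/matrixP => i o; rewrite !mxE.
  have E1 := mlde_solve Hz (H i); have E2 := mlde_solve Hz (H' i).
  transitivity (g 0%N z * (\sum_(s < p) g' (p - s)%N z * modD_iter k s (component F i) z) -
     g' 0%N z * (\sum_(s < p) g (p - s)%N z * modD_iter k s (component F i) z)).
    rewrite !mulr_sumr -sumrB; apply: eq_bigr => j _; rewrite !mxE compsE.
    move: (modD_iter _ _ _ _) (g 0%N z) (g' 0%N z) (g _ z) (g' _ z) => a1 a2 a3 a4 a5; ring.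
  move: (\sum_(_ < _) _) E1 (\sum_(_ < _) _) E2 => S1 E1 S2 E2.
  rewrite addrC in E1; rewrite addrC in E2.
  by move/eqP: E1; move/eqP: E2; rewrite !addr_eq0 => /eqP -> /eqP ->; ring.
have : \adj A *m (A *m v) = 0 by rewrite Av mulmx0.
rewrite mulmxA mul_adj_mx mul_scalar_mx => /(congr1 (fun X : 'cV_p => X s 0)).
by rewrite !mxE mulrBr => /eqP; rewrite subr_eq0 => /eqP.
Qed.

End Components.

(** * The ideal of leading coefficients *)

Section WeightSeparation.
Variable R : realType.
Local Notation C := (cplx R).
Implicit Types (z t w : C) (f g h : C -> C) (k l : int).

(* [f] transforms under a matrix with bottom row (1, d) by the factor
   (z + d)^k, a polynomial in d. *)
Lemma weight_sep (I J : finType) (v : I -> int) (u : I -> C -> C) (v' : J -> int) (u' : J -> C -> C) :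
  (forall i, modular_form (v i) (u i)) -> (forall j, modular_form (v' j) (u' j)) ->
  eq_uhp (fun z => \sum_i u i z) (fun z => \sum_j u' j z) ->
  forall x, eq_uhp (fun z => \sum_(i | v i == x) u i z) (fun z => \sum_(j | v' j == x) u' j z).
Proof.
move=> Hu Hu' E x z Hz.
have neg (K : finType) (a : K -> int) (b : K -> C -> C) : (forall i, modular_form (a i) (b i)) ->
    forall i, a i < 0 -> forall w, uhp R w -> b i w = 0.
  by move=> H i ai; exact: mf_neg (H i) ai.
have [x0|x0] := ltP x 0.
  by rewrite !big1// => i /eqP ix; [rewrite (neg _ _ _ Hu')|rewrite (neg _ _ _ Hu)]; rewrite ?ix.
(* The sum is read as a polynomial in the automorphy factor z + d; [absz] is harmless because forms
   of negative weight vanish. *)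
pose P (K : finType) (a : K -> int) (b : K -> C -> C) : {poly C} := \sum_i (b i z)%:P * 'X^(`|a i|).
have Px (K : finType) (a : K -> int) (b : K -> C -> C) : (forall i, modular_form (a i) (b i)) ->
    (P K a b)`_(`|x|) = \sum_(i | a i == x) b i z.
  move=> H; rewrite coef_sum [RHS]big_mkcond; apply: eq_bigr => i _.
  rewrite coefCM coefXn; have [a0|a0] := ltP (a i) 0.
    by rewrite (neg _ _ _ H)// mul0r; case: ifP.
  have -> : (`|x|%N == `|a i|%N) = (a i == x) by lia.
  by case: ifP; rewrite ?mulr1 ?mulr0.
rewrite -!Px//; suff -> : P I v u = P J v' u' by [].
apply/eqP; rewrite -subr_eq0; apply/eqP.
set D := P _ _ _ - P _ _ _.
(* [size D] exceeds the degree of a nonzero D by one, so this many distinct roots force D = 0. *)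
pose rs : seq C := [seq z + n%:R | n <- iota 0 (size D)].
apply: (@roots_geq_poly_eq0 _ D rs); last by rewrite size_map size_iota.
  apply/allP => y /mapP[n _ ->]; rewrite /root.
  pose gm := mx2 0 (-1) 1 n%:Z.
  have gS : gm \in SL2Z by rewrite SL2ZE det_mx2 mul0r mulN1r opprK add0r.
  have Hm := moebius_uhp gS Hz.
  have af : autom_factor gm z = z + n%:R.
    by rewrite /autom_factor /gm; have [_ _ -> ->] := mx2E 0 (-1) 1 n%:Z; rewrite mul1r.
  have Pv (K : finType) (a : K -> int) (b : K -> C -> C) : (forall i, modular_form (a i) (b i)) ->
      (P K a b).[z + n%:R] = \sum_i b i (moebius gm z).
    move=> H; rewrite /P horner_sum; apply: eq_bigr => i _.
    rewrite hornerM hornerC hornerXn.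
    have [a0|a0] := ltP (a i) 0; first by rewrite !(neg _ _ _ H)// mul0r.
    rewrite (mf_slash (H i) gS Hz) af mulrC; congr (_ * _).
    by rewrite exprnP gez0_abs.
  by rewrite /D hornerD hornerN !Pv// (E _ Hm) subrr.
rewrite map_inj_uniq ?iota_uniq// => a b /addrI /eqP.
by rewrite eqr_nat => /eqP.
Qed.

End WeightSeparation.

(** * The graded ideal and its generator *)

Section Ideal.
Variables (R : realType) (p : nat) (k : int).
Local Notation C := (cplx R).
Variables (rho : 'M[int]_2 -> 'M[C]_p) (F : C -> 'cV[C]_p).
Implicit Types (z t w : C) (f g h : C -> C) (l m : int).
Hypotheses (rhoP : is_repr rho) (HF : log_vvmf k rho F) (HI : lin_indep (component F)).

(** Weights are integers here so that they can be subtracted; [leadP] returns to natural numbers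
    because a nonzero form has nonnegative weight. *)
Definition lead_weight l f := exists g : nat -> C -> C, [/\ g 0%N = f, nonzero f,
  forall j, (j <= p)%N -> modular_form (l + 2 * j%:Z) (g j) &
  forall i, satisfies_mlde p k g (component F i)].

Lemma lead_weight_mf l f : lead_weight l f -> modular_form l f.
Proof. by move=> [g [<- _ H _]]; apply: mf_weight (H 0%N (leq0n _)) _; rewrite mulr0 addr0. Qed.

Lemma lead_weight_nonzero l f : lead_weight l f -> nonzero f. Proof. by case=> g []. Qed.

Lemma leadP f : mlde_lead k F f <-> exists l, lead_weight l f.
Proof.
split=> [[l [g [E [Hg g0] Hs]]]|[l Hf]].
  exists l%:Z, g; split; rewrite -?E// => j jp; apply: mf_weight (Hg j jp) _; lia.
have l0 := mf_weight_ge0 (lead_weight_mf Hf) (lead_weight_nonzero Hf).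
have [g [E nf Hg Hs]] := Hf; exists `|l|%N, g; split => //; split; last by rewrite E.
by move=> j jp; apply: mf_weight (Hg j jp) _; lia.
Qed.

Lemma lead_weight_eq l f f' : eq_uhp f f' -> lead_weight l f -> lead_weight l f'.
Proof.
move=> E [g [g0 nf Hg Hs]]; exists (fun j => if j is j'.+1 then g j else f'); split; first by [].
- by move=> H; apply: nf => z Hz; rewrite E// H.
- move=> [|j] jp; last exact: Hg.
  by apply: mf_eq (Hg 0%N jp); rewrite g0.
- move=> i z Hz; rewrite -[RHS](Hs i z Hz); apply: eq_bigr => -[[|j] jp] _ //=.
  by rewrite g0 E.
Qed.

Lemma lead_weight_mul l m h f : modular_form m h -> nonzero h -> lead_weight l f -> lead_weight (m + l) (fun z => h z * f z).
Proof.
move=> Hh nh Hf; have hf := mf_hol (lead_weight_mf Hf); have [g [g0 nf Hg Hs]] := Hf.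
exists (fun j z => h z * g j z); split.
- by rewrite g0.
- by move=> H; have [] := hol_mul_eq0 (mf_hol Hh) hf H.
- by move=> j jp; apply: mf_weight (mf_mul Hh (Hg j jp)) _; lia.
- move=> i z Hz; transitivity (h z * \sum_(j < p.+1) g j z * modD_iter k (p - j) (component F i) z).
    by rewrite mulr_sumr; apply: eq_bigr => j _; rewrite mulrA.
  by rewrite Hs// mulr0.
Qed.

Definition lead_or_zero l f := eq_uhp f (fun=> 0) \/ lead_weight l f.

Lemma lead_or_zero_eq l f f' : eq_uhp f f' -> lead_or_zero l f -> lead_or_zero l f'.
Proof.
move=> E [H|H]; last by right; exact: lead_weight_eq H.
by left=> z Hz; rewrite -E// H.
Qed.

Lemma lead_or_zero_add l f f' : lead_or_zero l f -> lead_or_zero l f' -> lead_or_zero l (fun z => f z + f' z).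
Proof.
move=> [H|H]; first by apply: lead_or_zero_eq => z Hz; rewrite H// add0r.
move=> [H'|H']; first by right; apply: lead_weight_eq H => z Hz; rewrite H'// addr0.
have [|nS] := pselect (eq_uhp (fun z => f z + f' z) (fun=> 0)); first by left.
right; have [g [g0 _ Hg Hs]] := H; have [g' [g'0 _ Hg' Hs']] := H'.
exists (fun j z => g j z + g' j z); split.
- by rewrite g0 g'0.
- exact: nS.
- by move=> j jp; apply: mf_add; [exact: Hg|exact: Hg'].
- move=> i z Hz; have E := Hs i z Hz; have E' := Hs' i z Hz.
  rewrite -[RHS]addr0 -[in X in _ = X + _]E -[in X in _ = _ + X]E' -big_split.
  by apply: eq_bigr => j _; rewrite mulrDl.
Qed.

Lemma lead_or_zero_sum l (I : Type) (r : seq I) (Q : pred I) (u : I -> C -> C) :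
  (forall i, Q i -> lead_or_zero l (u i)) -> lead_or_zero l (fun z => \sum_(i <- r | Q i) u i z).
Proof.
move=> H; elim: r => [|i r IH]; first by left=> z _; rewrite big_nil.
have [Qi|Qi] := boolP (Q i).
  by apply: lead_or_zero_eq (lead_or_zero_add (H i Qi) IH) => z _; rewrite big_cons Qi.
by apply: lead_or_zero_eq IH => z _; rewrite big_cons (negbTE Qi).
Qed.

Local Notation Id := (mlde_ideal k F).

Lemma ideal_eq f f' : eq_uhp f f' -> Id f -> Id f'.
Proof. by move=> E [n [u [Hu Ef]]]; exists n, u; split => // z Hz; rewrite -E// Ef. Qed.

Lemma ideal0 : Id (fun=> 0).
Proof. by exists 0%N, (fun _ _ => 0); split => [[]//|z _]; rewrite big_ord0. Qed.

Lemma ideal_lead l f : lead_weight l f -> Id f.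
Proof.
move=> H; exists 1%N, (fun=> f); split=> [_|z _]; last by rewrite big_ord1.
by apply/leadP; exists l.
Qed.

Lemma ideal_lead_or_zero l f : lead_or_zero l f -> Id f.
Proof.
move=> [H|]; last exact: ideal_lead.
exact: ideal_eq (eq_uhp_sym H) ideal0.
Qed.

Lemma ideal_add f f' : Id f -> Id f' -> Id (fun z => f z + f' z).
Proof.
move=> [n [u [Hu E]]] [n' [u' [Hu' E']]].
exists (n + n')%N, (fun i => match fintype.split i with inl a => u a | inr b => u' b end); split.
  by move=> i; case: (fintype.split i).
move=> z Hz; rewrite big_split_ord E// E'//; congr (_ + _); apply: eq_bigr => i _.
  by rewrite (unsplitK (inl i)).
by rewrite (unsplitK (inr i)).
Qed.

Lemma ideal_sum (I : Type) (r : seq I) (u : I -> C -> C) :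
  (forall i, Id (u i)) -> Id (fun z => \sum_(i <- r) u i z).
Proof.
move=> H; elim: r => [|i r IH]; first by apply: ideal_eq ideal0 => z _; rewrite big_nil.
by apply: ideal_eq (ideal_add (H i) IH) => z _; rewrite big_cons.
Qed.

Lemma idealP f : Id f <-> exists (n : nat) (v : 'I_n -> int) (u : 'I_n -> C -> C),
  (forall i, lead_weight (v i) (u i)) /\ eq_uhp f (fun z => \sum_i u i z).
Proof.
split=> [[n [u [Hu E]]]|[n [v [u [Hu E]]]]].
  by have [v Hv] := choice (fun i => (leadP (u i)).1 (Hu i)); exists n, v, u.
by exists n, u; split => // i; apply/leadP; exists (v i).
Qed.

Lemma ideal_mul f g : Mring R f -> Id g -> Id (fun z => f z * g z).
Proof.
move=> [n [v [u [Hu E]]]] /idealP[n' [v' [u' [Hu' E']]]].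
apply: (@ideal_eq (fun z => \sum_i \sum_j u i z * u' j z)).
  by move=> z Hz; rewrite E// E'// mulr_suml; apply: eq_bigr => i _; rewrite mulr_sumr.
apply: ideal_sum => i; apply: ideal_sum => j; apply: (@ideal_lead_or_zero (v i + v' j)).
have [H|H] := pselect (eq_uhp (u i) (fun=> 0)); first by left=> z Hz; rewrite H// mul0r.
by right; exact: lead_weight_mul.
Qed.

Lemma ideal_ideal : is_ideal Id.
Proof.
split; [|exact: ideal0|exact: ideal_add|exact: ideal_mul].
move=> f /idealP[n [v [u [Hu E]]]]; exists n, v, u; split => // i.
exact: lead_weight_mf (Hu i).
Qed.

(** Several leading coefficients of one weight may contribute to a component. [weight_sep] collects
    them, and sums within one weight are again leading coefficients or zero. *)
Lemma ideal_comp (n : nat) (v : 'I_n -> int) (u : 'I_n -> C -> C) : injective v ->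
  (forall i, modular_form (v i) (u i)) -> Id (fun z => \sum_i u i z) -> forall i, lead_or_zero (v i) (u i).
Proof.
move=> vi Hu /idealP[n' [v' [u' [Hu' E]]]] i.
have E1 := weight_sep Hu (fun j => lead_weight_mf (Hu' j)) E (v i).
have E2 : eq_uhp (fun z => \sum_(j | v j == v i) u j z) (u i).
  by move=> z _; rewrite (eq_bigl (pred1 i)) ?big_pred1_eq// => j; rewrite (inj_eq vi).
have E3 : eq_uhp (fun z => \sum_(j | v' j == v i) u' j z) (u i) by move=> z Hz; rewrite -E1// E2.
apply: lead_or_zero_eq E3 _; apply: lead_or_zero_sum => j /eqP <-; right; exact: Hu'.
Qed.

Lemma ideal_homog l f : modular_form l f -> Id f -> lead_or_zero l f.
Proof.
move=> Hf If; apply: (@ideal_comp 1 (fun=> l) (fun=> f) _ _ _ ord0) => //.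
  by move=> i j _; rewrite !ord1.
by apply: ideal_eq If => z _; rewrite big_ord1.
Qed.

(** The factor [wronsk id] of [mlde_prop] is not identically zero, so it cancels among holomorphic
    functions. *)
Lemma lead_cross l m f f' : lead_weight l f -> lead_weight m f' ->
  exists g g' : nat -> C -> C, [/\ g 0%N = f, g' 0%N = f',
   forall j, (j <= p)%N -> modular_form (l + 2 * j%:Z) (g j),
   forall j, (j <= p)%N -> modular_form (m + 2 * j%:Z) (g' j) &
   (forall i, satisfies_mlde p k g (component F i)) /\
   forall j, (j <= p)%N -> eq_uhp (fun z => f z * g' j z) (fun z => f' z * g j z)].
Proof.
move=> [g [g0 nf Hg Hs]] [g' [g'0 nf' Hg' Hs']]; exists g, g'; split=> //; split=> // j jp.
have [->|j0] := eqVneq j 0%N; first by move=> z _; rewrite g0 g'0 mulrC.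
have h0 := mf_hol (Hg 0%N (leq0n _)); have h0' := mf_hol (Hg' 0%N (leq0n _)).
have hj := mf_hol (Hg j jp); have hj' := mf_hol (Hg' j jp).
rewrite -g0 -g'0; apply: mul_cancel (wronsk_hol HF id) _ _ (wronsk_nonzero HF HI) _; try exact: hol_mul.
have sp : (p - j < p)%N by move: jp j0; lia.
by move=> z Hz; have := mlde_prop Hs Hs' (Ordinal sp) Hz; rewrite /= subKn.
Qed.

(* Dividing the equation with leading coefficient [g] by the part of [g] coprime
   to [f] gives an equation whose leading coefficient is gcd(f, g). *)
Lemma lead_min_dvd l m g f : lead_weight l g -> (forall (l' : int) f', lead_weight l' f' -> l <= l') -> lead_weight m f ->
  mf_dvd l m g f.
Proof.
move=> Hg Hmin Hf; have [gs [us [g0 u0 Mg Mu [Hs cross]]]] := lead_cross Hg Hf.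
have [a [d [x [y [Md Mx My [Eg Ef cop]]]]]] := coprime_split (lead_weight_mf Hg) (lead_weight_mf Hf) (lead_weight_nonzero Hg).
have nd := nonzero_mull Eg (lead_weight_nonzero Hg); have nx := nonzero_mulr Eg (lead_weight_nonzero Hg).
(* The common divisor d of f and g cancels from the proportionality of the two equations. *)
have xy j : (j <= p)%N -> eq_uhp (fun z => x z * us j z) (fun z => y z * gs j z).
  move=> jp; apply: (mul_cancel (mf_hol Md) _ _ nd).
  - exact: hol_mul (mf_hol Mx) (mf_hol (Mu j jp)).
  - exact: hol_mul (mf_hol My) (mf_hol (Mg j jp)).
  - by move=> z Hz; rewrite !mulrA -Eg// -Ef//; exact: cross.
(* As x and y have no common zero, x divides every coefficient of the equation led by g; the
   quotients form an equation led by d. *)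
have dv j : exists h, (j <= p)%N -> modular_form (l + 2 * j%:Z - (l - a)) h /\
     forall z, uhp R z -> gs j z = x z * h z.
  have [jp|jp] := boolP (j <= p)%N; last by exists (fun=> 0).
  by have [h Hh] := gauss_dvd Mx My (Mu j jp) (Mg j jp) nx cop (xy j jp); exists h.
have [h Hh] := choice dv.
have Ld : lead_weight a (h 0%N).
  exists h; split; first by [].
  - by apply: (nonzero_mulr (g := x)) (lead_weight_nonzero Hg) => z Hz; rewrite -g0; exact: (Hh 0%N (leq0n _)).2.
  - by move=> j jp; apply: mf_weight (Hh j jp).1 _; lia.
  - move=> i; apply: (mul_cancel (mf_hol Mx) _ (hol_cst 0) nx).
      apply: hol_sum => j; apply: hol_mul; last by apply: modD_iter_hol; exact: component_hol HF i.
      exact: mf_hol (Hh j (ltn_ord j)).1.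
    move=> z Hz; rewrite mulr0 -[RHS](Hs i z Hz) mulr_sumr; apply: eq_bigr => j _.
    by rewrite mulrA -(Hh j (ltn_ord j)).2.
(* Minimality gives l <= a, while x is a nonzero form of weight l - a. So x is constant, g is a
   multiple of d, and d divides f. *)
have la := Hmin _ _ Ld; have := mf_weight_ge0 Mx nx => al.
have [c Hc] : exists c : C, eq_uhp x (fun=> c) by apply: mf_weight0; apply: mf_weight Mx _; lia.
have c0 : c != 0 by apply/eqP => c0; apply: nx => z Hz; rewrite Hc.
exists (fun z => c^-1 * y z); split; first by apply: mf_scale; apply: mf_weight My _; lia.
by move=> z Hz; rewrite Ef// Eg// Hc// -mulrA mulVKf.
Qed.

Lemma exists_lead : exists l f, lead_weight l f.
Proof.
have [Hg g0] := wronsk_mlde_coefs rhoP HF HI; exists (mlde_weight p k)%:Z, (wronsk_mlde k F 0); exists (wronsk_mlde k F); split => //.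
exact: wronsk_mlde_sat.
Qed.

Lemma exists_min_lead : exists (l : int) (f : C -> C), lead_weight l f /\ forall (l' : int) f', lead_weight l' f' -> l <= l'.
Proof.
have [l1 [f1 H1]] := exists_lead.
have ex : exists n, `[< exists f, lead_weight n%:Z f >].
  have := mf_weight_ge0 (lead_weight_mf H1) (lead_weight_nonzero H1) => h; exists `|l1|%N; apply/asboolP; exists f1.
  by rewrite gez0_abs.
case: (ex_minnP ex) => n /asboolP[f Hf] Hn; exists n%:Z, f; split => // l' f' H'.
have h := mf_weight_ge0 (lead_weight_mf H') (lead_weight_nonzero H').
suff : (n <= `|l'|)%N by lia.
by apply: Hn; apply/asboolP; exists f'; rewrite gez0_abs.
Qed.

Lemma normalized_ex l f : modular_form l f -> nonzero f -> exists c : C, c != 0 /\ normalized (fun z => c * f z).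
Proof.
move=> Hf nf; have [a Ha] := mf_q Hf.
have ex : exists n, a n != 0.
  apply: contrapT => H; apply: nf => z Hz; apply: clim_uniq (Ha z Hz) _.
  apply: clim_ext (clim_cst 0) => N; rewrite /psum big1// => i _.
  have [->|ai] := eqVneq (a i) 0; first by rewrite mul0r.
  by exfalso; apply: H; exists (i : nat).
case: (ex_minnP ex) => n an Hn; exists (a n)^-1; split; first by rewrite invr_eq0.
exists (fun i => (a n)^-1 * a i), n; split; last by rewrite mulVf.
- apply/has_qexpP => z Hz; apply: clim_ext (climZ (a n)^-1 (Ha z Hz)) => N.
  by rewrite /psum mulr_sumr; apply: eq_bigr => i _; rewrite mulrA.
- move=> i ni; have [->|ai] := eqVneq (a i) 0; first by rewrite mulr0.
  by have := Hn i ai; rewrite leqNgt ni.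
Qed.

Lemma qcoefs_uniq (a b : nat -> C) f f' : eq_uhp f f' -> qcoefs a f -> qcoefs b f' -> a =1 b.
Proof.
move=> E Ha Hb n; apply/eqP; rewrite -subr_eq0; apply/eqP.
apply: (qexp_uniq0 (a := fun n => a n - b n)) => z Hz.
have := climB (Ha z Hz) (Hb z Hz); rewrite E// subrr; apply: clim_ext => N.
by rewrite /psum -sumrB; apply: eq_bigr => i _; rewrite mulrBl.
Qed.

Lemma normalized_uniq (c : C) f f' : normalized f -> normalized f' -> eq_uhp f' (fun z => c * f z) -> c = 1.
Proof.
move=> [a [m [/has_qexpP Ha am a1]]] [b [m' [/has_qexpP Hb bm b1]]] E.
have Hca : qcoefs (fun n => c * a n) (fun z => c * f z).
  move=> z Hz; apply: clim_ext (climZ c (Ha z Hz)) => N.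
  by rewrite /psum mulr_sumr; apply: eq_bigr => i _; rewrite mulrA.
have ab := qcoefs_uniq E Hb Hca.
have c0 : c != 0.
  by apply/eqP => c0; have := ab m'; rewrite b1 c0 mul0r => /eqP; rewrite oner_eq0.
have mm : m = m'.
  apply/eqP; rewrite eqn_leq; apply/andP; split; rewrite leqNgt; apply/negP => lt.
    by have := ab m'; rewrite b1 am// mulr0 => /eqP; rewrite oner_eq0.
  by have := ab m; rewrite a1 mulr1 bm// => /eqP; rewrite eq_sym (negbTE c0).
by have := ab m; rewrite a1 mulr1 {1}mm b1.
Qed.

Lemma normalized_nonzero f : normalized f -> nonzero f.
Proof.
move=> [a [m [/has_qexpP Ha _ a1]]] H.
have H0 : qcoefs (fun=> 0) (fun=> 0 : C).
  by move=> z _; apply: clim_ext (clim_cst 0) => N; rewrite /psum big1// => i _; rewrite mul0r.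
by have := qcoefs_uniq H Ha H0 m; rewrite a1 => /eqP; rewrite oner_eq0.
Qed.

Lemma generator : exists g, [/\ normalized_least_weight Id g,
  forall g', normalized_least_weight Id g' -> eq_uhp g' g & generated_by Id g].
Proof.
have [l [f [Hf Hmin]]] := exists_min_lead.
have [c [c0 Nc]] := normalized_ex (lead_weight_mf Hf) (lead_weight_nonzero Hf).
pose g z := c * f z.
have nc : nonzero (fun=> c) by move=> /(_ (mk 0 1)); rewrite uhp_mk => /(_ ltr01)/eqP; rewrite (negbTE c0).
have Hg : lead_weight l g by have := lead_weight_mul (mf_cst c) nc Hf; rewrite add0r.
exists g; split.
- exists l; split; [exact: lead_weight_mf|exact: Nc|exact: ideal_lead Hg|].
  by move=> v h Hh Ih nh; case: (ideal_homog Hh Ih) => [//|]; exact: Hmin.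
- move=> g' [v [Mg' Ng' Ig' Hv]].
  case: (ideal_homog Mg' Ig') => [/(normalized_nonzero Ng')//|Lg'].
  (* Both weights are least, hence equal; the quotient has weight 0, and comparing leading
     q-coefficients makes it 1. *)
  have lv := Hmin _ _ Lg'; have vl := Hv _ _ (lead_weight_mf Hg) (ideal_lead Hg) (lead_weight_nonzero Hg).
  have [h [Mh Eh]] := lead_min_dvd Hg Hmin Lg'.
  have [c' Hc'] : exists c' : C, eq_uhp h (fun=> c') by apply: mf_weight0; apply: mf_weight Mh _; lia.
  have E z : uhp R z -> g' z = c' * g z by move=> Hz; rewrite Eh// Hc'// mulrC.
  by move=> z Hz; rewrite E// (normalized_uniq Nc Ng' E) mul1r.
- move=> u; split=> [/idealP[n [v [us [Hu E]]]]|[h Mh E]]; last first.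
    by apply: ideal_eq (ideal_mul Mh (ideal_lead Hg)) => z Hz; rewrite E// mulrC.
  have [hs Hhs] := choice (fun i => lead_min_dvd Hg Hmin (Hu i)).
  exists (fun z => \sum_i hs i z).
    by exists n, (fun i => v i - l), hs; split => // i; exact: (Hhs i).1.
  by move=> z Hz; rewrite E// mulr_sumr; apply: eq_bigr => i _; exact: (Hhs i).2.
Qed.

End Ideal.

Theorem theorem3p14 (R : realType) (p : nat) (k : int)
    (rho : 'M[int]_2 -> 'M[cplx R]_p) (F : cplx R -> 'cV[cplx R]_p) :
  is_repr rho ->
  (forall a : cplx R, eigenvalue (rho matT) a -> `|a| = 1) ->
  log_vvmf k rho F ->
  lin_indep (component F) ->
  (exists (l : nat) (g : nat -> cplx R -> cplx R),
     mlde_coefs p l g /\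
     is_basis_of (component F) (mlde_solutions p k g)) /\
  [/\ is_ideal (mlde_ideal k F),
      is_graded (mlde_ideal k F),
      (* the homogeneous elements are exactly 0 and the leading coefficients *)
      (forall (w : int) (f : cplx R -> cplx R), modular_form w f ->
         (mlde_ideal k F f <-> eq_uhp f (fun=> 0) \/ mlde_lead k F f)),
      (exists f, mlde_ideal k F f /\ ~ eq_uhp f (fun=> 0))
    & exists g : cplx R -> cplx R,
        [/\ normalized_least_weight (mlde_ideal k F) g,
            forall g', normalized_least_weight (mlde_ideal k F) g' ->
              eq_uhp g' g
          & generated_by (mlde_ideal k F) g]].
Proof.
move=> rhoP _ HF HI; split.
  exists (mlde_weight p k), (wronsk_mlde k F); have Hc := wronsk_mlde_coefs rhoP HF HI; split => //.
  by apply: (mlde_basis HF HI Hc) => i; exact: wronsk_mlde_sat.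
split; [exact: ideal_ideal| | | |exact: (generator rhoP HF HI)].
- by move=> n v u vi Hu Iu i; apply: ideal_lead_or_zero (ideal_comp vi Hu Iu i).
- move=> v f Hf; split=> [If|[f0|/leadP[l Hl]]].
  + case: (ideal_homog Hf If) => [|H]; [by left|right].
    by apply/leadP; exists v.
  + exact: ideal_eq (eq_uhp_sym f0) (ideal0 _ _).
  + exact: ideal_lead Hl.
- have [l [f Hf]] := exists_lead rhoP HF HI; exists f; split; first exact: ideal_lead Hf.
  exact: lead_weight_nonzero Hf.
Qed.
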